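(* Let $\varphi(z)=|z|^2/2$ on $\mathbb C^n$ and let $m>0$. Identify $\mathbb C^n$ with $\mathbb R^{2n}$ and write $\langle w\rangle=(1+|w|^2)^{1/2}$ for Euclidean vectors $w$. Suppose that $f$ is a complex-valued symbol of order $-m$ with an asymptotically homogeneous principal part in the following sense: for some $\delta>0$, some $f_{-m}\in C^\infty(S^{2n-1})$, and a cut-off $\chi\in C^\infty(\mathbb R^{2n})$ which vanishes near the origin and equals one for $|z|$ large, $$f(z)=\chi(z)|z|^{-m}f_{-m}(z/|z|)+r(z),\qquad|\partial^\alpha r(z)|\le C_\alpha\langle z\rangle^{-m-\delta-|\alpha|}$$ for every real multi-index $\alpha$. Assume $f_{-m}\not\equiv0$ and set $$\rho=\frac{2n}{m},\qquad C_f=\frac1{2n\pi^n}\int_{S^{2n-1}}|f_{-m}(\omega)|^\rho\,dS(\omega),$$ where $dS$ is standard Euclidean surface measure. Then the Toeplitz operator $T_f$ on $F^2_\varphi$ satisfies $$N(t;T_f)\sim C_ft^{-\rho}\quad(t\downarrow0),\qquad s_j(T_f)\sim C_f^{1/\rho}j^{-1/\rho}\quad(j\to\infty).$$ No ellipticity is assumed: $f_{-m}$ may vanish on open subsets, or on a set of positive surface measure; only $f_{-m}\not\equiv0$ is required.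
   Context: $F^2_\varphi=L^2(\mathbb C^n,e^{-2\varphi}dv)\cap\mathcal H(\mathbb C^n)$ with $dv$ Lebesgue measure and $\mathcal H$ the entire functions; $P$ is the orthogonal projection of $L^2_\varphi=L^2(\mathbb C^n,e^{-2\varphi}dv)$ onto $F^2_\varphi$; $T_fg=P(fg)$. $s_1(A)\ge s_2(A)\ge\cdots$ are the singular values of a compact operator $A$ and $N(t;A)=\#\{k:s_k(A)>t\}$. $\sim$ means that the ratio of the two sides tends to $1$. *)

(* Defs.v *)
From HB Require Import structures.
From mathcomp Require Import all_boot all_order all_algebra.
From mathcomp Require Import finmap complex.
From mathcomp Require Import all_classical all_reals all_analysis.
From mathcomp Require Import measurable_realfun.
Set Implicit Arguments.
Unset Strict Implicit.
Unset Printing Implicit Defensive.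
Import Order.TTheory GRing.Theory Num.Theory numFieldNormedType.Exports.
Local Open Scope classical_set_scope.
Local Open Scope ring_scope.

(* Points of R^d with the product Borel sigma-algebra. *)
Notation Rtuple R d := (d.-tuple (measurableTypeR R)).

Section LebesgueMeasure.
Context {R : realType}.
Local Open Scope ereal_scope.

Definition tcons d (p : measurableTypeR R * Rtuple R d) : Rtuple R d.+1 :=
  [tuple of p.1 :: p.2].

Fixpoint lebesgue_tuple (d : nat) : set (Rtuple R d) -> \bar R :=
  match d with
  | 0%N => \d_([tuple])
  | d'.+1 => pushforward (lebesgue_measure \x @lebesgue_tuple d') (@tcons d')
  end.
Arguments lebesgue_tuple : clear implicits.

Lemma measurable_tcons d : measurable_fun setT (@tcons d).
Proof. by apply: measurable_cons; [exact: measurable_fst|exact: measurable_snd]. Qed.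

Lemma sigma_finite_tcons d (m : {measure set (measurableTypeR R * Rtuple R d) -> \bar R}) :
  sigma_finite setT m -> sigma_finite setT (pushforward m (@tcons d)).
Proof.
move=> [F FT mF].
pose uncons (t : Rtuple R d.+1) := (thead t, [tuple of behead t]).
have tK : cancel uncons (@tcons d) by move=> t; rewrite [RHS]tuple_eta.
have Kt : cancel (@tcons d) uncons.
  by move=> [x t]; congr pair => //; apply/val_inj.
have mu : measurable_fun setT uncons.
  apply/measurable_fun_pairP; split; first exact: measurable_tnth.
  exact: measurable_behead.
exists (fun k => uncons @^-1` F k).
  by rewrite -preimage_bigcup -FT preimage_setT.
move=> k; have [mFk Fkoo] := mF k; split.
  by rewrite -[X in measurable X]setTI; exact: mu.
rewrite /pushforward -comp_preimage (_ : uncons \o _ = id) //.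
exact/funext.
Qed.

Lemma sigma_finite_product d (mu : {sigma_finite_measure set (Rtuple R d) -> \bar R}) :
  sigma_finite setT (@lebesgue_measure R \x mu).
Proof.
have /sigma_finiteP[F [TF ndF Foo]] := sigma_finiteT (@lebesgue_measure R).
have /sigma_finiteP[G [TG ndG Goo]] := sigma_finiteT mu.
exists (fun k => F k `*` G k).
  rewrite -setXTT TF TG predeqE => -[x y]; split.
    move=> [/= [k _ Fkx] [l _ Gly]]; exists (maxn k l) => //; split.
    - by move: x Fkx; exact/subsetPset/ndF/leq_maxl.
    - by move: y Gly; exact/subsetPset/ndG/leq_maxr.
  by move=> [k _ []/= ? ?]; split; exists k.
move=> k; have [? ?] := Foo k; have [? ?] := Goo k.
split; first exact: measurableX.
by rewrite product_measure1E// lte_mul_pinfty// ge0_fin_numE.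
Qed.

Section step.
Variables (d : nat) (mu : {sigma_finite_measure set (Rtuple R d) -> \bar R}).

Definition lebesgue_step : set (Rtuple R d.+1) -> \bar R :=
  pushforward (@lebesgue_measure R \x mu) (@tcons d).

Let step0 : lebesgue_step set0 = 0.
Proof. by rewrite /lebesgue_step /pushforward preimage_set0 measure0. Qed.

Let step_ge0 A : 0 <= lebesgue_step A.
Proof. by rewrite /lebesgue_step /pushforward; exact: measure_ge0. Qed.

Let step_sigma_additive : semi_sigma_additive lebesgue_step.
Proof.
pose m : {measure set (Rtuple R d.+1) -> \bar R} :=
  pushforward (@lebesgue_measure R \x mu) (@tcons d).
exact: (@measure_semi_sigma_additive _ _ _ (m (@measurable_tcons d))).
Qed.

HB.instance Definition _ := isMeasure.Build _ _ _ lebesgue_step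
  step0 step_ge0 step_sigma_additive.

Let step_sigma_finite : sigma_finite setT lebesgue_step.
Proof. exact/sigma_finite_tcons/sigma_finite_product. Qed.

HB.instance Definition _ := Measure_isSigmaFinite.Build _ _ _ lebesgue_step
  step_sigma_finite.

End step.

Lemma lebesgue_tuple_sigma_finite_measure d :
  exists mu : {sigma_finite_measure set (Rtuple R d) -> \bar R},
    lebesgue_tuple d = mu :> (set _ -> \bar R).
Proof.
elim: d => [|d [mu IH]]; first by exists (\d_([tuple])).
by exists (lebesgue_step mu); rewrite /= IH.
Qed.

Let leb0 d : lebesgue_tuple d set0 = 0.
Proof. by have [mu ->] := lebesgue_tuple_sigma_finite_measure d. Qed.

Let leb_ge0 d A : 0 <= lebesgue_tuple d A.
Proof. by have [mu ->] := lebesgue_tuple_sigma_finite_measure d. Qed.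

Let leb_sigma_additive d : semi_sigma_additive (lebesgue_tuple d).
Proof.
have [mu ->] := lebesgue_tuple_sigma_finite_measure d.
exact: measure_semi_sigma_additive.
Qed.

HB.instance Definition _ d := isMeasure.Build _ _ _ (lebesgue_tuple d)
  (@leb0 d) (@leb_ge0 d) (@leb_sigma_additive d).

Let leb_sigma_finite d : sigma_finite setT (lebesgue_tuple d).
Proof.
by have [mu ->] := lebesgue_tuple_sigma_finite_measure d; exact: sigma_finiteT.
Qed.

HB.instance Definition _ d := Measure_isSigmaFinite.Build _ _ _
  (lebesgue_tuple d) (@leb_sigma_finite d).

End LebesgueMeasure.
Arguments lebesgue_tuple {R} d.

Section Euclidean.
Context {R : realType}.

(* The library norm on ['rV[R]_d] is the sup norm. *)
Definition enorm d (x : 'rV[R]_d) : R := Num.sqrt (\sum_i x 0 i ^+ 2).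

Definition japanese d (x : 'rV[R]_d) : R := Num.sqrt (1 + enorm x ^+ 2).

Definition rv d (t : Rtuple R d) : 'rV[R]_d := \row_i tnth t i.

Definition sphere d : set (Rtuple R d) := [set t | enorm (rv t) = 1].
Definition punctured_ball d : set (Rtuple R d) := [set t | 0 < enorm (rv t) <= 1].

Definition direction d (t : Rtuple R d) : Rtuple R d :=
  [tuple (tnth t i / enorm (rv t) : R) | i < d].

(* Surface measure of the unit sphere of R^d, as d times the Lebesgue volume of the
   cone over a set, i.e. the measure with dx = r^(d-1) dr dS in polar coordinates;
   it is carried by the sphere. *)
Definition sphere_measure d (A : set (Rtuple R d)) : \bar R :=
  (d%:R%:E * lebesgue_tuple d (@direction d @^-1` A `&` @punctured_ball d))%E.

Lemma measurable_enorm d :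
  measurable_fun setT (fun t : Rtuple R d => enorm (rv t)).
Proof.
apply: (measurableT_comp (f := @Num.sqrt R)).
  by apply: continuous_measurable_fun; exact: sqrt_continuous.
apply: measurable_sum => i; apply: measurable_funX.
under eq_fun do rewrite mxE.
exact: measurable_tnth.
Qed.

Lemma measurable_punctured_ball d : measurable (@punctured_ball d).
Proof.
rewrite (_ : @punctured_ball d =
  (fun t : Rtuple R d => enorm (rv t)) @^-1` `]0, 1]); last first.
  by apply/seteqP; split => t /=; rewrite in_itv.
by rewrite -[X in measurable X]setTI; exact: measurable_enorm.
Qed.

Lemma measurable_direction d : measurable_fun setT (@direction d).
Proof.
apply/measurable_fun_tnthP => i.
rewrite (_ : _ \o _ = fun t : Rtuple R d => tnth t i * (enorm (rv t))^-1).
  apply: measurable_funM; first exact: measurable_tnth.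
  have -> : (fun t : Rtuple R d => (enorm (rv t))^-1) =
      (@powR R ^~ (-1)) \o (fun t : Rtuple R d => enorm (rv t)).
    by apply/funext => t /=; rewrite powR_inv1// sqrtr_ge0.
  apply: (measurableT_comp (f := @powR R ^~ (-1))); first exact: measurable_powR.
  exact: measurable_enorm.
by apply/funext => t /=; rewrite tnth_mktuple.
Qed.

Let sphere_measure0 d : sphere_measure (@set0 (Rtuple R d)) = 0%E.
Proof. by rewrite /sphere_measure preimage_set0 set0I measure0 mule0. Qed.

Let sphere_measure_ge0 d (A : set (Rtuple R d)) : (0 <= sphere_measure A)%E.
Proof. by rewrite /sphere_measure mule_ge0// lee_fin ler0n. Qed.

Let sphere_measure_sigma_additive d : semi_sigma_additive (@sphere_measure d).
Proof.
pose m : {measure set (Rtuple R d) -> \bar R} :=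
  pushforward (mrestr (lebesgue_tuple d) (@measurable_punctured_ball d))
    (@direction d).
pose s : {measure set (Rtuple R d) -> \bar R} :=
  mscale (NngNum (ler0n R d)) (m (@measurable_direction d)).
have -> : @sphere_measure d = s by [].
exact: measure_semi_sigma_additive.
Qed.

HB.instance Definition _ d := isMeasure.Build _ _ _ (@sphere_measure d)
  (@sphere_measure0 d) (@sphere_measure_ge0 d)
  (@sphere_measure_sigma_additive d).

End Euclidean.
Arguments sphere_measure {R} d.
Arguments sphere {R} d.

Section Symbols.
Context {R : realType}.
Local Open Scope complex_scope.

(* Complex-valued functions are differentiated componentwise, as R[i] is not
   declared as a normed module over R. *)
Definition partial d (i : 'I_d) (g : 'rV[R]_d -> R) : 'rV[R]_d -> R :=
  fun x => 'D_(delta_mx 0 i) g x.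

Definition partials d (s : seq 'I_d) (g : 'rV[R]_d -> R) : 'rV[R]_d -> R :=
  foldr (@partial d) g s.

(* C^oo on an open set: every iterated partial derivative, in any order, exists
   and is (Frechet) differentiable, hence continuous. *)
Definition smooth_on d (U : set 'rV[R]_d) (g : 'rV[R]_d -> R) : Prop :=
  forall s x, U x -> differentiable (partials s g) x.

Definition csmooth_on d (U : set 'rV[R]_d) (g : 'rV[R]_d -> R[i]) : Prop :=
  smooth_on U (@complex.Re R \o g) /\ smooth_on U (@complex.Im R \o g).

(* Smoothness of functions on an embedded submanifold: local smooth extension
   to the ambient space. Values of g off the sphere are irrelevant. *)
Definition smooth_on_sphere d (g : 'rV[R]_d -> R[i]) : Prop :=
  forall w : 'rV[R]_d, enorm w = 1 ->
    exists (U : set 'rV[R]_d) (G : 'rV[R]_d -> R[i]),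
      [/\ open U, U w, csmooth_on U G &
          forall x, U x -> enorm x = 1 -> g x = G x].

(* d^alpha = d_0^(alpha 0) d_1^(alpha 1) ... *)
Definition mi_word d (alpha : 'I_d -> nat) : seq 'I_d :=
  flatten [seq nseq (alpha i) i | i <- enum 'I_d].

Definition mi_derive d (alpha : 'I_d -> nat) (g : 'rV[R]_d -> R[i])
    (x : 'rV[R]_d) : R[i] :=
  partials (mi_word alpha) (@complex.Re R \o g) x +i*
  partials (mi_word alpha) (@complex.Im R \o g) x.

Definition symbol d (mu : R) (g : 'rV[R]_d -> R[i]) : Prop :=
  csmooth_on setT g /\
  forall alpha : 'I_d -> nat, exists C : R, forall x,
    Normc.normc (mi_derive alpha g x) <=
      C * japanese x `^ (mu - (\sum_i alpha i)%:R).

End Symbols.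

Section Operators.
Context {R : realType} {V : lmodType R[i]}.
Variables (H : set V) (ip : V -> V -> R[i]).
Local Open Scope complex_scope.

Definition hnorm (u : V) : R := Num.sqrt (complex.Re (ip u u)).

(* H is the carrier of a Hilbert space with inner product ip (linear in its first
   argument); ip may be applied to vectors outside H, as in the projection onto H.
   [xget 0] returns 0 when no vector with the required property exists. *)
Definition orthogonal_projection (u : V) : V :=
  xget 0 [set h | H h /\ forall k, H k -> ip (u - h) k = 0].

Definition compact_operator (A : V -> V) : Prop :=
  [/\ forall u, H u -> H (A u),
      forall (a : R[i]) u v, H u -> H v -> A (a *: u + v) = a *: A u + A v &
      forall u : nat -> V, (forall k, H (u k)) ->
        (exists M : R, forall k, hnorm (u k) <= M) ->
        exists (h : nat -> nat) (v : V),
          [/\ {homo h : k l / (k < l)%N}, H v &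
              hnorm (A (u (h k)) - v) @[k --> \oo] --> (0 : R)]].

Definition adjoint (A : V -> V) (v : V) : V :=
  xget 0 [set w | H w /\ forall u, H u -> ip (A u) v = ip u w].

Definition has_dim (E : set V) (d : nat) : Prop :=
  exists e : 'I_d -> V,
    (forall u, E u <-> exists c : 'I_d -> R[i], u = \sum_i c i *: e i) /\
    (forall c : 'I_d -> R[i], \sum_i c i *: e i = 0 -> forall i, c i = 0).

(* Singular values of A are the square roots of the eigenvalues of A^* A; in
   the decreasing enumeration s, each t > 0 occurs as often as the dimension of
   the eigenspace for t^2. Indices start at 0: s k stands for s_{k+1}(A). *)
Definition is_singular_values (A : V -> V) (s : nat -> R) : Prop :=
  [/\ forall k, 0 <= s k,
      nonincreasing_seq s &
      forall t : R, 0 < t ->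
        finite_set [set k | s k = t] /\
        has_dim [set u | H u /\ adjoint A (A u) = (t ^+ 2)%:C *: u]
                #|` fset_set [set k | s k = t]|].

(* The enumeration is unique when it exists, as it does for compact A. *)
Definition singular_value (A : V -> V) : nat -> R :=
  xget (fun=> 0) (is_singular_values A).

Definition singular_count (A : V -> V) (t : R) : nat :=
  #|` fset_set [set k | t < singular_value A k]|.

End Operators.

Section Fock.
Context {R : realType} {n : nat}.
Local Open Scope complex_scope.

(* z_j = x_j + i x_{n+j} *)
Definition toC (x : 'rV[R]_(n + n)) : 'rV[R[i]]_n :=
  \row_j (x 0 (lshift n j) +i* x 0 (rshift n j)).


Definition pt (t : Rtuple R (n + n)) : 'rV[R[i]]_n := toC (rv t).

Definition Cint (g : 'rV[R[i]]_n -> R[i]) : R[i] :=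
  (\int[lebesgue_tuple (n + n)]_t complex.Re (g (pt t)))%R +i*
  (\int[lebesgue_tuple (n + n)]_t complex.Im (g (pt t)))%R.

Variable phi : 'rV[R[i]]_n -> R.

(* L^2(C^n, exp(-2 phi) dv), at the level of (Borel) representatives. *)
Definition L2 : set ('rV[R[i]]_n -> R[i]^o) := [set u : 'rV[R[i]]_n -> R[i]^o |
  [/\ measurable_fun setT (fun t => complex.Re (u (pt t)) : R),
      measurable_fun setT (fun t => complex.Im (u (pt t)) : R) &
      (\int[lebesgue_tuple (n + n)]_t
         (Normc.normc (u (pt t)) ^+ 2 * expR (- (2 * phi (pt t))))%:E < +oo)%E]].

(* Differentiability over the field R[i]; R[i]^o is R[i] as a normed module over
   itself. *)
Definition entire (u : 'rV[R[i]]_n -> R[i]^o) : Prop :=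
  forall z, differentiable u z.

Definition F2 : set ('rV[R[i]]_n -> R[i]^o) := [set u | L2 u /\ entire u].

Definition L2ip (u v : 'rV[R[i]]_n -> R[i]^o) : R[i] :=
  Cint (fun z => u z * (v z)^*%C * (expR (- (2 * phi z)))%:C).

Definition toeplitz (f : 'rV[R[i]]_n -> R[i]) (g : 'rV[R[i]]_n -> R[i]^o) :
    'rV[R[i]]_n -> R[i]^o :=
  orthogonal_projection F2 L2ip (fun z => f z * g z).

End Fock.

(* Main.v *)
Require Import Defs.
From HB Require Import structures.
From mathcomp Require Import all_boot all_order all_algebra.
From mathcomp Require Import finmap complex.
From mathcomp Require Import all_classical all_reals all_analysis.
From mathcomp Require Import measurable_realfun zify ring lra.
Set Implicit Arguments.
Unset Strict Implicit.
Unset Printing Implicit Defensive.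
Import Order.TTheory GRing.Theory Num.Theory numFieldNormedType.Exports.
Local Open Scope classical_set_scope.
Local Open Scope ring_scope.

(** The normalised reproducing kernels [k_z] are quasimodes of a Toeplitz operator:
    [T_f k_z - f(z) k_z] has squared norm at most the Gaussian mean of [|f - f(z)|^2]
    around [z]. Let [p(z)] be the squared norm of the projection of [k_z] on the span of the
    singular vectors of [T_f] with singular values above [t]. Then [p] has integral
    [pi^n N(t)], and [p(z)] is small where [|f(z)| < t] and close to [1] where [|f(z)| > t],
    up to an error governed by these Gaussian oscillations.
    Under the rescaling [z = t^(-1/m) x] the symbols [f(z) / t] converge to the
    [-m]-homogeneous extension [F] of the principal part, locally uniformly off the origin,
    while the oscillations tend to [0]; dominated convergence gives
    [N(t) t^rho -> pi^(-n) vol {|F| >= 1}]. The upper bound needs an integrable majorant, so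
    the values of [f] of size at most [e t] are first truncated to [0], at the cost of an
    operator of norm at most [2 e t].
    Homogeneity identifies [2 n vol {|F| >= 1}] with the integral of [|f_(-m)|^rho] over the
    sphere, and the asymptotics of [s_j] follow from those of [N] because
    [k < N(t)] is equivalent to [t < s_k]. *)

(** * Lebesgue measure on tuples *)

(** For complex [f] the operator need not be normal, so [coherent z] is compared with both [T_f] and
    its adjoint, whose symbol is the conjugate and has the same oscillation: left and right singular
    vectors differ, and only the two quasimode estimates together control the projections. Zeros of
    the principal part are harmless because nothing is inverted: only levels of |F| matter, and by
    homogeneity vol {|F| >= s} is s^(-rho) times its value at s = 1. Hence {|F| = 1} carries no
    mass, and bounds at the levels 1 + e and 1 - 2 e can be squeezed. The truncation is needed
    because far out p is bounded by a multiple of the oscillation, for which the estimates give only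
    polynomial decay; the truncated symbol vanishes there, so its oscillation has a Gaussian tail.
    The projection is defined by a choice; identifying it with an explicit integral operator rests
    on the reproducing formula, which comes from the mean value property and thus from Goursat's
    argument in polar coordinates. The factor pi^n is the Gaussian integral, and 2 n appears because
    surface measure is 2 n times cone volume. *)

Section LebesgueTuple.
Context {R : realType}.
Implicit Types d : nat.
Local Notation leb1 := (@lebesgue_measure R).
Local Notation leb := (@lebesgue_tuple R).

Lemma measurable_affine1 (c b : R) :
  measurable_fun setT (fun x : measurableTypeR R => c * x + b : measurableTypeR R).
Proof. by apply: measurable_funD => //; apply: measurable_funM. Qed.

(** The right-hand side is a measure in [A] that agrees with Lebesgue measure on half-open
    intervals, so uniqueness of Lebesgue measure applies. *)
Lemma lebesgue_affine (c b : R) (A : set (measurableTypeR R)) : 0 < c -> measurable A ->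
  leb1 A = (c%:E * leb1 ((fun x => (c * x + b : R)%R) @^-1` A))%E.
Proof.
move=> c0 mA.
pose m : {measure set (measurableTypeR R) -> \bar R} :=
  mscale (NngNum (ltW c0)) (pushforward leb1 (fun x : measurableTypeR R => (c * x + b : measurableTypeR R)%R)
   : {measure set (measurableTypeR R) -> \bar R}).
suff : leb1 A = m (measurable_affine1 c b) A by [].
apply: (lebesgue_measure_unique (mu := m (measurable_affine1 c b))) => // X [[u v] _ <-].
rewrite /=.
rewrite /m /mscale/= /pushforward.
have -> : (fun x : R => (c * x + b)%R) @^-1` `]u, v] = `](u - b) / c, (v - b) / c]%classic.
  apply/seteqP; split => x /=; rewrite !in_itv/=.
    by rewrite ltr_pdivrMr// ler_pdivlMr// ltrBlDr lerBrDr mulrC.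
  by rewrite ltr_pdivrMr// ler_pdivlMr// ltrBlDr lerBrDr (mulrC x).
rewrite !lebesgue_measure_itv/= !lte_fin ltr_pM2r ?invr_gt0// ltrD2r.
case: ifPn => _; last by rewrite mule0.
rewrite -!EFinD -EFinM; congr EFin.
by field; rewrite gt_eqF.
Qed.

Lemma integral1_affine (c b : R) (f : measurableTypeR R -> \bar R) : 0 < c ->
  measurable_fun setT f -> (forall x, 0 <= f x)%E ->
  (\int[leb1]_x f x = c%:E * \int[leb1]_x f (c * x + b)%R)%E.
Proof.
move=> c0 mf f0.
pose m : {measure set (measurableTypeR R) -> \bar R} :=
  mscale (NngNum (ltW c0)) (pushforward leb1 (fun x : measurableTypeR R => (c * x + b : measurableTypeR R)%R)
   : {measure set (measurableTypeR R) -> \bar R}).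
transitivity (\int[m (measurable_affine1 c b)]_x f x)%E.
  by apply: eq_measure_integral => A mA _; exact: lebesgue_affine.
by rewrite /m ge0_integral_mscale//= ge0_integral_pushforward//; exact: measurable_affine1.
Qed.

Lemma tcons_tnth0 d (x : R) (t : Rtuple R d) : tnth (tcons (x, t)) ord0 = x.
Proof. by []. Qed.

Lemma tcons_tnthS d (x : R) (t : Rtuple R d) i :
  tnth (tcons (x, t)) (lift ord0 i) = tnth t i.
Proof. by rewrite tnthS. Qed.

Lemma measurable_tcons_l d (t : Rtuple R d) :
  measurable_fun setT (fun x : measurableTypeR R => tcons (x, t) : Rtuple R d.+1).
Proof. by apply: (measurableT_comp (@measurable_tcons R d)). Qed.

Lemma measurable_tcons_r d (x : measurableTypeR R) :
  measurable_fun setT (fun t : Rtuple R d => tcons (x, t) : Rtuple R d.+1).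
Proof. by apply: (measurableT_comp (@measurable_tcons R d)). Qed.

Lemma integral_tupleS d (f : Rtuple R d.+1 -> \bar R) :
  measurable_fun setT f -> (forall t, 0 <= f t)%E ->
  (\int[leb d.+1]_t f t = \int[leb1]_x \int[leb d]_t f (tcons (x, t)))%E.
Proof.
move=> mf f0.
transitivity (\int[pushforward (leb1 \x leb d)%E (@tcons R d)]_t f t)%E; first by [].
rewrite ge0_integral_pushforward//; last exact: measurable_tcons.
rewrite preimage_setT (@fubini_tonelli1 _ _ _ _ _ leb1 (leb d) (f \o @tcons R d))//.
  by apply: measurableT_comp => //; exact: measurable_tcons.
by move=> x; exact: f0.
Qed.

Lemma integral_tupleS2 d (f : Rtuple R d.+1 -> \bar R) :
  measurable_fun setT f -> (forall t, 0 <= f t)%E ->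
  (\int[leb d.+1]_t f t = \int[leb d]_t \int[leb1]_x f (tcons (x, t)))%E.
Proof.
move=> mf f0; rewrite integral_tupleS//.
apply: (@fubini_tonelli _ _ _ _ _ leb1 (leb d) (f \o @tcons R d)) => //.
  by apply: measurableT_comp => //; exact: measurable_tcons.
by move=> x; exact: f0.
Qed.

Lemma measurable_tuple_int d (f : Rtuple R d.+1 -> \bar R) :
  measurable_fun setT f -> (forall t, 0 <= f t)%E ->
  measurable_fun setT (fun x : measurableTypeR R => \int[leb d]_t f (tcons (x, t)))%E.
Proof.
move=> mf f0.
apply: (@measurable_fun_fubini_tonelli_F _ _ _ _ _ (leb d) (f \o @tcons R d)) => //.
  by apply: measurableT_comp => //; exact: measurable_tcons.
by move=> x; exact: f0.
Qed.

(* Unipotent affine maps t_i |-> t_i + sum_j A i j t_j + b i. *)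
Definition shear d (A : nat -> nat -> R) (b : nat -> R) (t : Rtuple R d) : Rtuple R d :=
  [tuple (tnth t i + \sum_(j < d) A i j * tnth t j + b i : measurableTypeR R) | i < d].

Definition tscale d (c : R) (t : Rtuple R d) : Rtuple R d :=
  [tuple (c * tnth t i : measurableTypeR R) | i < d].

Lemma measurable_shear d A b : measurable_fun setT (@shear d A b).
Proof.
apply/measurable_fun_tnthP => i.
rewrite (_ : _ \o _ = fun t : Rtuple R d => tnth t i + \sum_(j < d) A i j * tnth t j + b i); last first.
  by apply/funext => t /=; rewrite tnth_mktuple.
apply: measurable_funD => //; apply: measurable_funD; first exact: measurable_tnth.
apply: measurable_sum => j; apply: measurable_funM => //; exact: measurable_tnth.
Qed.

Lemma measurable_tscale d c : measurable_fun setT (@tscale d c).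
Proof.
apply/measurable_fun_tnthP => i.
rewrite (_ : _ \o _ = fun t : Rtuple R d => c * tnth t i); last first.
  by apply/funext => t /=; rewrite tnth_mktuple.
apply: measurable_funM => //; exact: measurable_tnth.
Qed.

Lemma eq_tcons d (s : Rtuple R d.+1) (x : R) (t : Rtuple R d) :
  tnth s ord0 = x -> (forall i, tnth s (lift ord0 i) = tnth t i) -> s = tcons (x, t).
Proof.
move=> s0 sS; apply/eq_from_tnth => i; case: (unliftP ord0 i) => [j ->|->].
  by rewrite tcons_tnthS sS.
by rewrite tcons_tnth0 s0.
Qed.

Lemma integral_tscale d (c : R) (f : Rtuple R d -> \bar R) : 0 < c ->
  measurable_fun setT f -> (forall t, 0 <= f t)%E ->
  (\int[leb d]_t f t = (c ^+ d)%:E * \int[leb d]_t f (tscale c t))%E.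
Proof.
move=> c0; elim: d f => [|d IH] f mf f0.
  rewrite expr0 mul1e; apply: eq_integral => t _; congr f.
  by apply/eq_from_tnth => -[].
have mfs : measurable_fun setT (fun t => f (tscale c t)).
  by apply: measurableT_comp => //; exact: measurable_tscale.
rewrite [LHS]integral_tupleS; [|exact: mf|exact: f0].
rewrite [X in (_ * X)%E]integral_tupleS; [|exact: mfs|by move=> t; exact: f0].
rewrite [LHS](@integral1_affine c 0); first last.
- by move=> x; apply: integral_ge0.
- exact: measurable_tuple_int.
- exact: c0.
rewrite exprS EFinM -muleA; congr (_ * _)%E.
rewrite -ge0_integralZl//; first last.
- by rewrite lee_fin exprn_ge0// ltW.
- by move=> x _; apply: integral_ge0.
- exact: (measurable_tuple_int mfs).
apply: eq_integral => x _; rewrite IH//; last first.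
  apply: measurableT_comp => //; exact: measurable_tcons_r.
congr (_ * _)%E; apply: eq_integral => t _; congr f; symmetry; apply: eq_tcons.
  by rewrite tnth_mktuple addr0.
by move=> i; rewrite !tnth_mktuple tcons_tnthS.
Qed.

(** With the first coordinate [x] fixed, the tail undergoes a shear of the same kind, whose
    translation part [b'] absorbs the first column of [A] times [x]; the first coordinate itself is
    only translated. The induction therefore keeps [x] as the outer variable. *)
Lemma integral_shear_lower d A b (f : Rtuple R d -> \bar R) :
  (forall i j, (i <= j)%N -> A i j = 0) ->
  measurable_fun setT f -> (forall t, 0 <= f t)%E ->
  (\int[leb d]_t f (shear A b t) = \int[leb d]_t f t)%E.
Proof.
elim: d A b f => [|d IH] A b f AE mf f0.
  by apply: eq_integral => t _; congr f; apply/eq_from_tnth => -[].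
have mfs : measurable_fun setT (fun t => f (shear A b t)).
  by apply: measurableT_comp => //; exact: measurable_shear.
rewrite [LHS]integral_tupleS; [|exact: mfs|by move=> t; exact: f0].
rewrite [RHS]integral_tupleS; [|exact: mf|exact: f0].
rewrite [RHS](@integral1_affine 1 (b 0%N)); first last.
- by move=> x; apply: integral_ge0.
- exact: measurable_tuple_int.
- exact: ltr01.
rewrite mul1e; apply: eq_integral => x _.
pose b' i := A i.+1 0%N * x + b i.+1.
rewrite -(IH (fun i j => A i.+1 j.+1) b' (fun t => f (tcons ((1 * x + b 0%N)%R, t)))); first last.
- by move=> t; exact: f0.
- by apply: measurableT_comp => //; exact: measurable_tcons_r.
- by move=> i j ij; rewrite AE.
apply: eq_integral => t _; congr f; apply: eq_tcons.
  rewrite tnth_mktuple tcons_tnth0 big1 ?addr0 ?mul1r// => j _.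
  by rewrite AE ?mul0r.
move=> i; rewrite !tnth_mktuple tcons_tnthS big_ord_recl tcons_tnth0 /b'.
under eq_bigr do rewrite tcons_tnthS.
rewrite /= /bump/= add1n.
under eq_bigr do rewrite add1n.
by ring.
Qed.

(** Here the first coordinate moves by an affine form [l] in the tail, so it must be the inner
    variable: for a fixed tail the inner integral is translation invariant, and the tail is sheared
    by induction. *)
Lemma integral_shear_upper d A b (f : Rtuple R d -> \bar R) :
  (forall i j, (j <= i)%N -> A i j = 0) ->
  measurable_fun setT f -> (forall t, 0 <= f t)%E ->
  (\int[leb d]_t f (shear A b t) = \int[leb d]_t f t)%E.
Proof.
elim: d A b f => [|d IH] A b f AE mf f0.
  by apply: eq_integral => t _; congr f; apply/eq_from_tnth => -[].
have mfs : measurable_fun setT (fun t => f (shear A b t)).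
  by apply: measurableT_comp => //; exact: measurable_shear.
rewrite [LHS]integral_tupleS2; [|exact: mfs|by move=> t; exact: f0].
rewrite [RHS]integral_tupleS2; [|exact: mf|exact: f0].
pose A' i j := A i.+1 j.+1.
pose b' i := b i.+1.
transitivity (\int[leb d]_t \int[leb1]_x f (tcons (x, shear A' b' t)))%E.
  apply: eq_integral => t _.
  pose l := \sum_(j < d) A 0%N j.+1 * tnth t j + b 0%N.
  rewrite [RHS](@integral1_affine 1 l); first last.
  - by move=> x; exact: f0.
  - by apply: measurableT_comp => //; exact: measurable_tcons_l.
  - exact: ltr01.
  rewrite mul1e; apply: eq_integral => x _; congr f; apply: eq_tcons.
    rewrite tnth_mktuple tcons_tnth0 big_ord_recl AE// mul0r add0r.
    under eq_bigr do rewrite tcons_tnthS /= /bump/= add1n.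
    by rewrite mul1r addrA.
  move=> i; rewrite !tnth_mktuple tcons_tnthS big_ord_recl tcons_tnth0.
  rewrite /= /bump/= add1n AE// mul0r add0r.
  by under eq_bigr do rewrite tcons_tnthS /= /bump/= add1n.
have mg : measurable_fun setT (fun t : Rtuple R d => \int[leb1]_x f (tcons (x, t)))%E.
  apply: (@measurable_fun_fubini_tonelli_G _ _ _ _ _ leb1 (f \o @tcons R d)) => //.
    by apply: measurableT_comp => //; exact: measurable_tcons.
  by move=> x; exact: f0.
apply: (IH A' b' (fun t => \int[leb1]_x f (tcons (x, t)))%E).
- by move=> i j ij; rewrite /A' AE.
- exact: mg.
- by move=> t; apply: integral_ge0.
Qed.

End LebesgueTuple.

(** * Complex numbers *)

Section Complex.
Context {R : realType}.
Local Open Scope complex_scope.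
Implicit Types x y z : R[i].
Local Notation Re := (@complex.Re R).
Local Notation Im := (@complex.Im R).
Definition nc x : R := Normc.normc x.

Lemma nc_sqr x : nc x ^+ 2 = Re x ^+ 2 + Im x ^+ 2.
Proof. by case: x => a b; rewrite /nc /= sqr_sqrtr// addr_ge0 ?sqr_ge0. Qed.

Lemma nc_ge0 x : 0 <= nc x.
Proof. by case: x => a b; exact: sqrtr_ge0. Qed.

Lemma nc_norm x : `|x| = (nc x)%:C.
Proof. by case: x. Qed.

Lemma ncM x y : nc (x * y) = nc x * nc y.
Proof. exact: Normc.normcM. Qed.

Lemma ncD x y : nc (x + y) <= nc x + nc y.
Proof. exact: le_normcD. Qed.

Lemma ncN x : nc (- x) = nc x.
Proof. exact: normcN. Qed.

Lemma ncB x y : nc (x - y) <= nc x + nc y.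
Proof. by rewrite (le_trans (ncD _ _))// ncN. Qed.

Lemma nc_dist x y : nc (x - y) = nc (y - x).
Proof. by rewrite -ncN opprB. Qed.

Lemma nc_le_dist x y : nc x <= nc y + nc (x - y).
Proof. by rewrite -{1}(subrKC y x) ncD. Qed.

Lemma ncJ x : nc x^*%C = nc x.
Proof. by case: x => a b; rewrite /nc /= sqrrN. Qed.

Lemma ncR (a : R) : nc a%:C = `|a|.
Proof. by rewrite /nc /= expr0n/= addr0 sqrtr_sqr. Qed.

Lemma nc0 : nc 0 = 0.
Proof. by rewrite (ncR 0) normr0. Qed.

Lemma nc0_eq0 x : nc x = 0 -> x = 0.
Proof. exact: Normc.eq0_normc. Qed.

Lemma nc_gt0 x : x != 0 -> 0 < nc x.
Proof.
by move=> x0; rewrite lt_neqAle nc_ge0 andbT eq_sym; apply: contra x0 => /eqP/nc0_eq0 ->.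
Qed.

Lemma nc_Re x : `|Re x| <= nc x.
Proof.
by rewrite -(ler_pXn2r (n := 2%N))// ?nnegrE ?nc_ge0// real_normK ?num_real// nc_sqr lerDl sqr_ge0.
Qed.

Lemma nc_Im x : `|Im x| <= nc x.
Proof.
by rewrite -(ler_pXn2r (n := 2%N))// ?nnegrE ?nc_ge0// real_normK ?num_real// nc_sqr lerDr sqr_ge0.
Qed.

Lemma nc_leRI x : nc x <= `|Re x| + `|Im x|.
Proof.
rewrite -(ler_pXn2r (n := 2%N))// ?nnegrE ?nc_ge0 ?addr_ge0// nc_sqr.
rewrite -(real_normK (num_real (Re x))) -(real_normK (num_real (Im x))).
have := normr_ge0 (Re x); have := normr_ge0 (Im x); nra.
Qed.

Lemma mulcJ x : x * x^*%C = (nc x ^+ 2)%:C.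
Proof. by rewrite nc_sqr; case: x => a b; apply/eqP; rewrite eq_complex /=; apply/andP; split; apply/eqP; ring. Qed.

Lemma cReM x y : Re (x * y) = Re x * Re y - Im x * Im y.
Proof. by case: x; case: y. Qed.
Lemma cImM x y : Im (x * y) = Re x * Im y + Im x * Re y.
Proof. by case: x => ? ?; case: y. Qed.
Lemma cReD x y : Re (x + y) = Re x + Re y. Proof. by case: x; case: y. Qed.
Lemma cImD x y : Im (x + y) = Im x + Im y. Proof. by case: x; case: y. Qed.
Lemma cReN x : Re (- x) = - Re x. Proof. by case: x. Qed.
Lemma cImN x : Im (- x) = - Im x. Proof. by case: x. Qed.
Lemma cReJ x : Re x^*%C = Re x. Proof. by case: x. Qed.
Lemma cImJ x : Im x^*%C = - Im x. Proof. by case: x. Qed.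
Lemma cRe_sum (I : Type) (r : seq I) (P : pred I) (F : I -> R[i]) :
  Re (\sum_(i <- r | P i) F i) = \sum_(i <- r | P i) Re (F i).
Proof. exact: (big_morph Re cReD). Qed.
Lemma eq_creim x y : Re x = Re y -> Im x = Im y -> x = y.
Proof. by case: x; case: y => ? ? ? ? /= -> ->. Qed.

Lemma nc_sum (I : Type) (r : seq I) (P : pred I) (F : I -> R[i]) :
  nc (\sum_(i <- r | P i) F i) <= \sum_(i <- r | P i) nc (F i).
Proof.
elim/big_ind2: _ => //; first by rewrite nc0.
by move=> a b c e ab ce; rewrite (le_trans (ncD _ _))// lerD.
Qed.

Lemma cJM x y : (x * y)^*%C = x^*%C * y^*%C.
Proof. exact: rmorphM. Qed.
Lemma cJD x y : (x + y)^*%C = x^*%C + y^*%C.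
Proof. exact: rmorphD. Qed.
Lemma cJN x : (- x)^*%C = - x^*%C.
Proof. exact: rmorphN. Qed.
Lemma cJR (a : R) : (a%:C)^*%C = a%:C.
Proof. exact: conjc_real. Qed.
Lemma cRM (a b : R) : (a * b)%:C = a%:C * b%:C.
Proof. exact: rmorphM. Qed.
Definition cexp x : R[i] := (expR (Re x) * cos (Im x)) +i* (expR (Re x) * sin (Im x)).

Lemma Re_cexp x : Re (cexp x) = expR (Re x) * cos (Im x).
Proof. by []. Qed.
Lemma Im_cexp x : Im (cexp x) = expR (Re x) * sin (Im x).
Proof. by []. Qed.

Lemma cexpD x y : cexp (x + y) = cexp x * cexp y.
Proof.
by apply: eq_creim; rewrite ?cReM ?cImM !(Re_cexp, Im_cexp) cReD cImD expRD (cosD, sinD); ring.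
Qed.

Lemma nc_cexp x : nc (cexp x) = expR (Re x).
Proof.
by rewrite /nc /= !exprMn -mulrDr cos2Dsin2 mulr1 sqrtr_sqr ger0_norm ?expR_ge0.
Qed.

Lemma cexp0 : cexp 0 = 1.
Proof. by apply: eq_creim; rewrite (Re_cexp, Im_cexp)/= expR0 (cos0, sin0) ?mulr1 ?mulr0. Qed.

Lemma cexpR (a : R) : cexp a%:C = (expR a)%:C.
Proof. by apply: eq_creim; rewrite (Re_cexp, Im_cexp)/= (cos0, sin0) ?mulr1 ?mulr0. Qed.

(** The inequality e^x >= 1 + x, used at [a] and at [- a], suffices for both signs of [a]. *)
Lemma expR_sub1_bound (a : R) : `|expR a - 1| <= `|a| * expR `|a|.
Proof.
have h : expR a * (1 - a) <= 1.
  rewrite -[leRHS](mulfV (lt0r_neq0 (expR_gt0 a))) ler_pM2l ?expR_gt0// -expRN.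
  exact: expR_ge1Dx.
have h1 := expR_ge1Dx a.
have [a0|a0] := leP 0 a.
  by rewrite !ger0_norm//; nra.
rewrite ltr0_norm; last by rewrite subr_lt0 expR_lt1.
have := expR_ge1Dx (- a); rewrite (ltr0_norm a0); nra.
Qed.

Lemma expR_taylor1 (a : R) : `|expR a - 1 - a| <= a ^+ 2 * expR `|a|.
Proof.
have h : expR a * (1 - a) <= 1.
  rewrite -[leRHS](mulfV (lt0r_neq0 (expR_gt0 a))) ler_pM2l ?expR_gt0// -expRN.
  exact: expR_ge1Dx.
have h1 := expR_ge1Dx a.
rewrite ger0_norm; last by lra.
apply: (@le_trans _ _ (a * (expR a - 1))); first by lra.
apply: (le_trans (ler_norm _)); rewrite normrM -real_normK ?num_real// expr2 -mulrA.
by rewrite ler_wpM2l// expR_sub1_bound.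
Qed.

Lemma sin_le (b : R) : `|sin b| <= `|b|.
Proof.
wlog b0 : b / 0 <= b.
  move=> H; have [/H//|b0] := leP 0 b.
  by have := H (- b); rewrite sinN !normrN; apply; rewrite oppr_ge0 ltW.
have [c _] : exists2 c, c \in `[0, b]%R & sin b - sin 0 = cos c * (b - 0).
  apply: (@MVT_segment _ (@sin R) (@cos R)) => //.
  by apply: continuous_subspaceT => x; exact: continuous_sin.
by rewrite sin0 !subr0 => ->; rewrite normrM ler_piMl// cos_max.
Qed.

Lemma cos_taylor0 (b : R) : `|cos b - 1| <= b ^+ 2 /\ `|cos b - 1| <= `|b|.
Proof.
have e : `|cos b - 1| = 2 * sin (b / 2) ^+ 2.
  have -> : cos b = 1 - 2 * sin (b / 2) ^+ 2.
    rewrite [in LHS](_ : b = (b / 2) *+ 2); last by rewrite mulr2n -splitr.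
    by rewrite cos_mulr2n cos2sin2 mulr2n; ring.
  by rewrite addrAC subrr add0r normrN ger0_norm// mulr_ge0// sqr_ge0.
have h := sin_le (b / 2); rewrite normrM (@ger0_norm R 2^-1)// in h.
have h1 := sin_max (b / 2).
have h0 := normr_ge0 (sin (b / 2)); have hb := normr_ge0 b.
rewrite e -real_normK ?num_real// -[b ^+ 2]real_normK ?num_real//.
by split; nra.
Qed.

Lemma sin_taylor1 (b : R) : `|sin b - b| <= b ^+ 2.
Proof.
wlog b0 : b / 0 <= b.
  move=> H; have [/H//|b0] := leP 0 b.
  by have := H (- b); rewrite sinN -opprD normrN sqrrN; apply; rewrite oppr_ge0 ltW.
have [c cb] : exists2 c, c \in `[0, b]%R & sin b - sin 0 = cos c * (b - 0).
  apply: (@MVT_segment _ (@sin R) (@cos R)) => //.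
  by apply: continuous_subspaceT => x; exact: continuous_sin.
rewrite sin0 !subr0 => ->.
have -> : cos c * b - b = (cos c - 1) * b by ring.
rewrite normrM (ger0_norm b0) expr2 ler_wpM2r//.
apply: (le_trans (cos_taylor0 c).2).
by move: cb; rewrite in_itv/= => /andP[c0 ?]; rewrite ger0_norm.
Qed.

(** With x = a + ib, the real part of the remainder splits into e^a - 1 - a and e^a (cos b - 1), the
    imaginary part into e^a (sin b - b) and b (e^a - 1). Each of the four pieces is at most |x|^2
    e^|x|. The quadratic remainder is what [entire_quad] asks for. *)
Lemma cexp_taylor1 x : nc (cexp x - 1 - x) <= 4 * nc x ^+ 2 * expR (nc x).
Proof.
apply: (le_trans (nc_leRI _)); rewrite !(cReD, cImD, cReN, cImN) Re_cexp Im_cexp /= subr0.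
set a := Re x; set b := Im x; set r := nc x.
have ar : `|a| <= r by exact: nc_Re.
have br : `|b| <= r by exact: nc_Im.
have ea : expR a <= expR r by rewrite ler_expR (le_trans (ler_norm _)).
have eaa : expR `|a| <= expR r by rewrite ler_expR.
have e0 := expR_ge0 r.
have r0 : 0 <= r by exact: nc_ge0.
have a2 : a ^+ 2 <= r ^+ 2 by rewrite -real_normK ?num_real// ler_pXn2r ?nnegrE.
have b2 : b ^+ 2 <= r ^+ 2 by rewrite -real_normK ?num_real// ler_pXn2r ?nnegrE.
have h1 : `|expR a - 1 - a| <= r ^+ 2 * expR r.
  by apply: (le_trans (expR_taylor1 a)); rewrite ler_pM// ?sqr_ge0 ?expR_ge0.
have h2 : `|expR a * (cos b - 1)| <= r ^+ 2 * expR r.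
  rewrite normrM ger0_norm ?expR_ge0// mulrC ler_pM ?expR_ge0//.
  exact: (le_trans (cos_taylor0 b).1).
have h3 : `|expR a * (sin b - b)| <= r ^+ 2 * expR r.
  rewrite normrM ger0_norm ?expR_ge0// mulrC ler_pM ?expR_ge0//.
  exact: (le_trans (sin_taylor1 b)).
have h4 : `|b * (expR a - 1)| <= r ^+ 2 * expR r.
  rewrite normrM expr2 -mulrA ler_pM//.
  by apply: (le_trans (expR_sub1_bound a)); rewrite ler_pM ?expR_ge0.
have -> : expR a * cos b - 1 - a = (expR a - 1 - a) + expR a * (cos b - 1) by ring.
have -> : expR a * sin b - b = expR a * (sin b - b) + b * (expR a - 1) by ring.
have h5 := ler_normD (expR a - 1 - a) (expR a * (cos b - 1)).
have h6 := ler_normD (expR a * (sin b - b)) (b * (expR a - 1)).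
by lra.
Qed.

End Complex.
Arguments nc {R} x : simpl never.
Arguments cexp {R} x : simpl never.

(** * Integrals of complex-valued functions, taken componentwise *)

Section ComplexIntegral.
Context {d : measure_display} {T : measurableType d} {R : realType}.
Variable mu : {measure set T -> \bar R}.
Local Open Scope complex_scope.
Implicit Types g h : T -> R[i].

Definition cmeas g := measurable_fun setT (fun t => complex.Re (g t) : R) /\
  measurable_fun setT (fun t => complex.Im (g t) : R).

Definition cintg g := cmeas g /\ (\int[mu]_t (nc (g t))%:E < +oo)%E.

Definition cint g : R[i] :=
  (\int[mu]_t complex.Re (g t))%R +i* (\int[mu]_t complex.Im (g t))%R.

Lemma cmeas_nc g : cmeas g -> measurable_fun setT (fun t => nc (g t)).
Proof.
move=> [mr mi].
have -> : (fun t => nc (g t)) = (fun t => Num.sqrt (complex.Re (g t) ^+ 2 + complex.Im (g t) ^+ 2)).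
  by apply/funext => t; rewrite -nc_sqr sqrtr_sqr ger0_norm ?nc_ge0.
apply: (measurableT_comp (f := @Num.sqrt R)).
  by apply: continuous_measurable_fun; exact: sqrt_continuous.
by apply: measurable_funD; apply: measurable_funX.
Qed.

Lemma cmeasD g h : cmeas g -> cmeas h -> cmeas (fun t => g t + h t).
Proof.
move=> [? ?] [? ?]; split.
  by under eq_fun do rewrite cReD; apply: measurable_funD.
by under eq_fun do rewrite cImD; apply: measurable_funD.
Qed.

Lemma cmeasM g h : cmeas g -> cmeas h -> cmeas (fun t => g t * h t).
Proof.
move=> [? ?] [? ?]; split.
  by under eq_fun do rewrite cReM; apply: measurable_funB; apply: measurable_funM.
by under eq_fun do rewrite cImM; apply: measurable_funD; apply: measurable_funM.
Qed.

Lemma cmeas_cst (c : R[i]) : cmeas (fun=> c).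
Proof. by split; exact: measurable_cst. Qed.

Lemma cmeasJ g : cmeas g -> cmeas (fun t => (g t)^*%C).
Proof.
move=> [? ?]; split.
  by under eq_fun do rewrite cReJ.
by under eq_fun do rewrite cImJ; apply: measurableT_comp.
Qed.

Lemma cmeasR (f : T -> R) : measurable_fun setT f -> cmeas (fun t => (f t)%:C).
Proof. by move=> mf; split => //=; exact: measurable_cst. Qed.

Lemma cmeasN g : cmeas g -> cmeas (fun t => - g t).
Proof.
move=> mg; have := cmeasM (cmeas_cst (-1)) mg.
by congr cmeas; apply/funext => t; rewrite mulN1r.
Qed.

Lemma cmeasB g h : cmeas g -> cmeas h -> cmeas (fun t => g t - h t).
Proof. by move=> mg mh; apply: cmeasD => //; exact: cmeasN. Qed.

Lemma cmeas_cexp g : cmeas g -> cmeas (fun t => cexp (g t)).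
Proof.
move=> [mr mi]; split; rewrite /cexp/=; apply: measurable_funM.
- by apply: measurableT_comp.
- by apply: (measurableT_comp (f := @cos R)) => //; apply: continuous_measurable_fun; exact: continuous_cos.
- by apply: measurableT_comp.
- by apply: (measurableT_comp (f := @sin R)) => //; apply: continuous_measurable_fun; exact: continuous_sin.
Qed.

Lemma cintg_Re g : cintg g -> mu.-integrable setT (EFin \o (fun t => complex.Re (g t))).
Proof.
move=> [mg goo]; have mn := cmeas_nc mg; case: mg => mr mi.
apply/integrableP; split; first exact/measurable_EFinP.
apply: le_lt_trans goo; apply: ge0_le_integral => //.
- by apply: measurableT_comp => //; exact/measurable_EFinP.
- exact/measurable_EFinP.
- by move=> t _; rewrite /= lee_fin nc_Re.
Qed.

Lemma cintg_Im g : cintg g -> mu.-integrable setT (EFin \o (fun t => complex.Im (g t))).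
Proof.
move=> [mg goo]; have mn := cmeas_nc mg; case: mg => mr mi.
apply/integrableP; split; first exact/measurable_EFinP.
apply: le_lt_trans goo; apply: ge0_le_integral => //.
- by apply: measurableT_comp => //; exact/measurable_EFinP.
- exact/measurable_EFinP.
- by move=> t _; rewrite /= lee_fin nc_Im.
Qed.

Lemma cintg_nc g : cintg g -> mu.-integrable setT (EFin \o (fun t => nc (g t))).
Proof.
move=> [mg goo]; have mn := cmeas_nc mg; apply/integrableP; split; first exact/measurable_EFinP.
by under eq_integral do rewrite /= ger0_norm ?nc_ge0//.
Qed.

Lemma cintg_dom g (f : T -> R) : cmeas g -> mu.-integrable setT (EFin \o f) ->
  (forall t, nc (g t) <= f t) -> cintg g.
Proof.
move=> mg /integrableP[mf foo] gf; split=> //; apply: le_lt_trans foo.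
apply: ge0_le_integral => //.
- by move=> t _; rewrite lee_fin nc_ge0.
- by apply/measurable_EFinP; exact: cmeas_nc.
- by apply: measurableT_comp.
- by move=> t _; rewrite /= lee_fin (le_trans (gf t))// ler_norm.
Qed.

Lemma cintgD g h : cintg g -> cintg h -> cintg (fun t => g t + h t).
Proof.
move=> ig ih; apply: (@cintg_dom _ (fun t => nc (g t) + nc (h t))).
- by apply: cmeasD; [case: ig|case: ih].
- by apply: (integrableD measurableT (cintg_nc ig) (cintg_nc ih)).
- by move=> t; exact: ncD.
Qed.

Lemma cintgZ (c : R[i]) g : cintg g -> cintg (fun t => c * g t).
Proof.
move=> ig; apply: (@cintg_dom _ (fun t => nc c * nc (g t))).
- by apply: cmeasM; [exact: cmeas_cst|case: ig].
- exact: (integrableZl measurableT (nc c) (cintg_nc ig)).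
- by move=> t; rewrite ncM.
Qed.

Lemma cintg_eq g h : (forall t, g t = h t) -> cintg g -> cintg h.
Proof. by move=> gh; congr cintg; apply/funext. Qed.

Lemma cintgN g : cintg g -> cintg (fun t => - g t).
Proof. by move/(cintgZ (-1)); apply: cintg_eq => t; rewrite mulN1r. Qed.

Lemma cintgB g h : cintg g -> cintg h -> cintg (fun t => g t - h t).
Proof. by move=> ig ih; apply: cintgD => //; exact: cintgN. Qed.

Lemma eq_cint g h : (forall t, g t = h t) -> cint g = cint h.
Proof. by move=> gh; congr cint; apply/funext. Qed.

Lemma cintD g h : cintg g -> cintg h -> cint (fun t => g t + h t) = cint g + cint h.
Proof.
move=> ig ih; apply: eq_creim; rewrite /=.
  under eq_Rintegral do rewrite cReD.
  by rewrite RintegralD//; exact: cintg_Re.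
under eq_Rintegral do rewrite cImD.
by rewrite RintegralD//; exact: cintg_Im.
Qed.

Lemma cintZ (c : R[i]) g : cintg g -> cint (fun t => c * g t) = c * cint g.
Proof.
move=> ig; have rg := cintg_Re ig; have mg := cintg_Im ig.
have intZ (k : R) f : mu.-integrable setT (EFin \o f) -> mu.-integrable setT (EFin \o (fun t => k * f t)).
  by move=> fi; exact: (integrableZl measurableT k fi).
apply: eq_creim; rewrite ?(cReM, cImM) /=.
  under eq_Rintegral do rewrite cReM.
  by rewrite RintegralB ?RintegralZl//; exact: intZ.
under eq_Rintegral do rewrite cImM.
by rewrite RintegralD ?RintegralZl//; exact: intZ.
Qed.

Lemma cintN g : cintg g -> cint (fun t => - g t) = - cint g.
Proof.
move=> ig; rewrite -mulN1r -cintZ//.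
by apply: eq_cint => t; rewrite mulN1r.
Qed.

Lemma cintB g h : cintg g -> cintg h -> cint (fun t => g t - h t) = cint g - cint h.
Proof. by move=> ig ih; rewrite cintD ?cintN//; exact: cintgN. Qed.

Lemma cintJ g : cintg g -> cint (fun t => (g t)^*%C) = (cint g)^*%C.
Proof.
move=> ig; apply: eq_creim; rewrite ?(cReJ, cImJ) /=.
  by under eq_Rintegral do rewrite cReJ.
under eq_Rintegral do rewrite cImJ -mulN1r.
by rewrite RintegralZl ?mulN1r//; exact: cintg_Im.
Qed.

Lemma cint_real (f : T -> R) : cint (fun t => (f t)%:C) = (\int[mu]_t f t)%R%:C.
Proof.
by apply: eq_creim => //=; rewrite Rintegral_cst// mul0r.
Qed.

(** Estimating the real and imaginary parts separately costs the factor 2. This is harmless, since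
    the bound only serves to prove finiteness or differentiability; sharp operator norms come later
    from orthogonality. *)
Lemma nc_cint_le g : cintg g -> nc (cint g) <= 2 * (\int[mu]_t nc (g t))%R.
Proof.
move=> ig; apply: (le_trans (nc_leRI _)); rewrite /= mulr_natl mulr2n.
have H f : mu.-integrable setT (EFin \o f) -> (forall t, `|f t| <= nc (g t)) ->
    `| \int[mu]_t f t | <= (\int[mu]_t nc (g t))%R.
  move=> fi fg; apply: (le_trans (le_normr_Rintegral _ fi)) => //.
  apply: le_Rintegral => //; last exact: cintg_nc.
  by have := integrable_abse fi; apply: eq_integrable.
apply: lerD; apply: H.
- exact: cintg_Re.
- by move=> t; exact: nc_Re.
- exact: cintg_Im.
- by move=> t; exact: nc_Im.
Qed.

End ComplexIntegral.

Section ComplexFubini.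
Context {d1 d2 : measure_display} {T1 : measurableType d1} {T2 : measurableType d2} {R : realType}.
Variables (m1 : {sigma_finite_measure set T1 -> \bar R})
  (m2 : {sigma_finite_measure set T2 -> \bar R}).

(** Every slice, not just almost every one, is assumed integrable, so that [fine] loses nothing on
    the inner integrals and Fubini's theorem for extended reals transfers. *)
Lemma Rintegral_fubini (f : T1 * T2 -> R) :
  (m1 \x m2)%E.-integrable setT (EFin \o f) ->
  (forall x, m2.-integrable setT (EFin \o (fun y => f (x, y)))) ->
  (forall y, m1.-integrable setT (EFin \o (fun x => f (x, y)))) ->
  \int[m1]_x (\int[m2]_y f (x, y))%R = \int[m2]_y (\int[m1]_x f (x, y))%R :> R.
Proof.
move=> fi f1 f2; rewrite /Rintegral; congr fine.
transitivity (\int[m1]_x \int[m2]_y (f (x, y))%:E)%E.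
  by apply: eq_integral => x _; rewrite fineK//; exact: (integrable_fin_num measurableT (f1 x)).
transitivity (\int[m2]_y \int[m1]_x (f (x, y))%:E)%E; last first.
  by apply: eq_integral => y _; rewrite fineK//; exact: (integrable_fin_num measurableT (f2 y)).
exact: (@Fubini _ _ _ _ _ m1 m2 (EFin \o f)).
Qed.

Lemma cint_fubini (g : T1 * T2 -> R[i]) :
  cintg (m1 \x m2)%E g -> (forall x, cintg m2 (fun y => g (x, y))) ->
  (forall y, cintg m1 (fun x => g (x, y))) ->
  cint m1 (fun x => cint m2 (fun y => g (x, y))) = cint m2 (fun y => cint m1 (fun x => g (x, y))).
Proof.
move=> ig i1 i2; apply: eq_creim; rewrite /=.
  apply: (@Rintegral_fubini (fun p => complex.Re (g p))).
  - exact: cintg_Re.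
  - by move=> x; exact: (cintg_Re (i1 x)).
  - by move=> y; exact: (cintg_Re (i2 y)).
apply: (@Rintegral_fubini (fun p => complex.Im (g p))).
- exact: cintg_Im.
- by move=> x; exact: (cintg_Im (i1 x)).
- by move=> y; exact: (cintg_Im (i2 y)).
Qed.

End ComplexFubini.

(** * The mean value property of holomorphic functions *)

Section Goursat.
Context {R : realType}.
Implicit Types a b c d : R.

(* Goursat's subdivision argument, for an abstract additive function of
   rectangles [a, b] x [c, d]. *)
Lemma rectangle_bisection (I : R -> R -> R -> R -> R) a b c d :
  a < b -> c < d ->
  (forall a' m b' c' d', a <= a' -> a' < m -> m < b' -> b' <= b ->
     c <= c' -> c' < d' -> d' <= d ->
     I a' b' c' d' = I a' m c' d' + I m b' c' d') ->
  (forall a' b' c' m d', a <= a' -> a' < b' -> b' <= b ->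
     c <= c' -> c' < m -> m < d' -> d' <= d ->
     I a' b' c' d' = I a' b' c' m + I a' b' m d') ->
  (forall r t, a <= r <= b -> c <= t <= d -> forall e, 0 < e ->
     exists2 de, 0 < de & forall a' b' c' d',
       a <= a' -> a' < b' -> b' <= b -> c <= c' -> c' < d' -> d' <= d ->
       a' <= r <= b' -> c' <= t <= d' -> b' - a' + (d' - c') < de ->
       `|I a' b' c' d'| <= e * (b' - a' + (d' - c')) ^+ 2) ->
  I a b c d = 0.
Proof.
move=> ab cd Ir It loc; apply/eqP; rewrite -normr_le0 leNgt; apply/negP => I0.
pose s0 := b - a + (d - c).
have s0_gt0 : 0 < s0 by rewrite addr_gt0 ?subr_gt0.
pose ok (q : R * R * R * R) := let: (a', b', c', d') := q in
  [/\ a <= a', a' < b', b' <= b, c <= c' & c' < d'] /\ d' <= d.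
pose val (q : R * R * R * R) := let: (a', b', c', d') := q in `|I a' b' c' d'|.
pose sub (p q : R * R * R * R) := let: (a', b', c', d') := p in
  let: (a1, b1, c1, d1) := q in
  [/\ a1 <= a', b' <= b1, c1 <= c' & d' <= d1] /\
  (b' - a' = (b1 - a1) / 2 /\ d' - c' = (d1 - c1) / 2).
(* By the triangle inequality one of the four quarters carries at least a quarter of |I|. The sigma
   type makes the selection a function that can be iterated. *)
have step q : {p | ok q -> [/\ ok p, sub p q & val q <= 4 * val p]}.
  apply/cid.
  have [okq|nok] := pselect (ok q); last by exists q.
  move: q okq => [[[a1 b1] c1] d1] [[aa1 ab1 bb1 cc1 cd1] dd1].
  have [m mE] : exists m, m = (a1 + b1) / 2 by eexists.
  have [k kE] : exists k, k = (c1 + d1) / 2 by eexists.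
  have [f1 f2 f3 f4] : [/\ m - a1 = (b1 - a1) / 2, b1 - m = (b1 - a1) / 2,
      k - c1 = (d1 - c1) / 2 & d1 - k = (d1 - c1) / 2].
    by rewrite mE kE; split; field.
  have h1 : a1 < m by rewrite -subr_gt0 f1 divr_gt0 ?subr_gt0.
  have h2 : m < b1 by rewrite -subr_gt0 f2 divr_gt0 ?subr_gt0.
  have h3 : c1 < k by rewrite -subr_gt0 f3 divr_gt0 ?subr_gt0.
  have h4 : k < d1 by rewrite -subr_gt0 f4 divr_gt0 ?subr_gt0.
  have [g1 g2 g3 g4] := And4 (ltW h1) (ltW h2) (ltW h3) (ltW h4).
  have am : a <= m := le_trans aa1 g1.
  have mb : m <= b := le_trans g2 bb1.
  have ck : c <= k := le_trans cc1 g3.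
  have kd : k <= d := le_trans g4 dd1.
  have E : I a1 b1 c1 d1 = I a1 m c1 k + I a1 m k d1 + (I m b1 c1 k + I m b1 k d1).
    rewrite (Ir a1 m b1)// (It a1 m c1 k)//.
    by rewrite (It m b1 c1 k).
  have := ler_normD (I a1 m c1 k + I a1 m k d1) (I m b1 c1 k + I m b1 k d1).
  have := ler_normD (I a1 m c1 k) (I a1 m k d1).
  have := ler_normD (I m b1 c1 k) (I m b1 k d1).
  rewrite -E => e1 e2 e3.
  have [|q1] := leP `|I a1 b1 c1 d1| (4 * `|I a1 m c1 k|).
    by exists (a1, m, c1, k)  => _; do !split.
  have [|q2] := leP `|I a1 b1 c1 d1| (4 * `|I a1 m k d1|).
    by exists (a1, m, k, d1)  => _; do !split.
  have [|q3] := leP `|I a1 b1 c1 d1| (4 * `|I m b1 c1 k|).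
    by exists (m, b1, c1, k)  => _; do !split.
  exists (m, b1, k, d1) => _; do !split => //.
  rewrite /val; move: q1 q2 q3 e1 e2 e3; clear.
  move: `|I a1 b1 c1 d1| `|I a1 m c1 k| `|I a1 m k d1| `|I m b1 c1 k| `|I m b1 k d1|.
  by move: `|_| `|_| => *; lra.
pose Q k := iter k (fun q => projT1 (step q)) (a, b, c, d).
have okQ k : ok (Q k).
  elim: k => [|k IH]; first by split=> //; split.
  by rewrite /Q iterS -/(Q k); case: (step (Q k)) => p /= /(_ IH) [].
have stepQ k : sub (Q k.+1) (Q k) /\ val (Q k) <= 4 * val (Q k.+1).
  by rewrite /Q iterS -/(Q k); case: (step (Q k)) => p /= /(_ (okQ k)) [].
pose qa k := (Q k).1.1.1; pose qb k := (Q k).1.1.2.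
pose qc k := (Q k).1.2; pose qd k := (Q k).2.
have QE k : Q k = (qa k, qb k, qc k, qd k).
  by rewrite /qa /qb /qc /qd; case: (Q k) => [[[]]].
have ok' k : [/\ a <= qa k, qa k < qb k, qb k <= b, c <= qc k & qc k < qd k] /\ qd k <= d.
  by have := okQ k; rewrite QE.
have st k : [/\ qa k <= qa k.+1, qb k.+1 <= qb k, qc k <= qc k.+1 & qd k.+1 <= qd k] /\
   (qb k.+1 - qa k.+1 = (qb k - qa k) / 2 /\ qd k.+1 - qc k.+1 = (qd k - qc k) / 2).
  by have [h _] := stepQ k; move: h; rewrite (QE k) (QE k.+1).
have vl k : `|I (qa k) (qb k) (qc k) (qd k)| <= 4 * `|I (qa k.+1) (qb k.+1) (qc k.+1) (qd k.+1)|.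
  by have [_ h] := stepQ k; move: h; rewrite (QE k) (QE k.+1).
have size k : qb k - qa k + (qd k - qc k) = s0 / 2 ^+ k.
  elim: k => [|k IH]; first by rewrite expr0 divr1.
  have [_ [-> ->]] := st k; rewrite -mulrDl IH exprSr invfM mulrA//.
(* Each bisection divides the squared size by 4 and |I| by at most 4, so the ratio of |I| to the
   squared size never drops below its initial value. *)
have big k : `|I a b c d| / s0 ^+ 2 * (qb k - qa k + (qd k - qc k)) ^+ 2 <=
    `|I (qa k) (qb k) (qc k) (qd k)|.
  elim: k => [|k IH]; first by rewrite mulfVK// sqrf_eq0 gt_eqF.
  have := vl k.
  have -> : qb k.+1 - qa k.+1 + (qd k.+1 - qc k.+1) = (qb k - qa k + (qd k - qc k)) / 2.
    by have [_ [-> ->]] := st k; rewrite -mulrDl.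
  rewrite expr_div_n; set x := (_ ^+ 2) in IH *.
  set y := `|I a b c d| / _ in IH *.
  move: IH; rewrite (_ : 2 ^+ 2 = 4 :> R); last by ring.
  by rewrite mulrA; lra.
have mono (u : nat -> R) : (forall k, u k <= u k.+1) -> forall k l, (k <= l)%N -> u k <= u l.
  by move=> hu k l kl; exact: (homo_leq (@lexx _ _) (@le_trans _ _) hu).
have nested (u v : nat -> R) : (forall k, u k <= u k.+1) -> (forall k, v k.+1 <= v k) ->
    (forall k, u k < v k) -> exists x, forall k, u k <= x <= v k.
  move=> hu hv uv; exists (sup (range u)) => k.
  have H l : u l <= v k.
    have [kl|lk] := leP k l.
      apply: (le_trans (ltW (uv l))).
      by rewrite -lerN2; apply: (mono (fun i => - v i)) => // i; rewrite lerN2.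
    by apply: (le_trans (mono _ hu _ _ (ltW lk))); exact: ltW.
  apply/andP; split.
    by apply: ub_le_sup; [exists (v k) => _ [l _ <-]; exact: H|exists k].
  by apply: ge_sup; [exists (u 0%N); exists 0%N|move=> _ [l _ <-]; exact: H].
have [r hr] : exists r, forall k, qa k <= r <= qb k.
  by apply: nested => k; [have [[]]:=st k|have [[]]:=st k|have [[]]:=ok' k].
have [t ht] : exists t, forall k, qc k <= t <= qd k.
  by apply: nested => k; [have [[]]:=st k|have [[]]:=st k|have [[]]:=ok' k].
(* Half of the initial ratio: on small rectangles around the common point [(r, t)], the local
   estimate with this [e] contradicts [big]. *)
pose e := `|I a b c d| / s0 ^+ 2 / 2.
have e0 : 0 < e by rewrite !divr_gt0// exprn_gt0.
have [de de0 hde] := loc r t (hr 0%N) (ht 0%N) e e0.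
have [k hk] : exists k, s0 / 2 ^+ k < de.
  have := @cvg_geometric R s0 (2^-1).
  rewrite ger0_norm// invf_lt1// ltr1n => /(_ isT) /cvgrPdist_lt/(_ _ de0)[k _ /(_ k)].
  rewrite /= leqnn => /(_ isT); rewrite sub0r normrN ger0_norm ?mulr_ge0 ?exprn_ge0 ?(ltW s0_gt0)//.
  by rewrite exprVn => h; exists k.
have [[k1 k2 k3 k4 k5] k6] := ok' k.
have := hde _ _ _ _ k1 k2 k3 k4 k5 k6 (hr k) (ht k).
rewrite size => /(_ hk).
have := big k; rewrite size => h1 h2.
have := le_trans h1 h2; rewrite ler_pM2r ?exprn_gt0 ?divr_gt0 ?exprn_gt0//.
have h : 0 < `|I a b c d| / s0 ^+ 2 by rewrite divr_gt0 ?exprn_gt0.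
by rewrite /e; lra.
Qed.

End Goursat.

Section MeanValue.
Context {R : realType}.
Local Open Scope complex_scope.
Local Notation leb1 := (@lebesgue_measure R).
Implicit Types a b c d r t : R.

Lemma continuous_itv_integrable (f : R -> R) a b :
  (forall x, a <= x <= b -> {for x, continuous f}) ->
  leb1.-integrable `[a, b] (EFin \o f).
Proof.
move=> cf; apply: continuous_compact_integrable; first exact: segment_compact.
apply: continuous_in_subspaceT => x; rewrite inE/= in_itv/=; exact: cf.
Qed.

Lemma lebesgue_itvcc a b : a <= b -> leb1 `[a, b]%classic = (b - a)%:E.
Proof.
move=> ab; have := lebesgue_measure_itv `[a, b]; rewrite /= lte_fin => ->.
by case: ltP => // ba; have -> : a = b; [apply/eqP; rewrite eq_le ab ba|rewrite subrr].
Qed.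

Lemma Rintegral_itv_bound (f : R -> R) M a b : a <= b ->
  leb1.-integrable `[a, b] (EFin \o f) -> (forall x, a <= x <= b -> `|f x| <= M) ->
  `| \int[leb1]_(x in `[a, b]) f x | <= M * (b - a).
Proof.
move=> ab fi fM; apply: (le_trans (le_normr_Rintegral _ fi)) => //.
have -> : M * (b - a) = \int[leb1]_(x in `[a, b]) M.
  rewrite Rintegral_cst//; congr (_ * _).
  exact: (esym (congr1 fine (lebesgue_itvcc ab))).
apply: le_Rintegral => //.
- by have := integrable_abse fi; apply: eq_integrable.
- apply: continuous_itv_integrable => x _; exact: cst_continuous.
Qed.

Lemma Rintegral_itv_cst (k : R) a b : a <= b ->
  \int[leb1]_(x in `[a, b]) k = k * (b - a).
Proof.
move=> ab; rewrite Rintegral_cst//; congr (_ * _).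
exact: (congr1 fine (lebesgue_itvcc ab)).
Qed.

Lemma Rintegral_itv_split (f : R -> R) a m b : a <= m -> m <= b ->
  leb1.-integrable `[a, b] (EFin \o f) ->
  \int[leb1]_(x in `[a, b]) f x = \int[leb1]_(x in `[a, m]) f x + \int[leb1]_(x in `[m, b]) f x.
Proof.
move=> am mb fi.
have := @Rintegral_itvB R f (BLeft a) (BRight b) m fi.
rewrite !bnd_simp => /(_ am mb) h.
rewrite -[\int[leb1]_(x in `[m, b]) f x]Rintegral_itv_obnd_cbnd; first by rewrite -h subrKC.
by apply: integrableS fi => //; apply: subset_itvr; rewrite bnd_simp.
Qed.

(** Complex differentiability with real radii and real errors, so that Goursat's estimates stay in
    [R]; the complex slope [k] is what encodes the Cauchy-Riemann equations. *)
Definition cdiff (g : R[i] -> R[i]) := forall x, exists k, forall e, 0 < e ->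
  exists2 de, 0 < de & forall y, nc (y - x) < de ->
    nc (g y - g x - k * (y - x)) <= e * nc (y - x).

Definition polar r t : R[i] := (r * cos t) +i* (r * sin t).

Lemma polar_lip r t r0 t0 :
  nc (polar r t - polar r0 t0) <= 2 * `|r - r0| + 2 * `|r0| * `|t - t0|.
Proof.
have key (f df : R -> R) : (forall x : R, is_derive x (1 : R) f (df x)) -> (forall x, `|df x| <= 1) ->
    forall x y, `|f x - f y| <= `|x - y|.
  move=> fdf df1.
  have H x y : x <= y -> `|f y - f x| <= `|y - x|.
    move=> xy; have [z _ ->] : exists2 z, z \in `[x, y]%R & f y - f x = df z * (y - x).
      apply: MVT_segment => // z.
      by apply: derivable_within_continuous => z' _; exact: ex_derive.
    by rewrite normrM ler_piMl.
  move=> x y; have [xy|/ltW yx] := leP y x; first exact: H.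
  by rewrite distrC (distrC x); exact: H.
have cl := key _ _ (@is_derive_cos R) (fun x => eq_ind_r (fun z => z <= 1) (sin_max x) (normrN _)).
have sl := key _ _ (@is_derive_sin R) (@cos_max R).
apply: (le_trans (nc_leRI _)); rewrite /=.
have -> : r * cos t - r0 * cos t0 = (r - r0) * cos t + r0 * (cos t - cos t0) by ring.
have -> : r * sin t - r0 * sin t0 = (r - r0) * sin t + r0 * (sin t - sin t0) by ring.
have h1 : `|(r - r0) * cos t + r0 * (cos t - cos t0)| <= `|r - r0| + `|r0| * `|t - t0|.
  apply: (le_trans (ler_normD _ _)); rewrite !normrM lerD// ?ler_wpM2l//.
  by rewrite ler_piMr// cos_max.
have h2 : `|(r - r0) * sin t + r0 * (sin t - sin t0)| <= `|r - r0| + `|r0| * `|t - t0|.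
  apply: (le_trans (ler_normD _ _)); rewrite !normrM lerD// ?ler_wpM2l//.
  by rewrite ler_piMr// sin_max.
by lra.
Qed.

Section fix_g.
Variable g : R[i] -> R[i].
Hypothesis gd : cdiff g.

Lemma cdiff_cont x e : 0 < e -> exists2 de, 0 < de & forall y, nc (y - x) < de -> nc (g y - g x) < e.
Proof.
move=> e0; have [k /(_ 1 ltr01)[de de0 H]] := gd x.
have k0 := nc_ge0 k.
exists (Num.min de (e / (1 + nc k + 1))); first by rewrite lt_min de0 divr_gt0//; lra.
move=> y; rewrite lt_min => /andP[/H h]; rewrite ltr_pdivlMr; last by lra.
move=> h2; have := nc_le_dist (g y - g x) (k * (y - x)); rewrite ncM.
have := nc_ge0 (y - x).
move: h h2; rewrite mul1r; move: (nc (y - x)) (nc k) (nc (g y - g x)) k0 (nc _) => u v w *.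
nra.
Qed.

Let U r t := complex.Re (g (polar r t)).
Let V r t := complex.Im (g (polar r t)).

Let UV_cont r0 t0 e : 0 < e -> exists2 de, 0 < de & forall r t,
  `|r - r0| < de -> `|t - t0| < de -> `|U r t - U r0 t0| < e /\ `|V r t - V r0 t0| < e.
Proof.
move=> e0; have [de de0 H] := cdiff_cont (polar r0 t0) e0.
have r00 := normr_ge0 r0.
exists (de / (2 + 2 * `|r0| + 1)); first by rewrite divr_gt0//; lra.
move=> r t; rewrite ltr_pdivlMr; last by lra.
move=> h1; rewrite ltr_pdivlMr; last by lra.
move=> h2; have : nc (polar r t - polar r0 t0) < de.
  apply: (le_lt_trans (polar_lip _ _ _ _)).
  have := normr_ge0 (r - r0); have := normr_ge0 (t - t0).
  move: h1 h2; move: `|r0| r00 `|r - r0| `|t - t0| => *; nra.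
move/H => h; split; apply: le_lt_trans h; rewrite /U /V.
  by rewrite -cReN -cReD nc_Re.
by rewrite -cImN -cImD nc_Im.
Qed.

Let U_cont r : continuous (U r).
Proof.
move=> t; apply/cvgrPdist_lt => e e0; have [de de0 H] := UV_cont r t e0.
near=> s; rewrite distrC; apply: (H r s _ _).1; first by rewrite subrr normr0.
by near: s; exists de => //= s /=; rewrite distrC.
Unshelve. all: by end_near. Qed.

Let V_cont t : continuous (V ^~ t).
Proof.
move=> r; apply/cvgrPdist_lt => e e0; have [de de0 H] := UV_cont r t e0.
near=> s; rewrite distrC; apply: (H s t _ _).2; last by rewrite subrr normr0.
by near: s; exists de => //= s /=; rewrite distrC.
Unshelve. all: by end_near. Qed.

Let iU r c d : leb1.-integrable `[c, d] (EFin \o U r).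
Proof. by apply: continuous_itv_integrable => x _; exact: U_cont. Qed.

Let iV t a b : 0 < a -> leb1.-integrable `[a, b] (EFin \o (fun r => V r t / r)).
Proof.
move=> a0; apply: continuous_itv_integrable => x /andP[ax _].
apply: continuousM; first exact: V_cont.
by apply: inv_continuous; rewrite gt_eqF// (lt_le_trans a0).
Qed.

(* The closed form Im (g(z) dz / z) = V dr / r + U dt, integrated over the boundary. *)
Let I a b c d := \int[leb1]_(r in `[a, b]) (V r c / r - V r d / r) +
  \int[leb1]_(t in `[c, d]) (U b t - U a t).

Let iVB c d a b : 0 < a -> leb1.-integrable `[a, b] (EFin \o (fun r => V r c / r - V r d / r)).
Proof. by move=> a0; have := integrableB _ (iV c b a0) (iV d b a0); apply. Qed.

Let iUB a b c d : leb1.-integrable `[c, d] (EFin \o (fun t => U b t - U a t)).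
Proof. by have := integrableB _ (iU b c d) (iU a c d); apply. Qed.

(** The affine part A + k z of [g] contributes nothing: along the radii it gives (b' - a') (ph c' -
    ph d'), and along the arcs the opposite, because [ph'] is the derivative of [ph]. What remains
    is the error of the affine approximation, small compared with the size, integrated over a path
    of length comparable to the size. *)
Let I_loc a b r0 t0 e : 0 < a -> a <= r0 <= b -> 0 < e ->
  exists2 de, 0 < de & forall a' b' c' d',
     a <= a' -> a' < b' -> b' <= b -> c' < d' ->
     a' <= r0 <= b' -> c' <= t0 <= d' -> b' - a' + (d' - c') < de ->
     `|I a' b' c' d'| <= e * (b' - a' + (d' - c')) ^+ 2.
Proof.
move=> a0 /andP[ar rb] e0; have [k Hk] := gd (polar r0 t0).
have b0 : 0 < b by apply: lt_le_trans rb; exact: lt_le_trans ar.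
have ai : 0 < a^-1 by rewrite invr_gt0.
(* [M] is the Lipschitz constant of polar coordinates for radii up to [b]; [N] collects [M], the two
   opposite sides and the weight 1/r <= 1/a, so that the final bound is exactly [e * s ^+ 2]. *)
pose M := 2 + 2 * b; have M0 : 0 < M by rewrite /M; lra.
pose N := 2 * M * (a^-1 + 1); have N0 : 0 < N by rewrite /N !mulr_gt0//; lra.
have [de de0 H] := Hk (e / N) (divr_gt0 e0 N0).
exists (de / M); first exact: divr_gt0.
move=> a' b' c' d' aa ab bb cd /andP[ra rb'] /andP[tc td].
set s := _ + _ => sd.
have s0 : 0 < s by rewrite /s; lra.
have a'0 : 0 < a' by exact: lt_le_trans aa.
pose A := g (polar r0 t0) - k * polar r0 t0.
pose E r t := g (polar r t) - (A + k * polar r t).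
pose eta := e / N * (M * s).
have HE r t : a' <= r <= b' -> c' <= t <= d' -> nc (E r t) <= eta.
  move=> /andP[h1 h2] /andP[h3 h4].
  have lip : nc (polar r t - polar r0 t0) <= M * s.
    apply: (le_trans (polar_lip _ _ _ _)).
    have e1 : `|r - r0| <= b' - a' by rewrite ler_norml; apply/andP; split; lra.
    have e2 : `|t - t0| <= d' - c' by rewrite ler_norml; apply/andP; split; lra.
    have e3 : `|r0| <= b by rewrite gtr0_norm//; lra.
    have e4 : `|r0| * `|t - t0| <= b * (d' - c') by rewrite ler_pM.
    have e5 : 0 <= b * (b' - a') by rewrite mulr_ge0//; lra.
    by rewrite /M /s; lra.
  have -> : E r t = g (polar r t) - g (polar r0 t0) - k * (polar r t - polar r0 t0).
    by rewrite /E /A; ring.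
  apply: (le_trans (H _ _)); last by rewrite ler_wpM2l// divr_ge0// ltW.
  by apply: (le_lt_trans lip); rewrite mulrC -ltr_pdivlMr.
have eta0 : 0 <= eta by apply: mulr_ge0; [rewrite divr_ge0// ltW|rewrite mulr_ge0// ltW].
pose p := complex.Re A; pose q := complex.Im A.
pose k1 := complex.Re k; pose k2 := complex.Im k.
pose ph t := k1 * sin t + k2 * cos t.
pose ph' t := k1 * cos t - k2 * sin t.
have VE r t : V r t = q + r * ph t + complex.Im (E r t).
  by rewrite /V /E cImD cImN cImD cImM /= /ph /q /k1 /k2; ring.
have UE r t : U r t = p + r * ph' t + complex.Re (E r t).
  by rewrite /U /E cReD cReN cReD cReM /= /ph' /p /k1 /k2; ring.
have ph'c : continuous ph'.
  move=> t; apply: cvgB; apply: cvgM; try exact: cvg_cst; [exact: continuous_cos|exact: continuous_sin].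
have ph'i c d : leb1.-integrable `[c, d] (EFin \o ph').
  by apply: continuous_itv_integrable => x _; exact: ph'c.
have phd t : is_derive t 1 ph (ph' t).
  have := is_deriveD (is_deriveZ k1 (is_derive_sin t)) (is_deriveZ k2 (is_derive_cos t)).
  by rewrite /ph /ph' /GRing.scale/= mulrN.
have phI : \int[leb1]_(t in `[c', d']) ph' t = ph d' - ph c'.
  rewrite /Rintegral (@continuous_FTC2 _ ph' ph)//.
  - exact: continuous_subspaceT.
  - have phc : continuous ph.
      by move=> t; apply: differentiable_continuous; apply/derivable1_diffP; exact: ex_derive.
    split.
    + by move=> t _; exact: ex_derive.
    + by apply: cvg_at_right_filter; exact: phc.
    + by apply: cvg_at_left_filter; exact: phc.
  - by move=> t _; rewrite derive1E derive_val.
pose d1 r := V r c' / r - V r d' / r - (ph c' - ph d').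
pose d2 t := U b' t - U a' t - (b' - a') * ph' t.
have id1 : leb1.-integrable `[a', b'] (EFin \o d1).
  have ic : leb1.-integrable `[a', b'] (EFin \o (fun=> ph c' - ph d')).
    by apply: continuous_itv_integrable => x _; exact: cst_continuous.
  by have := integrableB _ (iVB c' d' b' a'0) ic; apply.
have iph : leb1.-integrable `[c', d'] (EFin \o (fun t => (b' - a') * ph' t)).
  by have := integrableZl _ (b' - a') (ph'i c' d'); apply.
have id2 : leb1.-integrable `[c', d'] (EFin \o d2).
  by have := integrableB _ (iUB a' b' c' d') iph; apply.
have -> : I a' b' c' d' = \int[leb1]_(r in `[a', b']) d1 r + \int[leb1]_(t in `[c', d']) d2 t.
  rewrite /d1 RintegralB//; last 2 first.
    exact: iVB.
    by apply: continuous_itv_integrable => x _; exact: cst_continuous.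
  rewrite /d2 RintegralB// RintegralZl// phI Rintegral_itv_cst ?ltW//.
  by rewrite /I; ring.
have B1 : `|\int[leb1]_(r in `[a', b']) d1 r| <= (2 * eta / a) * (b' - a').
  apply: Rintegral_itv_bound => //; first exact: ltW.
  move=> r rab; have r0p : 0 < r by case/andP: rab => h _; exact: lt_le_trans h.
  have -> : d1 r = (complex.Im (E r c') - complex.Im (E r d')) / r.
    by rewrite /d1 !VE; field; rewrite gt_eqF.
  rewrite normrM normfV (gtr0_norm r0p) ler_pM//.
  - by rewrite invr_ge0 ltW.
  - have h1 := HE r c' rab; have h2 := HE r d' rab.
    rewrite (le_trans (ler_normB _ _))// mulr_natl mulr2n lerD//.
      by apply: (le_trans (nc_Im _)); apply: h1; rewrite lexx ltW.
    by apply: (le_trans (nc_Im _)); apply: h2; rewrite lexx ltW.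
  - rewrite lef_pV2 ?posrE//; case/andP: rab => h _; exact: le_trans h.
have B2 : `|\int[leb1]_(t in `[c', d']) d2 t| <= (2 * eta) * (d' - c').
  apply: Rintegral_itv_bound => //; first exact: ltW.
  move=> t tcd.
  have -> : d2 t = complex.Re (E b' t) - complex.Re (E a' t).
    by rewrite /d2 !UE; ring.
  rewrite (le_trans (ler_normB _ _))// mulr_natl mulr2n lerD//.
    by apply: (le_trans (nc_Re _)); apply: HE => //; rewrite lexx andbT ltW.
  by apply: (le_trans (nc_Re _)); apply: HE => //; rewrite lexx ltW.
apply: (le_trans (ler_normD _ _)).
apply: (@le_trans _ _ (2 * eta * (a^-1 + 1) * s)).
  have h1 : 0 <= eta * a^-1 * (d' - c').
    by apply: mulr_ge0; [apply: mulr_ge0 => //; exact: ltW|rewrite subr_ge0 ltW].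
  have h2 : 0 <= eta * (b' - a') by apply: mulr_ge0 => //; rewrite subr_ge0 ltW.
  move: B1 B2; rewrite /s; set X := `|_|; set Y := `|_|; move: X Y h1 h2.
  by move: (eta) (a^-1) => *; nra.
rewrite le_eqVlt; apply/orP; left; apply/eqP.
rewrite /eta /N; field.
by rewrite !gt_eqF//; rewrite /M; lra.
Qed.

Let I0 a b c d : 0 < a -> a < b -> c < d -> I a b c d = 0.
Proof.
move=> a0 ab cd; apply: rectangle_bisection => //.
- move=> a' m b' c' d' aa am mb bb cc cd' dd; rewrite /I.
  have a'0 : 0 < a' by exact: lt_le_trans aa.
  rewrite (@Rintegral_itv_split _ a' m b') ?ltW//; last exact: iVB.
  have -> : \int[leb1]_(t in `[c', d']) (U b' t - U a' t) =
      \int[leb1]_(t in `[c', d']) (U m t - U a' t) + \int[leb1]_(t in `[c', d']) (U b' t - U m t).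
    rewrite -RintegralD//; apply: eq_Rintegral => t _; ring.
  by ring.
- move=> a' b' c' m d' aa ab' bb cc cm md dd; rewrite /I.
  have a'0 : 0 < a' by exact: lt_le_trans aa.
  rewrite (@Rintegral_itv_split _ c' m d') ?ltW//.
  have -> : \int[leb1]_(r in `[a', b']) (V r c' / r - V r d' / r) =
      \int[leb1]_(r in `[a', b']) (V r c' / r - V r m / r) +
      \int[leb1]_(r in `[a', b']) (V r m / r - V r d' / r).
    rewrite -RintegralD//; [|exact: iVB|exact: iVB].
    by apply: eq_Rintegral => r _; ring.
  by ring.
- move=> r t rab _ e e0; have [de de0 H] := I_loc t a0 rab e0.
  by exists de => // *; apply: H.
Qed.

(** On the rectangle [r, 1] x [0, 2 pi] the sides t = 0 and t = 2 pi describe the same segment and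
    cancel, so the vanishing of [I] says that the circular mean does not depend on the radius.
    Continuity at 0 then gives its value. *)
Lemma Re_mean_value : \int[leb1]_(t in `[0, 2 * pi]) complex.Re (g (polar 1 t)) =
  2 * pi * complex.Re (g 0).
Proof.
pose J r := \int[leb1]_(t in `[0, 2 * pi]) U r t.
have p0 : 0 < 2 * pi :> R by rewrite mulr_gt0// pi_gt0.
have JE r : 0 < r -> r < 1 -> J r = J 1.
  move=> r0 r1; have := I0 r0 r1 p0; rewrite /I.
  have -> : \int[leb1]_(x in `[r, 1]) (V x 0 / x - V x (2 * pi) / x) = 0.
    under eq_Rintegral => x _.
      rewrite /V /polar mulr_natl cos2pi sin2pi cos0 sin0 subrr; over.
    by rewrite Rintegral_itv_cst ?mul0r// ltW.
  by rewrite add0r RintegralB// => /eqP; rewrite subr_eq0 => /eqP.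
suff : `|J 1 - 2 * pi * complex.Re (g 0)| <= 0.
  by rewrite normr_le0 subr_eq0 => /eqP.
apply/ler_addgt0Pr => e e0; rewrite add0r.
have e1 : 0 < e / (2 * pi) by rewrite divr_gt0.
have [de de0 H] := cdiff_cont 0 e1.
pose r := Num.min (1 / 2) (de / 2).
have r0 : 0 < r by rewrite lt_min !divr_gt0.
have r1 : r < 1 by rewrite gt_min; apply/orP; left; lra.
have rde : r < de by rewrite gt_min; apply/orP; right; lra.
rewrite -(JE r)// (mulrC _ (complex.Re _)) -{1}(subr0 (2 * pi)) -Rintegral_itv_cst ?(ltW p0)// /J -RintegralB//; last first.
  by apply: continuous_itv_integrable => x _; exact: cst_continuous.
have -> : e = e / (2 * pi) * (2 * pi - 0) by rewrite subr0 mulfVK// gt_eqF.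
have ic : leb1.-integrable `[0, 2 * pi] (EFin \o (fun=> complex.Re (g 0))).
  by apply: continuous_itv_integrable => x _; exact: cst_continuous.
apply: Rintegral_itv_bound => //; first exact: ltW.
  by have := integrableB _ (iU r 0 (2 * pi)) ic; apply.
move=> t _; rewrite /U -cReN -cReD; apply: (le_trans (nc_Re _)); apply/ltW/H.
rewrite subr0 /nc /polar /= !exprMn -mulrDr cos2Dsin2 mulr1 sqrtr_sqr gtr0_norm//.
Qed.

Lemma Re_circle_integrable : leb1.-integrable `[0, 2 * pi]
  (EFin \o (fun t => complex.Re (g (polar 1 t)))).
Proof. exact: iU. Qed.

End fix_g.

End MeanValue.

(** * Complex integrals and the Gaussian weight *)

Section NumFieldDifferentiability.
Context {K : numFieldType}.

Lemma differentiable_line (V : normedModType K) (u : V -> K^o) (w : V) :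
  (forall z, differentiable u z) -> forall x0 : K, exists k : K, forall e, 0 < e ->
  exists2 de, 0 < de & forall y, `|y - x0| < de ->
    `|u (y *: w) - u (x0 *: w) - k * (y - x0)| <= e * `|y - x0|.
Proof.
move=> du x0; exists ('d u (x0 *: w) w) => e e0.
have /diff_locally/eqaddoP := du (x0 *: w).
have W0 := normr_ge0 w; have W1 : 0 < `|w| + 1 by rewrite ltr_wpDl.
move=> /(_ _ (divr_gt0 e0 W1)) /nbhs_ballP[de /= de0 H].
exists (de / (`|w| + 1)); first by rewrite divr_gt0.
move=> y hy; have := H ((y - x0) *: w); rewrite -ball_normE /= sub0r normrN normrZ.
have h1 : `|y - x0| * `|w| < de.
  move: hy; rewrite ltr_pdivlMr// mulrDr mulr1; apply: le_lt_trans.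
  by rewrite lerDl.
move=> /(_ h1); rewrite !fctE /= -scalerDl subrK linearZ/= opprD addrA.
have -> : ('d u (x0 *: w) w : K) * (y - x0) = (y - x0) *: 'd u (x0 *: w) w by rewrite mulrC.
move=> /le_trans; apply.
rewrite [_ * `|w|]mulrC mulrA ler_wpM2r//.
by rewrite mulrAC ler_pdivrMr// ler_wpM2l ?(ltW e0)// lerDl.
Qed.

Lemma differentiable_lin (V : normedModType K) (u : V -> K^o) z (L : {linear V -> K^o}) :
  continuous L ->
  (forall e, 0 < e -> exists2 de, 0 < de & forall h, `|h| < de ->
    `|u (h + z) - u z - L h| <= e * `|h|) ->
  differentiable u z.
Proof.
move=> cL H.
have key : u \o shift z = cst (u z) + L +o_ 0 id.
  apply/eqaddoP => e e0; have [de de0 Hd] := H e e0.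
  apply/nbhs_ballP; exists de => //= h; rewrite -ball_normE /= sub0r normrN => /Hd.
  by rewrite !fctE/= opprD addrA.
have dE : 'd u z = L :> (_ -> _) by apply: diff_unique.
by apply/diff_locallyP; rewrite dE.
Qed.

Definition linc n (k : 'I_n -> K) (z : 'rV[K]_n) : K^o := \sum_j z 0 j * k j.

Lemma linc_is_linear n (k : 'I_n -> K) : linear (linc k).
Proof.
move=> a x y; rewrite /linc scaler_sumr -big_split/=; apply: eq_bigr => j _.
by rewrite !mxE mulrDl -mulrA.
Qed.

HB.instance Definition _ n (k : 'I_n -> K) :=
  GRing.isLinear.Build K 'rV[K]_n K^o *:%R (linc k) (linc_is_linear k).

Lemma linc_continuous n (k : 'I_n -> K) : continuous (linc k : 'rV[K]_n -> K^o).
Proof.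
have H (r : seq 'I_n) : continuous (fun z : 'rV[K]_n => \sum_(j <- r) z 0 j * k j : K^o).
  elim: r => [|j r IH] z.
    rewrite (_ : (fun _ => _) = (fun=> 0)); first exact: (@cst_continuous _ _ (0 : K^o)).
    by apply/funext => ?; rewrite big_nil.
  rewrite (_ : (fun _ => _) = (fun z : 'rV[K]_n => z 0 j * k j + \sum_(j <- r) z 0 j * k j)); last first.
    by apply/funext => ?; rewrite big_cons.
  apply: (@continuousD K K^o 'rV[K]_n (fun z => z 0 j * k j)); last exact: IH.
  apply: (@continuousM K 'rV[K]_n (fun z => z 0 j) (fun=> k j)); first exact: coord_continuous.
  exact: (@cst_continuous _ _ (k j)).
exact: H.
Qed.

Lemma norm_coord n (z : 'rV[K]_n) j : `|z 0 j| <= `|z|.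
Proof.
rewrite [leRHS]mx_normE -[leLHS]nngE num_le.
exact: (le_bigmax _ (fun i : 'I_1 * 'I_n => `|z i.1 i.2|%:nng) (0, j)).
Qed.

Lemma differentiable_quad n (u : 'rV[K]_n -> K^o) z (k : 'I_n -> K) (C : K) : 0 <= C ->
  (forall h, `|h| <= 1 -> `|u (h + z) - u z - linc k h| <= C * `|h| ^+ 2) ->
  differentiable u z.
Proof.
move=> C0 H; apply: (differentiable_lin (L := linc k)); first exact: linc_continuous.
move=> e e0; have C1 : 0 < C + 1 by rewrite ltr_wpDl.
have ec : 0 < e / (C + 1) by rewrite divr_gt0.
have er : e / (C + 1) \is Num.real by rewrite gtr0_real.
exists (Num.min 1 (e / (C + 1))); first by rewrite comparable_lt_min ?real_comparable ?real1// ltr01.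
move=> h; rewrite comparable_lt_min ?real_comparable ?real1// => /andP[/ltW h1 h2].
apply: (le_trans (H h h1)); rewrite expr2 mulrA ler_wpM2r//.
rewrite (le_trans (_ : _ <= (C + 1) * `|h|))//; first by rewrite ler_wpM2r// lerDl.
by rewrite mulrC -ler_pdivlMr// ltW.
Qed.

End NumFieldDifferentiability.

Section ComplexDifferentiability.
Context {R : realType} {n : nat}.
Local Open Scope complex_scope.

Definition cl1 (z : 'rV[R[i]]_n) : R := \sum_j nc (z 0 j).

Lemma cl1_ge0 z : 0 <= cl1 z.
Proof. by apply: sumr_ge0 => j _; exact: nc_ge0. Qed.

Lemma entire_line (u : 'rV[R[i]]_n -> R[i]^o) w : entire u ->
  cdiff (fun x : R[i] => u (x *: w)).
Proof.
move=> du x0; have [k H] := differentiable_line w du x0; exists k => e e0.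
have e1 : 0 < e%:C by rewrite ltcR.
have [de de0 Hd] := H _ e1.
exists (complex.Re de); first by rewrite -ltcR RRe_real// gtr0_real.
move=> y hy; have := Hd y; rewrite !nc_norm -rmorphM/= lecR; apply.
by rewrite -[de]RRe_real ?gtr0_real// ltcR.
Qed.

(** A criterion for holomorphy suited to explicit kernels: a candidate linear part and a quadratic
    remainder, both in coordinates. It is transferred to the sup norm of row vectors because [cl1 h]
    is at most n times that norm. *)
Lemma entire_quad (u : 'rV[R[i]]_n -> R[i]^o) (k : 'rV[R[i]]_n -> 'I_n -> R[i]) (C : 'rV[R[i]]_n -> R) :
  (forall z h : 'rV[R[i]]_n, (forall j, nc (h 0 j) <= 1) ->
    nc (u (h + z) - u z - \sum_j h 0 j * k z j) <= C z * cl1 h ^+ 2) ->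
  entire u.
Proof.
move=> H z; have C0 : 0 <= (`|C z| * n%:R ^+ 2)%:C by rewrite ler0c mulr_ge0// sqr_ge0.
apply: (differentiable_quad (k := k z) C0) => h h1.
pose W := complex.Re `|h|; have WE : `|h| = W%:C.
  by rewrite /W RRe_real// ger0_real.
have hW j : nc (h 0 j) <= W by rewrite -lecR -nc_norm -WE; exact: norm_coord.
have W1 : W <= 1 by rewrite -lecR -WE.
have := H z h (fun j => le_trans (hW j) W1) => {}H.
have -> : `|u (h + z) - u z - linc (k z) h| =
    (nc (u (h + z) - u z - \sum_j h 0 j * k z j))%:C := nc_norm _.
have -> : (`|C z| * n%:R ^+ 2)%:C * `|h| ^+ 2 = ((`|C z| * n%:R ^+ 2) * W ^+ 2)%:C.
  by rewrite WE !expr2 !rmorphM.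
rewrite lecR; apply: (le_trans H).
rewrite -mulrA -exprMn; apply: (@le_trans _ _ (`|C z| * cl1 h ^+ 2)).
  by rewrite ler_wpM2r ?sqr_ge0 ?ler_norm.
have W0 : 0 <= W by rewrite -lecR -WE normr_ge0.
rewrite ler_wpM2l// ler_pXn2r ?nnegrE ?cl1_ge0 ?mulr_ge0//.
by rewrite /cl1 (le_trans (ler_sum _ (fun j _ => hW j)))// sumr_const card_ord mulr_natl.
Qed.

End ComplexDifferentiability.

(** * Measure-preserving maps of C^n and Gaussian integrals *)

Section FockMeasure.
Context {R : realType} {n : nat}.
Local Open Scope complex_scope.
Local Notation CV := 'rV[R[i]]_n.
Local Notation X := (Rtuple R (n + n)).
Local Notation leb := (@lebesgue_tuple R (n + n)).
Implicit Types (z w a : CV) (t : X) (g h : CV -> R[i]).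

Definition ns z : R := \sum_j nc (z 0 j) ^+ 2.
(** The same term as the weight in the theorem, so that the operators there agree with those studied
    here by conversion. *)
Definition fock_weight z : R := (\sum_j Normc.normc (z 0 j) ^+ 2) / 2.
Definition gw z : R := expR (- ns z).
Definition dot z w : R[i] := \sum_j z 0 j * (w 0 j)^*%C.

Lemma gwE z : expR (- (2 * fock_weight z)) = gw z.
Proof. by rewrite /fock_weight mulrC mulfVK. Qed.

Lemma gw_ge0 z : 0 <= gw z. Proof. exact: expR_ge0. Qed.

Lemma ns_ge0 z : 0 <= ns z.
Proof. by apply: sumr_ge0 => j _; exact: sqr_ge0. Qed.

Lemma Re_pt t j : complex.Re (pt t 0 j) = tnth t (lshift n j).
Proof. by rewrite /pt /toC !mxE. Qed.

Lemma Im_pt t j : complex.Im (pt t 0 j) = tnth t (rshift n j).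
Proof. by rewrite /pt /toC !mxE. Qed.

Lemma ns_pt t : ns (pt t) = \sum_i tnth t i ^+ 2.
Proof.
rewrite big_split_ord/= -big_split/=; apply: eq_bigr => j _.
by rewrite nc_sqr Re_pt Im_pt.
Qed.

Lemma cmeas_pt j : cmeas (fun t => pt t 0 j).
Proof.
split; first by under eq_fun do rewrite Re_pt; exact: measurable_tnth.
by under eq_fun do rewrite Im_pt; exact: measurable_tnth.
Qed.

Lemma measurable_ns : measurable_fun setT (fun t => ns (pt t)).
Proof. by apply: measurable_sum => j; apply: measurable_funX; exact/cmeas_nc/cmeas_pt. Qed.

Lemma measurable_gw : measurable_fun setT (fun t => gw (pt t)).
Proof.
apply: (measurableT_comp (f := @expR R)) => //.
by apply: measurableT_comp => //; exact: measurable_ns.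
Qed.

Lemma cmeas_sum (d : measure_display) (T : measurableType d) (I : Type) (r : seq I) (F : I -> T -> R[i]) :
  (forall i, cmeas (F i)) -> cmeas (fun x => \sum_(i <- r) F i x).
Proof.
move=> mF; elim: r => [|i r IH].
  by under eq_fun do rewrite big_nil; exact: cmeas_cst.
by under eq_fun do rewrite big_cons; apply: cmeasD.
Qed.

Definition tp z : X := [tuple (match fintype.split i with
  | inl j => complex.Re (z 0 j) | inr j => complex.Im (z 0 j) end : measurableTypeR R) | i < n + n].

Lemma tpK z : pt (tp z) = z.
Proof.
apply/rowP => j; apply: eq_creim; rewrite ?(Re_pt, Im_pt) tnth_mktuple.
  by rewrite (unsplitK (inl _ j)).
by rewrite (unsplitK (inr _ j)).
Qed.

Lemma pt_inj t t' : pt t = pt t' -> t = t'.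
Proof.
move=> tt; apply/eq_from_tnth => i; rewrite -(fintype.splitK i); case: (fintype.split i) => j /=.
  by rewrite -!Re_pt tt.
by rewrite -!Im_pt tt.
Qed.

Lemma ptK t : tp (pt t) = t.
Proof. by apply: pt_inj; rewrite tpK. Qed.

(** Stated through integrals of nonnegative functions, the form that Tonelli's theorem gives for
    shears. *)
Definition mpres (S : X -> X) := measurable_fun setT S /\
  forall f : X -> \bar R, measurable_fun setT f -> (forall t, 0 <= f t)%E ->
  (\int[leb]_t f (S t) = \int[leb]_t f t)%E.

Lemma mpres_comp S S' : mpres S -> mpres S' -> mpres (S \o S').
Proof.
move=> [mS HS] [mS' HS']; split; first exact: measurableT_comp.
move=> f mf f0; rewrite -[RHS]HS// -[RHS](HS' (fun t => f (S t)))//.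
exact: measurableT_comp.
Qed.

Lemma mpres_integral S (f : X -> \bar R) : mpres S -> measurable_fun setT f ->
  (\int[leb]_t f (S t) = \int[leb]_t f t)%E.
Proof.
move=> [mS HS] mf; rewrite [LHS]integralE [RHS]integralE; congr (_ - _)%E.
  by rewrite -(HS (f^\+)%E (measurable_funepos mf))//; apply: eq_integral => t _; rewrite -[RHS]/((f^\+%E \o S) t) -funepos_comp.
by rewrite -(HS (f^\-)%E (measurable_funeneg mf))//; apply: eq_integral => t _; rewrite -[RHS]/((f^\-%E \o S) t) -funeneg_comp.
Qed.

Lemma mpres_cint S (g : X -> R[i]) : mpres S -> cmeas g ->
  cint leb (fun t => g (S t)) = cint leb g.
Proof.
move=> mS [mr mi]; apply: eq_creim; congr fine.
  by rewrite (mpres_integral mS (f := fun t => (complex.Re (g t))%:E))//; exact/measurable_EFinP.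
by rewrite (mpres_integral mS (f := fun t => (complex.Im (g t))%:E))//; exact/measurable_EFinP.
Qed.

Lemma cmeas_comp d1 (T1 : measurableType d1) d2 (T2 : measurableType d2)
  (S : T1 -> T2) (g : T2 -> R[i]) : measurable_fun setT S -> cmeas g ->
  cmeas (fun x => g (S x)).
Proof.
move=> mS [mr mi]; split.
  exact: (measurableT_comp (f := fun y => complex.Re (g y))).
exact: (measurableT_comp (f := fun y => complex.Im (g y))).
Qed.

Definition ttrans a t : X := shear (fun _ _ => 0) (nth 0 (tp a)) t.

Lemma pt_ttrans a t : pt (ttrans a t) = pt t + a.
Proof.
apply/rowP => j; rewrite [RHS]mxE; apply: eq_creim.
  rewrite cReD !Re_pt tnth_mktuple big1 ?addr0; last by move=> ? _; rewrite mul0r.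
  by congr (_ + _); have := Re_pt (tp a) j; rewrite tpK => ->; rewrite (tnth_nth 0).
rewrite cImD !Im_pt tnth_mktuple big1 ?addr0; last by move=> ? _; rewrite mul0r.
by congr (_ + _); have := Im_pt (tp a) j; rewrite tpK => ->; rewrite (tnth_nth 0).
Qed.

Lemma mpres_ttrans a : mpres (ttrans a).
Proof. by split; [exact: measurable_shear|move=> f mf f0; exact: integral_shear_lower]. Qed.

Definition shx (k : R) t : X :=
  shear (fun i j => if (i < n)%N && (j == i + n)%N then k else 0) (fun=> 0) t.
Definition shy (k : R) t : X :=
  shear (fun i j => if (j < n)%N && (i == j + n)%N then k else 0) (fun=> 0) t.

Lemma mpres_shx k : mpres (shx k).
Proof.
split; first exact: measurable_shear.
move=> f mf f0; apply: integral_shear_upper => // i j ji.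
by case: ifP => // /andP[i0 /eqP E]; lia.
Qed.

Lemma mpres_shy k : mpres (shy k).
Proof.
split; first exact: measurable_shear.
move=> f mf f0; apply: integral_shear_lower => // i j ji.
by case: ifP => // /andP[j0 /eqP E]; lia.
Qed.

Lemma pt_shx k t j : pt (shx k t) 0 j =
  (complex.Re (pt t 0 j) + k * complex.Im (pt t 0 j)) +i* complex.Im (pt t 0 j).
Proof.
apply: eq_creim; rewrite ?(Re_pt, Im_pt) tnth_mktuple addr0.
  rewrite (bigD1 (rshift n j))//= ltn_ord addnC eqxx big1 ?addr0// => i ij.
  case: ifP => [/eqP E|_]; last by rewrite mul0r.
  by case/eqP: ij; apply/val_inj; rewrite /= E addnC.
by rewrite big1 ?addr0// => i _ /=; rewrite ltnNge leq_addr/= mul0r.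
Qed.

Lemma pt_shy k t j : pt (shy k t) 0 j =
  complex.Re (pt t 0 j) +i* (complex.Im (pt t 0 j) + k * complex.Re (pt t 0 j)).
Proof.
apply: eq_creim; rewrite ?(Re_pt, Im_pt) tnth_mktuple addr0.
  rewrite big1 ?addr0// => i _ /=; case: ifP => [/andP[_ /eqP E]|_]; last by rewrite mul0r.
  by have := ltn_ord j; rewrite E ltnNge leq_addl.
rewrite (bigD1 (lshift n j))//= ltn_ord addnC eqxx big1 ?addr0// => i ij.
case: ifP => [/andP[_ /eqP E]|_]; last by rewrite mul0r.
by case/eqP: ij; apply/val_inj; rewrite /=; lia.
Qed.

(** A plane rotation by an angle a is a product of three shears, horizontal, vertical, horizontal,
    with horizontal coefficient k = - tan (a / 2) = - s / (1 + c) and vertical coefficient s. Shears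
    preserve volume by the unipotent case. *)
Lemma rotation_mpres (c s : R) : c ^+ 2 + s ^+ 2 = 1 ->
  exists2 S, mpres S & forall t, pt (S t) = (c +i* s) *: pt t.
Proof.
move=> cs1.
have H c' s' : c' ^+ 2 + s' ^+ 2 = 1 -> 1 + c' != 0 ->
    exists2 S, mpres S & forall t, pt (S t) = (c' +i* s') *: pt t.
  move=> {}cs1; move: c' s' cs1 => {}c {}s cs1 c1; pose k := - (s / (1 + c)).
  exists (shx k \o (shy s \o shx k)).
    by apply: mpres_comp; [exact: mpres_shx|apply: mpres_comp; [exact: mpres_shy|exact: mpres_shx]].
  move=> t; apply/rowP => j; rewrite /= [RHS]mxE.
  have ks : 1 + k * s = c.
    have -> : c = (1 + c - (1 - c ^+ 2)) / (1 + c) by field.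
    have -> : 1 - c ^+ 2 = s ^+ 2 by rewrite -cs1; ring.
    by rewrite /k; field.
  have k1 : k * (1 + c) = - s by rewrite /k; field.
  rewrite pt_shx pt_shy pt_shx.
  apply: eq_creim; rewrite ?cReM ?cImM /=; set x := complex.Re _; set y := complex.Im _.
    transitivity ((1 + k * s) * x + k * (1 + (1 + k * s)) * y); first by ring.
    by rewrite ks k1; ring.
  transitivity ((1 + k * s) * y + s * x); first by ring.
  by rewrite ks.
(* The factorisation breaks down only for the half turn, which is the square of a quarter turn. *)
case: (eqVneq (1 + c) 0) => [c1|]; last exact: H.
have [||S mS SE] := H 0 1; [by ring|by rewrite addr0 oner_neq0|].
exists (S \o S); first exact: mpres_comp.
have cE : c = -1 by apply/eqP; rewrite -addr_eq0 addrC; apply/eqP.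
have sE : s = 0 by apply/eqP; rewrite -sqrf_eq0; apply/eqP; rewrite -(subr0 (s ^+ 2)) -[in LHS](subrr 1) -{1}cs1 cE; ring.
move=> t; rewrite /= !SE scalerA cE sE; congr (_ *: _).
by apply: eq_creim; rewrite ?cReM ?cImM/=; ring.
Qed.

Lemma gauss_tuple d : (\int[@lebesgue_tuple R d]_t (expR (- \sum_i tnth t i ^+ 2))%:E =
  (Num.sqrt pi ^+ d)%:E)%E.
Proof.
elim: d => [|d IH].
  rewrite expr0.
  transitivity (\int[@lebesgue_tuple R 0]_t (cst 1%:E t))%E.
    by apply: eq_integral => t _; rewrite big_ord0 oppr0 expR0.
  rewrite integral_cst//= mul1e /lebesgue_tuple diracE.
  by rewrite mem_set.
have mg e : measurable_fun setT (fun t : Rtuple R e => (expR (- \sum_i tnth t i ^+ 2))%:E).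
  apply/measurable_EFinP; apply: (measurableT_comp (f := @expR R)) => //.
  apply: measurableT_comp => //; apply: measurable_sum => i.
  by apply: measurable_funX; exact: measurable_tnth.
rewrite integral_tupleS//.
transitivity (\int[@lebesgue_measure R]_x ((Num.sqrt pi ^+ d)%:E * (gauss_fun x)%:E))%E.
  apply: eq_integral => x _; rewrite -IH muleC -ge0_integralZl//; first last.
  - by rewrite lee_fin expR_ge0.
  - exact: mg.
  apply: eq_integral => t _; rewrite -EFinM /gauss_fun -expRD big_ord_recl tcons_tnth0.
  congr (expR _)%:E; rewrite opprD; congr (_ - _).
  by apply: eq_bigr => i _; rewrite tcons_tnthS.
rewrite ge0_integralZl//; first last.
- by move=> t _; rewrite lee_fin expR_ge0.
- by apply/measurable_EFinP; exact: measurable_gauss_fun.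
by rewrite integralT_gauss -EFinM exprSr.
Qed.

Lemma gauss_int (c : R) : 0 < c -> (\int[leb]_t (expR (- (ns (pt t) / c ^+ 2)))%:E =
  (c ^+ (n + n) * pi ^+ n)%:E)%E.
Proof.
move=> c0; rewrite (integral_tscale c0); first last.
- by move=> t; rewrite lee_fin expR_ge0.
- apply/measurable_EFinP; apply: (measurableT_comp (f := @expR R)) => //.
  apply: measurableT_comp => //; apply: measurable_funM => //; exact: measurable_ns.
rewrite EFinM; congr (_ * _)%E; rewrite -[pi]sqr_sqrtr ?pi_ge0// -exprM mul2n -addnn -gauss_tuple.
apply: eq_integral => t _; congr (expR (- _))%:E.
rewrite ns_pt mulr_suml; apply: eq_bigr => i _; rewrite tnth_mktuple exprMn mulrAC divff ?mul1r//.
by rewrite expf_neq0// gt_eqF.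
Qed.

Lemma integral_gw : (\int[leb]_t (gw (pt t))%:E = (pi ^+ n)%:E)%E.
Proof.
have := gauss_int ltr01; rewrite (expr1n _ (n + n)) mul1r => <-.
by apply: eq_integral => t _; rewrite expr1n divr1.
Qed.

End FockMeasure.

(** * The Fock space *)

Section FockSpace.
Context {R : realType} {n : nat}.
Local Open Scope complex_scope.
Local Notation CV := 'rV[R[i]]_n.
Local Notation X := (Rtuple R (n + n)).
Local Notation leb := (@lebesgue_tuple R (n + n)).
Local Notation phi := (@fock_weight R n).
Local Notation L2 := (L2 phi).
Local Notation ip := (L2ip phi).
Local Notation H := (F2 phi).
Implicit Types (z w a : CV) (t : X) (u v g : CV -> R[i]^o).

Lemma sqr_le2D (a b c : R) : 0 <= c -> c <= a + b -> c ^+ 2 <= 2 * (a ^+ 2 + b ^+ 2).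
Proof. by move=> c0 cab; have := sqr_ge0 (a - b); rewrite !expr2; nra. Qed.

Lemma ipE u v : ip u v = cint leb (fun t => u (pt t) * (v (pt t))^*%C * (gw (pt t))%:C).
Proof.
rewrite /L2ip (_ : (fun z => _) = (fun z => u z * (v z)^*%C * (gw z)%:C))//.
by apply/funext => z; rewrite gwE.
Qed.

Lemma L2P u : L2 u <-> cmeas (fun t => u (pt t)) /\
  (\int[leb]_t (nc (u (pt t)) ^+ 2 * gw (pt t))%:E < +oo)%E.
Proof.
rewrite /Defs.L2 /cmeas /=; split.
  move=> [mr mi uoo]; split; first by split.
  by under eq_integral do rewrite -gwE.
move=> [[mr mi] uoo]; split; [exact: mr|exact: mi|].
by under eq_integral do rewrite gwE.
Qed.

Definition sqn u : R := \int[leb]_t (nc (u (pt t)) ^+ 2 * gw (pt t)).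

Lemma measurable_sqn u : cmeas (fun t => u (pt t)) ->
  measurable_fun setT (fun t => nc (u (pt t)) ^+ 2 * gw (pt t)).
Proof.
move=> mu; apply: measurable_funM; last exact: measurable_gw.
by apply: measurable_funX; exact: (cmeas_nc mu).
Qed.

Lemma L2_integrable u : L2 u ->
  leb.-integrable setT (EFin \o (fun t => nc (u (pt t)) ^+ 2 * gw (pt t))).
Proof.
move=> /L2P[mu uoo]; apply/integrableP; split.
  by apply/measurable_EFinP; exact: measurable_sqn.
rewrite (eq_integral (fun t => (nc (u (pt t)) ^+ 2 * gw (pt t))%:E))// => t _.
by rewrite /= ger0_norm// mulr_ge0 ?sqr_ge0 ?gw_ge0.
Qed.

Lemma sqnE u : L2 u -> (\int[leb]_t (nc (u (pt t)) ^+ 2 * gw (pt t))%:E = (sqn u)%:E)%E.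
Proof. by move=> Lu; rewrite /sqn /Rintegral fineK//; exact: (integrable_fin_num _ (L2_integrable Lu)). Qed.

Lemma sqn_ge0 u : 0 <= sqn u.
Proof. by apply: Rintegral_ge0 => t _; rewrite mulr_ge0 ?sqr_ge0 ?gw_ge0. Qed.

Lemma L2_cintg u v : L2 u -> L2 v ->
  cintg leb (fun t => u (pt t) * (v (pt t))^*%C * (gw (pt t))%:C).
Proof.
move=> Lu Lv; apply: (@cintg_dom _ _ _ _ _ (fun t => nc (u (pt t)) ^+ 2 * gw (pt t) + nc (v (pt t)) ^+ 2 * gw (pt t))).
- have [mu _] := (L2P u).1 Lu; have [mv _] := (L2P v).1 Lv.
  by apply: cmeasM; [apply: cmeasM => //; exact: cmeasJ|apply: cmeasR; exact: measurable_gw].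
- exact: (integrableD measurableT (L2_integrable Lu) (L2_integrable Lv)).
- move=> t; rewrite !ncM ncJ ncR ger0_norm ?gw_ge0// -mulrDl ler_wpM2r ?gw_ge0//.
  by have := nc_ge0 (u (pt t)); have := nc_ge0 (v (pt t)); nra.
Qed.

Lemma L2_dom u v (k : R) : cmeas (fun t => v (pt t)) -> L2 u ->
  (forall z, nc (v z) <= k * nc (u z)) -> L2 v.
Proof.
move=> mv Lu vu; apply/L2P; split => //.
have [mu _] := (L2P u).1 Lu.
apply: (@le_lt_trans _ _ (\int[leb]_t ((k ^+ 2)%:E * (nc (u (pt t)) ^+ 2 * gw (pt t))%:E))%E).
  apply: ge0_le_integral => //.
  - by move=> t _; rewrite lee_fin mulr_ge0 ?sqr_ge0 ?gw_ge0.
  - by apply/measurable_EFinP; exact: measurable_sqn.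
  - by apply: measurable_funeM; apply/measurable_EFinP; exact: measurable_sqn.
  - move=> t _; rewrite -EFinM lee_fin mulrA ler_wpM2r ?gw_ge0// -exprMn.
    by rewrite ler_pXn2r ?nnegrE ?nc_ge0//; exact: le_trans (nc_ge0 _) (vu _).
rewrite ge0_integralZl//.
- by rewrite sqnE// -EFinM ltry.
- by apply/measurable_EFinP; exact: measurable_sqn.
- by move=> t _; rewrite lee_fin mulr_ge0 ?sqr_ge0 ?gw_ge0.
- by rewrite lee_fin sqr_ge0.
Qed.

Lemma L2Z (a : R[i]) u : L2 u -> L2 (a *: u).
Proof.
move=> Lu; apply: (@L2_dom u _ (nc a)) => //; last by move=> z; rewrite ncM.
by have [mu _] := (L2P u).1 Lu; exact: (cmeasM (cmeas_cst _)).
Qed.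

Lemma L2D u v : L2 u -> L2 v -> L2 (u + v).
Proof.
move=> Lu Lv; have [mu _] := (L2P u).1 Lu; have [mv _] := (L2P v).1 Lv.
apply/L2P; split; first exact: cmeasD.
apply: (@le_lt_trans _ _ (\int[leb]_t (2%:E * ((nc (u (pt t)) ^+ 2 * gw (pt t))%:E + (nc (v (pt t)) ^+ 2 * gw (pt t))%:E)))%E).
  apply: ge0_le_integral => //.
  - by move=> t _; rewrite lee_fin mulr_ge0 ?sqr_ge0 ?gw_ge0.
  - by apply/measurable_EFinP; apply: measurable_sqn; exact: cmeasD.
  - by apply: measurable_funeM; apply: emeasurable_funD; apply/measurable_EFinP; exact: measurable_sqn.
  - move=> t _; rewrite -EFinD -EFinM lee_fin -mulrDl mulrA ler_wpM2r ?gw_ge0//.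
    apply: sqr_le2D; first exact: nc_ge0.
    exact: ncD.
rewrite ge0_integralZl//.
- rewrite ge0_integralD//; last 4 first.
  + by move=> t _; rewrite lee_fin mulr_ge0 ?sqr_ge0 ?gw_ge0.
  + by apply/measurable_EFinP; exact: measurable_sqn.
  + by move=> t _; rewrite lee_fin mulr_ge0 ?sqr_ge0 ?gw_ge0.
  + by apply/measurable_EFinP; exact: measurable_sqn.
  by rewrite !sqnE// -EFinD -EFinM ltry.
- by apply: emeasurable_funD; apply/measurable_EFinP; exact: measurable_sqn.
- by move=> t _; rewrite adde_ge0// lee_fin mulr_ge0 ?sqr_ge0 ?gw_ge0.
Qed.

Lemma L2_0 : L2 0.
Proof.
apply/L2P; split; first exact: cmeas_cst.
under eq_integral do rewrite nc0 expr0n/= mul0r.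
by rewrite integral0.
Qed.

Lemma ipDZ (a : R[i]) u v (w : CV -> R[i]^o) : L2 u -> L2 v -> L2 w -> ip (a *: u + v) w = a * ip u w + ip v w.
Proof.
move=> Lu Lv Lw; rewrite !ipE -cintZ; last exact: L2_cintg.
rewrite -cintD; [|exact/cintgZ/L2_cintg|exact: L2_cintg].
by apply: eq_cint => t; rewrite !fctE /GRing.scale/=; ring.
Qed.

Lemma ipJ u v : L2 u -> L2 v -> ip u v = (ip v u)^*%C.
Proof.
move=> Lu Lv; rewrite !ipE -cintJ; last exact: L2_cintg.
by apply: eq_cint => t; apply: eq_creim; rewrite !(cReM, cImM, cReJ, cImJ) /=; ring.
Qed.

Lemma ip_sqn u : ip u u = (sqn u)%:C.
Proof.
by rewrite ipE -cint_real; apply: eq_cint => t; rewrite mulcJ -cRM.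
Qed.

Lemma nc_dot z w : nc (dot z w) <= \sum_j nc (z 0 j) * nc (w 0 j).
Proof. by apply: (le_trans (nc_sum _ _ _)); apply: ler_sum => j _; rewrite ncM ncJ. Qed.

(** The arithmetic-geometric inequality with unequal weights: growth of the kernel in [w] costs only
    e^(|w|^2 / 8), which leaves most of the Gaussian weight available for domination. *)
Lemma nc_dot_le z w : nc (dot z w) <= 2 * ns z + ns w / 8.
Proof.
apply: (le_trans (nc_dot z w)); rewrite mulr_sumr mulr_suml -big_split/=.
apply: ler_sum => j _.
have := sqr_ge0 (4 * nc (z 0 j) - nc (w 0 j)); rewrite !expr2; nra.
Qed.

Lemma Re_dot_le z w : complex.Re (dot z w) <= 2 * ns z + ns w / 8.
Proof. by apply: le_trans (nc_dot_le z w); apply: le_trans (nc_Re _); exact: ler_norm. Qed.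

Lemma dotJ z w : dot w z = (dot z w)^*%C.
Proof. by rewrite /dot rmorph_sum/=; apply: eq_bigr => j _; rewrite rmorphM/= conjcK mulrC. Qed.

Lemma dotDl z z' w : dot (z + z') w = dot z w + dot z' w.
Proof. by rewrite /dot -big_split/=; apply: eq_bigr => j _; rewrite mxE mulrDl. Qed.

Lemma dotNr z w : dot z (- w) = - dot z w.
Proof. by rewrite /dot -sumrN; apply: eq_bigr => j _; rewrite mxE rmorphN mulrN. Qed.

Lemma dotzz z : dot z z = (ns z)%:C.
Proof. by rewrite /dot /ns rmorph_sum; apply: eq_bigr => j _; rewrite mulcJ. Qed.

Lemma nsD z w : ns (z + w) = ns z + ns w + 2 * complex.Re (dot z w).
Proof.
apply: (@complexI R); rewrite -dotzz dotDl !(dotJ (z + w)) !dotDl !rmorphD/= -!dotJ !dotzz.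
rewrite (dotJ z w) mulr_natl mulr2n rmorphD/=.
have -> : (complex.Re (dot z w))%:C + (complex.Re (dot z w))%:C = dot z w + (dot z w)^*%C.
  by apply: eq_creim; rewrite !(cReD, cImD, cReJ, cImJ)/=; ring.
ring.
Qed.

Lemma cmeas_dotr z : cmeas (fun t => dot z (pt t)).
Proof. by apply: cmeas_sum => j; apply: (cmeasM (cmeas_cst _)); apply: cmeasJ; exact: cmeas_pt. Qed.

Lemma cmeas_dotl z : cmeas (fun t => dot (pt t) z).
Proof. by apply: cmeas_sum => j; apply: cmeasM; [exact: cmeas_pt|exact: cmeas_cst]. Qed.

(* The reproducing kernel: [K z] is evaluation at [z]. *)
Definition rker z : CV -> R[i]^o := fun w => ((pi ^+ n)^-1)%:C * cexp (dot w z).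
Local Notation K := rker.

Lemma KJ z w : (K z w)^*%C = ((pi ^+ n)^-1)%:C * cexp (dot z w).
Proof. rewrite /rker (dotJ z w); apply: eq_creim;
  by rewrite !(cReM, cImM, cReJ, cImJ, Re_cexp, Im_cexp) /= ?cosN ?sinN; ring. Qed.

Lemma pin_gt0 : 0 < (pi ^+ n)^-1 :> R.
Proof. by rewrite invr_gt0 exprn_gt0// pi_gt0. Qed.

Lemma nc_K z w : nc (K z w) = (pi ^+ n)^-1 * expR (complex.Re (dot w z)).
Proof. by rewrite /rker ncM ncR nc_cexp gtr0_norm// pin_gt0. Qed.

Lemma gauss_integrable (c : R) : 0 < c ->
  leb.-integrable setT (EFin \o (fun t => expR (- (ns (pt t) / c ^+ 2)))).
Proof.
move=> c0; apply/integrableP; split.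
  apply/measurable_EFinP; apply: (measurableT_comp (f := @expR R)) => //.
  apply: measurableT_comp => //; apply: measurable_funM => //; exact: measurable_ns.
under eq_integral => t _ do rewrite /= ger0_norm ?expR_ge0//.
by rewrite gauss_int// ltry.
Qed.

Lemma K_L2 z : L2 (K z).
Proof.
have mK : cmeas (fun t => K z (pt t)).
  apply: (cmeasM (cmeas_cst _)); apply: cmeas_cexp; exact: cmeas_dotl.
apply/L2P; split => //.
pose C := (pi ^+ n)^-1 ^+ 2 * expR (4 * ns z).
have /integrableP[_] := integrableZl measurableT C (gauss_integrable (ltr0Sn R 1)).
apply: le_lt_trans; apply: ge0_le_integral => //.
- by move=> t _; rewrite lee_fin mulr_ge0 ?sqr_ge0 ?gw_ge0.
- by apply/measurable_EFinP; exact: measurable_sqn.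
- apply: measurableT_comp => //; apply: measurable_funeM.
  by have /integrableP[] := gauss_integrable (ltr0Sn R 1).
- move=> t _; rewrite /= lee_fin ger0_norm; last first.
    by rewrite mulr_ge0 ?expR_ge0// mulr_ge0 ?expR_ge0 ?sqr_ge0.
  rewrite nc_K exprMn /C -!mulrA; do 2![apply: ler_wpM2l; first exact: ltW pin_gt0].
  rewrite /gw -!expRD ler_expR.
  have := Re_dot_le (pt t) z; have := nc_Re (dot (pt t) z); have := nc_dot_le z (pt t).
  rewrite dotJ ncJ => h1 h2 _; have := ler_norm (complex.Re (dot (pt t) z)).
  have -> : 2 ^+ 2 = 4 :> R by ring.
  have := ns_ge0 (pt t); move: h1 h2; rewrite dotJ cReJ ncJ; lra.
Qed.

Lemma cl1_dot z w : (forall j, nc (z 0 j) <= 1) -> nc (dot z w) <= cl1 w.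
Proof.
move=> z1; apply: (le_trans (nc_dot z w)); apply: ler_sum => j _.
by rewrite ler_piMl// nc_ge0.
Qed.

Lemma cl1_dot2 z w : nc (dot z w) <= cl1 z * cl1 w.
Proof.
apply: (le_trans (nc_dot z w)); rewrite mulr_suml; apply: ler_sum => j _.
rewrite ler_wpM2l ?nc_ge0// /cl1 (bigD1 j)//= lerDl.
by apply: sumr_ge0 => i _; exact: nc_ge0.
Qed.

Lemma cexp_dot_taylor (h w : CV) : (forall j, nc (h 0 j) <= 1) ->
  nc (cexp (dot h w) - 1 - dot h w) <= 4 * cl1 h ^+ 2 * (cl1 w ^+ 2 * expR (cl1 w)).
Proof.
move=> h1; apply: (le_trans (cexp_taylor1 _)); rewrite mulrA -[4 * _ * cl1 w ^+ 2]mulrA -exprMn.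
apply: ler_pM; rewrite ?expR_ge0 ?mulr_ge0 ?sqr_ge0 ?nc_ge0//.
  by rewrite ler_wpM2l// ler_pXn2r ?nnegrE ?nc_ge0 ?mulr_ge0 ?cl1_ge0// cl1_dot2.
by rewrite ler_expR cl1_dot.
Qed.

Lemma K_entire z : entire (K z).
Proof.
apply: (@entire_quad _ _ _ (fun w j => (z 0 j)^*%C * K z w)
  (fun w => nc (K z w) * (4 * (cl1 z ^+ 2 * expR (cl1 z))))) => w h h1.
have -> : K z (h + w) - K z w - \sum_j h 0 j * ((z 0 j)^*%C * K z w) =
    K z w * (cexp (dot h z) - 1 - dot h z).
  have -> : \sum_j h 0 j * ((z 0 j)^*%C * K z w) = dot h z * K z w.
    by rewrite /dot mulr_suml; apply: eq_bigr => j _; rewrite mulrA.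
  rewrite /rker dotDl cexpD; ring.
rewrite ncM -mulrA ler_wpM2l ?nc_ge0//; apply: (le_trans (cexp_dot_taylor _ h1)).
by rewrite le_eqVlt; apply/orP; left; apply/eqP; ring.
Qed.

Lemma K_H z : H (K z).
Proof. by split; [exact: K_L2|exact: K_entire]. Qed.

(** Split e^(-3s/4) = e^(-s/2) e^(-s/4) and use ab <= a^2 + b^2: the first square is the [L2]
    density of [g], the second is a Gaussian. The result is the majorant for differentiating under
    the integral against the kernel. *)
Lemma L2_dom_integrable g : L2 g ->
  leb.-integrable setT (EFin \o (fun t => nc (g (pt t)) * expR (- (3 / 4 * ns (pt t))))).
Proof.
move=> Lg; have [mg _] := (L2P g).1 Lg.
have := integrableD measurableT (L2_integrable Lg) (gauss_integrable (ltr0Sn R 1)).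
apply: le_integrable => //.
  apply/measurable_EFinP; apply: measurable_funM; first exact: (cmeas_nc mg).
  apply: (measurableT_comp (f := @expR R)) => //; apply: measurableT_comp => //.
  by apply: measurable_funM => //; exact: measurable_ns.
move=> t _; rewrite /= lee_fin ger0_norm ?mulr_ge0 ?nc_ge0 ?expR_ge0//.
rewrite ger0_norm; last first.
  by apply: addr_ge0; [apply: mulr_ge0; [exact: sqr_ge0|exact: gw_ge0]|exact: expR_ge0].
set s := ns (pt t).
have s0 : 0 <= s by exact: ns_ge0.
have -> : gw (pt t) = expR (- (s / 2)) ^+ 2.
  by rewrite expr2 -expRD; congr expR; rewrite /s; field.
have -> : expR (- (3 / 4 * s)) = expR (- (s / 2)) * expR (- (s / 4)).
  by rewrite -expRD; congr expR; field.
apply: (@le_trans _ _ ((nc (g (pt t)) * expR (- (s / 2))) ^+ 2 + expR (- (s / 4)) ^+ 2)).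
  have := sqr_ge0 (nc (g (pt t)) * expR (- (s / 2)) - expR (- (s / 4))).
  have : 0 <= nc (g (pt t)) * expR (- (s / 2)) * expR (- (s / 4)) by rewrite !mulr_ge0 ?nc_ge0 ?expR_ge0.
  by rewrite mulrA !expr2; nra.
rewrite exprMn lerD2l expr2 -expRD ler_expR.
have -> : 2 ^+ 2 = 4 :> R by ring.
lra.
Qed.

(** Differentiation under the integral sign. The candidate partial derivatives insert the conjugate
    of the j-th coordinate. In the remainder, the kernel and the Taylor error each cost a factor
    e^(s/8), and together with e^(-s) these leave the e^(-3s/4) of [L2_dom_integrable]. *)
Lemma ip_K_entire g : L2 g -> entire (fun z => ip g (K z) : R[i]^o).
Proof.
move=> Lg; have [mg _] := (L2P g).1 Lg.
pose G z t := g (pt t) * (K z (pt t))^*%C * (gw (pt t))%:C.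
have iG z : cintg leb (G z) by apply: L2_cintg => //; exact: K_L2.
have id := L2_dom_integrable Lg.
pose Cz z := (pi ^+ n)^-1 * expR (2 * ns z).
have Cz0 z : 0 <= Cz z by rewrite mulr_ge0 ?expR_ge0 ?(ltW pin_gt0).
(* The constant of the bound [cl1E]: x^2 e^x <= 2 e^(2x), and 2x <= 8 + x^2 / 8 in each of the n
   coordinates. *)
pose E := expR (8 * n%:R) : R.
have cl1E w : cl1 w ^+ 2 * expR (cl1 w) <= 2 * E * expR (ns w / 8).
  apply: (@le_trans _ _ (2 * expR (2 * cl1 w))).
    rewrite [2 * cl1 w]mulr_natl mulr2n expRD mulrA ler_wpM2r ?expR_ge0//.
    have := @expR_ge1Dxn R (cl1 w) 1 (cl1_ge0 w).
    rewrite (_ : (2`!)%:R = 2 :> R)//; have := cl1_ge0 w; lra.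
  rewrite -mulrA ler_wpM2l// -expRD ler_expR mulr_sumr mulr_suml.
  have -> : 8 * n%:R = \sum_(j < n) 8 :> R by rewrite sumr_const card_ord mulr_natr.
  rewrite -big_split/=; apply: ler_sum => j _.
  by have := sqr_ge0 (nc (w 0 j) - 8); rewrite !expr2; nra.
have Gb z t : nc (G z t) <= Cz z * (expR (ns (pt t) / 8) * (nc (g (pt t)) * gw (pt t))).
  rewrite !ncM ncJ ncR ger0_norm ?gw_ge0// nc_K.
  rewrite [leRHS](_ : _ = nc (g (pt t)) * ((pi ^+ n)^-1 * (expR (2 * ns z) * expR (ns (pt t) / 8))) * gw (pt t)); last by rewrite /Cz; ring.
  rewrite ler_wpM2r ?gw_ge0// ler_wpM2l ?nc_ge0// ler_wpM2l ?(ltW pin_gt0)//.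
  by rewrite -expRD ler_expR dotJ cReJ Re_dot_le.
pose D z (h : CV) t := G z t * (cexp (dot h (pt t)) - 1 - dot h (pt t)).
have mGd (F : X -> R[i]) z : cmeas F -> cmeas (fun t => G z t * F t).
  by move=> mF; apply: cmeasM => //; case: (iG z).
have gwexp w : expR (ns w / 8) * expR (ns w / 8) * gw w = expR (- (3 / 4 * ns w)).
  by rewrite -!expRD; congr expR; field.
have Db z (h : CV) t : (forall j, nc (h 0 j) <= 1) ->
    nc (D z h t) <= 8 * Cz z * E * cl1 h ^+ 2 * (nc (g (pt t)) * expR (- (3 / 4 * ns (pt t)))).
  move=> h1; rewrite ncM; apply: (le_trans (ler_pM (nc_ge0 _) (nc_ge0 _) (Gb z t) (cexp_dot_taylor (pt t) h1))).
  apply: (@le_trans _ _ (Cz z * (expR (ns (pt t) / 8) * (nc (g (pt t)) * gw (pt t))) *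
     (4 * cl1 h ^+ 2 * (2 * E * expR (ns (pt t) / 8))))).
    apply: ler_wpM2l.
      apply: mulr_ge0; first exact: Cz0.
      by apply: mulr_ge0; [exact: expR_ge0|apply: mulr_ge0; [exact: nc_ge0|exact: gw_ge0]].
    apply: ler_wpM2l; last exact: cl1E.
    by rewrite mulr_ge0 ?sqr_ge0.
  by rewrite -gwexp le_eqVlt; apply/orP; left; apply/eqP; ring.
have iD z (h : CV) : (forall j, nc (h 0 j) <= 1) -> cintg leb (D z h).
  move=> h1; apply: (cintg_dom _ (integrableZl measurableT (8 * Cz z * E * cl1 h ^+ 2) id)).
    apply: mGd; apply: cmeasB; last exact: cmeas_dotr.
    by apply: cmeasB; [apply: cmeas_cexp; exact: cmeas_dotr|exact: cmeas_cst].
  by move=> t; exact: Db.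
have iGw z j : cintg leb (fun t => G z t * (pt t 0 j)^*%C).
  apply: (cintg_dom _ (integrableZl measurableT (Cz z * (2 * E)) id)).
    by apply: mGd; apply: cmeasJ; exact: cmeas_pt.
  move=> t; rewrite ncM ncJ.
  have wE : nc (pt t 0 j) <= 2 * E * expR (ns (pt t) / 8).
    apply: (@le_trans _ _ (cl1 (pt t))).
      by rewrite /cl1 (bigD1 j)//= lerDl; apply: sumr_ge0 => i _; exact: nc_ge0.
    apply: (@le_trans _ _ (2 * expR (2 * cl1 (pt t)))).
      by have := expR_ge1Dx (2 * cl1 (pt t)); have := cl1_ge0 (pt t); lra.
    rewrite -mulrA ler_wpM2l// -expRD ler_expR mulr_sumr mulr_suml.
    have -> : 8 * n%:R = \sum_(j < n) 8 :> R by rewrite sumr_const card_ord mulr_natr.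
    rewrite -big_split/=; apply: ler_sum => i _.
    by have := sqr_ge0 (nc (pt t 0 i) - 8); rewrite !expr2; nra.
  apply: (le_trans (ler_pM (nc_ge0 _) (nc_ge0 _) (Gb z t) wE)).
  by rewrite -gwexp le_eqVlt; apply/orP; left; apply/eqP; ring.
apply: (@entire_quad _ _ _ (fun z j => cint leb (fun t => G z t * (pt t 0 j)^*%C))
  (fun z => 2 * (8 * Cz z * E * \int[leb]_t (nc (g (pt t)) * expR (- (3 / 4 * ns (pt t))))))) => z h h1.
have isum (r : seq 'I_n) : cintg leb (fun t => \sum_(j <- r) h 0 j * (G z t * (pt t 0 j)^*%C)) /\
    cint leb (fun t => \sum_(j <- r) h 0 j * (G z t * (pt t 0 j)^*%C)) =
    \sum_(j <- r) h 0 j * cint leb (fun t => G z t * (pt t 0 j)^*%C).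
  elim: r => [|j r [IH1 IH2]].
    rewrite big_nil; split.
      apply: (cintg_eq (g := fun t => 0 * G z t)); first by move=> t; rewrite mul0r big_nil.
      exact: cintgZ.
    have -> : cint leb (fun t => \sum_(j <- [::]) h 0 j * (G z t * (pt t 0 j)^*%C)) =
        cint leb (fun t => 0 * G z t) by apply: eq_cint => t; rewrite mul0r big_nil.
    by rewrite cintZ// mul0r.
  rewrite big_cons; split.
    apply: (cintg_eq (g := fun t => h 0 j * (G z t * (pt t 0 j)^*%C) + \sum_(j <- r) h 0 j * (G z t * (pt t 0 j)^*%C))).
      by move=> t; rewrite big_cons.
    by apply: cintgD => //; exact: cintgZ.
  rewrite -IH2 -cintZ// -cintD//; last exact: cintgZ.
  by apply: eq_cint => t; rewrite big_cons.
have [is1 is2] := isum (index_enum 'I_n).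
have -> : ip g (K (h + z)) - ip g (K z) - \sum_j h 0 j * cint leb (fun t => G z t * (pt t 0 j)^*%C) =
    cint leb (D z h).
  rewrite !ipE -is2 -cintB; [|exact: iG|exact: iG].
  rewrite -cintB//; last by apply: cintgB; exact: iG.
  apply: eq_cint => t.
  have -> : \sum_j h 0 j * (G z t * (pt t 0 j)^*%C) = G z t * dot h (pt t).
    by rewrite /dot mulr_sumr; apply: eq_bigr => j _; ring.
  by rewrite /D /G !KJ dotDl cexpD; ring.
apply: (le_trans (nc_cint_le (iD z h h1))); rewrite -[leRHS]mulrA; apply: ler_wpM2l => //.
rewrite mulrAC -RintegralZl//.
apply: le_Rintegral => //; first exact: (cintg_nc (iD z h h1)).
  exact: (integrableZl measurableT _ id).
by move=> t _; exact: Db.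
Qed.

End FockSpace.

Section EntireOperations.
Context {R : realType} {n : nat}.
Local Notation CV := 'rV[R[i]]_n.

Lemma differentiable_shift (K : numFieldType) (V : normedModType K) (u : V -> K^o) (a : V) :
  (forall z, differentiable u z) -> forall z, differentiable (fun x => u (x + a)) z.
Proof.
move=> du z; apply: (@differentiable_comp _ _ _ _ (fun x => x + a) u); last exact: du.
by apply: differentiableD; [exact: ex_diff|exact: differentiable_cst].
Qed.

Lemma differentiable_mul (K : numFieldType) (V : normedModType K) (u v : V -> K^o) :
  (forall z, differentiable u z) -> (forall z, differentiable v z) ->
  forall z, differentiable (fun x => (u x : K) * v x : K^o) z.
Proof. by move=> du dv z; apply: differentiableM; [exact: du|exact: dv]. Qed.

Lemma differentiable_lincomb (K : numFieldType) (V : normedModType K) (a : K) (u v : V -> K^o) :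
  (forall z, differentiable u z) -> (forall z, differentiable v z) ->
  forall z, differentiable (a *: u + v) z.
Proof.
by move=> du dv z; apply: differentiableD; [apply: differentiableZ; exact: du|exact: dv].
Qed.

Lemma entire_shift (u : CV -> R[i]^o) (a : CV) : entire u -> entire (fun z => u (z + a)).
Proof. exact: differentiable_shift. Qed.

Lemma entireM (u v : CV -> R[i]^o) : entire u -> entire v -> entire (fun z => u z * v z).
Proof. exact: differentiable_mul. Qed.

Lemma entireDZ (c : R[i]) (u v : CV -> R[i]^o) : entire u -> entire v -> entire (c *: u + v).
Proof. exact: differentiable_lincomb. Qed.

End EntireOperations.

(** * The reproducing formula *)

Section Reproducing.
Context {R : realType} {n : nat}.
Local Open Scope complex_scope.
Local Notation CV := 'rV[R[i]]_n.
Local Notation X := (Rtuple R (n + n)).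
Local Notation leb := (@lebesgue_tuple R (n + n)).
Local Notation leb1 := (@lebesgue_measure R).
Local Notation phi := (@fock_weight R n).
Local Notation L2 := (L2 phi).
Local Notation K := (@rker R n).
Local Notation ip := (L2ip phi).
Local Notation H := (F2 phi).
Implicit Types (z w a : CV) (t : X) (u v g : CV -> R[i]^o).

Lemma nc_polar1 (s : R) : nc (polar 1 s) = 1.
Proof. by rewrite /nc /polar /= !mul1r cos2Dsin2 sqrtr1. Qed.

Lemma ns_polar (s : R) z : ns (polar 1 s *: z) = ns z.
Proof. by apply: eq_bigr => j _; rewrite mxE ncM nc_polar1 mul1r. Qed.

Lemma gw_polar (s : R) z : gw (polar 1 s *: z) = gw z.
Proof. by rewrite /gw ns_polar. Qed.

Definition rott (p : measurableTypeR R * X) : X := tp (polar 1 p.1 *: pt p.2).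

Lemma measurable_rott : measurable_fun setT rott.
Proof.
have mfst : measurable_fun setT (fun p : measurableTypeR R * X => p.1 : R) by exact: measurable_fst.
have mc : measurable_fun setT (fun p : measurableTypeR R * X => cos p.1).
  apply: (measurableT_comp (f := @cos R)) mfst.
  by apply: continuous_measurable_fun; exact: continuous_cos.
have ms : measurable_fun setT (fun p : measurableTypeR R * X => sin p.1).
  apply: (measurableT_comp (f := @sin R)) mfst.
  by apply: continuous_measurable_fun; exact: continuous_sin.
have mt i : measurable_fun setT (fun p : measurableTypeR R * X => tnth p.2 i : R).
  by apply: (measurableT_comp (f := fun t : X => tnth t i)); [exact: measurable_tnth|exact: measurable_snd].
apply/measurable_fun_tnthP => i.
rewrite -(fintype.splitK i); case: (fintype.split i) => j /=.
  have mA : measurable_fun setT (fun p : measurableTypeR R * X => cos p.1 * tnth p.2 (lshift n j) - sin p.1 * tnth p.2 (rshift n j) : R).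
    by apply: measurable_funB; apply: measurable_funM; [exact: mc|exact: mt|exact: ms|exact: mt].
  rewrite (_ : _ \o _ = fun p : measurableTypeR R * X => cos p.1 * tnth p.2 (lshift n j) - sin p.1 * tnth p.2 (rshift n j)); first exact: mA.
  apply/funext => p /=; rewrite -[LHS]Re_pt /rott tpK mxE cReM Re_pt Im_pt /polar/=; ring.
have mA : measurable_fun setT (fun p : measurableTypeR R * X => cos p.1 * tnth p.2 (rshift n j) + sin p.1 * tnth p.2 (lshift n j) : R).
  by apply: measurable_funD; apply: measurable_funM; [exact: mc|exact: mt|exact: ms|exact: mt].
rewrite (_ : _ \o _ = fun p : measurableTypeR R * X => cos p.1 * tnth p.2 (rshift n j) + sin p.1 * tnth p.2 (lshift n j)); first exact: mA.
by apply/funext => p /=; rewrite -[LHS]Im_pt /rott tpK mxE cImM Re_pt Im_pt /polar/=; ring.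
Qed.

(** Multiplication by e^(is) preserves both volume and Gaussian, so the integral may be averaged
    over s in [0, 2 pi]. After exchanging the integrals, the inner one is the circular mean of [u]
    on the complex line through [pt t], which equals its value at 0. *)
Lemma Re_gauss_mean u : entire u ->
  cintg leb (fun t => u (pt t) * (gw (pt t))%:C) -> cmeas (fun t => u (pt t)) ->
  \int[leb]_t (complex.Re (u (pt t)) * gw (pt t)) = pi ^+ n * complex.Re (u 0).
Proof.
move=> eu iu [mr mi].
pose I := `[0, 2 * pi]%classic : set R.
have mI : measurable (I : set (measurableTypeR R)) by exact: measurable_itv.
have p0 : 0 < 2 * pi :> R by rewrite mulr_gt0// pi_gt0.
pose f (p : measurableTypeR R * X) : R :=
  \1_I p.1 * (complex.Re (u (pt (rott p))) * gw (pt p.2)).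
pose h t := complex.Re (u (pt t)) * gw (pt t).
have mh : measurable_fun setT h by apply: measurable_funM => //; exact: measurable_gw.
have ih : leb.-integrable setT (EFin \o h).
  have := cintg_Re iu; apply: eq_integrable => // t _.
  by rewrite /= cReM /= mulr0 subr0.
have rotE (s : R) : exists2 S, mpres S & forall t, pt (S t) = polar 1 s *: pt t.
  have := @rotation_mpres R n (cos s) (sin s) (cos2Dsin2 s).
  by rewrite /polar !mul1r.
have introt (s : R) (k : X -> \bar R) : measurable_fun setT k ->
    (\int[leb]_t k (rott (s, t)) = \int[leb]_t k t)%E.
  move=> mk; have [S mS SE] := rotE s; rewrite -(mpres_integral mS mk).
  by apply: eq_integral => t _; rewrite /rott /= -SE ptK.
have fE s t : f (s, t) = \1_I s * h (rott (s, t)).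
  by rewrite /f /h /rott tpK gw_polar.
have mf : measurable_fun setT f.
  have -> : f = fun p => \1_I p.1 * h (rott p) by apply/funext => -[s t]; exact: fE.
  apply: measurable_funM; last by apply: measurableT_comp => //; exact: measurable_rott.
  by apply: (measurableT_comp (f := \1_I : measurableTypeR R -> R)); [exact: measurable_indic|exact: measurable_fst].
have LI : leb1 I = (2 * pi)%:E by have := lebesgue_itvcc (ltW p0); rewrite subr0.
have II : (\int[leb1]_s (\1_I s)%:E = (2 * pi)%:E)%E by rewrite integral_indic// setIT.
have iI : leb1.-integrable setT (EFin \o (\1_I : R -> R)).
  apply/integrableP; split; first by apply/measurable_EFinP; exact: measurable_indic.
  have -> : (\int[leb1]_x `|(EFin \o (\1_I : R -> R)) x| = \int[leb1]_s (\1_I s)%:E)%E.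
    by apply: eq_integral => s _; rewrite /= ger0_norm.
  by rewrite II ltry.
have intI (c : \bar R) : (0 <= c)%E -> (\int[leb1]_s ((\1_I s)%:E * c) = (2 * pi)%:E * c)%E.
  move=> c0; rewrite ge0_integralZr//.
  - by rewrite II.
  - by apply/measurable_EFinP; exact: measurable_indic.
have hoo : (\int[leb]_t `|(h t)%:E| < +oo)%E by have /integrableP[] := ih.
have fi : (leb1 \x leb)%E.-integrable setT (EFin \o f).
  apply/integrable12ltyP; first exact/measurable_EFinP.
  rewrite (eq_integral (fun s : measurableTypeR R => (\1_I s)%:E * \int[leb]_t `|(h t)%:E|)%E).
    rewrite intI; last by apply: integral_ge0.
    by rewrite lte_mul_pinfty// lee_fin ltW.
  move=> s _; rewrite -(introt s (fun t => `|(h t)%:E|%E)).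
    rewrite -ge0_integralZl//.
    - by apply: eq_integral => t _; rewrite /= fE normrM ger0_norm// EFinM.
    - apply: (measurableT_comp (f := fun t => `|(h t)%:E|%E)).
        by apply: measurableT_comp => //; exact/measurable_EFinP.
      by apply: (measurableT_comp measurable_rott); exact: measurable_pair1.
  by apply: measurableT_comp => //; exact/measurable_EFinP.
have f1 s : leb.-integrable setT (EFin \o (fun t => f (s, t))).
  have mhs : measurable_fun setT (fun t => h (rott (s, t))).
    by apply: measurableT_comp => //; apply: (measurableT_comp measurable_rott); exact: measurable_pair1.
  have : leb.-integrable setT (EFin \o (fun t => h (rott (s, t)))).
    apply/integrableP; split; first exact/measurable_EFinP.
    rewrite /= (introt s (fun t => `|(h t)%:E|%E))//.
    by apply: measurableT_comp => //; exact/measurable_EFinP.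
  move=> /(integrableZl measurableT (\1_I s)); apply: eq_integrable => // t _.
  by rewrite /= fE.
have cdl w : cdiff (fun x : R[i] => u (x *: w)) by exact: entire_line.
have f2E t s : f (s, t) = ((fun s => complex.Re (u (polar 1 s *: pt t)) * gw (pt t)) \_ I) s.
  rewrite /f /rott tpK /patch /=; rewrite indicE; case: ifPn => _; by rewrite ?mul1r ?mul0r.
have f2 t : leb1.-integrable setT (EFin \o (fun s => f (s, t))).
  have := Re_circle_integrable (cdl (pt t)).
  move=> /(integrableZr mI (gw (pt t))) h2.
  have h3 : leb1.-integrable I (EFin \o (fun s => complex.Re (u (polar 1 s *: pt t)) * gw (pt t))).
    move: h2; apply: eq_integrable => // s _; by rewrite /= EFinM.
  have : leb1.-integrable setT ((EFin \o (fun s => complex.Re (u (polar 1 s *: pt t)) * gw (pt t))) \_ I).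
    exact/(integrable_mkcond _ mI).
  apply: eq_integrable => // s _.
  by rewrite /= f2E /patch; case: ifP.
have := Rintegral_fubini fi f1 f2.
have -> : \int[leb1]_s (\int[leb]_t f (s, t))%R = 2 * pi * \int[leb]_t h t.
  have E s : \int[leb]_t f (s, t) = \1_I s * \int[leb]_t h t.
    have -> : \int[leb]_t f (s, t) = \int[leb]_t (\1_I s * h (rott (s, t))).
      by apply: eq_Rintegral => t _; exact: fE.
    have ihs : leb.-integrable setT (EFin \o (fun t => h (rott (s, t)))).
      apply/integrableP; split.
        by apply/measurable_EFinP; apply: measurableT_comp => //; apply: (measurableT_comp measurable_rott); exact: measurable_pair1.
      rewrite /= (introt s (fun t => `|(h t)%:E|%E))//.
      by apply: measurableT_comp => //; exact/measurable_EFinP.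
    transitivity (\1_I s * \int[leb]_t h (rott (s, t))).
      exact: (RintegralZl (\1_I s) measurableT ihs).
    apply: (congr1 (fun x => \1_I s * fine x)).
    by apply: (introt s (fun t => (h t)%:E)); exact/measurable_EFinP.
  have i1 : leb1.-integrable setT (EFin \o \1_I).
    apply/integrableP; split; first by apply/measurable_EFinP; exact: measurable_indic.
    rewrite (eq_integral (fun s : measurableTypeR R => (\1_I s)%:E)); first by rewrite II ltry.
    by move=> s _ /=; rewrite ger0_norm.
  transitivity (\int[leb1]_s (\1_I s * \int[leb]_t h t)).
    by apply: eq_Rintegral => s _; exact: E.
  transitivity ((\int[leb1]_s \1_I s) * \int[leb]_t h t).
    exact: (RintegralZr _ measurableT i1).
  by congr (_ * _); rewrite /Rintegral II.
have -> : \int[leb]_t (\int[leb1]_s f (s, t))%R = \int[leb]_t (2 * pi * complex.Re (u 0) * gw (pt t)).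
  apply: eq_Rintegral => t _.
  have -> : \int[leb1]_s f (s, t) = \int[leb1]_(s in I) (complex.Re (u (polar 1 s *: pt t)) * gw (pt t)).
    rewrite [RHS]Rintegral_mkcond; apply: eq_Rintegral => s _; exact: f2E.
  rewrite [LHS](RintegralZr _ mI (Re_circle_integrable (cdl (pt t)))).
  by rewrite (Re_mean_value (cdl (pt t))) scale0r.
have igw : leb.-integrable setT (EFin \o (fun t => gw (pt t))).
  apply/integrableP; split; first by apply/measurable_EFinP; exact: measurable_gw.
  rewrite (eq_integral (fun t => (gw (pt t))%:E)); first by rewrite integral_gw ltry.
  by move=> t _; rewrite /= ger0_norm// gw_ge0.
rewrite (RintegralZl _ measurableT igw) {2}/Rintegral integral_gw /= => E.
apply: (@mulfI _ (2 * pi)); first by rewrite gt_eqF.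
by rewrite E; ring.
Qed.

Lemma gauss_mean u : entire u -> cmeas (fun t => u (pt t)) ->
  cintg leb (fun t => u (pt t) * (gw (pt t))%:C) ->
  cint leb (fun t => u (pt t) * (gw (pt t))%:C) = (pi ^+ n)%:C * u 0.
Proof.
move=> eu mu iu; apply: eq_creim; rewrite /= ?cReM ?cImM /= ?mul0r ?subr0 ?addr0.
  rewrite -Re_gauss_mean//; apply: eq_Rintegral => t _.
  by rewrite cReM /= mulr0 subr0.
(* The imaginary part of [u] is the real part of -i u, to which the previous lemma applies. *)
have en : entire ((- 'i) *: u + 0).
  by apply: entireDZ => //; rewrite /entire => z; exact: differentiable_cst.
have E z : ((- 'i) *: u + 0) z = - 'i * u z by rewrite !fctE /= addr0.
have := Re_gauss_mean en.
rewrite E; have -> : complex.Re (- 'i * u 0) = complex.Im (u 0) by rewrite cReM /=; ring.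
move=> <-.
- apply: eq_Rintegral => t _; rewrite E !(cReM, cImM) /=; ring.
- have := cintgZ (- 'i) iu; apply: cintg_eq => t; rewrite E mulrA//.
- have := cmeasM (cmeas_cst (- 'i)) mu; congr cmeas; apply/funext => t; exact: esym (E _).
Qed.

(* Translating [z] to [0] reduces the claim to the mean value property, averaged over rotations. *)
Lemma reproducing u z : H u -> u z = ip u (K z).
Proof.
move=> [Lu eu]; have [mu _] := (L2P u).1 Lu.
(* The Weyl translate of [u]: the holomorphic factor [K (- z)] absorbs the change of the Gaussian
   weight, so that [v] against the Gaussian is the translated integrand of [ip u (K z)]. *)
pose v w := u (w + z) * K (- z) w : R[i].
have ev : entire (v : CV -> R[i]^o) by apply: entireM; [exact: entire_shift|exact: K_entire].
pose G t := u (pt t) * (K z (pt t))^*%C * (gw (pt t))%:C.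
have iG : cintg leb G by apply: L2_cintg => //; exact: K_L2.
have mS := mpres_ttrans z.
have GE t : v (pt t) * (gw (pt t))%:C = G (ttrans z t).
  rewrite /G pt_ttrans KJ /v /rker dotNr /gw nsD -!cexpR -![in RHS]mulrA -![in LHS]mulrA.
  congr (_ * (_ * _)); rewrite -!cexpD; congr cexp.
  rewrite (dotJ (pt t + z) z) dotDl dotzz.
  apply: eq_creim; rewrite !(cReD, cImD, cReN, cImN, cReJ, cImJ)/=; ring.
have iv : cintg leb (fun t => v (pt t) * (gw (pt t))%:C).
  split.
    have [mG _] := iG; have := cmeas_comp mS.1 mG.
    by congr cmeas; apply/funext => t; rewrite GE.
  under eq_integral do rewrite GE.
  rewrite (mpres_integral mS (f := fun t => (nc (G t))%:E)); first by case: iG.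
  by apply/measurable_EFinP; apply: cmeas_nc; case: iG.
have mv : cmeas (fun t => v (pt t)).
  apply: cmeasM; last by have [] := (L2P (K (- z))).1 (K_L2 _).
  have := cmeas_comp mS.1 mu; congr cmeas; apply/funext => t; by rewrite pt_ttrans.
have := gauss_mean ev mv iv.
rewrite (eq_cint leb GE) (mpres_cint mS); last by case: iG.
rewrite -ipE => ->; rewrite /v add0r /rker /dot.
have -> : \sum_j (0 : CV) 0 j * ((- z) 0 j)^*%C = 0.
  by rewrite big1// => j _; rewrite mxE mul0r.
rewrite cexp0 mulr1 mulrCA -cRM mulfV ?mulr1//.
by rewrite expf_neq0// gt_eqF// pi_gt0.
Qed.

End Reproducing.

(** * Borel measurability of continuous functions on tuples *)

Section ContinuousTuple.
Context {R : realType} {d : nat}.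
Local Notation X := (Rtuple R d).

(* A continuous function is the pointwise limit of its values at the lattice points
   below the argument, which are measurable step functions. *)
Lemma measurable_tuple_cont (g : X -> R) :
  (forall t e, 0 < e -> exists2 de, 0 < de &
     forall s : X, (forall i, `|tnth s i - tnth t i : R| < de) -> `|g s - g t| < e) ->
  measurable_fun setT g.
Proof.
move=> gc.
pose fl k (x : R) : int := Num.floor (k.+1%:R * x).
pose q k (t : X) : d.-tuple int := [tuple fl k (tnth t i) | i < d].
pose p k (m : d.-tuple int) : X := [tuple ((tnth m i)%:~R / k.+1%:R : measurableTypeR R) | i < d].
apply: (@measurable_fun_cvg _ _ _ setT (fun k t => g (p k (q k t)))) => [k|t _].
- move=> _ B mB; rewrite setTI.
  have -> : (fun t => g (p k (q k t))) @^-1` B =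
      \bigcup_(m in [set m : d.-tuple int | B (g (p k m))]) [set t | q k t = m].
    apply/seteqP; split => t /=; first by move=> h; exists (q k t).
    by move=> [m Bm /= E]; rewrite E.
  rewrite bigcup_mkcond; apply: countable_bigcupT_measurable; first exact: countableP.
  move=> m; case: ifP => _ //.
  have -> : [set t | q k t = m] = \bigcap_(i in [set: 'I_d]) [set t : X | fl k (tnth t i) = tnth m i].
    apply/seteqP; split => t /=; first by move=> <- i _; rewrite tnth_mktuple.
    by move=> h; apply/eq_from_tnth => i; rewrite tnth_mktuple h.
  rewrite -[X in measurable X]setCK setC_bigcap; apply: measurableC.
  apply: fin_bigcup_measurable; first exact: finite_finset.
  move=> i _; apply: measurableC.
  have -> : [set t : X | fl k (tnth t i) = tnth m i] =
     (fun t : X => k.+1%:R * tnth t i : R) @^-1` `[(tnth m i)%:~R, (tnth m i + 1)%:~R[%classic.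
    apply/seteqP; split => t /=; rewrite in_itv/=.
      by move=> <-; exact: floor_itv.
    by move=> h; apply: floor_def.
  rewrite -[X in measurable X]setTI.
  have mi : measurable_fun setT (fun t : X => k.+1%:R * tnth t i : R).
    by apply: measurable_funM => //; exact: measurable_tnth.
  by apply: mi => //; exact: measurable_itv.
- apply/cvgrPdist_lt => e e0; have [de de0 H] := gc t e e0.
  near=> k; rewrite distrC; apply: H => i; rewrite !tnth_mktuple.
  have k0 : 0 < k.+1%:R :> R by [].
  have -> : (fl k (tnth t i))%:~R / k.+1%:R - tnth t i =
      ((fl k (tnth t i))%:~R - k.+1%:R * tnth t i) / k.+1%:R :> R.
    by field; rewrite gt_eqF.
  rewrite normrM normfV (@ger0_norm R k.+1%:R)// ltr_pdivrMr//.
  apply: (@le_lt_trans _ _ 1).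
    have := floor_itv (k.+1%:R * tnth t i : R); rewrite -/(fl k (tnth t i)) intrD => /andP[h1 h2].
    by rewrite ler_norml; apply/andP; split; lra.
  rewrite -ltr_pdivrMr// div1r; near: k.
  exact: (near_infty_natSinv_lt (PosNum de0)).
Unshelve. all: by end_near. Qed.

End ContinuousTuple.

(** * Inner product spaces *)

Lemma le0_eps (R : realType) (x C : R) : (forall e, 0 < e -> x <= C * e) -> x <= 0.
Proof.
move=> h; apply/ler_addgt0Pr => e e0; rewrite add0r.
pose c := `|C| + 1; have c0 : 0 < c by rewrite ltr_pwDr.
apply: (le_trans (h (e / c) (divr_gt0 e0 c0))).
rewrite mulrCA ger_pMr// ler_pdivrMr// mul1r /c (le_trans (ler_norm C))// lerDl//.
Qed.

Section PreHilbert.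
Context {R : realType} {V : lmodType R[i]}.
Variables (H : set V) (ip : V -> V -> R[i]).
Local Open Scope complex_scope.
Local Notation hnorm := (hnorm ip).

(** Only semidefiniteness is included, and [definite] is kept apart: square-integrable functions are
    not identified almost everywhere, so [L2] satisfies the former but not the latter, whereas [F2]
    satisfies both. *)
Record prehilbert : Prop := PreHilbert {
  ph0 : H 0;
  phL : forall (a : R[i]) u v, H u -> H v -> H (a *: u + v);
  phl : forall (a : R[i]) u v w, H u -> H v -> H w -> ip (a *: u + v) w = a * ip u w + ip v w;
  phJ : forall u v, H u -> H v -> ip u v = (ip v u)^*%C;
  ph_ge0 : forall u, H u -> 0 <= complex.Re (ip u u) }.

Definition definite := forall u, H u -> complex.Re (ip u u) = 0 -> u = 0.

Hypothesis HP : prehilbert.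

Definition sqnorm u : R := complex.Re (ip u u).
Local Notation sq := sqnorm.

Lemma phD u v : H u -> H v -> H (u + v).
Proof. by move=> Hu Hv; rewrite -[u]scale1r; exact: phL. Qed.
Lemma phZ (a : R[i]) u : H u -> H (a *: u).
Proof. by move=> Hu; rewrite -[_ *: _]addr0; apply: phL => //; exact: ph0. Qed.
Lemma phN u : H u -> H (- u).
Proof. by move=> Hu; rewrite -scaleN1r; exact: phZ. Qed.
Lemma phB u v : H u -> H v -> H (u - v).
Proof. by move=> Hu Hv; apply: phD => //; exact: phN. Qed.
Lemma ph_sum (I : Type) (r : seq I) (F : I -> V) :
  (forall i, H (F i)) -> H (\sum_(i <- r) F i).
Proof. by move=> HF; elim/big_ind : _ => //; [exact: ph0|exact: phD]. Qed.

Lemma ip_Dl u v w : H u -> H v -> H w -> ip (u + v) w = ip u w + ip v w.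
Proof. by move=> *; rewrite -[u]scale1r phl// mul1r scale1r. Qed.
Lemma ip_0l w : H w -> ip 0 w = 0.
Proof.
move=> Hw; have := ip_Dl (ph0 HP) (ph0 HP) Hw; rewrite addr0 => /esym/eqP.
by rewrite -subr_eq0 addrK => /eqP.
Qed.
Lemma ip_Zl (a : R[i]) u w : H u -> H w -> ip (a *: u) w = a * ip u w.
Proof. by move=> Hu Hw; rewrite -[_ *: _]addr0 phl//; [rewrite ip_0l// addr0|exact: ph0]. Qed.
Lemma ip_Nl u w : H u -> H w -> ip (- u) w = - ip u w.
Proof. by move=> Hu Hw; rewrite -scaleN1r ip_Zl// mulN1r. Qed.
Lemma ip_Bl u v w : H u -> H v -> H w -> ip (u - v) w = ip u w - ip v w.
Proof. by move=> Hu Hv Hw; rewrite ip_Dl// ?ip_Nl//; exact: phN. Qed.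
Lemma ip_Dr u v w : H u -> H v -> H w -> ip w (u + v) = ip w u + ip w v.
Proof.
move=> Hu Hv Hw; rewrite (phJ HP)//; last exact: phD.
by rewrite ip_Dl// cJD -!(phJ HP).
Qed.
Lemma ip_Zr (a : R[i]) u w : H u -> H w -> ip w (a *: u) = a^*%C * ip w u.
Proof.
move=> Hu Hw; rewrite (phJ HP)//; last exact: phZ.
by rewrite ip_Zl// cJM -(phJ HP).
Qed.
Lemma ip_0r w : H w -> ip w 0 = 0.
Proof. by move=> Hw; rewrite (phJ HP)//; [rewrite ip_0l// conjc0|exact: ph0]. Qed.
Lemma ip_Br u v w : H u -> H v -> H w -> ip w (u - v) = ip w u - ip w v.
Proof.
move=> Hu Hv Hw; rewrite (phJ HP)//; last exact: phB.
by rewrite ip_Bl// cJD cJN -!(phJ HP).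
Qed.
Lemma ip_suml (I : Type) (r : seq I) (F : I -> V) w : (forall i, H (F i)) -> H w ->
  ip (\sum_(i <- r) F i) w = \sum_(i <- r) ip (F i) w.
Proof.
move=> HF Hw; elim: r => [|i r IH]; first by rewrite !big_nil ip_0l.
by rewrite !big_cons ip_Dl ?IH//; exact: ph_sum.
Qed.
Lemma ip_sumr (I : Type) (r : seq I) (F : I -> V) w : (forall i, H (F i)) -> H w ->
  ip w (\sum_(i <- r) F i) = \sum_(i <- r) ip w (F i).
Proof.
move=> HF Hw; elim: r => [|i r IH]; first by rewrite !big_nil ip_0r.
by rewrite !big_cons ip_Dr ?IH//; exact: ph_sum.
Qed.

Lemma ipuu u : H u -> ip u u = (sq u)%:C.
Proof.
move=> Hu; apply: eq_creim => //=.
have := phJ HP Hu Hu => /(congr1 (@complex.Im R)); rewrite cImJ; lra.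
Qed.

Lemma sq_ge0 u : H u -> 0 <= sq u. Proof. exact: ph_ge0. Qed.

Lemma sqD u v : H u -> H v -> sq (u + v) = sq u + sq v + 2 * complex.Re (ip u v).
Proof.
move=> Hu Hv; have Huv := phD Hu Hv.
rewrite /sqnorm ip_Dl// !ip_Dr// !cReD.
have -> : complex.Re (ip v u) = complex.Re (ip u v) by rewrite (phJ HP Hv Hu) cReJ.
ring.
Qed.

Lemma sqN u : H u -> sq (- u) = sq u.
Proof. by move=> Hu; rewrite /sqnorm -scaleN1r ip_Zl ?ip_Zr//; [rewrite cJN conjc1 mulrA mulrNN !mul1r|exact: phZ]. Qed.

Lemma sqZ (a : R[i]) u : H u -> sq (a *: u) = nc a ^+ 2 * sq u.
Proof.
move=> Hu; rewrite /sqnorm ip_Zl ?ip_Zr//; last exact: phZ.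
by rewrite mulrA mulcJ ipuu// -cRM.
Qed.

Lemma sqB u v : H u -> H v -> sq (u - v) = sq u + sq v - 2 * complex.Re (ip u v).
Proof.
move=> Hu Hv; rewrite sqD ?sqN//; last exact: phN.
rewrite -[- v]scaleN1r ip_Zr// cJN conjc1 mulN1r cReN; ring.
Qed.

Lemma hnorm_ge0 u : 0 <= hnorm u. Proof. exact: sqrtr_ge0. Qed.

Lemma hnorm_sqr u : H u -> hnorm u ^+ 2 = sq u.
Proof. by move=> Hu; rewrite sqr_sqrtr// sq_ge0. Qed.

Lemma hnorm_le u (c : R) : H u -> 0 <= c -> sq u <= c ^+ 2 -> hnorm u <= c.
Proof. by move=> Hu c0 uc; rewrite -(ler_pXn2r (n := 2))// ?nnegrE ?hnorm_ge0// hnorm_sqr. Qed.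

Lemma sq_le u (c : R) : H u -> hnorm u <= c -> sq u <= c ^+ 2.
Proof. by move=> Hu uc; rewrite -hnorm_sqr// ler_pXn2r ?nnegrE ?hnorm_ge0// (le_trans (hnorm_ge0 u)). Qed.

(** Expand the squared norm of u - r <u, v> v for every real r. If v has norm zero, letting r grow
    forces <u, v> = 0, so definiteness does not enter. *)
Lemma cauchy_schwarz u v : H u -> H v -> nc (ip u v) <= hnorm u * hnorm v.
Proof.
move=> Hu Hv; rewrite -(ler_pXn2r (n := 2))// ?nnegrE ?nc_ge0 ?mulr_ge0 ?hnorm_ge0//.
rewrite exprMn !hnorm_sqr//.
set A := nc _ ^+ 2; have A0 : 0 <= A by exact: sqr_ge0.
have key (r : R) : 2 * r * A <= sq u + r ^+ 2 * A * sq v.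
  have := sq_ge0 (phB Hu (phZ (r%:C * ip u v) Hv)).
  rewrite sqB//; last exact: phZ.
  rewrite sqZ// ip_Zr// cJM cJR -mulrA [_^*%C * _]mulrC mulcJ -cRM/= ncM ncR exprMn real_normK ?num_real//.
  rewrite -/A; lra.
have [v0|v0] := eqVneq (sq v) 0.
  rewrite v0 mulr0; apply: (@le0_eps _ _ (sq u / 2)) => e e0.
  have := key e^-1; rewrite v0 mulr0 addr0 mulrAC => h.
  by move: h; rewrite ler_pdivrMr//; lra.
have vp : 0 < sq v by rewrite lt_neqAle eq_sym v0 sq_ge0.
have := key (sq v)^-1.
have -> : (sq v)^-1 ^+ 2 * A * sq v = A / sq v by field.
have -> : 2 / sq v * A = 2 * (A / sq v) by ring.
by move=> h; rewrite -ler_pdivrMr//; lra.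
Qed.

Lemma phnD u v : H u -> H v -> hnorm (u + v) <= hnorm u + hnorm v.
Proof.
move=> Hu Hv; apply: hnorm_le; [exact: phD|by rewrite addr_ge0 ?hnorm_ge0|].
rewrite sqD// sqrrD !hnorm_sqr//.
have := cauchy_schwarz Hu Hv; have := nc_Re (ip u v); have := ler_norm (complex.Re (ip u v)).
rewrite -mulr_natl; lra.
Qed.

Lemma phnZ (a : R[i]) u : H u -> hnorm (a *: u) = nc a * hnorm u.
Proof. by move=> Hu; rewrite /Defs.hnorm -/(sq _) sqZ// sqrtrM ?sqr_ge0// sqrtr_sqr ger0_norm ?nc_ge0. Qed.

Lemma phnN u : H u -> hnorm (- u) = hnorm u.
Proof. by move=> Hu; rewrite /Defs.hnorm -!/(sq _) sqN. Qed.

Lemma phnB u v : H u -> H v -> hnorm (u - v) <= hnorm u + hnorm v.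
Proof. by move=> Hu Hv; rewrite -(phnN Hv); apply: phnD => //; exact: phN. Qed.

Lemma hnorm_eq0 u : definite -> H u -> hnorm u <= 0 -> u = 0.
Proof.
move=> HD Hu u0; apply: HD => //; apply/eqP; rewrite eq_le (sq_ge0 Hu) andbT.
by have := sq_le Hu u0; rewrite expr0n.
Qed.

Lemma phn0 : hnorm 0 = 0.
Proof. by rewrite /Defs.hnorm ip_0l ?sqrtr0//; exact: ph0. Qed.

Definition orthofam (N : nat) (b : nat -> V) := forall j k, (j < N)%N -> (k < N)%N ->
  ip (b j) (b k) = (j == k)%:R.

Definition oproj (N : nat) (b : nat -> V) u := \sum_(k < N) ip u (b k) *: b k.

Section OrthonormalFamily.
Variables (N : nat) (b : nat -> V).
Hypotheses (Hb : forall k, H (b k)) (onb : orthofam N b).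

Lemma proj_H u : H (oproj N b u).
Proof. by apply: ph_sum => k; exact: phZ. Qed.

Lemma ip_lin_b (c : 'I_N -> R[i]) (k : 'I_N) : ip (\sum_(j < N) c j *: b j) (b k) = c k.
Proof.
rewrite ip_suml//; last by move=> j; exact: phZ.
rewrite (bigD1 k)//= ip_Zl// onb// eqxx mulr1 big1 ?addr0// => j jk.
by rewrite ip_Zl// onb// -(inj_eq val_inj) in jk *; rewrite (negbTE jk) mulr0.
Qed.

Lemma sq_lin (c : 'I_N -> R[i]) : sq (\sum_(j < N) c j *: b j) = \sum_(j < N) nc (c j) ^+ 2.
Proof.
have Hs : H (\sum_(j < N) c j *: b j) by apply: ph_sum => k; exact: phZ.
rewrite /sqnorm ip_sumr//; last by move=> j; exact: phZ.
by rewrite cRe_sum; apply: eq_bigr => j _; rewrite ip_Zr// ip_lin_b mulrC mulcJ.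
Qed.

Lemma sq_proj u : sq (oproj N b u) = \sum_(k < N) nc (ip u (b k)) ^+ 2.
Proof. exact: sq_lin. Qed.

Lemma proj_orth u k : H u -> (k < N)%N -> ip (u - oproj N b u) (b k) = 0.
Proof.
move=> Hu kN; rewrite ip_Bl//; last exact: proj_H.
by rewrite /oproj (ip_lin_b (fun k : 'I_N => ip u (b k)) (Ordinal kN)) subrr.
Qed.

Lemma sq_proj_compl u : H u -> sq (u - oproj N b u) = sq u - \sum_(k < N) nc (ip u (b k)) ^+ 2.
Proof.
move=> Hu; have Hp := proj_H u.
rewrite sqB// sq_proj.
have -> : complex.Re (ip u (oproj N b u)) = \sum_(k < N) nc (ip u (b k)) ^+ 2.
  rewrite /oproj ip_sumr//; last by move=> k; exact: phZ.
  by rewrite cRe_sum; apply: eq_bigr => k _; rewrite ip_Zr// mulrC mulcJ.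
ring.
Qed.

Lemma bessel u : H u -> \sum_(k < N) nc (ip u (b k)) ^+ 2 <= sq u.
Proof. by move=> Hu; rewrite -subr_ge0 -sq_proj_compl//; apply: sq_ge0; apply: phB => //; exact: proj_H. Qed.

Lemma hnorm_proj u : H u -> hnorm (oproj N b u) <= hnorm u.
Proof.
move=> Hu; apply: hnorm_le; [exact: proj_H|exact: hnorm_ge0|].
by rewrite sq_proj hnorm_sqr// bessel.
Qed.

Lemma hnorm_proj_compl u : H u -> hnorm (u - oproj N b u) <= hnorm u.
Proof.
move=> Hu; apply: hnorm_le; [by apply: phB => //; exact: proj_H|exact: hnorm_ge0|].
rewrite sq_proj_compl// hnorm_sqr// lerBlDr lerDl.
by apply: sumr_ge0 => k _; exact: sqr_ge0.
Qed.

Lemma projDZ (a : R[i]) u v : H u -> H v -> oproj N b (a *: u + v) = a *: oproj N b u + oproj N b v.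
Proof.
move=> Hu Hv; rewrite /oproj scaler_sumr -big_split/=; apply: eq_bigr => k _.
by rewrite (phl HP)// scalerDl scalerA.
Qed.

End OrthonormalFamily.

(** More unknowns than equations: the left kernel of [A] is not trivial. This dimension count gives
    both the uniqueness of dimensions and the comparison of singular counts. *)
Lemma exists_orth (N N1 : nat) (M : 'I_N -> 'I_N1 -> R[i]) : (N1 < N)%N ->
  exists c : 'I_N -> R[i], (exists k, c k != 0) /\ forall j, \sum_k c k * M k j = 0.
Proof.
move=> NN; pose A := \matrix_(k < N, j < N1) M k j.
have : kermx A != 0.
  rewrite kermx_eq0 /row_free neq_ltn; apply/orP; left.
  exact: leq_ltn_trans (rank_leq_col A) NN.
case/rowV0Pn => v /sub_kermxP vA v0.
exists (fun k => v 0 k); split.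
  have [k vk] := rV0Pn _ v0; by exists k.
move=> j; have : (v *m A) 0 j = 0 by rewrite vA mxE.
by rewrite mxE => E; rewrite -[RHS]E; apply: eq_bigr => k _; rewrite mxE.
Qed.

Lemma has_dim_leq (E : set V) d d' : has_dim E d -> has_dim E d' -> (d' <= d)%N.
Proof.
move=> [e [eE _]] [e' [eE' ind']]; rewrite leqNgt; apply/negP => dd.
have Ee' j : E (e' j).
  apply/eE'; exists (fun i => (i == j)%:R).
  rewrite (bigD1 j)//= eqxx scale1r big1 ?addr0// => i ij.
  by rewrite (negbTE ij) scale0r.
have /choice[M HM] : forall j, exists c : 'I_d -> R[i], e' j = \sum_i c i *: e i.
  by move=> j; exact: (eE (e' j)).1.
have [c [[k ck] Hc]] := exists_orth M dd.
have : \sum_j c j *: e' j = 0.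
  transitivity (\sum_i (\sum_j c j * M j i) *: e i).
    under eq_bigr do rewrite HM scaler_sumr.
    rewrite exchange_big/=; apply: eq_bigr => i _.
    by rewrite scaler_suml; apply: eq_bigr => j _; rewrite scalerA.
  by rewrite big1// => i _; rewrite Hc scale0r.
by move=> /ind'/(_ k) /eqP; rewrite (negbTE ck).
Qed.

Lemma has_dim_inj (E : set V) d d' : has_dim E d -> has_dim E d' -> d = d'.
Proof. by move=> h h'; apply/eqP; rewrite eqn_leq (has_dim_leq h h') (has_dim_leq h' h). Qed.

(** At a first index [k] with s2 k < s1 k, the indices where s2 takes the value s1 k all lie below
    [k], hence are shared by s1, which also takes this value at [k]. The two multiplicities then
    differ, although both are the dimension of the same eigenspace. *)
Lemma singular_values_unique (A : V -> V) s s' :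
  is_singular_values H ip A s -> is_singular_values H ip A s' -> s = s'.
Proof.
have key s1 s2 : is_singular_values H ip A s1 -> is_singular_values H ip A s2 ->
    forall k, (forall j, (j < k)%N -> s1 j = s2 j) -> s1 k <= s2 k.
  move=> [p1 n1 d1] [p2 n2 d2] k E; rewrite leNgt; apply/negP => lt.
  have t0 : 0 < s1 k by exact: le_lt_trans (p2 k) lt.
  have [f1 h1] := d1 _ t0; have [f2 h2] := d2 _ t0.
  have := has_dim_inj h1 h2.
  suff : (#|` fset_set [set j | s2 j = s1 k]| < #|` fset_set [set j | s1 j = s1 k]|)%N.
    by move=> + e; rewrite e ltnn.
  apply: fproper_ltn_card; rewrite fproperEneq; apply/andP; split; last first.
    apply/fsubsetP => j; rewrite !in_fset_set// !inE/= => s2j.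
    have jk : (j < k)%N.
      by rewrite ltnNge; apply/negP => kj; have := n2 _ _ kj; rewrite s2j leNgt lt.
    by rewrite E.
  apply/eqP => /(congr1 (fun F => k \in F)); rewrite !in_fset_set//.
  have -> : (k \in [set j | s1 j = s1 k]) by rewrite inE.
  by move=> /set_mem/= e; move: lt; rewrite e ltxx.
move=> h h'; apply/funext => k; elim/ltn_ind : k => k IH.
by apply/eqP; rewrite eq_le (key _ _ h h')// (key _ _ h' h)// => j jk; rewrite IH.
Qed.

End PreHilbert.

(** * Singular values of compact operators *)

Section Schmidt.
Context {R : realType} {V : lmodType R[i]}.
Variables (H : set V) (ip : V -> V -> R[i]).
Local Open Scope complex_scope.
Local Notation hnorm := (hnorm ip).
Local Notation sq := (sqnorm ip).
Hypotheses (HP : prehilbert H ip) (HD : definite H ip).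

(** [adjoint] is defined by choice and says nothing until an adjoint is known to exist, so an
    explicit candidate [T'] is carried along; [adjointE] identifies the two. *)
Record bounded_pair (T T' : V -> V) (B : R) : Prop := BoundedPair {
  bp_compact : compact_operator H ip T;
  bp_H : forall u, H u -> H (T' u);
  bp_lin : forall (a : R[i]) u v, H u -> H v -> T' (a *: u + v) = a *: T' u + T' v;
  bp_adj : forall u v, H u -> H v -> ip (T u) v = ip u (T' v);
  bp_B : 0 <= B;
  bp_le : forall u, H u -> hnorm (T u) <= B * hnorm u }.

Section Operator.
Variables (T T' : V -> V) (B : R).
Hypothesis TP : bounded_pair T T' B.

Let TH u : H u -> H (T u). Proof. by have [h _ _] := bp_compact TP; exact: h. Qed.
Let TL (a : R[i]) u v : H u -> H v -> T (a *: u + v) = a *: T u + T v.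
Proof. by have [_ h _] := bp_compact TP; exact: h. Qed.
Let T'H u : H u -> H (T' u). Proof. exact: (bp_H TP). Qed.

Lemma lin_0 (S : V -> V) : (forall (a : R[i]) u v, H u -> H v -> S (a *: u + v) = a *: S u + S v) -> S 0 = 0.
Proof.
move=> SL; have := SL (-1) 0 0 (ph0 HP) (ph0 HP).
by rewrite scaler0 addr0 scaleN1r addNr.
Qed.
Lemma lin_Z (S : V -> V) : (forall (a : R[i]) u v, H u -> H v -> S (a *: u + v) = a *: S u + S v) ->
  forall (a : R[i]) u, H u -> S (a *: u) = a *: S u.
Proof.
by move=> SL a u Hu; rewrite -[a *: u]addr0 SL//; [rewrite lin_0// addr0|exact: (ph0 HP)].
Qed.
Lemma lin_B (S : V -> V) : (forall (a : R[i]) u v, H u -> H v -> S (a *: u + v) = a *: S u + S v) ->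
  forall u v, H u -> H v -> S (u - v) = S u - S v.
Proof. by move=> SL u v Hu Hv; rewrite addrC -scaleN1r SL// scaleN1r addrC. Qed.
Lemma lin_sum (S : V -> V) : (forall (a : R[i]) u v, H u -> H v -> S (a *: u + v) = a *: S u + S v) ->
  forall N (c : 'I_N -> R[i]) (b : nat -> V), (forall k, H (b k)) ->
  S (\sum_(k < N) c k *: b k) = \sum_(k < N) c k *: S (b k).
Proof.
move=> SL N c b Hb; elim: N c => [|N IH] c; first by rewrite !big_ord0 lin_0.
rewrite !big_ord_recr/= addrC SL//; first by rewrite IH addrC.
by apply: (ph_sum HP) => // k; exact: (phZ HP).
Qed.

Let T'L := bp_lin TP.
Let B0 := bp_B TP.

Lemma adj' u v : H u -> H v -> ip (T' u) v = ip u (T v).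
Proof. by move=> Hu Hv; rewrite (phJ HP)//; [rewrite -(bp_adj TP)// -(phJ HP)//; exact: TH|exact: T'H]. Qed.

Lemma le_T' u : H u -> hnorm (T' u) <= B * hnorm u.
Proof.
move=> Hu; have Hu' := T'H Hu.
have [h0|h0] := ltP 0 (hnorm (T' u)); last by rewrite (le_trans h0)// mulr_ge0// hnorm_ge0.
rewrite -(ler_pM2l h0) -expr2 (hnorm_sqr HP)//.
have -> : sq (T' u) = complex.Re (ip u (T (T' u))) by rewrite /Defs.hnorm /sqnorm adj'.
apply: (le_trans (ler_norm _)); apply: (le_trans (nc_Re _)).
apply: (le_trans (cauchy_schwarz HP Hu (TH Hu'))).
by rewrite mulrC mulrCA mulrA ler_wpM2r ?hnorm_ge0// (bp_le TP).
Qed.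

Lemma adjointE v : H v -> adjoint H ip T v = T' v.
Proof.
move=> Hv; apply: (@xget_unique _ 0 [set w | H w /\ forall u, H u -> ip (T u) v = ip u w]) => /=.
  by split; [exact: T'H|move=> u Hu; exact: bp_adj TP _ _ _ _].
move=> w [Hw hw]; have HB := phB HP Hw (T'H Hv).
apply/eqP; rewrite -subr_eq0; apply/eqP; apply: HD => //.
by rewrite (ip_Br HP)//; [rewrite -hw// -(bp_adj TP)// subrr|exact: T'H].
Qed.

Definition orth (l : seq V) u := forall y, y \in l -> ip u y = 0.

Definition eigs (l : seq V) := forall y, y \in l -> H y /\ exists c : R[i], T' (T y) = c *: y.

(** The self-adjoint operator T'T preserves the orthogonal complement of its eigenvectors, so the
    maximisation can be repeated there. *)
Lemma orth_A l u : eigs l -> H u -> orth l u -> orth l (T' (T u)).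
Proof.
move=> El Hu ou y yl; have [Hy [c Ec]] := El y yl.
by rewrite adj' ?(bp_adj TP)//; [rewrite Ec (ip_Zr HP)// ou// mulr0|exact: TH|exact: TH].
Qed.

(* [p] is the next pair of singular value and right singular vector after [l]; the vector is
   [0] once the singular values vanish. *)
Definition maximiser l (p : R * V) : Prop :=
  [/\ 0 <= p.1, H p.2, orth l p.2 & T' (T p.2) = (p.1 ^+ 2)%:C *: p.2] /\
  [/\ 0 < p.1 -> sq p.2 = 1, p.1 = 0 -> p.2 = 0 &
   forall u, H u -> orth l u -> hnorm (T u) <= p.1 * hnorm u].

(* A sequence in the unit ball maximising [|T u|] nearly satisfies the eigenvalue equation
   [T^* T u = s^2 u]; compactness of [T] yields a convergent subsequence. *)
Lemma exists_maximiser l : eigs l -> exists p, maximiser l p.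
Proof.
move=> El.
pose S := [set sq (T u) | u in [set u | [/\ H u, orth l u & sq u <= 1]]].
have o0 : orth l 0 by move=> y yl; have [Hy _] := El y yl; rewrite (ip_0l HP).
have sq0 : sq 0 = 0 by rewrite /sqnorm (ip_0l HP)//; exact: (ph0 HP).
have T0 : T 0 = 0 := lin_0 TL.
have S0 : S 0.
  by exists 0; [split; [exact: (ph0 HP)|exact: o0|rewrite sq0]|rewrite T0 sq0].
have supS : has_sup S.
  split; first by exists 0.
  exists (B ^+ 2) => _ [u [Hu _ u1] <-].
  apply: (sq_le HP); [exact: TH|apply: (le_trans (bp_le TP Hu))].
  by rewrite ler_piMr//; apply: (hnorm_le HP) => //; rewrite expr1n.
pose M := sup S.
have MS u : H u -> orth l u -> sq u <= 1 -> sq (T u) <= M.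
  by move=> Hu ou u1; apply: sup_upper_bound => //; exists u.
have M0 : 0 <= M by apply: sup_upper_bound.
pose s := Num.sqrt M.
have s2 : s ^+ 2 = M by rewrite sqr_sqrtr.
have s0 : 0 <= s by exact: sqrtr_ge0.
have Tle u : H u -> orth l u -> hnorm (T u) <= s * hnorm u.
  move=> Hu ou; have [h0|h0] := leP (hnorm u) 0.
    rewrite (hnorm_eq0 HP HD Hu h0) T0 (phn0 HP) mulr0//.
  pose c : R[i] := ((hnorm u)^-1)%:C.
  have Hc := phZ HP c Hu.
  have nc_c : nc c = (hnorm u)^-1 by rewrite ncR ger0_norm// invr_ge0 ltW.
  have oc : orth l (c *: u) by move=> y yl; have [Hy _] := El y yl; rewrite (ip_Zl HP)// ou// mulr0.
  have := MS _ Hc oc.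
  rewrite (lin_Z TL)// !(sqZ HP)//; last exact: TH.
  rewrite nc_c -!(hnorm_sqr HP)//; last exact: TH.
  rewrite -exprMn mulVf ?gt_eqF// expr1n => /(_ (lexx _)).
  rewrite -s2 -exprMn ler_pXn2r ?nnegrE ?mulr_ge0 ?invr_ge0 ?hnorm_ge0//.
  by rewrite mulrC ler_pdivrMr.
(* If [T] vanishes on the complement, the pair (0, 0) lets the construction continue with singular
   value 0. *)
have [M_0|Mn0] := eqVneq M 0.
  have s_0 : s = 0 by rewrite /s M_0 sqrtr0.
  exists (0, 0); split; split => //=.
  - exact: (ph0 HP).
  - by rewrite T0 (lin_0 T'L) scaler0.
  - by rewrite ltxx.
  - by move=> u Hu ou; rewrite -[X in X * _]s_0 Tle.
have Mp : 0 < M by rewrite lt_neqAle eq_sym Mn0.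
have /choice[u Hu] : forall k : nat, exists v, [/\ H v, orth l v, sq v <= 1 & M - k.+1%:R^-1 < sq (T v)].
  move=> k.
  have k0 : 0 < k.+1%:R^-1 :> R by rewrite invr_gt0.
  by have [_ [v [Hv ov v1] <-] lt] := sup_adherent k0 supS; exists v.
(* Expand the square: |T'T w|^2 <= M^2, because both [w] and [T' (T w)] lie in the complement, where
   |T| is at most s; then |M w|^2 <= M^2 and the cross term is -2 M |T w|^2. *)
have Au w : H w -> orth l w -> sq w <= 1 -> sq (T' (T w) - M%:C *: w) <= 2 * M * (M - sq (T w)).
  move=> Hw ow w1; have HTw := TH Hw; have HA := T'H HTw; have HM := phZ HP (M%:C) Hw.
  rewrite (sqB HP)// (sqZ HP)// (ip_Zr HP)// adj'// conjc_real (ipuu HP)// -cRM/= ncR (ger0_norm M0).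
  have oA := orth_A El Hw ow.
  have : hnorm (T' (T w)) <= M * hnorm w.
    have [h0|h0] := ltP 0 (hnorm (T' (T w))); last by rewrite (le_trans h0)// mulr_ge0// hnorm_ge0.
    rewrite -(ler_pM2l h0) -expr2 (hnorm_sqr HP)//.
    have -> : sq (T' (T w)) = complex.Re (ip (T w) (T (T' (T w)))) by rewrite /sqnorm adj'.
    apply: (le_trans (ler_norm _)); apply: (le_trans (nc_Re _)).
    apply: (le_trans (cauchy_schwarz HP HTw (TH HA))).
    apply: (le_trans (ler_pM _ _ (Tle _ Hw ow) (Tle _ HA oA))); rewrite ?hnorm_ge0//.
    by rewrite le_eqVlt; apply/orP; left; apply/eqP; rewrite -s2; ring.
  move=> /(sq_le HP HA); rewrite exprMn (hnorm_sqr HP)// => h.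
  have := ler_wpM2l (sqr_ge0 M) w1; nra.
have [_ _ cT] := bp_compact TP.
have [|h [v [hh Hv Tv]]] := cT u (fun k => let: And4 a _ _ _ := Hu k in a).
  by exists 1 => k; have [Hk _ k1 _] := Hu k; apply: (hnorm_le HP) => //; rewrite expr1n.
(* Along the subsequence T'T w is close to M w while T w tends to [v], so w itself must approach
   M^-1 T' v. *)
pose psi := (M^-1)%:C *: T' v.
have Hpsi : H psi by apply: (phZ HP); exact: T'H.
have approx e : 0 < e -> exists w, [/\ H w, orth l w, sq w <= 1 & M - e < sq (T w)] /\
    (hnorm (T' (T w) - M%:C *: w) <= e /\ hnorm (T w - v) < e).
  move=> e0; have d0 : 0 < Num.min e (e ^+ 2 / (2 * M)).
    by rewrite lt_min e0 divr_gt0// ?exprn_gt0// mulr_gt0.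
  near \oo => k; exists (u (h k)).
  have [Hk ok k1 kM] := Hu (h k).
  have hk : (h k).+1%:R^-1 < Num.min e (e ^+ 2 / (2 * M)).
    apply: (@le_lt_trans _ _ (k.+1%:R^-1)).
      rewrite lef_pV2 ?posrE// ler_nat ltnS; elim: (k) => // j IH.
      by apply: (leq_ltn_trans IH); apply: hh.
    near: k; exact: (near_infty_natSinv_lt (PosNum d0)).
  move: hk; rewrite lt_min => /andP[h1 h2].
  move: kM h1 h2; set d := (h k).+1%:R^-1 => kM h1 h2.
  split; first by split => //; lra.
  split; last first.
    have : `|0 - hnorm (T (u (h k)) - v)| < e by near: k; move/cvgrPdist_lt: Tv; exact.
    by rewrite sub0r normrN ger0_norm// hnorm_ge0.
  apply: (hnorm_le HP); [|exact: ltW|].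
    by apply: (phB HP); [exact/T'H/TH|exact: (phZ HP)].
  apply: (le_trans (Au _ Hk ok k1)).
  move: h2; rewrite ltr_pdivlMr ?mulr_gt0// => h2.
  have : 2 * M * (M - sq (T (u (h k)))) <= 2 * M * d.
    by apply: ler_wpM2l; [rewrite mulr_ge0|lra].
  lra.
pose C := (1 + B) / M; have C0 : 0 <= C by rewrite divr_ge0// addr_ge0.
have close w e : H w -> hnorm (T' (T w) - M%:C *: w) <= e -> hnorm (T w - v) < e -> hnorm (w - psi) <= C * e.
  move=> Hw h1 h2; have HTw := TH Hw; have HTv := phB HP HTw Hv.
  have HA : H (T' (T w) - M%:C *: w) by apply: (phB HP); [exact: T'H|exact: (phZ HP)].
  have -> : w - psi = (M^-1)%:C *: (T' (T w - v) - (T' (T w) - M%:C *: w)).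
    rewrite (lin_B T'L)// opprB [in RHS]addrC subrKA scalerBr scalerA -cRM mulVf ?gt_eqF//.
    by rewrite scale1r.
  rewrite (phnZ HP); last by apply: (phB HP) => //; exact: T'H.
  rewrite ncR ger0_norm ?invr_ge0// /C mulrAC mulrC ler_pM2r ?invr_gt0//.
  have h3 := phnB HP (T'H HTv) HA; have h4 := le_T' HTv.
  have h5 : B * hnorm (T w - v) <= B * e by rewrite ler_wpM2l// ltW.
  lra.
(* At most 1, being close to vectors of the unit ball; at least 1, because M - e < |T w|^2 <= M
   |w|^2 forces |w|^2 >= 1 - e / M. *)
have hpsi : hnorm psi = 1.
  apply/eqP; rewrite eq_le; apply/andP; split; rewrite -subr_le0.
    apply: (@le0_eps _ _ C) => e /approx[w [[Hw ow w1 _] [h1 h2]]].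
    have hw := close w e Hw h1 h2; have Hwp := phB HP Hw Hpsi.
    have : hnorm w <= 1 by apply: (hnorm_le HP) => //; rewrite expr1n.
    have := phnB HP Hw Hwp; rewrite subKr; lra.
  apply: (@le0_eps _ _ (C + M^-1)) => e /approx[w [[Hw ow w1 wM] [h1 h2]]].
  have hw := close w e Hw h1 h2; have Hwp := phB HP Hw Hpsi.
  have w1' : hnorm w <= 1 by apply: (hnorm_le HP) => //; rewrite expr1n.
  have := phnD HP Hwp Hpsi; rewrite subrK.
  have : sq (T w) <= M * sq w.
    by have := sq_le HP (TH Hw) (Tle _ Hw ow); rewrite exprMn s2 (hnorm_sqr HP).
  rewrite -(hnorm_sqr HP Hw) => h3.
  have : 1 - M^-1 * e <= hnorm w ^+ 2.
    have -> : 1 - M^-1 * e = (M - e) / M by field; rewrite gt_eqF.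
    by rewrite ler_pdivrMr//; lra.
  have := hnorm_ge0 ip w; move: w1' hw; clear; nra.
have sqpsi : sq psi = 1 by rewrite -(hnorm_sqr HP)// hpsi expr1n.
have zm (x y a b : V) : a - b = x - y - (x - a - (y - b)).
  by rewrite opprB addrA subrKA opprB addrC subrKA.
exists (s, psi); split; split => //=.
- move=> y yl; have [Hy _] := El y yl.
  have : nc (ip psi y) <= 0.
    apply: (@le0_eps _ _ (C * hnorm y)) => e /approx[w [[Hw ow _ _] [h1 h2]]].
    have -> : ip psi y = - ip (w - psi) y by rewrite (ip_Bl HP)// ow// sub0r opprK.
    rewrite ncN; have Hwp := phB HP Hw Hpsi.
    apply: (le_trans (cauchy_schwarz HP Hwp Hy)).
    by rewrite mulrAC ler_wpM2r ?hnorm_ge0// close.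
  by move=> h0; apply: nc0_eq0; apply/eqP; rewrite eq_le h0 nc_ge0.
- apply/eqP; rewrite -subr_eq0 s2; apply/eqP.
  have HA : H (T' (T psi) - M%:C *: psi) by apply: (phB HP); [exact/T'H/TH|exact: (phZ HP)].
  apply: (hnorm_eq0 HP HD) => //.
  apply: (@le0_eps _ _ (B * B * C + M * C + 1)) => e /approx[w [[Hw ow _ _] [h1 h2]]].
  have Hwp := phB HP Hw Hpsi.
  have HA' : H (T' (T w) - M%:C *: w) by apply: (phB HP); [exact/T'H/TH|exact: (phZ HP)].
  have -> : T' (T psi) - M%:C *: psi = (T' (T w) - M%:C *: w) - (T' (T (w - psi)) - M%:C *: (w - psi)).
    rewrite (lin_B TL)// (lin_B T'L)//; [|exact: TH|exact: TH].
    by rewrite scalerBr; exact: zm.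
  have HT2 := T'H (TH Hwp).
  apply: (le_trans (phnB HP HA' (phB HP HT2 (phZ HP _ Hwp)))).
  have hw := close w e Hw h1 h2.
  have := phnB HP HT2 (phZ HP M%:C Hwp).
  rewrite (phnZ HP)// ncR (ger0_norm M0).
  have := le_T' (TH Hwp); have := bp_le TP Hwp; have := hnorm_ge0 ip (w - psi).
  move: B0 M0 hw h1; clear; nra.
- by move=> s_0; move: Mp; rewrite -s2 s_0 expr0n ltxx.
Unshelve. all: by end_near. Qed.

(** Iterates [exists_maximiser], with the list [L k] of the vectors found so far. The values tend to
    0: if all stayed above t > 0, the images T psi_k would be orthogonal of norm at least t, hence
    at mutual distance at least t, and no subsequence could converge, against compactness. *)
Lemma schmidt_sequence : exists (s : nat -> R) (psi : nat -> V),
  [/\ forall k, 0 <= s k, nonincreasing_seq s & forall t, 0 < t -> exists k, s k < t] /\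
  [/\ forall k, H (psi k),
   forall j k, 0 < s j -> 0 < s k -> ip (psi j) (psi k) = (j == k)%:R,
   forall k, T' (T (psi k)) = (s k ^+ 2)%:C *: psi k &
   forall k u, H u -> (forall j, (j < k)%N -> ip u (psi j) = 0) -> hnorm (T u) <= s k * hnorm u].
Proof.
have /choice[F HF] : forall l, exists p, eigs l -> maximiser l p.
  move=> l; have [El|nE] := pselect (eigs l); last by exists (0, 0) => /nE.
  by have [p hp] := exists_maximiser El; exists p.
pose L := fix L k := if k is k'.+1 then (F (L k')).2 :: L k' else [::].
pose s k := (F (L k)).1; pose psi k := (F (L k)).2.
have EL k : eigs (L k).
  elim: k => [|k IH] y //=; rewrite inE => /orP[/eqP ->|/IH//].
  by have [[_ h _ e] _] := HF _ IH; split => //; eexists; exact: e.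
have LP k y : y \in L k -> exists2 j, (j < k)%N & y = psi j.
  elim: k => [//|k IH] /=; rewrite inE => /orP[/eqP ->|/IH[j jk ->]]; first by exists k.
  by exists j => //; exact: ltnW.
have PL j k : (j < k)%N -> psi j \in L k.
  elim: k => [//|k IH] /=; rewrite ltnS leq_eqVlt inE => /orP[/eqP ->|/IH ->]; rewrite ?eqxx//.
  by rewrite orbT.
have s0 k : 0 <= s k by have [[]] := HF _ (EL k).
have Hpsi k : H (psi k) by have [[]] := HF _ (EL k).
have Apsi k : T' (T (psi k)) = (s k ^+ 2)%:C *: psi k by have [[]] := HF _ (EL k).
have max k u : H u -> (forall j, (j < k)%N -> ip u (psi j) = 0) -> hnorm (T u) <= s k * hnorm u.
  move=> Hu ou; have [_ [_ _ h]] := HF _ (EL k); apply: h => // y /LP[j jk ->]; exact: ou.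
have lt0 j k : (j < k)%N -> ip (psi k) (psi j) = 0.
  by move=> jk; have [[_ _ o _] _] := HF _ (EL k); apply: o; exact: PL.
have sq1 k : 0 < s k -> sq (psi k) = 1 by have [_ []] := HF _ (EL k).
have on j k : 0 < s j -> 0 < s k -> ip (psi j) (psi k) = (j == k)%:R.
  move=> sj sk; have [jk|kj|->] := ltngtP j k.
  - by rewrite (phJ HP)// lt0// conjc0.
  - by rewrite lt0.
  - by rewrite (ipuu HP)// sq1.
have sqT k : 0 < s k -> sq (T (psi k)) = s k ^+ 2.
  move=> sk; rewrite /sqnorm (bp_adj TP)//; last exact: TH.
  by rewrite Apsi (ip_Zr HP)// cJR (ipuu HP)// -cRM/= sq1// mulr1.
have ns : nonincreasing_seq s.
  apply/nonincreasing_seqP => k; have [s1|s1] := leP (s k.+1) 0; first exact: le_trans s1 (s0 k).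
  have := max k (psi k.+1) (Hpsi _) (fun j jk => lt0 j k.+1 (ltnW jk)).
  rewrite -(ler_pXn2r (n := 2)) ?nnegrE ?mulr_ge0 ?hnorm_ge0// exprMn !(hnorm_sqr HP)//; last exact: TH.
  by rewrite sqT// sq1// mulr1 ler_pXn2r// nnegrE.
exists s, psi; split; split => // t t0; apply: contrapT => /forallNP h.
have st k : t <= s k by have /negP := h k; rewrite -leNgt.
have sp k : 0 < s k by exact: lt_le_trans t0 (st k).
have [_ _ cT] := bp_compact TP.
have [|g [v [hg Hv Tv]]] := cT psi Hpsi.
  by exists 1 => k; apply: (hnorm_le HP) => //; rewrite expr1n sq1.
have far j k : j != k -> t ^+ 2 <= sq (T (psi j) - T (psi k)).
  move=> jk; have Tj := TH (Hpsi j); have Tk := TH (Hpsi k).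
  rewrite (sqB HP)// (bp_adj TP)// Apsi (ip_Zr HP)// on// (negbTE jk) mulr0/= mulr0 subr0 !sqT//.
  rewrite -[X in X <= _]addr0 lerD ?sqr_ge0// ler_pXn2r// nnegrE ltW//.
have t2 : 0 < t / 2 by rewrite divr_gt0.
have /cvgrPdist_lt/(_ _ t2)[N _ HN] := Tv.
have n1 := HN N (leqnn _); have n2 := HN N.+1 (leqnSn _).
move: n1 n2; rewrite /= !sub0r !normrN !ger0_norm ?hnorm_ge0// => n1 n2.
have gN : g N != g N.+1 by rewrite neq_ltn hg.
have Ta := TH (Hpsi (g N)); have Tb := TH (Hpsi (g N.+1)).
have : t <= hnorm (T (psi (g N)) - T (psi (g N.+1))).
  rewrite -(ler_pXn2r (n := 2)) ?nnegrE ?(ltW t0) ?hnorm_ge0// (hnorm_sqr HP) ?far//.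
  exact: (phB HP).
have -> : T (psi (g N)) - T (psi (g N.+1)) = (T (psi (g N)) - v) - (T (psi (g N.+1)) - v).
  by rewrite opprB subrKA.
have := phnB HP (phB HP Ta Hv) (phB HP Tb Hv); lra.
Qed.

(** What remains is that the eigenspace of T'T for t^2 is spanned by the psi_k with s_k = t. Let [N]
    be the first index with s_N < t. The part w of an eigenvector orthogonal to the first N vectors
    is again an eigenvector, so |T w| = t |w|, while |T w| <= s_N |w|; hence w = 0. Orthogonality of
    eigenspaces removes the other coefficients. *)
Lemma has_singular_values : exists (s : nat -> R) (psi : nat -> V),
  [/\ singular_value H ip T = s, forall k, 0 <= s k & nonincreasing_seq s] /\
  (forall t, 0 < t -> exists k, s k < t) /\
  [/\ forall k, H (psi k),
   forall j k, 0 < s j -> 0 < s k -> ip (psi j) (psi k) = (j == k)%:R,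
   forall k, T' (T (psi k)) = (s k ^+ 2)%:C *: psi k &
   forall k u, H u -> (forall j, (j < k)%N -> ip u (psi j) = 0) -> hnorm (T u) <= s k * hnorm u].
Proof.
have [s [psi [[s0 ns s_0] [Hpsi on Apsi max]]]] := schmidt_sequence.
exists s, psi; split; last by [].
split => //; suff h : is_singular_values H ip T s.
  by apply: (singular_values_unique _ h); exact: (xgetPex (fun=> 0) (ex_intro _ s h)).
split => // t t0; have [N sN sb] : exists2 N, s N < t & forall k, (k < N)%N -> t <= s k.
  have := s_0 t t0 => ex; exists (ex_minn ex); case: ex_minnP => // N sN mN k kN.
  by rewrite leNgt; apply/negP => /mN; rewrite leqNgt kN.
pose l := [seq k <- iota 0 N | s k == t].
have lE k : (k \in l) = (s k == t).
  rewrite mem_filter mem_iota add0n andb_idr// => /eqP st; rewrite ltnNge; apply/negP => Nk.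
  by have := ns _ _ Nk; rewrite st leNgt sN.
have fin : finite_set [set k | s k = t].
  apply: (@sub_finite_set _ _ [set` l]); last exact: finite_seq.
  by move=> k /= /eqP; rewrite -lE.
split => //.
have -> : #|` fset_set [set k | s k = t]| = size l.
  have ul : uniq l by apply: filter_uniq; exact: iota_uniq.
  apply: perm_size; apply: uniq_perm => //.
  move=> k; rewrite lE; have -> : (k \in enum_fset (fset_set [set k | s k = t])) = (k \in fset_set [set k | s k = t]) by [].
  rewrite in_fset_set//; apply/idP/eqP => [/set_mem//|e]; exact/mem_set.
have big (c : nat -> R[i]) : \sum_(i < size l) c (nth 0%N l i) *: psi (nth 0%N l i) = \sum_(k < N | s k == t) c k *: psi k.
  rewrite -(big_mkord (fun k => s k == t) (fun k => c k *: psi k)) /index_iota subn0 -big_filter -/l.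
  by rewrite (big_nth 0%N) big_mkord.
have sN' k : (k < N)%N -> 0 < s k by move=> /sb; exact: lt_le_trans.
have onN : orthofam ip N psi by move=> j k jN kN; apply: on; exact: sN'.
exists (fun i => psi (nth 0%N l i)); split; last first.
  move=> c e i; have il := mem_nth 0%N (ltn_ord i).
  have /eqP si : s (nth 0%N l i) == t by rewrite -lE.
  have := congr1 (fun u => ip u (psi (nth 0%N l i))) e.
  rewrite /= (ip_0l HP)// (ip_suml HP)//; last by move=> j; exact: (phZ HP).
  rewrite (bigD1 i)//= (ip_Zl HP)// on ?si// eqxx mulr1 big1 ?addr0// => j ji.
  have /eqP sj : s (nth 0%N l j) == t by rewrite -lE mem_nth.
  rewrite (ip_Zl HP)// on ?si ?sj// nth_uniq//; last by apply: filter_uniq; exact: iota_uniq.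
  by rewrite (inj_eq val_inj) (negbTE ji) mulr0.
move=> u; split; last first.
  move=> [c ->]; have Hs : H (\sum_i c i *: psi (nth 0%N l i)) by apply: (ph_sum HP) => i; exact: (phZ HP).
  split => //; rewrite adjointE; last exact: TH.
  rewrite (@lin_sum _ TL _ _ (fun i => psi (nth 0%N l i)))// (@lin_sum _ T'L _ _ (fun i => T (psi (nth 0%N l i)))); last by move=> k; exact: TH.
  rewrite scaler_sumr; apply: eq_bigr => i _; rewrite Apsi !scalerA mulrC.
  by have /eqP -> : s (nth 0%N l i) == t by rewrite -lE mem_nth.
move=> [Hu]; rewrite adjointE; last exact: TH.
move=> Eu.
have ip0 k : s k != t -> ip u (psi k) = 0.
  move=> sk; have : ip (T' (T u)) (psi k) = ip u (T' (T (psi k))).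
    by rewrite adj' ?(bp_adj TP)//; exact: TH.
  rewrite Eu Apsi (ip_Zl HP)// (ip_Zr HP)// cJR => /eqP; rewrite -subr_eq0 -mulrBl mulf_eq0.
  case/orP => [|/eqP//]; rewrite subr_eq0 => /eqP/complexI/eqP; rewrite eqrXn2 ?(ltW t0)// => /eqP e.
  by rewrite e eqxx in sk.
have Hp := proj_H HP N Hpsi u.
have Eu' : u = oproj ip N psi u.
  apply/eqP; rewrite -subr_eq0; apply/eqP; set w := u - _.
  have Hw : H w by exact: (phB HP).
  have Aw : T' (T w) = (t ^+ 2)%:C *: w.
    rewrite /w (lin_B TL)// (lin_B T'L)//; [|exact: TH|exact: TH].
    rewrite Eu scalerBr; congr (_ - _).
    rewrite /oproj (lin_sum TL)// (@lin_sum _ T'L _ _ (fun k => T (psi k))); last by move=> k; exact: TH.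
    rewrite scaler_sumr; apply: eq_bigr => k _; rewrite Apsi !scalerA.
    by have [->|sk] := eqVneq (s k) t; [rewrite mulrC|rewrite ip0// mulr0 mul0r].
  have sqw : sq (T w) = t ^+ 2 * sq w.
    rewrite /sqnorm (bp_adj TP)//; last exact: TH.
    by rewrite Aw (ip_Zr HP)// cJR (ipuu HP)// -cRM.
  have := sq_le HP (TH Hw) (max N w Hw (fun j jN => proj_orth HP Hpsi onN Hu jN)).
  rewrite sqw exprMn (hnorm_sqr HP)// => h.
  apply: HD => //; apply/eqP; rewrite eq_le (sq_ge0 HP Hw) andbT.
  have : s N ^+ 2 < t ^+ 2 by rewrite ltr_pXn2r// nnegrE// ltW.
  rewrite -/(sq w); nra.
exists (fun i => ip u (psi (nth 0%N l i))).
rewrite (big (fun k => ip u (psi k))) {1}Eu' /oproj [in RHS]big_mkcond; apply: eq_bigr => k _.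
by case: ifPn => // sk; rewrite ip0// scale0r.
Qed.

(** Since the enumeration is nonincreasing and tends to 0, the indices with singular value above [t]
    form a finite initial segment. As indices start at 0, its length is the first index not in
    it. *)
Lemma singular_countP t k : 0 < t ->
  (k < singular_count H ip T t)%N = (t < singular_value H ip T k).
Proof.
move=> t0; rewrite /singular_count.
have [s [psi [[-> s0 ns] [s_0 _]]]] := has_singular_values.
have [N sN sb] : exists2 N, s N <= t & forall k, (k < N)%N -> t < s k.
  have ex : exists k, s k <= t by have [j sj] := s_0 t t0; exists j; exact: ltW.
  exists (ex_minn ex); case: ex_minnP => // N sN mN j jN.
  by rewrite ltNge; apply/negP => /mN; rewrite leqNgt jN.
have E j : (j < N)%N = (t < s j).
  have [/sb->//|Nj] := ltnP j N; apply/esym/negbTE; rewrite -leNgt.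
  exact: le_trans (ns _ _ Nj) sN.
have -> : [set j | t < s j] = `I_N by apply/seteqP; split => j /=; rewrite E.
by rewrite -E (card_fset_set (n := N)).
Qed.

(** The left singular vectors are phi_k = T psi_k / s_k. The last bound follows from the preceding
    one, since [T'] maps vectors orthogonal to the phi_k to vectors orthogonal to the psi_k. *)
Lemma schmidt_decomposition t : 0 < t -> exists (b phi : nat -> V) (s : nat -> R),
  let N := singular_count H ip T t in
  [/\ forall k, H (b k), forall k, H (phi k), orthofam ip N b & orthofam ip N phi] /\
  [/\ forall k, (k < N)%N -> t < s k,
   forall k, (k < N)%N -> T (b k) = (s k)%:C *: phi k &
   forall k, (k < N)%N -> T' (phi k) = (s k)%:C *: b k] /\
  (forall u, H u -> (forall j, (j < N)%N -> ip u (b j) = 0) -> hnorm (T u) <= t * hnorm u) /\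
  (forall u, H u -> (forall j, (j < N)%N -> ip u (phi j) = 0) -> hnorm (T' u) <= t * hnorm u).
Proof.
move=> t0; have ct k := singular_countP k t0.
have [s [psi [[E s0 ns] [_ [Hpsi on Apsi max]]]]] := has_singular_values.
rewrite E in ct; set N := singular_count H ip T t in ct *.
pose phi k := ((s k)^-1)%:C *: T (psi k).
have Hphi k : H (phi k) by apply: (phZ HP); exact: TH.
have sp k : (k < N)%N -> 0 < s k by rewrite ct; exact: lt_trans.
have Tpsi k : (k < N)%N -> T (psi k) = (s k)%:C *: phi k.
  by move=> /sp sk; rewrite scalerA -cRM mulfV ?gt_eqF// scale1r.
have Tphi k : (k < N)%N -> T' (phi k) = (s k)%:C *: psi k.
  move=> /sp sk; rewrite /phi (lin_Z T'L); last exact: TH.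
  by rewrite Apsi scalerA -cRM expr2 mulKf ?gt_eqF.
have upper u : H u -> (forall j, (j < N)%N -> ip u (psi j) = 0) -> hnorm (T u) <= t * hnorm u.
  move=> Hu ou; apply: (le_trans (max N u Hu ou)); rewrite ler_wpM2r ?hnorm_ge0//.
  by rewrite leNgt -ct ltnn.
exists psi, phi, s; split; [split => //|split; [split => // k|split => //]].
- by move=> j k jN kN; apply: on; exact: sp.
- move=> j k jN kN; rewrite {1}/phi (ip_Zl HP _ (TH (Hpsi j)) (Hphi k)).
  rewrite (bp_adj TP)// Tphi// (ip_Zr HP)// cJR on ?sp// mulrA -cRM.
  have [->|jk] := eqVneq j k; last by rewrite mulr0.
  by rewrite mulVf ?gt_eqF ?sp// mulr1.
- by rewrite ct.
- move=> u Hu ou; have H1 := T'H Hu.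
  have [h0|h0] := ltP 0 (hnorm (T' u)); last by rewrite (le_trans h0)// mulr_ge0 ?hnorm_ge0// ltW.
  rewrite -(ler_pM2l h0) -expr2 (hnorm_sqr HP)//.
  have -> : sq (T' u) = complex.Re (ip u (T (T' u))) by rewrite /sqnorm adj'.
  apply: (le_trans (ler_norm _)); apply: (le_trans (nc_Re _)).
  apply: (le_trans (cauchy_schwarz HP Hu (TH H1))).
  rewrite mulrC mulrCA mulrA ler_wpM2r ?hnorm_ge0//; apply: upper => // j jN.
  by rewrite adj'// Tpsi// (ip_Zr HP)// ou// mulr0.
Qed.

(* With u = v + w, v the projection on the first N singular vectors, T acts on v and w
   within orthogonal subspaces, and likewise T'; comparing T v with c v, and T' v with
   c^* v, bounds v when |c| < t and w when |c| > t. *)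
Lemma quasimode_family t : 0 < t -> exists b : nat -> V,
  let N := singular_count H ip T t in
  [/\ forall k, H (b k), orthofam ip N b &
   forall c e u, H u -> sq u = 1 ->
   hnorm (T u - c *: u) <= e -> hnorm (T' u - c^*%C *: u) <= e ->
   let p := \sum_(k < N) nc (ip u (b k)) ^+ 2 in
   (nc c < t -> (t - nc c) ^+ 2 * p <= 4 * e ^+ 2) /\
   (t < nc c -> (nc c - t) ^+ 2 * (1 - p) <= 4 * e ^+ 2)].
Proof.
move=> t0; have [b [phi [s]]] := schmidt_decomposition t0.
set N := singular_count H ip T t => /= -[[Hb Hphi onb onp] [[st Tb Tphi] [Tle T'le]]].
exists b; split; [exact: Hb|exact: onb|move=> c e u Hu u1 h1 h2].
set p := \sum_(k < N) _.
have e0 : 0 <= e by exact: le_trans (hnorm_ge0 _ _) h1.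
have H1 := proj_H HP N Hb u; have H2 := proj_H HP N Hphi u.
have HTu := TH Hu; have HTu' := T'H Hu.
have Hg : H (T u - c *: u) by apply: (phB HP) => //; exact: (phZ HP).
have Hg' : H (T' u - c^*%C *: u) by apply: (phB HP) => //; exact: (phZ HP).
(* [T] carries right singular vectors to multiples of left ones, so it intertwines the two
   projections; [E2] is the same for [T'] in the opposite direction. *)
have E1 : T (oproj ip N b u) = oproj ip N phi (T u).
  rewrite /oproj (lin_sum TL)//; apply: eq_bigr => k _.
  by rewrite Tb// scalerA (bp_adj TP)// Tphi// (ip_Zr HP)// cJR mulrC.
have E2 : T' (oproj ip N phi u) = oproj ip N b (T' u).
  rewrite /oproj (lin_sum T'L)//; apply: eq_bigr => k _.
  by rewrite Tphi// scalerA adj'// Tb// (ip_Zr HP)// cJR mulrC.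
have F1 : T (oproj ip N b u) = c *: oproj ip N phi u + oproj ip N phi (T u - c *: u).
  by rewrite E1 -(projDZ HP)//; congr oproj; rewrite addrC subrK.
have F2 : T' (oproj ip N phi u) = c^*%C *: oproj ip N b u + oproj ip N b (T' u - c^*%C *: u).
  by rewrite E2 -(projDZ HP)//; congr oproj; rewrite addrC subrK.
have zm (x y z : V) : x - y = z - y + x - z by rewrite addrAC [z - y]addrC addrK addrC.
have pE : p = hnorm (oproj ip N b u) ^+ 2 by rewrite (hnorm_sqr HP)// (sq_proj HP).
split => ct.
- have grow (a a' : nat -> V) (S : V -> V) w : (forall k, H (a k)) -> (forall k, H (a' k)) ->
      orthofam ip N a -> orthofam ip N a' ->
      (forall (a : R[i]) u v, H u -> H v -> S (a *: u + v) = a *: S u + S v) ->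
      (forall k, (k < N)%N -> S (a k) = (s k)%:C *: a' k) -> H w ->
      t * hnorm (oproj ip N a w) <= hnorm (S (oproj ip N a w)).
    move=> Ha Ha' ona ona' SL Sa Hw.
    have Hp := proj_H HP N Ha w.
    rewrite /oproj (lin_sum SL)// -/(oproj ip N a w).
    have -> : \sum_(k < N) ip w (a k) *: S (a k) = \sum_(k < N) (ip w (a k) * (s k)%:C) *: a' k.
      by apply: eq_bigr => k _; rewrite Sa// scalerA.
    set x := \sum_(k < N) _; have Hx : H x by apply: (ph_sum HP) => k; exact: (phZ HP).
    rewrite -(ler_pXn2r (n := 2)) ?nnegrE ?mulr_ge0 ?hnorm_ge0 ?(ltW t0)// exprMn !(hnorm_sqr HP)//.
    rewrite (sq_proj HP)// (sq_lin HP)// mulr_sumr; apply: ler_sum => k _.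
    rewrite ncM exprMn mulrC ler_wpM2l ?sqr_ge0// ncR.
    have := st k (ltn_ord k) => sk; rewrite ger0_norm; last by rewrite ltW// (lt_trans t0).
    have s0' := lt_trans t0 sk.
    by rewrite ler_pXn2r ?nnegrE ?(ltW t0) ?(ltW s0') ?(ltW sk).
  have g1 := grow b phi T u Hb Hphi onb onp TL Tb Hu.
  have g2 := grow phi b T' u Hphi Hb onp onb T'L Tphi Hu.
  have k1 : hnorm (T (oproj ip N b u)) <= nc c * hnorm (oproj ip N phi u) + e.
    rewrite F1; apply: (le_trans (phnD HP (phZ HP c H2) (proj_H HP N Hphi _))).
    by rewrite (phnZ HP)// lerD2l; apply: le_trans h1; apply: (hnorm_proj HP).
  have k2 : hnorm (T' (oproj ip N phi u)) <= nc c * hnorm (oproj ip N b u) + e.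
    rewrite F2; apply: (le_trans (phnD HP (phZ HP _ H1) (proj_H HP N Hb _))).
    by rewrite (phnZ HP)// ncJ lerD2l; apply: le_trans h2; apply: (hnorm_proj HP).
  (* With x and y the norms of the projections on the right and left families, t x <= |c| y + e and
     t y <= |c| x + e. Eliminating y bounds (t - |c|) x; neither inequality suffices alone when the
     two families differ. *)
  have := hnorm_ge0 ip (oproj ip N phi u); have := hnorm_ge0 ip (oproj ip N b u).
  have : 4 * e ^+ 2 = (2 * e) ^+ 2 by ring.
  move=> -> x0 y0; rewrite pE -exprMn ler_pXn2r ?nnegrE ?mulr_ge0// ?subr_ge0 ?(ltW ct)//.
  nra.
- have Hw1 := phB HP Hu H1; have Hw2 := phB HP Hu H2.
  have G1 : T (u - oproj ip N b u) = c *: (u - oproj ip N phi u) + ((T u - c *: u) - oproj ip N phi (T u - c *: u)).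
    rewrite (lin_B TL)// F1 scalerBr opprD !addrA; congr (_ - _).
    exact: zm.
  have G2 : T' (u - oproj ip N phi u) = c^*%C *: (u - oproj ip N b u) + ((T' u - c^*%C *: u) - oproj ip N b (T' u - c^*%C *: u)).
    rewrite (lin_B T'L)// F2 scalerBr opprD !addrA; congr (_ - _).
    exact: zm.
  have k1 : hnorm (T (u - oproj ip N b u)) <= t * hnorm (u - oproj ip N b u).
    by apply: Tle => // j jN; apply: (proj_orth HP).
  have k2 : hnorm (T' (u - oproj ip N phi u)) <= t * hnorm (u - oproj ip N phi u).
    by apply: T'le => // j jN; apply: (proj_orth HP).
  have Hr1 := phB HP Hg (proj_H HP N Hphi (T u - c *: u)).
  have Hr2 := phB HP Hg' (proj_H HP N Hb (T' u - c^*%C *: u)).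
  have m1 : nc c * hnorm (u - oproj ip N phi u) <= hnorm (T (u - oproj ip N b u)) + e.
    rewrite -(phnZ HP)// -[c *: _](addrK ((T u - c *: u) - oproj ip N phi (T u - c *: u))) -G1.
    apply: (le_trans (phnB HP (TH Hw1) Hr1)); rewrite lerD2l.
    by apply: le_trans h1; apply: (hnorm_proj_compl HP).
  have m2 : nc c * hnorm (u - oproj ip N b u) <= hnorm (T' (u - oproj ip N phi u)) + e.
    rewrite -(ncJ c) -(phnZ HP)// -[_ *: _](addrK ((T' u - c^*%C *: u) - oproj ip N b (T' u - c^*%C *: u))) -G2.
    apply: (le_trans (phnB HP (T'H Hw2) Hr2)); rewrite lerD2l.
    by apply: le_trans h2; apply: (hnorm_proj_compl HP).
  have qE : 1 - p = hnorm (u - oproj ip N b u) ^+ 2 by rewrite (hnorm_sqr HP)// (sq_proj_compl HP)// u1.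
  have := hnorm_ge0 ip (u - oproj ip N phi u); have := hnorm_ge0 ip (u - oproj ip N b u).
  have : 4 * e ^+ 2 = (2 * e) ^+ 2 by ring.
  move=> -> x0 y0; rewrite qE -exprMn ler_pXn2r ?nnegrE ?mulr_ge0// ?subr_ge0 ?(ltW ct)//.
  nra.
Qed.

End Operator.

(** Weyl's perturbation inequality. If the count for [T] were larger, some nonzero combination u of
    its first right singular vectors would be orthogonal to those of [T1]; then |T u| > t |u|,
    whereas |T u| <= a |u| + (t - a) |u|. *)
Lemma singular_count_le (T T' T1 T1' : V -> V) (B B1 a t : R) :
  bounded_pair T T' B -> bounded_pair T1 T1' B1 -> 0 <= a < t ->
  (forall u, H u -> hnorm (T u - T1 u) <= a * hnorm u) ->
  (singular_count H ip T t <= singular_count H ip T1 (t - a))%N.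
Proof.
move=> TP TP1 /andP[a0 at_] hT; have t0 : 0 < t by exact: le_lt_trans at_.
have ta0 : 0 < t - a by rewrite subr_gt0.
have [b [phi [s]]] := schmidt_decomposition TP t0.
set N := singular_count H ip T t => /= -[[Hb Hphi onb onp] [[st Tb Tphi] _]].
have [b1 [phi1 [s1]]] := schmidt_decomposition TP1 ta0.
set N1 := singular_count H ip T1 _ => /= -[[Hb1 _ _ _] [_ [T1le _]]].
rewrite leqNgt; apply/negP => NN.
have [c [[k ck] Hc]] := exists_orth (fun (k : 'I_N) (j : 'I_N1) => ip (b k) (b1 j)) NN.
pose u := \sum_(k < N) c k *: b k.
have Hu : H u by apply: (ph_sum HP) => j; exact: (phZ HP).
have [[TH TL _] [TH1 _ _]] := (bp_compact TP, bp_compact TP1).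
have ou j : (j < N1)%N -> ip u (b1 j) = 0.
  move=> jN; rewrite /u (ip_suml HP)//; last by move=> i; exact: (phZ HP).
  by rewrite -[RHS](Hc (Ordinal jN)); apply: eq_bigr => i _; rewrite (ip_Zl HP).
have lt : t ^+ 2 * sq u < sq (T u).
  rewrite /u (lin_sum TL)//.
  have -> : \sum_(k < N) c k *: T (b k) = \sum_(k < N) (c k * (s k)%:C) *: phi k.
    by apply: eq_bigr => i _; rewrite Tb// scalerA.
  rewrite !(sq_lin HP)// mulr_sumr.
  have st2 (i : 'I_N) : t ^+ 2 < s i ^+ 2.
    by rewrite ltr_pXn2r ?nnegrE ?(ltW t0) ?st// ltW// (lt_trans t0)// st.
  rewrite (bigD1 k)//= [ltRHS](bigD1 k)//=; apply: ltr_leD.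
    rewrite ncM exprMn mulrC ltr_pM2l ?exprn_gt0 ?nc_gt0//.
    by rewrite ncR real_normK ?num_real.
  apply: ler_sum => i _; rewrite ncM exprMn mulrC ler_wpM2l ?sqr_ge0//.
  by rewrite ncR real_normK ?num_real// ltW.
have HTu := TH _ Hu; have HT1u := TH1 _ Hu.
have : hnorm (T u) <= t * hnorm u.
  rewrite -(subrK (T1 u) (T u)); apply: (le_trans (phnD HP (phB HP HTu HT1u) HT1u)).
  have := hT u Hu; have := T1le u Hu ou; lra.
by move=> /(sq_le HP HTu); rewrite exprMn (hnorm_sqr HP)// leNgt lt.
Qed.

End Schmidt.

(** * The Bargmann projection and Toeplitz operators *)

Lemma differentiable_dist (K : numFieldType) (V : normedModType K) (u : V -> K^o) (z : V) :
  differentiable u z -> forall e, 0 < e -> exists2 de, 0 < de &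
    forall y, `|y - z| < de -> `|u y - u z| < e.
Proof.
move=> /differentiable_continuous uc e e0.
have /nbhs_normP[de/= de0 Hd] : \forall y \near z, `|u z - u y| < e by move/cvgrPdist_lt : uc; exact.
by exists de => // y yz; rewrite distrC; apply: Hd; rewrite /= distrC.
Qed.

Lemma norm_row_le (K : numFieldType) n (z : 'rV[K]_n) (e : K) : 0 <= e ->
  (forall j, `|z 0 j| <= e) -> `|z| <= e.
Proof.
move=> e0 h; rewrite [leLHS]mx_normE -[leRHS]/((NngNum e0)%:num) num_le.
by apply: bigmax_le => [|[i j] _]; rewrite -num_le//= ord1.
Qed.

Section FockContinuity.
Context {R : realType} {n : nat}.
Local Notation CV := 'rV[R[i]]_n.

Lemma entire_cont (u : CV -> R[i]^o) (z : CV) (e : R) : entire u -> 0 < e ->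
  exists2 de : R, 0 < de & forall y : CV, (forall j, nc (y 0 j - z 0 j) < de) -> nc (u y - u z) < e.
Proof.
move=> eu e0; have e1 : 0 < e%:C%C by rewrite ltcR.
have [de de0 Hd] := differentiable_dist (eu z) e1.
have der : de = (complex.Re de)%:C%C by rewrite RRe_real// gtr0_real.
have dp : 0 < complex.Re de by rewrite -ltcR -der.
exists (complex.Re de / 2); first by rewrite divr_gt0.
move=> y hy; rewrite -ltcR -nc_norm; apply: Hd.
apply: (@le_lt_trans _ _ (complex.Re de / 2)%:C%C).
  apply: norm_row_le => [|j]; first by rewrite lecR divr_ge0// ltW.
  rewrite !mxE nc_norm lecR; exact/ltW/hy.
by rewrite [X in _ < X]der ltcR ltr_pdivrMr// ltr_pMr// ltr1n.
Qed.

Lemma cmeas_of_cont (u : CV -> R[i]) :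
  (forall (z : CV) (e : R), 0 < e -> exists2 de : R, 0 < de &
     forall y : CV, (forall j, nc (y 0 j - z 0 j) < de) -> nc (u y - u z) < e) ->
  cmeas (fun t => u (pt t)).
Proof.
move=> uc; have hc t de (s : Rtuple R (n + n)) : (forall i, `|tnth s i - tnth t i : R| < de / 2) ->
    forall j, nc (pt s 0 j - pt t 0 j) < de.
  move=> hs j; apply: le_lt_trans (nc_leRI _) _.
  rewrite cReD cImD cReN cImN !Re_pt !Im_pt.
  have := hs (lshift n j); have := hs (rshift n j); lra.
split; apply: measurable_tuple_cont => t e e0; have [de de0 Hd] := uc (pt t) e e0;
  exists (de / 2); rewrite ?divr_gt0// => s hs.
- have := nc_Re (u (pt s) - u (pt t)); rewrite cReD cReN => /le_lt_trans; apply; exact/Hd/hc.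
- have := nc_Im (u (pt s) - u (pt t)); rewrite cImD cImN => /le_lt_trans; apply; exact/Hd/hc.
Qed.

Lemma entire_cmeas (u : CV -> R[i]^o) : entire u -> cmeas (fun t => u (pt t)).
Proof. by move=> eu; apply: cmeas_of_cont => z e; exact: entire_cont. Qed.

End FockContinuity.

Section WeightedCauchySchwarz.
Context {d : measure_display} {T : measurableType d} {R : realType}.
Variable mu : {measure set T -> \bar R}.

(** The variance of [g] about its weighted mean [c] is nonnegative. *)
Lemma weighted_cauchy_schwarz (g k : T -> R) : (forall t, 0 <= k t) ->
  mu.-integrable setT (EFin \o k) -> mu.-integrable setT (EFin \o (fun t => g t * k t)) ->
  mu.-integrable setT (EFin \o (fun t => g t ^+ 2 * k t)) -> 0 < \int[mu]_t k t ->
  (\int[mu]_t (g t * k t)) ^+ 2 <= (\int[mu]_t k t) * \int[mu]_t (g t ^+ 2 * k t).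
Proof.
move=> k0 ik igk igk2; set A := \int[mu]_t k t; set P := \int[mu]_t (g t * k t).
set Q := \int[mu]_t _ => A0; pose c := P / A.
have E : \int[mu]_t ((g t - c) ^+ 2 * k t) = Q - 2 * c * P + c ^+ 2 * A.
  have i1 := integrableZl measurableT (2 * c) igk.
  have i2 := integrableZl measurableT (c ^+ 2) ik.
  transitivity (\int[mu]_t ((g t ^+ 2 * k t - 2 * c * (g t * k t)) + c ^+ 2 * k t)).
    by apply: eq_Rintegral => t _; ring.
  have i3 : mu.-integrable setT (EFin \o (fun t => g t ^+ 2 * k t - 2 * c * (g t * k t))).
    have := integrableB measurableT igk2 i1; apply: eq_integrable => // t _.
  rewrite [LHS](RintegralD measurableT i3 i2) (RintegralB measurableT igk2 i1).
  by rewrite (RintegralZl _ measurableT igk) (RintegralZl _ measurableT ik).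
have : 0 <= \int[mu]_t ((g t - c) ^+ 2 * k t).
  by apply: Rintegral_ge0 => t _; rewrite mulr_ge0// sqr_ge0.
rewrite E => h; have := mulr_ge0 (ltW A0) h.
have -> : A * (Q - 2 * c * P + c ^+ 2 * A) = A * Q - P ^+ 2 by rewrite /c; field; rewrite gt_eqF.
by rewrite subr_ge0.
Qed.

End WeightedCauchySchwarz.

Lemma abs_mul_le (R : realType) (g k : R) : 0 <= k -> `|g * k| <= `|g ^+ 2 * k + k|.
Proof.
move=> k0; have e : 0 <= g ^+ 2 * k + k := addr_ge0 (mulr_ge0 (sqr_ge0 g) k0) k0.
rewrite normrM (ger0_norm k0) (ger0_norm e).
by have := sqr_ge0 (`|g| - 1); rewrite -[g ^+ 2]real_normK ?num_real//; nra.
Qed.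

Lemma sqr_le_chain (R : realType) (x c P A Q : R) : 0 <= x -> x <= c * P ->
  P ^+ 2 <= A * Q -> x ^+ 2 <= c ^+ 2 * A * Q.
Proof.
move=> x0 xc h; have cP : 0 <= c * P by exact: le_trans xc.
rewrite -mulrA; apply: (@le_trans _ _ ((c * P) ^+ 2)); first by rewrite ler_pXn2r ?nnegrE.
by rewrite exprMn ler_wpM2l ?sqr_ge0.
Qed.

(** * The integral operator with the reproducing kernel *)

Section Projection.
Context {R : realType} {n : nat}.
Local Open Scope complex_scope.
Local Notation CV := 'rV[R[i]]_n.
Local Notation X := (Rtuple R (n + n)).
Local Notation leb := (@lebesgue_tuple R (n + n)).
Local Notation phi := (@fock_weight R n).
Local Notation L2 := (L2 phi).
Local Notation ip := (L2ip phi).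
Local Notation H := (F2 phi).
Local Notation K := (@rker R n).
Implicit Types (u v : CV -> R[i]^o).

Lemma L2_prehilbert : prehilbert L2 ip.
Proof.
split; [exact: L2_0|by move=> a u v Hu Hv; apply: L2D => //; exact: L2Z|..].
- by move=> a u v w Hu Hv Hw; exact: ipDZ.
- exact: ipJ.
- by move=> u Hu; rewrite ip_sqn sqn_ge0.
Qed.

Lemma F2_L2 u : H u -> L2 u. Proof. by case. Qed.

Lemma F2_prehilbert : prehilbert H ip.
Proof.
split.
- by split; [exact: L2_0|move=> z; exact: differentiable_cst].
- move=> a u v [Hu eu] [Hv ev]; split; [by apply: L2D => //; exact: L2Z|exact: entireDZ].
- by move=> a u v w /F2_L2 Hu /F2_L2 Hv /F2_L2 Hw; exact: ipDZ.
- by move=> u v /F2_L2 Hu /F2_L2 Hv; exact: ipJ.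
- by move=> u Hu; rewrite ip_sqn sqn_ge0.
Qed.

Lemma hnorm_sqn u : hnorm ip u = Num.sqrt (sqn u).
Proof. by rewrite /hnorm ip_sqn. Qed.

(** Norm zero alone gives vanishing almost everywhere; the reproducing formula with the
    Cauchy-Schwarz inequality turns it into vanishing at every point. *)
Lemma F2_definite : definite H ip.
Proof.
move=> u Hu u0; apply/funext => z; rewrite (reproducing z Hu).
have := cauchy_schwarz L2_prehilbert (F2_L2 Hu) (K_L2 z).
rewrite {1}/hnorm u0 sqrtr0 mul0r => h; apply: nc0_eq0.
by apply/eqP; rewrite eq_le h nc_ge0.
Qed.

Lemma nsN (z : CV) : ns (- z) = ns z.
Proof. by apply: eq_bigr => j _; rewrite mxE ncN. Qed.

(* The modulus of the kernel of the projection, after conjugation by the square root of the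
   Gaussian weight and up to the factor [pi^-n]; Schur's test applies to it. *)
Definition schur_kernel (p : X * X) : R := expR (- (ns (pt p.2 - pt p.1) / 2)).

Lemma schur_kernelC s t : schur_kernel (s, t) = schur_kernel (t, s).
Proof. by rewrite /schur_kernel/= -nsN opprB. Qed.

Lemma schur_kernel_ge0 p : 0 <= schur_kernel p. Proof. exact: expR_ge0. Qed.
Lemma schur_kernel_le1 p : schur_kernel p <= 1.
Proof. by rewrite /schur_kernel -expR0 ler_expR oppr_le0 divr_ge0 ?ns_ge0. Qed.

Lemma measurable_schur_kernel : measurable_fun setT schur_kernel.
Proof.
apply: measurableT_comp => //; apply: measurableT_comp => //.
apply: measurable_funM => //; apply: measurable_sum => j; apply: measurable_funX.
have -> : (fun p : X * X => nc ((pt p.2 - pt p.1) 0 j)) = (fun p : X * X => nc (pt p.2 0 j - pt p.1 0 j)).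
  by apply/funext => p; rewrite mxE [X in _ + X]mxE.
apply: cmeas_nc; apply: cmeasB.
  exact: (cmeas_comp measurable_snd (cmeas_pt j)).
exact: (cmeas_comp measurable_fst (cmeas_pt j)).
Qed.

(** This is (2 pi)^n, the integral of e^(-|w|^2 / 2) over C^n, in the shape that [gauss_int] gives
    for c = sqrt 2. *)
Definition schur_const : R := Num.sqrt 2 ^+ (n + n) * pi ^+ n.

Lemma schur_const_gt0 : 0 < schur_const. Proof. by rewrite mulr_gt0// exprn_gt0// ?pi_gt0// sqrtr_gt0. Qed.

Lemma int_schur_kernel s : (\int[leb]_t (schur_kernel (s, t))%:E = schur_const%:E)%E.
Proof.
have s2 : 0 < Num.sqrt 2 :> R by rewrite sqrtr_gt0.
have G := gauss_int (n := n) s2; have e : Num.sqrt 2 ^+ 2 = 2 :> R by rewrite sqr_sqrtr.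
rewrite e in G; etransitivity; last exact: G.
rewrite -(mpres_integral (mpres_ttrans (- pt s)) (f := fun t => (expR (- (ns (pt t) / 2)))%:E)).
  by apply: eq_integral => t _; rewrite pt_ttrans.
apply/measurable_EFinP; apply: measurableT_comp => //; apply: measurableT_comp => //.
by apply: measurable_funM => //; exact: measurable_ns.
Qed.

Lemma schur_kernel_integrable s : leb.-integrable setT (EFin \o (fun t => schur_kernel (s, t))).
Proof.
apply/integrableP; split; first by apply/measurable_EFinP; apply: measurableT_comp (measurable_pair1 s); exact: measurable_schur_kernel.
rewrite (eq_integral (fun t => (schur_kernel (s, t))%:E)); first by rewrite int_schur_kernel ltry.
by move=> t _; rewrite /= ger0_norm// schur_kernel_ge0.
Qed.

Lemma schur_kernel_integrable_snd (h : X -> R) : leb.-integrable setT (EFin \o h) ->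
  (leb \x leb)%E.-integrable setT (EFin \o (fun p => h p.2 * schur_kernel p)).
Proof.
move=> ih; have /integrableP[/measurable_EFinP mh hoo] := ih.
have m2 : measurable_fun setT (fun p : X * X => h p.2 * schur_kernel p).
  by apply: measurable_funM; [exact: measurableT_comp mh measurable_snd|exact: measurable_schur_kernel].
apply/integrable21ltyP; first exact/measurable_EFinP.
have E t : (\int[leb]_s `|(EFin \o (fun p : X * X => (h p.2 * schur_kernel p)%R)) (s, t)| = `|(h t)%:E| * schur_const%:E)%E.
  rewrite -(int_schur_kernel t) -ge0_integralZl//; last 2 first.
  - by apply/measurable_EFinP; apply: measurableT_comp (measurable_pair1 t); exact: measurable_schur_kernel.
  - by move=> s _; rewrite lee_fin schur_kernel_ge0.
  by apply: eq_integral => s _; rewrite /= normrM [X in _ * X]ger0_norm ?schur_kernel_ge0// schur_kernelC.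
under eq_integral do rewrite E.
have /integrableP[_] := integrableZr measurableT schur_const ih; apply: le_lt_trans.
rewrite le_eqVlt; apply/orP; left; apply/eqP; apply: eq_integral => t _.
by rewrite abseM; congr (_ * _)%E; rewrite /= ger0_norm// ltW// schur_const_gt0.
Qed.

Lemma schur_kernel_integrable_fst (h : X -> R) : leb.-integrable setT (EFin \o h) ->
  (leb \x leb)%E.-integrable setT (EFin \o (fun p => h p.1 * schur_kernel p)).
Proof.
move=> ih; have /integrableP[/measurable_EFinP mh hoo] := ih.
have m2 : measurable_fun setT (fun p : X * X => h p.1 * schur_kernel p).
  by apply: measurable_funM; [exact: measurableT_comp mh measurable_fst|exact: measurable_schur_kernel].
apply/integrable12ltyP; first exact/measurable_EFinP.
have E s : (\int[leb]_t `|(EFin \o (fun p : X * X => (h p.1 * schur_kernel p)%R)) (s, t)| = `|(h s)%:E| * schur_const%:E)%E.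
  rewrite -(int_schur_kernel s) -ge0_integralZl//; last 2 first.
  - by apply/measurable_EFinP; apply: measurableT_comp (measurable_pair1 s); exact: measurable_schur_kernel.
  - by move=> t _; rewrite lee_fin schur_kernel_ge0.
  by apply: eq_integral => t _; rewrite /= normrM [X in _ * X]ger0_norm ?schur_kernel_ge0.
under eq_integral do rewrite E.
have /integrableP[_] := integrableZr measurableT schur_const ih; apply: le_lt_trans.
rewrite le_eqVlt; apply/orP; left; apply/eqP; apply: eq_integral => t _.
by rewrite abseM; congr (_ * _)%E; rewrite /= ger0_norm// ltW// schur_const_gt0.
Qed.

Definition sqrt_gw (t : X) : R := expR (- (ns (pt t) / 2)).

Lemma sqrt_gw_sqr t : sqrt_gw t ^+ 2 = gw (pt t).
Proof. by rewrite /sqrt_gw /gw -expRM_natl; congr expR; field. Qed.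

(** Completing the square: 2 Re <t, s> - |t|^2 - |s|^2 = - |t - s|^2. After conjugation by the root
    of the weight the kernel becomes a convolution kernel. *)
Lemma nc_K_schur s t : nc (K (pt s) (pt t)) * gw (pt t) * sqrt_gw s = (pi ^+ n)^-1 * schur_kernel (s, t) * sqrt_gw t.
Proof.
rewrite nc_K -!mulrA; congr (_ * _); rewrite /gw /sqrt_gw /schur_kernel -!expRD; congr expR => /=.
by rewrite nsD dotNr cReN nsN; field.
Qed.

(* Written as an explicit integral operator, defined on all of [L2]. *)
Definition bproj (g : CV -> R[i]^o) : CV -> R[i]^o := fun z => ip g (K z).

(** Schur's test: the Cauchy-Schwarz inequality against [schur_kernel], whose mass in each variable
    is [schur_const], then Tonelli. Only finiteness matters; norm at most 1 follows afterwards from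
    orthogonality. *)
Lemma bproj_L2 g : L2 g -> L2 (bproj g).
Proof.
move=> Lg; have eP : entire (bproj g) by exact: ip_K_entire.
have mP := entire_cmeas eP; apply/L2P; split => //.
have [mg _] := (L2P g).1 Lg.
pose G t := nc (g (pt t)) * sqrt_gw t.
have G2 t : G t ^+ 2 = nc (g (pt t)) ^+ 2 * gw (pt t) by rewrite exprMn sqrt_gw_sqr.
have mhg : measurable_fun setT sqrt_gw.
  apply: measurableT_comp => //; apply: measurableT_comp => //.
  by apply: measurable_funM => //; exact: measurable_ns.
have mG : measurable_fun setT G by apply: measurable_funM => //; exact: cmeas_nc.
have iG2 : leb.-integrable setT (EFin \o (fun t => G t ^+ 2)).
  by have := L2_integrable Lg; apply: eq_integrable => // t _; rewrite /= G2.
have mk s : measurable_fun setT (fun t => schur_kernel (s, t)).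
  by apply: measurableT_comp (measurable_pair1 s); exact: measurable_schur_kernel.
have iG2k s : leb.-integrable setT (EFin \o (fun t => G t ^+ 2 * schur_kernel (s, t))).
  apply: le_integrable iG2 => //.
    by apply/measurable_EFinP; apply: measurable_funM => //; exact: measurable_funX.
  move=> t _ /=; rewrite lee_fin normrM [X in _ * X]ger0_norm ?schur_kernel_ge0//.
  by rewrite ger0_norm ?sqr_ge0// ler_piMr ?sqr_ge0 ?schur_kernel_le1.
have iGk s : leb.-integrable setT (EFin \o (fun t => G t * schur_kernel (s, t))).
  have := integrableD measurableT (iG2k s) (schur_kernel_integrable s); apply: le_integrable => //.
    by apply/measurable_EFinP; exact: measurable_funM.
  by move=> t _; rewrite lee_fin; apply: abs_mul_le; exact: schur_kernel_ge0.
have bound s : nc (bproj g (pt s)) ^+ 2 * gw (pt s) <=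
    (2 * (pi ^+ n)^-1) ^+ 2 * schur_const * \int[leb]_t (G t ^+ 2 * schur_kernel (s, t)).
  rewrite -sqrt_gw_sqr -exprMn.
  have ikA : \int[leb]_t schur_kernel (s, t) = schur_const by rewrite /Rintegral int_schur_kernel.
  have := weighted_cauchy_schwarz (fun t => schur_kernel_ge0 (s, t)) (schur_kernel_integrable s) (iGk s) (iG2k s).
  rewrite ikA => /(_ schur_const_gt0) h.
  apply: sqr_le_chain h; first by rewrite mulr_ge0 ?nc_ge0 ?expR_ge0.
  have ig := L2_cintg Lg (K_L2 (pt s)).
  have := nc_cint_le ig; rewrite -ipE -/(bproj g (pt s)) => h1.
  apply: (le_trans (ler_wpM2r (expR_ge0 _) h1)).
  rewrite -!mulrA ler_pM2l// -(RintegralZl _ measurableT (iGk s)).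
  rewrite -(RintegralZr _ measurableT (cintg_nc ig)) le_eqVlt; apply/orP; left; apply/eqP.
  apply: eq_Rintegral => t _; rewrite !ncM ncJ ncR ger0_norm ?gw_ge0//.
  by rewrite -/(sqrt_gw s) -!mulrA [nc (K _ _) * _]mulrA nc_K_schur /G; ring.
have iF := integrable_fubini_F (schur_kernel_integrable_snd iG2).
have := integrableZl measurableT ((2 * (pi ^+ n)^-1) ^+ 2 * schur_const) iF.
set F := (X in leb.-integrable _ X) => iF'.
have : leb.-integrable setT (EFin \o (fun s => nc (bproj g (pt s)) ^+ 2 * gw (pt s))).
  apply: le_integrable iF' => //; first by apply/measurable_EFinP; exact: measurable_sqn.
  move=> s _; rewrite /F /fubini_F /=.
  have -> : (\int[leb]_t (G t ^+ 2 * schur_kernel (s, t))%:E = (\int[leb]_t (G t ^+ 2 * schur_kernel (s, t)))%:E)%E.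
    by rewrite fineK//; exact: (integrable_fin_num measurableT (iG2k s)).
  rewrite -EFinM abse_EFin lee_fin (ger0_norm (mulr_ge0 (sqr_ge0 _) (gw_ge0 _))).
  exact: (le_trans (bound s) (ler_norm _)).
move=> /integrableP[_]; apply: le_lt_trans; apply: ge0_le_integral => //.
- by move=> s _; rewrite lee_fin (mulr_ge0 (sqr_ge0 _) (gw_ge0 _)).
- by apply/measurable_EFinP; exact: measurable_sqn.
- by apply/measurable_EFinP; apply: measurableT_comp => //; exact: measurable_sqn.
- by move=> s _; rewrite /= lee_fin ler_norm.
Qed.

End Projection.

Lemma mul_le_add_sqr (R : realType) (a b x y c k : R) : 0 <= c -> 0 <= k ->
  c * (a * x) * (b * y) * k <= c * (a ^+ 2 * x ^+ 2 * k + b ^+ 2 * y ^+ 2 * k).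
Proof.
move=> c0 k0; have ck := mulr_ge0 c0 k0.
have h : (a * x) * (b * y) <= (a * x) ^+ 2 + (b * y) ^+ 2.
  have := sqr_ge0 (a * x - b * y); have := sqr_ge0 (a * x); have := sqr_ge0 (b * y); nra.
have := ler_wpM2l ck h; set p := _ * _; set q := (X in _ <= X -> _).
have -> : c * (a ^+ 2 * x ^+ 2 * k + b ^+ 2 * y ^+ 2 * k) = q by rewrite /q; ring.
by apply: le_trans; rewrite /p le_eqVlt; apply/orP; left; apply/eqP; ring.
Qed.

(** * Toeplitz operators with bounded symbols *)

Section Toeplitz.
Context {R : realType} {n : nat}.
Local Open Scope complex_scope.
Local Notation CV := 'rV[R[i]]_n.
Local Notation X := (Rtuple R (n + n)).
Local Notation leb := (@lebesgue_tuple R (n + n)).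
Local Notation phi := (@fock_weight R n).
Local Notation L2 := (L2 phi).
Local Notation ip := (L2ip phi).
Local Notation H := (F2 phi).
Local Notation K := (@rker R n).
Implicit Types (u v g : CV -> R[i]^o).

Lemma KC (z w : CV) : (K z w)^*%C = K w z.
Proof. by rewrite KJ. Qed.

(** Fubini and the symmetry of the kernel move the projection onto [k], where the reproducing
    formula applies. The double integrand is absolutely integrable because [mul_le_add_sqr] splits
    it into two terms, each an [L2] density times the Schur kernel. *)
Lemma ip_bproj g k : L2 g -> H k -> ip (bproj g) k = ip g k.
Proof.
move=> Lg Hk; have Lk := F2_L2 Hk.
have [[mg _] [mk _]] := ((L2P g).1 Lg, (L2P k).1 Lk).
pose F (p : X * X) := (k (pt p.1))^*%C * (gw (pt p.1))%:C * (g (pt p.2) * (K (pt p.1) (pt p.2))^*%C * (gw (pt p.2))%:C).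
have mgw : cmeas (fun t : X => (gw (pt t))%:C) by apply: cmeasR; exact: measurable_gw.
have mKK : cmeas (fun p : X * X => (K (pt p.1) (pt p.2))^*%C).
  apply: cmeasJ; apply: cmeasM; first exact: cmeas_cst.
  apply: cmeas_cexp; apply: cmeas_sum => j; apply: cmeasM.
    exact: (cmeas_comp measurable_snd (cmeas_pt j)).
  by apply: cmeasJ; exact: (cmeas_comp measurable_fst (cmeas_pt j)).
have mF : cmeas F.
  apply: cmeasM; apply: cmeasM.
  - by apply: cmeasJ; exact: (cmeas_comp measurable_fst mk).
  - exact: (cmeas_comp measurable_fst mgw).
  - by apply: cmeasM => //; exact: (cmeas_comp measurable_snd mg).
  - exact: (cmeas_comp measurable_snd mgw).
pose G2 t := nc (g (pt t)) ^+ 2 * gw (pt t); pose K2 t := nc (k (pt t)) ^+ 2 * gw (pt t).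
have i1 := schur_kernel_integrable_snd (L2_integrable Lg).
have i2 := schur_kernel_integrable_fst (L2_integrable Lk).
have ncF (p : X * X) : nc (F p) = (pi ^+ n)^-1 * (nc (g (pt p.2)) * sqrt_gw p.2) * (nc (k (pt p.1)) * sqrt_gw p.1) * schur_kernel p.
  case: p => s t; rewrite /F !ncM !ncJ !ncR !ger0_norm ?gw_ge0// [(s, t).1]/= [(s, t).2]/=.
  rewrite -!sqrt_gw_sqr; have := nc_K_schur s t; rewrite -sqrt_gw_sqr => E.
  have -> : nc (k (pt s)) * sqrt_gw s ^+ 2 * (nc (g (pt t)) * nc (K (pt s) (pt t)) * sqrt_gw t ^+ 2) =
    nc (k (pt s)) * sqrt_gw s * nc (g (pt t)) * (nc (K (pt s) (pt t)) * sqrt_gw t ^+ 2 * sqrt_gw s) by ring.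
  by rewrite E; ring.
have iF : cintg (leb \x leb)%E F.
  apply: (cintg_dom mF (integrableZl measurableT (pi ^+ n)^-1 (integrableD measurableT i1 i2))) => p.
  rewrite ncF -!sqrt_gw_sqr; apply: mul_le_add_sqr; [exact: ltW pin_gt0|exact: schur_kernel_ge0].
have FE0 s t : F (s, t) = ((k (pt s))^*%C * (gw (pt s))%:C) * (g (pt t) * (K (pt s) (pt t))^*%C * (gw (pt t))%:C) by [].
have F1 s : cintg leb (fun t => F (s, t)).
  have := cintgZ ((k (pt s))^*%C * (gw (pt s))%:C) (L2_cintg Lg (K_L2 (pt s))).
  by apply: cintg_eq => t; rewrite FE0.
have FE s t : F (s, t) = (g (pt t) * (gw (pt t))%:C) * (K (pt t) (pt s) * (k (pt s))^*%C * (gw (pt s))%:C).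
  by rewrite /F KC [(s, t).1]/= [(s, t).2]/=; ring.
have F2 t : cintg leb (fun s => F (s, t)).
  have := cintgZ (g (pt t) * (gw (pt t))%:C) (L2_cintg (K_L2 (pt t)) Lk).
  by apply: cintg_eq => s; rewrite FE.
have E1 : ip (bproj g) k = cint leb (fun s => cint leb (fun t => F (s, t))).
  rewrite ipE; apply: eq_cint => s.
  transitivity (((k (pt s))^*%C * (gw (pt s))%:C) * cint leb (fun t => g (pt t) * (K (pt s) (pt t))^*%C * (gw (pt t))%:C)).
    by rewrite -ipE -/(bproj g (pt s)); ring.
  rewrite -cintZ; last by apply: L2_cintg => //; exact: K_L2.
  by apply: eq_cint => t; rewrite FE0.
have E2 : ip g k = cint leb (fun t => cint leb (fun s => F (s, t))).
  rewrite ipE; apply: eq_cint => t.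
  transitivity ((g (pt t) * (gw (pt t))%:C) * cint leb (fun s => K (pt t) (pt s) * (k (pt s))^*%C * (gw (pt s))%:C)).
    by rewrite -ipE (ipJ (K_L2 _) Lk) -(reproducing (pt t) Hk); ring.
  rewrite -cintZ; last by apply: L2_cintg => //; exact: K_L2.
  by apply: eq_cint => s; rewrite FE.
rewrite E1 E2; exact: (cint_fubini iF F1 F2).
Qed.

Lemma bproj_H g : L2 g -> H (bproj g).
Proof. by move=> Lg; split; [exact: bproj_L2|exact: ip_K_entire]. Qed.

(** The defining property of the projection holds for [bproj g] by [ip_bproj], and for no other
    element of [F2] by definiteness, so the choice operator can only return it. *)
Lemma orthogonal_projectionE g : L2 g -> orthogonal_projection H ip g = bproj g.
Proof.
move=> Lg; have HP := bproj_H Lg; have LP := F2_L2 HP.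
apply: (@xget_unique _ 0 [set h | H h /\ forall k, H k -> ip (g - h) k = 0]) => /=.
  split => // k Hk; rewrite (ip_Bl L2_prehilbert)//; last exact: F2_L2.
  by rewrite ip_bproj// subrr.
move=> h [Hh oh]; have Hd := phB F2_prehilbert Hh HP.
apply/eqP; rewrite -subr_eq0; apply/eqP; apply: F2_definite => //.
rewrite (ip_Bl F2_prehilbert)// ip_bproj//; have := oh _ Hd.
rewrite (ip_Bl L2_prehilbert Lg (F2_L2 Hh) (F2_L2 Hd)) => /eqP; rewrite subr_eq0 => /eqP ->.
by rewrite subrr.
Qed.

Lemma hnorm_bproj g : L2 g -> hnorm ip (bproj g) <= hnorm ip g.
Proof.
move=> Lg; have HP := bproj_H Lg; have LP := F2_L2 HP.
have [h0|h0] := ltP 0 (hnorm ip (bproj g)); last by rewrite (le_trans h0)// hnorm_ge0.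
rewrite -(ler_pM2r h0) -expr2 (hnorm_sqr F2_prehilbert)// /sqnorm ip_bproj//.
apply: (le_trans (ler_norm _)); apply: (le_trans (nc_Re _)).
exact: (cauchy_schwarz L2_prehilbert).
Qed.

Section Symbol.
Variables (f : CV -> R[i]) (B : R).
Hypotheses (mf : cmeas (fun t => f (pt t))) (fB : forall z, nc (f z) <= B).

Lemma mul_L2 u : L2 u -> L2 (fun z => f z * u z).
Proof.
move=> Lu; have [mu _] := (L2P u).1 Lu.
apply: (L2_dom (k := B)) Lu _; first exact: cmeasM.
by move=> z; rewrite ncM ler_wpM2r ?nc_ge0.
Qed.

Lemma toeplitzE u : L2 u -> toeplitz phi f u = bproj (fun z => f z * u z).
Proof. by move=> Lu; rewrite /toeplitz orthogonal_projectionE//; exact: mul_L2. Qed.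

Lemma toeplitz_H u : L2 u -> H (toeplitz phi f u).
Proof. by move=> Lu; rewrite toeplitzE//; apply: bproj_H; exact: mul_L2. Qed.

Lemma bprojDZ (a : R[i]) u v : L2 u -> L2 v -> bproj (a *: u + v) = a *: bproj u + bproj v.
Proof. by move=> Lu Lv; apply/funext => z; rewrite /bproj ipDZ//; exact: K_L2. Qed.

Lemma toeplitz_lin (a : R[i]) u v : L2 u -> L2 v ->
  toeplitz phi f (a *: u + v) = a *: toeplitz phi f u + toeplitz phi f v.
Proof.
move=> Lu Lv; rewrite !toeplitzE//; last by apply: L2D => //; exact: L2Z.
rewrite -bprojDZ; [|exact: mul_L2..]; congr bproj; apply/funext => z.
by rewrite !fctE mulrDr; congr (_ + _); rewrite /GRing.scale/= mulrCA.
Qed.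

Lemma ip_toeplitz u v : L2 u -> H v -> ip (toeplitz phi f u) v = ip (fun z => f z * u z) v.
Proof. by move=> Lu Hv; rewrite toeplitzE// ip_bproj//; exact: mul_L2. Qed.

Lemma hnorm_mono u v : L2 u -> L2 v -> (forall z, nc (v z) <= nc (u z)) ->
  hnorm ip v <= hnorm ip u.
Proof.
move=> Lu Lv uv; rewrite !hnorm_sqn ler_sqrt ?sqn_ge0//.
rewrite -lee_fin -!sqnE//; apply: ge0_le_integral => //.
- by move=> t _; rewrite lee_fin (mulr_ge0 (sqr_ge0 _) (gw_ge0 _)).
- by apply/measurable_EFinP; apply: measurable_sqn; case: ((L2P v).1 Lv).
- by apply/measurable_EFinP; apply: measurable_sqn; case: ((L2P u).1 Lu).
- by move=> t _; rewrite lee_fin ler_wpM2r ?gw_ge0// ler_pXn2r ?nnegrE ?nc_ge0.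
Qed.

Lemma hnorm_toeplitz u : 0 <= B -> L2 u -> hnorm ip (toeplitz phi f u) <= B * hnorm ip u.
Proof.
move=> B0 Lu; have Lfu := mul_L2 Lu; rewrite toeplitzE//; apply: (le_trans (hnorm_bproj Lfu)).
have := phnZ L2_prehilbert B%:C Lu; rewrite ncR ger0_norm// => <-.
apply: hnorm_mono => //; first exact: L2Z.
by move=> z; rewrite /= fctE /GRing.scale/= !ncM ncR ger0_norm// ler_wpM2r ?nc_ge0.
Qed.

End Symbol.
End Toeplitz.

(** * Limits of integrals *)

Section Limits.
Context {d : measure_display} {T : measurableType d} {R : realType}.
Variable mu : {measure set T -> \bar R}.

Lemma fatou_bound (f_ : nat -> T -> R) (f : T -> R) (M : R) :
  (forall k, measurable_fun setT (f_ k)) -> (forall k t, 0 <= f_ k t) ->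
  (forall t, f_ k t @[k --> \oo] --> f t) ->
  (forall k, (\int[mu]_t (f_ k t)%:E <= M%:E)%E) -> (\int[mu]_t (f t)%:E <= M%:E)%E.
Proof.
move=> mf f0 ff fM.
have := @fatou _ _ _ mu setT measurableT (fun k t => (f_ k t)%:E)
  (fun k => (measurable_EFinP _ _).2 (mf k)) (fun k t _ => f0 k t).
rewrite (eq_integral (fun t => (f t)%:E)); last first.
  by move=> t _; apply: (cvg_limn_einf_sup _).1; apply: cvg_EFin; [exact: nearW|exact: ff].
move=> /le_trans; apply; rewrite limn_einf_lim; apply: lime_le; first exact: is_cvg_einfs.
apply: nearW => k; apply: le_trans (fM k); apply: ereal_inf_lbound => /=; exists k => //=.
Qed.

Lemma dominated_Rcvg (f_ : nat -> T -> R) (f g : T -> R) :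
  (forall k, measurable_fun setT (f_ k)) -> mu.-integrable setT (EFin \o g) ->
  (forall k t, `|f_ k t| <= g t) -> (forall t, f_ k t @[k --> \oo] --> f t) ->
  (\int[mu]_t f_ k t)%R @[k --> \oo] --> (\int[mu]_t f t)%R.
Proof.
move=> mf ig fg ff; have mff := measurable_fun_cvg mf (fun t _ => ff t).
have f1 : {ae mu, forall t, setT t -> (f_ k t)%:E @[k --> \oo] --> (f t)%:E}.
  by apply: aeW => t _; apply: cvg_EFin; [exact: nearW|exact: ff].
have f2 : {ae mu, forall t k, setT t -> (`|(f_ k t)%:E| <= (g t)%:E)%E}.
  by apply: aeW => t k _; rewrite lee_fin.
have [i1 _ c1] := dominated_convergence measurableT (fun k => (measurable_EFinP _ _).2 (mf k))
  ((measurable_EFinP _ _).2 mff) f1 ig f2.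
by apply: fine_cvg; rewrite /Rintegral fineK//; exact: (integrable_fin_num measurableT i1).
Qed.

End Limits.

Lemma homo_ltn_geq (h : nat -> nat) k : {homo h : i j / (i < j)%N} -> (k <= h k)%N.
Proof. by move=> hh; elim: k => // k IH; apply: (leq_ltn_trans IH); apply: hh. Qed.

Lemma cvg0_mul (R : realType) (a : nat -> R) (c : R) :
  a k @[k --> \oo] --> (0 : R) -> a k * c @[k --> \oo] --> (0 : R).
Proof. by move=> ca; rewrite -[X in _ --> X](mul0r c); apply: cvgM => //; exact: cvg_cst. Qed.

(** * Diagonal extraction of subsequences *)

Section Diagonal.
Context {R : realType}.

Lemma bounded_subsequence (a : nat -> R) : (exists M, forall k, `|a k| <= M) ->
  exists h : nat -> nat, {homo h : i j / (i < j)%N} /\ cvgn (a \o h).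
Proof.
move=> [M aM]; have [|h hh ch] := @bolzano_weierstrass R a.
  by exists M; split; [exact: num_real|move=> x Mx k _; apply: (le_trans (aM k)); exact: ltW].
exists h; split => // i j ij; rewrite ltnNge; apply/negP.
by have := hh j i; rewrite !leEnat => ->; rewrite leqNgt ij.
Qed.

(** Each [G j.+1] is a subsequence of [G j] along which the j-th bounded sequence converges. By
    [tail], the diagonal k |-> G k k is eventually a subsequence of every [G j.+1]. *)
Lemma diagonal_subsequence (I : countType) (a : I -> nat -> R) :
  (forall i, exists M, forall k, `|a i k| <= M) ->
  exists D : nat -> nat, {homo D : i j / (i < j)%N} /\ forall i, cvgn (a i \o D).
Proof.
move=> ab; pose b j k := if choice.unpickle j is Some i then a i k else 0.
have bb j : exists M, forall k, `|b j k| <= M.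
  rewrite /b; case: (choice.unpickle j) => [i|]; first exact: ab.
  by exists 0 => k; rewrite normr0.
have /choice[F HF] : forall p : (nat -> nat) * nat, exists h : nat -> nat,
    {homo h : i j / (i < j)%N} /\ cvgn ((b p.2 \o p.1) \o h).
  by move=> [g j]; apply: bounded_subsequence; have [M bM] := bb j; exists M => k; exact: bM.
pose G := fix G j : nat -> nat := if j is j'.+1 then G j' \o F (G j', j') else id.
have GS j : G j.+1 = G j \o F (G j, j) by [].
have Gh j : {homo G j : i j / (i < j)%N}.
  by elim: j => // j IH x y xy; rewrite GS /=; apply: IH; apply: (HF _).1.
have tail j k : (j <= k)%N -> exists e, {homo e : i j / (i < j)%N} /\ G k = G j \o e.
  elim: k => [|k IH]; first by rewrite leqn0 => /eqP ->; exists id; split.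
  rewrite leq_eqVlt => /orP[/eqP ->|/IH[e [eh Ge]]]; first by exists id; split.
  exists (e \o F (G k, k)); split; last by rewrite GS {1}Ge.
  by move=> x y xy /=; apply: eh; apply: (HF _).1.
exists (fun k => G k k); split.
  apply: homo_ltn => [|k]; first exact: ltn_trans.
  rewrite GS /=; apply: Gh; apply: (@leq_trans k.+1) => //.
  exact: homo_ltn_geq (HF _).1.
move=> i; have [_ /cvg_ex[/= l cl]] := HF (G (choice.pickle i), choice.pickle i).
apply/cvg_ex; exists l; apply/cvgrPdist_lt => e e0.
have /cvgrPdist_lt/(_ _ e0)[N _ HN] := cl.
exists (maxn N (choice.pickle i).+1) => // k /=; rewrite geq_max => /andP[Nk ik].
have [g [gh Gg]] := tail _ _ ik.
have := HN (g k) (leq_trans Nk (homo_ltn_geq k gh)).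
by rewrite /= /b choice.pickleK Gg GS.
Qed.

Lemma equicontinuous_cvg (Z I : Type) (a : Z -> nat -> R) (q : I -> Z) (z : Z) :
  (forall i, cvgn (a (q i))) ->
  (forall e, 0 < e -> exists i, forall k, `|a z k - a (q i) k| <= e) -> cvgn (a z).
Proof.
move=> ac ae; apply/cauchy_cvgP; apply/cauchy_exP => e e0.
have e2 : 0 < e / 2 by rewrite divr_gt0.
have [i Hi] := ae _ e2; exists (lim (a (q i) @ \oo)).
have /cvgrPdist_lt/(_ _ e2)[N _ HN] := ac i.
exists N => // k /HN /=; rewrite /ball /= => h; have := Hi k; rewrite distrC => h'.
rewrite -(subrKA (a (q i) k)); apply: (le_lt_trans (ler_normD _ _)); lra.
Qed.

End Diagonal.

(** * Compactness of Toeplitz operators *)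

Lemma rat_dense (R : realType) (x e : R) : 0 < e -> exists q : rat, `|ratr q - x| < e.
Proof.
move=> e0; have h : x - e < x + e by lra.
have [q] := rat_in_itvoo h; rewrite in_itv/= => /andP[h1 h2]; exists q.
by rewrite ltr_norml; apply/andP; split; lra.
Qed.

Section ToeplitzCompact.
Context {R : realType} {n : nat}.
Local Open Scope complex_scope.
Local Notation CV := 'rV[R[i]]_n.
Local Notation X := (Rtuple R (n + n)).
Local Notation leb := (@lebesgue_tuple R (n + n)).
Local Notation phi := (@fock_weight R n).
Local Notation L2 := (L2 phi).
Local Notation ip := (L2ip phi).
Local Notation hn := (hnorm ip).
Local Notation H := (F2 phi).
Local Notation K := (@rker R n).
Implicit Types (u v g : CV -> R[i]^o).

Lemma nc_reproducing u z : H u -> nc (u z) <= hn u * hn (K z).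
Proof. by move=> Hu; rewrite (reproducing z Hu); exact: (cauchy_schwarz F2_prehilbert Hu (K_H z)). Qed.

Lemma sq_K (z : CV) : sqnorm ip (K z) = (pi ^+ n)^-1 * expR (ns z).
Proof.
by rewrite /sqnorm -(reproducing z (K_H z)) /rker dotzz cReM /= mul0r subr0 cos0 mulr1.
Qed.

Lemma hn_K (z : CV) : hn (K z) = Num.sqrt (pi ^+ n)^-1 * expR (ns z / 2).
Proof.
apply/eqP; rewrite -(eqrXn2 (n := 2)) ?hnorm_ge0 ?mulr_ge0 ?sqrtr_ge0 ?expR_ge0//.
rewrite (hnorm_sqr F2_prehilbert) ?sq_K; last exact: K_H.
rewrite exprMn sqr_sqrtr ?(ltW pin_gt0)// -expRM_natl; apply/eqP; congr (_ * expR _).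
by field.
Qed.

Lemma sq_K_sub (z w : CV) : sqnorm ip (K w - K z) <=
  (pi ^+ n)^-1 * `|expR (ns w) - expR (ns z)| + 2 * nc (K z w - K z z).
Proof.
have [Hw Hz] := (K_H w, K_H z); have Hd := phB F2_prehilbert Hw Hz.
rewrite /sqnorm (ip_Br F2_prehilbert)// -!reproducing// !fctE.
have E (x : CV) : K x x = ((pi ^+ n)^-1 * expR (ns x))%:C.
  by rewrite /rker dotzz cexpR cRM.
have -> : K w w - K z w - (K w z - K z z) = (((pi ^+ n)^-1 * expR (ns w))%:C - ((pi ^+ n)^-1 * expR (ns z))%:C) - (K z w - K z z) - (K z w - K z z)^*%C.
  by rewrite cJD cJN -(KC w z) conjcK (KC z z) -!E; ring.
apply: (le_trans (ler_norm _)); apply: (le_trans (nc_Re _)).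
apply: (le_trans (ncB _ _)); rewrite ncJ.
apply: (le_trans (lerD (ncB _ _) (lexx _))).
rewrite -rmorphB/= ncR -mulrBr normrM (ger0_norm (ltW pin_gt0)); lra.
Qed.

Lemma ns_dist (z : CV) (e : R) : 0 < e -> exists2 de : R, 0 < de &
  forall y : CV, (forall j, nc (y 0 j - z 0 j) < de) -> `|ns y - ns z| < e.
Proof.
move=> e0; pose S := 1 + \sum_j (2 * nc (z 0 j) + 1).
have S0 : 0 < S by rewrite ltr_pwDl// sumr_ge0// => j _; rewrite addr_ge0// mulr_ge0// nc_ge0.
exists (Num.min 1 (e / S)); first by rewrite lt_min ltr01 divr_gt0.
move=> y hy; rewrite /ns -sumrB; apply: (le_lt_trans (ler_norm_sum _ _ _)).
have d0 : 0 < Num.min 1 (e / S) by rewrite lt_min ltr01 divr_gt0.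
apply: (@le_lt_trans _ _ (\sum_j Num.min 1 (e / S) * (2 * nc (z 0 j) + 1))).
  apply: ler_sum => j _; have := hy j; rewrite lt_min => /andP[h1 h2].
  have h3 : nc (y 0 j - z 0 j) <= Num.min 1 (e / S) by rewrite ltW.
  have h4 : `|nc (y 0 j) - nc (z 0 j)| <= nc (y 0 j - z 0 j).
    rewrite ler_norml; have := nc_le_dist (y 0 j) (z 0 j); have := nc_le_dist (z 0 j) (y 0 j).
    by rewrite [nc (z 0 j - _)]nc_dist => k1 k2; apply/andP; split; lra.
  rewrite subr_sqr normrM ler_pM ?(le_trans h4)//.
  have := nc_ge0 (y 0 j); have := nc_ge0 (z 0 j); have := nc_le_dist (y 0 j) (z 0 j) => k0 k1 k2.
  by rewrite ger0_norm ?addr_ge0//; lra.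
rewrite -mulr_sumr; apply: (@lt_le_trans _ _ (Num.min 1 (e / S) * S)).
  by rewrite ltr_pM2l// /S ltrDr.
by rewrite -ler_pdivlMr// ge_min lexx orbT.
Qed.

(** Norm continuity of z |-> K z. By the reproducing formula it is a modulus of continuity shared by
    all elements of a bounded subset of [F2]. *)
Lemma K_dist (z : CV) (e : R) : 0 < e -> exists2 de : R, 0 < de &
  forall y : CV, (forall j, nc (y 0 j - z 0 j) < de) -> hn (K z - K y) <= e.
Proof.
move=> e0; have e2 : 0 < e ^+ 2 / 4 by rewrite divr_gt0// exprn_gt0.
pose c : R := (pi ^+ n)^-1; have c0 : 0 < c := pin_gt0.
have [d1 d10 H1] := entire_cont z (@K_entire R n z) e2.
have ec : 0 < e ^+ 2 / (2 * c) by rewrite divr_gt0 ?exprn_gt0// mulr_gt0.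
have /cvgrPdist_lt/(_ _ ec) := @continuous_expR R (ns z).
move=> /nbhs_normP[d2/= d20 H2]; have [d3 d30 H3] := ns_dist z d20.
exists (Num.min d1 d3); first by rewrite lt_min d10.
move=> y hy; have Hd := phB F2_prehilbert (K_H z) (K_H y).
have h1 : nc (K z y - K z z) < e ^+ 2 / 4 by apply: H1 => j; have := hy j; rewrite lt_min => /andP[].
have h2 : `|expR (ns z) - expR (ns y)| < e ^+ 2 / (2 * c).
  by apply: H2; rewrite /= distrC; apply: H3 => j; have := hy j; rewrite lt_min => /andP[].
apply: (hnorm_le F2_prehilbert) => //; first exact: ltW.
have -> : sqnorm ip (K z - K y) = sqnorm ip (K y - K z).
  by rewrite -(sqN F2_prehilbert) ?opprB//; exact: (phB F2_prehilbert (K_H y) (K_H z)).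
apply: (le_trans (sq_K_sub z y)).
have h3 : c * `|expR (ns y) - expR (ns z)| <= e ^+ 2 / 2.
  rewrite distrC; apply: (@le_trans _ _ (c * (e ^+ 2 / (2 * c)))); first by rewrite ler_pM2l// ltW.
  by rewrite le_eqVlt; apply/orP; left; apply/eqP; field; rewrite gt_eqF.
rewrite -/c; lra.
Qed.

Lemma nc_reproducing_sub u (z w : CV) : H u -> nc (u z - u w) <= hn u * hn (K z - K w).
Proof.
move=> Hu; rewrite (reproducing z Hu) (reproducing w Hu) -(ip_Br F2_prehilbert (K_H z) (K_H w) Hu).
exact: (cauchy_schwarz F2_prehilbert Hu (phB F2_prehilbert (K_H z) (K_H w))).
Qed.

Definition ratpt (q : 'rV[rat * rat]_n) : CV := \row_j (ratr (q 0 j).1 +i* ratr (q 0 j).2).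

Lemma ratpt_dense (z : CV) (e : R) : 0 < e -> exists q, forall j, nc (ratpt q 0 j - z 0 j) < e.
Proof.
move=> e0; have e2 : 0 < e / 2 by rewrite divr_gt0.
have /choice[q Hq] : forall j, exists q : rat * rat,
    `|ratr q.1 - complex.Re (z 0 j)| < e / 2 /\ `|ratr q.2 - complex.Im (z 0 j)| < e / 2.
  move=> j; have [q1 h1] := rat_dense (complex.Re (z 0 j)) e2.
  by have [q2 h2] := rat_dense (complex.Im (z 0 j)) e2; exists (q1, q2).
exists (\row_j q j) => j; rewrite !mxE; apply: (le_lt_trans (nc_leRI _)).
have [h1 h2] := Hq j; rewrite cReD cImD cReN cImN/=; lra.
Qed.

(* Pointwise convergence of a subsequence on a countable dense set propagates to all points,
   as bounded sequences of F2 are equicontinuous by the reproducing formula. *)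
Lemma pointwise_subsequence (u : nat -> (CV -> R[i]^o)) (M : R) :
  (forall k, H (u k)) -> (forall k, hn (u k) <= M) ->
  exists (h : nat -> nat) (v : CV -> R[i]^o), {homo h : k l / (k < l)%N} /\
    forall z, complex.Re (u (h k) z) @[k --> \oo] --> complex.Re (v z) /\
              complex.Im (u (h k) z) @[k --> \oo] --> complex.Im (v z).
Proof.
move=> Hu uM; have M0 : 0 <= M := le_trans (hnorm_ge0 ip (u 0%N)) (uM 0%N).
pose part (b : bool) (x : R[i]) : R := if b then complex.Re x else complex.Im x.
have part_le b x y : `|part b x - part b y| <= nc (x - y).
  by case: b; rewrite /part; [have := nc_Re (x - y)|have := nc_Im (x - y)];
    rewrite ?cReD ?cReN ?cImD ?cImN.
have bnd b z k : `|part b (u k z)| <= M * hn (K z).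
  apply: (@le_trans _ _ (nc (u k z))); first by case: b; [exact: nc_Re|exact: nc_Im].
  by apply: (le_trans (nc_reproducing z (Hu k))); rewrite ler_wpM2r// hnorm_ge0.
pose a (i : 'rV[rat * rat]_n * bool) k := part i.2 (u k (ratpt i.1)).
have [|h [hh ha]] := @diagonal_subsequence R _ a.
  by move=> i; exists (M * hn (K (ratpt i.1))) => k; exact: bnd.
have cz b z : cvgn (fun k => part b (u (h k) z)).
  apply: (@equicontinuous_cvg R CV 'rV[rat * rat]_n (fun z k => part b (u (h k) z)) ratpt z) => [q|e e0].
    exact: ha (q, b).
  have M1 : 0 < M + 1 by rewrite ltr_wpDl.
  have [de de0 Hd] := K_dist z (divr_gt0 e0 M1).
  have [q Hq] := ratpt_dense z de0; exists q => k.
  apply: (le_trans (part_le _ _ _)); apply: (le_trans (nc_reproducing_sub _ _ (Hu _))).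
  have h1 := Hd _ Hq.
  apply: (le_trans (ler_pM (hnorm_ge0 _ _) (hnorm_ge0 _ _) (uM _) h1)).
  by rewrite mulrCA ger_pMr// ler_pdivrMr// mul1r lerDl.
exists h, (fun z => lim (part true (u (h k) z) @[k --> \oo]) +i* lim (part false (u (h k) z) @[k --> \oo])).
by split => // z; split; [exact: (cz true z)|exact: (cz false z)].
Qed.

Lemma hnK_dom (z : CV) : leb.-integrable setT (EFin \o (fun t => sqrt_gw t * nc (K z (pt t)))).
Proof.
(* The root of the weight contributes e^(-s/2) and the kernel at most e^(s/8), where s is
   [ns (pt t)]; the product e^(-3s/8) is the Gaussian with c^2 = 8/3. *)
have s0 : 0 < Num.sqrt (8 / 3) :> R by rewrite sqrtr_gt0.
have := integrableZl measurableT ((pi ^+ n)^-1 * expR (2 * ns z)) (gauss_integrable (n := n) s0).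
apply: le_integrable => //.
  apply/measurable_EFinP; apply: measurable_funM.
    apply: measurableT_comp => //; apply: measurableT_comp => //.
    by apply: measurable_funM => //; exact: measurable_ns.
  by apply: cmeas_nc; exact: entire_cmeas (@K_entire _ _ z).
move=> t _ /=; rewrite lee_fin !ger0_norm ?mulr_ge0 ?expR_ge0 ?nc_ge0 ?(ltW pin_gt0)//.
rewrite nc_K mulrCA -mulrA ler_pM2l ?pin_gt0// /sqrt_gw -!expRD ler_expR sqr_sqrtr//.
have := Re_dot_le z (pt t); rewrite dotJ cReJ.
have -> : ns (pt t) / (8 / 3) = 3 / 8 * ns (pt t) by field.
lra.
Qed.

Lemma cvg_nc_sqr (a : nat -> R[i]) (l : R[i]) :
  complex.Re (a k) @[k --> \oo] --> complex.Re l -> complex.Im (a k) @[k --> \oo] --> complex.Im l ->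
  nc (a k) ^+ 2 @[k --> \oo] --> nc l ^+ 2.
Proof.
move=> cr ci; rewrite nc_sqr.
under eq_fun do rewrite nc_sqr.
by apply: cvgD; under eq_fun do rewrite expr2; rewrite expr2; apply: cvgM.
Qed.

(** Fatou's lemma puts [v] in [L2]. The bound |u_k(w)| <= M |K w| dominates the reproducing
    integrals, so the formula passes to the limit and v = bproj v, which makes [v] holomorphic
    without any local uniform convergence. *)
Lemma pointwise_limit_F2 (u : nat -> (CV -> R[i]^o)) (v : CV -> R[i]^o) (M : R) :
  (forall k, H (u k)) -> (forall k, hn (u k) <= M) ->
  (forall z, complex.Re (u k z) @[k --> \oo] --> complex.Re (v z) /\
             complex.Im (u k z) @[k --> \oo] --> complex.Im (v z)) -> H v.
Proof.
move=> Hu uM uv; have M0 : 0 <= M := le_trans (hnorm_ge0 ip (u 0%N)) (uM 0%N).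
have mu k : cmeas (fun t => u k (pt t)) by have [] := (L2P (u k)).1 (F2_L2 (Hu k)).
have mv : cmeas (fun t => v (pt t)).
  split.
    by apply: (measurable_fun_cvg (h := fun k t => complex.Re (u k (pt t)))) => [k|t _]; [case: (mu k)|case: (uv (pt t))].
  by apply: (measurable_fun_cvg (h := fun k t => complex.Im (u k (pt t)))) => [k|t _]; [case: (mu k)|case: (uv (pt t))].
have Lv : L2 v.
  apply/L2P; split => //; apply: (@le_lt_trans _ _ (M ^+ 2)%:E); last exact: ltry.
  apply: (fatou_bound (f_ := fun k t => nc (u k (pt t)) ^+ 2 * gw (pt t))).
  - by move=> k; exact: measurable_sqn.
  - by move=> k t; rewrite (mulr_ge0 (sqr_ge0 _) (gw_ge0 _)).
  - move=> t; apply: cvgM; last exact: cvg_cst.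
    by have [c1 c2] := uv (pt t); exact: cvg_nc_sqr.
  - move=> k; rewrite sqnE ?lee_fin; last exact: F2_L2.
    have := sq_le F2_prehilbert (Hu k) (uM k); by rewrite /sqnorm ip_sqn.
suff -> : v = bproj v by exact: bproj_H.
apply/funext => z; rewrite /bproj ipE.
pose F k t := u k (pt t) * (K z (pt t))^*%C * (gw (pt t))%:C.
pose G t := v (pt t) * (K z (pt t))^*%C * (gw (pt t))%:C.
have mKg : cmeas (fun t => (K z (pt t))^*%C * (gw (pt t))%:C).
  apply: cmeasM; last by apply: cmeasR; exact: measurable_gw.
  by apply: cmeasJ; exact: entire_cmeas (@K_entire _ _ z).
have mF k : cmeas (F k).
  by have := cmeasM (mu k) mKg; congr cmeas; apply/funext => t; rewrite /F mulrA.
have ncF k t : nc (F k t) <= M * Num.sqrt (pi ^+ n)^-1 * (sqrt_gw t * nc (K z (pt t))).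
  rewrite /F ncM ncM ncJ ncR (ger0_norm (gw_ge0 _)).
  have h1 : nc (u k (pt t)) <= M * (Num.sqrt (pi ^+ n)^-1 * expR (ns (pt t) / 2)).
    apply: (le_trans (nc_reproducing _ (Hu k))); rewrite hn_K ler_wpM2r//.
  have h2 : expR (ns (pt t) / 2) * gw (pt t) = sqrt_gw t.
    by rewrite /gw /sqrt_gw -expRD; congr expR; field.
  rewrite -h2; apply: (le_trans (ler_wpM2r (gw_ge0 _) (ler_wpM2r (nc_ge0 _) h1))).
  by rewrite le_eqVlt; apply/orP; left; apply/eqP; ring.
have idom := integrableZl measurableT (M * Num.sqrt (pi ^+ n)^-1) (hnK_dom z).
have cF t : complex.Re (F k t) @[k --> \oo] --> complex.Re (G t) /\
            complex.Im (F k t) @[k --> \oo] --> complex.Im (G t).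
  have [c1 c2] := uv (pt t).
  pose c := (K z (pt t))^*%C * (gw (pt t))%:C.
  have FE k : F k t = u k (pt t) * c by rewrite /F /c mulrA.
  have GE : G t = v (pt t) * c by rewrite /G /c mulrA.
  rewrite GE; split.
    rewrite (_ : (fun k => complex.Re (F k t)) = fun k => complex.Re (u k (pt t)) * complex.Re c - complex.Im (u k (pt t)) * complex.Im c).
      by rewrite (cReM (v (pt t)) c); apply: cvgB; apply: cvgM => //; exact: cvg_cst.
    by apply/funext => k; rewrite FE (cReM _ c).
  rewrite (_ : (fun k => complex.Im (F k t)) = fun k => complex.Re (u k (pt t)) * complex.Im c + complex.Im (u k (pt t)) * complex.Re c).
    by rewrite (cImM (v (pt t)) c); apply: cvgD; apply: cvgM => //; exact: cvg_cst.
  by apply/funext => k; rewrite FE (cImM _ c).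
have [c1 c2] := uv z.
have E k : u k z = cint leb (F k) by rewrite (reproducing z (Hu k)) ipE.
apply: eq_creim.
- have := @dominated_Rcvg _ _ _ leb (fun k t => complex.Re (F k t)) (fun t => complex.Re (G t)) _
    (fun k => (mF k).1) idom (fun k t => le_trans (nc_Re _) (ncF k t)) (fun t => (cF t).1).
  have -> : (fun k => \int[leb]_t complex.Re (F k t)) = (fun k => complex.Re (u k z)).
    by apply/funext => k; rewrite E.
  move=> /(cvg_lim (@Rhausdorff R)) cl; exact: etrans (esym (cvg_lim (@Rhausdorff R) c1)) cl.
- have := @dominated_Rcvg _ _ _ leb (fun k t => complex.Im (F k t)) (fun t => complex.Im (G t)) _
    (fun k => (mF k).2) idom (fun k t => le_trans (nc_Im _) (ncF k t)) (fun t => (cF t).2).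
  have -> : (fun k => \int[leb]_t complex.Im (F k t)) = (fun k => complex.Im (u k z)).
    by apply/funext => k; rewrite E.
  move=> /(cvg_lim (@Rhausdorff R)) cl; exact: etrans (esym (cvg_lim (@Rhausdorff R) c2)) cl.
Qed.

Section Decay.
Variables (f : CV -> R[i]) (B : R).
Hypotheses (mf : cmeas (fun t => f (pt t))) (fB : forall z, nc (f z) <= B) (B0 : 0 <= B).

Definition fconj (z : CV) := (f z)^*%C.

Lemma toeplitz_adj u v : H u -> H v -> ip (toeplitz phi f u) v = ip u (toeplitz phi fconj v).
Proof.
move=> Hu Hv; have [Lu Lv] := (F2_L2 Hu, F2_L2 Hv).
have mfc : cmeas (fun t => fconj (pt t)) by exact: cmeasJ.
have fBc z : nc (fconj z) <= B by rewrite ncJ.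
rewrite (ip_toeplitz mf fB)//.
have Lc := toeplitz_H mfc fBc Lv.
rewrite (ipJ Lu (F2_L2 Lc)) (ip_toeplitz mfc fBc)//.
have Lfv := mul_L2 mfc fBc Lv.
rewrite -(ipJ Lu Lfv) !ipE; apply: eq_cint => t.
by rewrite cJM conjcK; ring.
Qed.

Hypothesis f0 : forall e : R, 0 < e -> exists rho : R, forall z, rho <= ns z -> nc (f z) <= e.

(** For w_k = u_k - v, tending to 0 pointwise along the subsequence, the image is controlled by the
    norm of f w_k. Outside a large ball [f] is small; inside it, the bound [wb] on the density of
    w_k allows dominated convergence. *)
Lemma toeplitz_compact : compact_operator H ip (toeplitz phi f).
Proof.
have mfc : forall u, H u -> L2 (fun z => f z * u z) by move=> u /F2_L2 Lu; exact: (mul_L2 mf fB).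
split; [by move=> u /F2_L2; exact: (toeplitz_H mf fB)| |].
  by move=> a u v /F2_L2 Lu /F2_L2 Lv; exact: (toeplitz_lin mf fB).
move=> u Hu [M uM]; have M0 : 0 <= M := le_trans (hnorm_ge0 ip (u 0%N)) (uM 0%N).
have [h [v [hh uv]]] := pointwise_subsequence Hu uM.
have Hv : H v := pointwise_limit_F2 (fun k => Hu (h k)) (fun k => uM (h k)) uv.
exists h, (toeplitz phi f v); split => //; first exact: (toeplitz_H mf fB (F2_L2 Hv)).
pose w k := u (h k) - v; have Hw k : H (w k) := phB F2_prehilbert (Hu _) Hv.
pose M' := M + hn v.
have wM k : hn (w k) <= M'.
  by apply: (le_trans (phnB F2_prehilbert (Hu _) Hv)); rewrite lerD2r.
have M'0 : 0 <= M' := le_trans (hnorm_ge0 ip (w 0%N)) (wM 0%N).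
have mw k : cmeas (fun t => w k (pt t)) by have [] := (L2P (w k)).1 (F2_L2 (Hw k)).
have E k : hn (toeplitz phi f (u (h k)) - toeplitz phi f v) <= hn (fun z => f z * w k z).
  have := toeplitz_lin mf fB (-1) (F2_L2 Hv) (F2_L2 (Hu (h k))).
  rewrite !scaleN1r ![- _ + _]addrC => <-; rewrite (toeplitzE mf fB (F2_L2 (Hw k))).
  exact: (hnorm_bproj (mfc _ (Hw k))).
have w0 t : nc (w k (pt t)) ^+ 2 @[k --> \oo] --> (0 : R).
  have [c1 c2] := uv (pt t); rewrite -[X in _ --> X](expr0n R 2) -[X in X ^+ 2]nc0 -[X in nc X](subrr (v (pt t))).
  by apply: cvg_nc_sqr; rewrite ?cReD ?cImD ?cReN ?cImN; under eq_fun do rewrite /w !fctE ?cReD ?cImD ?cReN ?cImN;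
    apply: cvgB => //; exact: cvg_cst.
have wb k t : nc (w k (pt t)) ^+ 2 * gw (pt t) <= M' ^+ 2 * (pi ^+ n)^-1.
  have h1 : nc (w k (pt t)) <= M' * hn (K (pt t)).
    by apply: (le_trans (nc_reproducing _ (Hw k))); rewrite ler_wpM2r ?hnorm_ge0.
  have h2 : nc (w k (pt t)) ^+ 2 <= (M' * hn (K (pt t))) ^+ 2.
    by rewrite ler_pXn2r ?nnegrE ?nc_ge0// mulr_ge0 ?hnorm_ge0.
  apply: (le_trans (ler_wpM2r (gw_ge0 _) h2)).
  rewrite exprMn (hnorm_sqr F2_prehilbert (K_H (pt t))) sq_K -!mulrA ler_wpM2l ?sqr_ge0//.
  by rewrite /gw -expRD subrr expR0 mulr1.
apply/cvgrPdist_le => e e0; pose e1 := e / 2 / (M' + 1).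
have M1 : 0 < M' + 1 by rewrite ltr_wpDl.
have e10 : 0 < e1 by rewrite !divr_gt0.
have [rho Hrho] := f0 e10.
(* The factor e^rho e^(-ns) is at least 1 where ns <= rho, so it replaces the indicator of the ball,
   and it makes the uniformly bounded densities of w_k integrable. *)
pose a k (t : X) := nc (w k (pt t)) ^+ 2 * gw (pt t) * (expR rho * gw (pt t)).
have a0 k t : 0 <= a k t.
  by rewrite /a (mulr_ge0 (mulr_ge0 (sqr_ge0 _) (gw_ge0 _)) (mulr_ge0 (expR_ge0 _) (gw_ge0 _))).
have ma k : measurable_fun setT (a k).
  apply: measurable_funM; first exact: measurable_sqn.
  by apply: measurable_funM => //; exact: measurable_gw.
have igw : leb.-integrable setT (EFin \o (fun t => gw (pt t))).
  have := gauss_integrable (n := n) (@ltr01 R); apply: eq_integrable => // t _.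
  by rewrite /= expr1n divr1.
have idom := integrableZl measurableT (M' ^+ 2 * (pi ^+ n)^-1 * expR rho) igw.
have adom k t : `|a k t| <= M' ^+ 2 * (pi ^+ n)^-1 * expR rho * gw (pt t).
  rewrite ger0_norm// /a -[leRHS]mulrA ler_wpM2r//.
  exact: mulr_ge0 (expR_ge0 _) (gw_ge0 _).
have ia k : leb.-integrable setT (EFin \o a k).
  apply: le_integrable idom => //; first exact/measurable_EFinP.
  by move=> t _; rewrite lee_fin; exact: le_trans (adom k t) (ler_norm _).
have ca t : a k t @[k --> \oo] --> (0 : R).
  exact: (cvg0_mul (expR rho * gw (pt t)) (cvg0_mul (gw (pt t)) (w0 t))).
have := dominated_Rcvg ma idom adom ca.
have -> : \int[leb]_t (0 : R) = 0 by rewrite /Rintegral integral0.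
have B1 : 0 < B ^+ 2 + 1 by rewrite ltr_wpDl// sqr_ge0.
have e2 : 0 < e ^+ 2 / 2 / (B ^+ 2 + 1) by rewrite !divr_gt0// exprn_gt0.
move=> /cvgrPdist_lt/(_ _ e2); apply: filterS => k.
have Ia : 0 <= \int[leb]_t a k t by apply: Rintegral_ge0.
rewrite !sub0r !normrN (ger0_norm Ia) (ger0_norm (hnorm_ge0 _ _)) => ak.
apply: (le_trans (E k)); apply: (hnorm_le L2_prehilbert (mfc _ (Hw k)) (ltW e0)).
rewrite /sqnorm ip_sqn /=.
have Lw := F2_L2 (Hw k); have iw := L2_integrable Lw.
have i1 := integrableZl measurableT (B ^+ 2) (ia k).
have i2 := integrableZl measurableT (e1 ^+ 2) iw.
have : sqn (fun z => f z * w k z) <= B ^+ 2 * (\int[leb]_t a k t) + e1 ^+ 2 * sqn (w k).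
  rewrite /sqn -(RintegralZl _ measurableT (ia k)) -(RintegralZl _ measurableT iw) -(RintegralD measurableT i1 i2).
  apply: le_Rintegral => //; first exact: (L2_integrable (mfc _ (Hw k))).
    exact: (integrableD measurableT i1 i2).
  move=> t _; rewrite ncM exprMn.
  have fBt := fB (pt t); have fn := nc_ge0 (f (pt t)).
  have wg := mulr_ge0 (sqr_ge0 (nc (w k (pt t)))) (gw_ge0 (pt t)).
  have [rt|tr] := leP rho (ns (pt t)).
    have fe := Hrho _ rt.
    have f2 : nc (f (pt t)) ^+ 2 <= e1 ^+ 2 by rewrite ler_pXn2r ?nnegrE// ltW.
    rewrite -mulrA; apply: (le_trans (ler_wpM2r wg f2)); rewrite lerDr.
    by rewrite mulr_ge0// sqr_ge0.
  have f2 : nc (f (pt t)) ^+ 2 <= B ^+ 2 by rewrite ler_pXn2r ?nnegrE.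
  have g1 : 1 <= expR rho * gw (pt t) by rewrite /gw -expRD -expR0 ler_expR subr_ge0 ltW.
  rewrite -mulrA; apply: (le_trans (ler_wpM2r wg f2)).
  apply: (@le_trans _ _ (B ^+ 2 * a k t)); last by rewrite lerDl mulr_ge0// sqr_ge0.
  by rewrite ler_wpM2l ?sqr_ge0// /a ler_peMr.
move=> /le_trans; apply.
have sw : sqn (w k) <= M' ^+ 2.
  by have := sq_le F2_prehilbert (Hw k) (wM k); rewrite /sqnorm ip_sqn.
have h1 : B ^+ 2 * (\int[leb]_t a k t) <= e ^+ 2 / 2.
  move: ak; rewrite ltr_pdivlMr// => ak.
  have := sqr_ge0 B; move: Ia ak; set I := (\int[leb]_t _); clear; nra.
have h2 : e1 ^+ 2 * sqn (w k) <= e ^+ 2 / 4.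
  apply: (le_trans (ler_wpM2l (sqr_ge0 _) sw)); rewrite -exprMn.
  have -> : e ^+ 2 / 4 = (e / 2) ^+ 2 by field.
  have n1 : e1 * M' \is Num.nneg by rewrite nnegrE mulr_ge0// ltW.
  have n2 : e / 2 \is Num.nneg by rewrite nnegrE divr_ge0// ltW.
  rewrite ler_pXn2r//.
  rewrite /e1 mulrAC ler_pdivrMr// ler_wpM2l ?divr_ge0 ?(ltW e0)// lerDl//.
have := sqr_ge0 e; lra.
Qed.

Lemma toeplitz_bounded_pair : bounded_pair H ip (toeplitz phi f) (toeplitz phi fconj) B.
Proof.
have mfc : cmeas (fun t => fconj (pt t)) by exact: cmeasJ.
have fBc z : nc (fconj z) <= B by rewrite ncJ.
split => //.
- exact: toeplitz_compact.
- by move=> u /F2_L2; exact: (toeplitz_H mfc fBc).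
- by move=> a u v /F2_L2 Lu /F2_L2 Lv; exact: (toeplitz_lin mfc fBc).
- exact: toeplitz_adj.
- by move=> u /F2_L2; exact: (hnorm_toeplitz mf fB).
Qed.

End Decay.
End ToeplitzCompact.

(** * Coherent states and eigenvalue counting *)

Section ToeplitzCount.
Context {R : realType} {n : nat}.
Local Open Scope complex_scope.
Local Notation CV := 'rV[R[i]]_n.
Local Notation X := (Rtuple R (n + n)).
Local Notation leb := (@lebesgue_tuple R (n + n)).
Local Notation phi := (@fock_weight R n).
Local Notation L2 := (L2 phi).
Local Notation ip := (L2ip phi).
Local Notation hn := (hnorm ip).
Local Notation H := (F2 phi).
Local Notation K := (@rker R n).
Implicit Types (u v g : CV -> R[i]^o).

Lemma bproj_id u : H u -> bproj u = u.
Proof. by move=> Hu; apply/funext => z; rewrite /bproj -reproducing. Qed.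

Definition coherent (z : CV) : CV -> R[i]^o := ((hn (K z))^-1)%:C *: K z.

Lemma hn_K_gt0 (z : CV) : 0 < hn (K z).
Proof. by rewrite hn_K mulr_gt0 ?expR_gt0// sqrtr_gt0 pin_gt0. Qed.

Lemma coherent_H (z : CV) : H (coherent z). Proof. exact: (phZ F2_prehilbert _ (K_H z)). Qed.

Lemma sq_coherent (z : CV) : sqnorm ip (coherent z) = 1.
Proof.
rewrite /coherent (sqZ F2_prehilbert _ (K_H z)) ncR ger0_norm ?invr_ge0 ?hnorm_ge0//.
by rewrite -(hnorm_sqr F2_prehilbert (K_H z)) -exprMn mulVf ?expr1n// gt_eqF// hn_K_gt0.
Qed.

Lemma hn_K_sqV (z : CV) : (hn (K z))^-1 ^+ 2 = pi ^+ n * gw z.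
Proof.
rewrite exprVn (hnorm_sqr F2_prehilbert (K_H z)) sq_K invfM invrK; congr (_ * _).
by rewrite -expRN.
Qed.

(** The density of a coherent state is the normalised Gaussian centred at [z]; this is why [osc] is
    a Gaussian mean around [z]. *)
Lemma nc_coherent (z w : CV) : nc (coherent z w) ^+ 2 * gw w = (pi ^+ n)^-1 * gw (w - z).
Proof.
rewrite /coherent fctE /GRing.scale/= ncM ncR ger0_norm ?invr_ge0 ?hnorm_ge0// exprMn hn_K_sqV.
rewrite nc_K exprMn -expRM_natl.
have -> : gw (w - z) = gw z * expR (2%:R * complex.Re (dot w z)) * gw w.
  by rewrite /gw -!expRD nsD nsN dotNr cReN; congr expR; ring.
by field; rewrite expf_neq0// gt_eqF// pi_gt0.
Qed.

(** Pairing with a coherent state is weighted evaluation. Integrating over [z] shows that coherent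
    states resolve pi^n times the identity, the source of the factor pi^n in the count. *)
Lemma ip_coherent (z : CV) u : H u -> nc (ip (coherent z) u) ^+ 2 = pi ^+ n * (nc (u z) ^+ 2 * gw z).
Proof.
move=> Hu; rewrite /coherent (ip_Zl F2_prehilbert _ (K_H z) Hu) ncM ncR ger0_norm ?invr_ge0 ?hnorm_ge0//.
rewrite exprMn hn_K_sqV (phJ F2_prehilbert (K_H z) Hu) ncJ -reproducing//; ring.
Qed.

(* The squared norm of [(f - f z) * coherent z], see [sqn_osc]. *)
Definition osc (f : CV -> R[i]) (z : CV) : R :=
  (pi ^+ n)^-1 * \int[leb]_t (nc (f (pt t + z) - f z) ^+ 2 * gw (pt t)).

Section Symbol.
Variables (f : CV -> R[i]) (B : R).
Hypotheses (mf : cmeas (fun t => f (pt t))) (fB : forall z, nc (f z) <= B) (B0 : 0 <= B).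

Lemma osc_ge0 z : 0 <= osc f z.
Proof.
rewrite /osc mulr_ge0 ?(ltW pin_gt0)//; apply: Rintegral_ge0 => t _.
exact: mulr_ge0 (sqr_ge0 _) (gw_ge0 _).
Qed.

Lemma sqn_osc z : sqn (fun w => (f w - f z) * coherent z w) = osc f z.
Proof.
have mS := mpres_ttrans z; rewrite /sqn /osc.
have mF : measurable_fun setT (fun t => nc (f (pt t) - f z) ^+ 2 * gw (pt t - z)).
  apply: measurable_funM.
    by apply: measurable_funX; apply: cmeas_nc; apply: cmeasB => //; exact: cmeas_cst.
  have := measurableT_comp (measurable_gw (R := R) (n := n)) (mpres_ttrans (- z)).1.
  by congr measurable_fun; apply/funext => t /=; rewrite pt_ttrans.
have i0 t : 0 <= nc (f (pt t) - f z) ^+ 2 * gw (pt t - z) := mulr_ge0 (sqr_ge0 _) (gw_ge0 _).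
transitivity ((pi ^+ n)^-1 * \int[leb]_t (nc (f (pt t) - f z) ^+ 2 * gw (pt t - z))).
  rewrite /Rintegral; transitivity (fine (\int[leb]_t ((pi ^+ n)^-1%:E * (nc (f (pt t) - f z) ^+ 2 * gw (pt t - z))%:E))%E).
    congr fine; apply: eq_integral => t _; rewrite -EFinM ncM exprMn -mulrA nc_coherent; congr EFin; ring.
  have mE : measurable_fun setT (fun t => (nc (f (pt t) - f z) ^+ 2 * gw (pt t - z))%:E) by exact/measurable_EFinP.
  have I0 : (0 <= \int[leb]_t (nc (f (pt t) - f z) ^+ 2 * gw (pt t - z))%:E)%E.
    by apply: integral_ge0 => t _; rewrite lee_fin i0.
  have -> : (\int[leb]_t ((pi ^+ n)^-1%:E * (nc (f (pt t) - f z) ^+ 2 * gw (pt t - z))%:E) =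
      (pi ^+ n)^-1%:E * \int[leb]_t (nc (f (pt t) - f z) ^+ 2 * gw (pt t - z))%:E)%E.
    apply: ge0_integralZl => //; last by rewrite lee_fin ltW// pin_gt0.
    by move=> t _; rewrite lee_fin i0.
  (* No finiteness is assumed: if the integral is infinite, [fine] returns 0 on both sides. *)
  move: I0; set I := integral _ _ _; case: I => [r| |]// _.
  by rewrite gt0_muley ?lte_fin ?pin_gt0//= mulr0.
apply: (congr1 (fun x => (pi ^+ n)^-1 * fine x)).
rewrite -(mpres_integral mS (f := fun t => (nc (f (pt t) - f z) ^+ 2 * gw (pt t - z))%:E)); last exact/measurable_EFinP.
by apply: eq_integral => t _; rewrite pt_ttrans addrK.
Qed.

(** The projection fixes [coherent z], so the difference is the projection of (f - f(z)) times the
    coherent state, and the projection does not increase norms. *)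
Lemma quasimode z : hn (toeplitz phi f (coherent z) - f z *: coherent z) <= Num.sqrt (osc f z).
Proof.
have Hc := coherent_H z; have Lc := F2_L2 Hc; have Lfc := mul_L2 mf fB Lc.
have -> : toeplitz phi f (coherent z) - f z *: coherent z = bproj (fun w => (f w - f z) * coherent z w).
  rewrite (toeplitzE mf fB Lc) -{2}(bproj_id Hc) addrC -scaleNr -(bprojDZ (- f z) Lc Lfc).
  by congr bproj; apply/funext => w; rewrite !fctE /GRing.scale/= mulrBl mulNr addrC.
rewrite -sqn_osc -hnorm_sqn; apply: hnorm_bproj.
have mg : cmeas (fun t => f (pt t) - f z) by apply: cmeasB => //; exact: cmeas_cst.
apply: (mul_L2 (B := B + nc (f z)) mg _ Lc) => w.
by apply: (le_trans (ncB _ _)); rewrite lerD2r.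
Qed.

End Symbol.

Section Count.
Variables (f : CV -> R[i]) (B : R).
Hypotheses (mf : cmeas (fun t => f (pt t))) (fB : forall z, nc (f z) <= B) (B0 : 0 <= B).
Hypothesis f0 : forall e : R, 0 < e -> exists rho : R, forall z, rho <= ns z -> nc (f z) <= e.

Lemma osc_fconj z : osc (fconj f) z = osc f z.
Proof.
by rewrite /osc; congr (_ * _); apply: eq_Rintegral => t _; rewrite /fconj -cJN -cJD ncJ.
Qed.

(** Here p(z) is the sum of |<k_z, b_k>|^2, at most 1 by Bessel's inequality; each term is pi^n
    times the density of the unit vector b_k, hence integrates to pi^n. Conjugating the symbol
    leaves [osc] unchanged, so both estimates required by [quasimode_family] hold with the same
    error. *)
Lemma toeplitz_count t : 0 < t -> exists p : CV -> R,
  [/\ measurable_fun setT (fun s => p (pt s)), forall z, 0 <= p z <= 1 &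
     (\int[leb]_s (p (pt s))%:E = (pi ^+ n * (singular_count H ip (toeplitz phi f) t)%:R)%:E)%E] /\
  forall z, (nc (f z) < t -> (t - nc (f z)) ^+ 2 * p z <= 4 * osc f z) /\
            (t < nc (f z) -> (nc (f z) - t) ^+ 2 * (1 - p z) <= 4 * osc f z).
Proof.
move=> t0; have TP := toeplitz_bounded_pair mf fB B0 f0.
have [b] := quasimode_family F2_prehilbert F2_definite TP t0.
set N := singular_count _ _ _ _ => /= -[Hb onb qb].
exists (fun z => \sum_(k < N) nc (ip (coherent z) (b k)) ^+ 2).
have mb k : cmeas (fun s => b k (pt s)) by have [] := (L2P (b k)).1 (F2_L2 (Hb k)).
have E s : \sum_(k < N) nc (ip (coherent (pt s)) (b k)) ^+ 2 =
    \sum_(k < N) pi ^+ n * (nc (b k (pt s)) ^+ 2 * gw (pt s)).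
  by apply: eq_bigr => k _; rewrite ip_coherent.
have mk (k : 'I_N) : measurable_fun setT (fun s => pi ^+ n * (nc (b k (pt s)) ^+ 2 * gw (pt s)) : R).
  by apply: measurable_funM => //; exact: measurable_sqn.
split; first split.
- by under eq_fun do rewrite E; exact: measurable_sum.
- move=> z; rewrite sumr_ge0/=; last by move=> k _; exact: sqr_ge0.
  by rewrite -(sq_coherent z); exact: (bessel F2_prehilbert Hb onb (coherent_H z)).
- under eq_integral do rewrite E -sumEFin.
  rewrite ge0_integral_sum//; last 2 first.
  + by move=> k; exact/measurable_EFinP.
  + by move=> k s _; rewrite lee_fin mulr_ge0 ?exprn_ge0 ?pi_ge0// (mulr_ge0 (sqr_ge0 _) (gw_ge0 _)).
  rewrite (eq_bigr (fun=> (pi ^+ n)%:E)); last first.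
    move=> k _; have h1 : (\int[leb]_s (nc (b k (pt s)) ^+ 2 * gw (pt s))%:E = 1)%E.
      rewrite (sqnE (F2_L2 (Hb k))); congr EFin.
      by have := congr1 (@complex.Re R) (onb k k (ltn_ord k) (ltn_ord k)); rewrite ip_sqn eqxx.
    under eq_integral do rewrite EFinM.
    rewrite ge0_integralZl ?h1 ?mule1//.
    + by apply/measurable_EFinP; exact: measurable_sqn.
    + by move=> s _; rewrite lee_fin (mulr_ge0 (sqr_ge0 _) (gw_ge0 _)).
    + by rewrite lee_fin exprn_ge0// pi_ge0.
  by rewrite sumEFin sumr_const card_ord mulr_natr.
move=> z; have Hc := coherent_H z.
have mfc : cmeas (fun t => fconj f (pt t)) by exact: cmeasJ.
have fBc w : nc (fconj f w) <= B by rewrite ncJ.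
have q1 := quasimode mf fB z; have q2 := quasimode mfc fBc z.
rewrite osc_fconj in q2.
have := qb (f z) _ (coherent z) Hc (sq_coherent z) q1 q2.
by rewrite sqr_sqrtr//; exact: osc_ge0.
Qed.

End Count.

Lemma toeplitz_sub_le (f f1 : CV -> R[i]) (B B1 a : R) u :
  cmeas (fun t => f (pt t)) -> (forall z, nc (f z) <= B) ->
  cmeas (fun t => f1 (pt t)) -> (forall z, nc (f1 z) <= B1) -> 0 <= a ->
  (forall z, nc (f z - f1 z) <= a) -> H u ->
  hn (toeplitz phi f u - toeplitz phi f1 u) <= a * hn u.
Proof.
move=> mf fB mf1 fB1 a0 fa Hu; have Lu := F2_L2 Hu.
have mg : cmeas (fun t => (fun z => f z - f1 z) (pt t)) by exact: cmeasB.
have -> : toeplitz phi f u - toeplitz phi f1 u = toeplitz phi (fun z => f z - f1 z) u.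
  rewrite (toeplitzE mf fB Lu) (toeplitzE mf1 fB1 Lu) (toeplitzE mg fa Lu).
  rewrite addrC -scaleN1r -(bprojDZ (-1) (mul_L2 mf1 fB1 Lu) (mul_L2 mf fB Lu)).
  by congr bproj; apply/funext => w; rewrite !fctE /GRing.scale/= mulrBl mulN1r addrC.
exact: (hnorm_toeplitz mg fa a0 Lu).
Qed.

Lemma toeplitz_count_le (f f1 : CV -> R[i]) (B B1 a t : R) :
  cmeas (fun t => f (pt t)) -> (forall z, nc (f z) <= B) -> 0 <= B ->
  (forall e : R, 0 < e -> exists rho : R, forall z, rho <= ns z -> nc (f z) <= e) ->
  cmeas (fun t => f1 (pt t)) -> (forall z, nc (f1 z) <= B1) -> 0 <= B1 ->
  (forall e : R, 0 < e -> exists rho : R, forall z, rho <= ns z -> nc (f1 z) <= e) ->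
  0 <= a < t -> (forall z, nc (f z - f1 z) <= a) ->
  (singular_count H ip (toeplitz phi f) t <= singular_count H ip (toeplitz phi f1) (t - a))%N.
Proof.
move=> mf fB B0 f0 mf1 fB1 B10 f10 at_ fa.
have TP := toeplitz_bounded_pair mf fB B0 f0; have TP1 := toeplitz_bounded_pair mf1 fB1 B10 f10.
apply: (singular_count_le F2_prehilbert F2_definite TP TP1 at_) => u Hu.
by apply: toeplitz_sub_le mf fB mf1 fB1 _ fa Hu; case/andP : at_.
Qed.

End ToeplitzCount.

(** * Volumes of star-shaped sets *)

Definition ind {R : realType} (b : bool) : R := b%:R.

Lemma ind_ge0 (R : realType) b : 0 <= ind b :> R. Proof. exact: ler0n. Qed.

Lemma ind_le1 (R : realType) b : ind b <= 1 :> R. Proof. by case: b. Qed.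

Lemma measurable_ind (d : measure_display) (T : measurableType d) (R : realType) (P : T -> bool) :
  measurable_fun setT P -> measurable_fun setT (fun t => ind (P t) : R).
Proof. by move=> mP; apply: (measurableT_comp (f := fun b : bool => ind b : R)). Qed.

Lemma ind_itv (R : realType) (a : R) : 0 <= a ->
  (\int[@lebesgue_measure R]_s (ind ((0 < s) && (s <= a)))%:E = a%:E)%E.
Proof.
move=> a0; rewrite (eq_integral (fun s : measurableTypeR R => (\1_(`]0, a]%classic) s)%:E)).
  transitivity (@lebesgue_measure R `]0, a]%classic); first by rewrite integral_indic// setIT.
  rewrite (@lebesgue_measure_itv R `]0, a]) /= lte_fin.
  by case: ltP => [_|a_0]; rewrite ?sube0//; congr EFin; apply/eqP; rewrite eq_le a0 a_0.
by move=> s _; rewrite indicE mem_setE in_itv.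
Qed.

Section Cone.
Context {R : realType} {d' : nat}.
Local Notation d := d'.+1.
Local Notation X := (Rtuple R d).
Local Notation leb := (@lebesgue_tuple R d).
Local Notation leb1 := (@lebesgue_measure R).

Definition en (t : X) : R := enorm (rv t).

Lemma en_ge0 t : 0 <= en t. Proof. exact: sqrtr_ge0. Qed.

Lemma en_scale (c : R) t : 0 < c -> en (tscale c t) = c * en t.
Proof.
move=> c0; rewrite /en /enorm -[c in RHS](ger0_norm (ltW c0)) -sqrtr_sqr -sqrtrM ?sqr_ge0//.
congr Num.sqrt; rewrite mulr_sumr; apply: eq_bigr => i _.
by rewrite !mxE tnth_mktuple exprMn.
Qed.

Lemma en_scale_gt0 (c : R) t : 0 < c -> (0 < en (tscale c t)) = (0 < en t).
Proof. by move=> c0; rewrite en_scale// pmulr_rgt0. Qed.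

Lemma measurable_en : measurable_fun setT en. Proof. exact: measurable_enorm. Qed.

Variable h : X -> R.
Hypotheses (mh : measurable_fun setT h) (h0 : forall t, 0 <= h t)
  (hs : forall c t, 0 < c -> h (tscale c t) = h t).

Let u t : R := en t ^+ d.
Let mu_ : measurable_fun setT u. Proof. by apply: measurable_funX; exact: measurable_en. Qed.
Let us c t : 0 < c -> u (tscale c t) = c ^+ d * u t.
Proof. by move=> c0; rewrite /u en_scale// exprMn. Qed.

Let root (s : R) : 0 < s -> exists2 c : R, 0 < c & c ^+ d = s.
Proof.
move=> s0; exists (s `^ (d%:R^-1)); first exact: powR_gt0.
by rewrite -powR_mulrn ?powR_ge0// -powRrM mulVf ?powRr1// ltW.
Qed.

Let mfst : measurable_fun setT (fun p : X * measurableTypeR R => u p.1).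
Proof. exact: measurableT_comp mu_ measurable_fst. Qed.
Let men1 : measurable_fun setT (fun p : X * measurableTypeR R => en p.1).
Proof. exact: measurableT_comp measurable_en measurable_fst. Qed.
Let mh1 : measurable_fun setT (fun p : X * measurableTypeR R => h p.1).
Proof. exact: measurableT_comp mh measurable_fst. Qed.
Let msnd : measurable_fun setT (fun p : X * measurableTypeR R => p.2 : R).
Proof. exact: measurable_snd. Qed.

Let A (t : X) (s : R) : R := ind [&& 0 < en t, 0 < s, u t <= s & s <= h t] * s `^ (-1).

Let A0 t s : 0 <= A t s.
Proof. by rewrite /A mulr_ge0 ?ind_ge0 ?powR_ge0. Qed.

Let A_le0 t s : s <= 0 -> A t s = 0.
Proof. by move=> s0; rewrite /A [0 < s]ltNge s0 /= andbF /ind mul0r. Qed.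

Let tonelli (f : X -> R -> R) : measurable_fun setT (fun p : X * measurableTypeR R => f p.1 p.2) ->
  (forall t s, 0 <= f t s) ->
  (\int[leb]_t \int[leb1]_s (f t s)%:E = \int[leb1]_s \int[leb]_t (f t s)%:E)%E.
Proof.
move=> mf f0; apply: (@fubini_tonelli _ _ _ _ _ leb leb1 (fun p => (f p.1 p.2)%:E)).
  exact/measurable_EFinP.
by move=> p; rewrite lee_fin.
Qed.

(** Write [h t] as the length of ]0, h t]. For fixed s, the substitution t -> s^(1/d) t in the
    integral of [A] has Jacobian s, which cancels the weight 1/s, and it turns u t <= s into en t <=
    1 while leaving h unchanged. *)
Let ball_side : (\int[leb]_t (ind (0 < en t <= 1) * h t)%:E = \int[leb]_t \int[leb1]_s (A t s)%:E)%E.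
Proof.
have E1 t : ((ind (0 < en t <= 1) * h t)%:E = \int[leb1]_s (ind [&& 0 < en t <= 1, 0 < s & s <= h t])%:E)%E.
  case: (0 < en t <= 1) => /=; first by rewrite mul1r ind_itv.
  by rewrite mul0r integral0.
under eq_integral do rewrite E1.
rewrite (tonelli (f := fun t s => ind [&& 0 < en t <= 1, 0 < s & s <= h t])); last 2 first.
- apply: measurable_ind; apply: measurable_and; first apply: measurable_and.
  + exact: measurable_fun_ltr.
  + exact: measurable_fun_ler.
  + by apply: measurable_and; [exact: measurable_fun_ltr|exact: measurable_fun_ler].
- by move=> t s; exact: ind_ge0.
rewrite tonelli; last 2 first.
- apply: measurable_funM.
    apply: measurable_ind; apply: measurable_and; first exact: measurable_fun_ltr.
    apply: measurable_and; first exact: measurable_fun_ltr.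
    by apply: measurable_and; exact: measurable_fun_ler.
  exact: measurableT_comp (measurable_powR (-1)) msnd.
- exact: A0.
apply: eq_integral => s _; have [s0|s0] := ltP 0 s; last first.
  rewrite !integral0_eq// => t _; first by rewrite A_le0.
  by rewrite /ind /= andbF.
have [c c0 cd] := root s0.
have mA : measurable_fun setT (fun t => (A t s)%:E).
  apply/measurable_EFinP; apply: measurable_funM => //; apply: measurable_ind.
  apply: measurable_and; first by apply: (measurable_fun_ltr (f := fun=> 0)) => //; exact: measurable_en.
  apply: measurable_and; first exact: measurable_cst.
  by apply: measurable_and; exact: measurable_fun_ler.
rewrite [RHS](integral_tscale c0 mA); last by move=> t; rewrite lee_fin.
rewrite -ge0_integralZl//; last 3 first.
- exact: measurableT_comp mA (measurable_tscale c).
- by move=> t _; rewrite lee_fin.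
- by rewrite lee_fin cd ltW.
apply: eq_integral => t _; rewrite -EFinM; congr EFin.
rewrite /A en_scale_gt0// us// hs// cd powR_inv1 ?(ltW s0)// mulrCA mulfV ?gt_eqF// mulr1.
have -> : (s * u t <= s) = (en t <= 1).
  by rewrite ger_pMr// /u expr_le1// en_ge0.
by rewrite s0 /= andbA.
Qed.

(** For fixed t, the substitution s -> h(t) s leaves ds/s invariant and turns [A] into [C]. For
    fixed s in ]0, 1], the rescaling t -> s^(1/d) t then gives the volume [VV], independent of s,
    and the interval has length 1. *)
Let cone_side : (\int[leb]_t (ind ((0 < en t) && (u t <= h t)))%:E = \int[leb]_t \int[leb1]_s (A t s)%:E)%E.
Proof.
pose C (t : X) (s : R) : R := ind [&& 0 < en t, 0 < s, u t <= s * h t & s <= 1] * s `^ (-1).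
have C0 t s : 0 <= C t s by rewrite /C mulr_ge0 ?ind_ge0 ?powR_ge0.
have mC : measurable_fun setT (fun p : X * measurableTypeR R => C p.1 p.2).
  apply: measurable_funM.
    apply: measurable_ind; apply: measurable_and; first exact: measurable_fun_ltr.
    apply: measurable_and; first exact: measurable_fun_ltr.
    apply: measurable_and; last exact: measurable_fun_ler.
    by apply: measurable_fun_ler => //; exact: measurable_funM.
  exact: measurableT_comp (measurable_powR (-1)) msnd.
have mA : measurable_fun setT (fun p : X * measurableTypeR R => A p.1 p.2).
  apply: measurable_funM.
    apply: measurable_ind; apply: measurable_and; first exact: measurable_fun_ltr.
    apply: measurable_and; first exact: measurable_fun_ltr.
    by apply: measurable_and; exact: measurable_fun_ler.
  exact: measurableT_comp (measurable_powR (-1)) msnd.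
transitivity (\int[leb]_t \int[leb1]_s (C t s)%:E)%E; last first.
  apply: eq_integral => t _; have [e0|e0] := ltP 0 (en t); last first.
    by rewrite !integral0_eq// => s _; rewrite /A /C ltNge e0 /ind mul0r.
  have u0 : 0 < u t by exact: exprn_gt0.
  have [ht|ht] := ltP 0 (h t); last first.
    have hE : h t = 0 by apply/eqP; rewrite eq_le ht h0.
    rewrite !integral0_eq// => s _; rewrite /A /C hE.
      by case: (ltP 0 s) => s0; rewrite ?andbF /ind ?mul0r//= !andbF mul0r.
    by rewrite mulr0 [u t <= 0]leNgt u0 /= !andbF /ind mul0r.
  rewrite [RHS](integral1_affine 0 ht); last 2 first.
  - apply/measurable_EFinP; exact: measurableT_comp mA (measurable_pair1 t).
  - by move=> s; rewrite lee_fin.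
  rewrite -ge0_integralZl//; last 3 first.
  - apply/measurable_EFinP.
    apply: (measurableT_comp (f := fun s : measurableTypeR R => A t s)); first exact: measurableT_comp mA (measurable_pair1 t).
    exact: measurable_affine1.
  - by move=> s _; rewrite lee_fin.
  - by rewrite lee_fin ltW.
  apply: eq_integral => s _; rewrite -EFinM addr0; congr EFin; rewrite /A /C pmulr_rgt0// ger_pMr//.
  rewrite [h t * s]mulrC; have [s0|s0] := ltP 0 s; last by rewrite /ind !andbF !mul0r mulr0.
  rewrite !powR_inv1 ?mulr_ge0 ?(ltW s0)// invfM mulrCA; congr (_ * _).
  by rewrite mulrCA mulfV ?mulr1// gt_eqF.
rewrite (tonelli mC C0).
set VV := (\int[leb]_t _)%E.
have E s : (\int[leb]_t (C t s)%:E = (ind ((0 < s) && (s <= 1)))%:E * VV)%E.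
  have [s0|s0] := ltP 0 s; last first.
    rewrite (_ : ind _ = 0 :> R)// mul0e -[RHS](integral0 leb setT).
    by apply: eq_integral => t _; rewrite /C [0 < s]ltNge s0 /ind /= andbF mul0r.
  have [s1|s1] := leP s 1; last first.
    rewrite (_ : ind _ = 0 :> R)// mul0e -[RHS](integral0 leb setT).
    by apply: eq_integral => t _; rewrite /C [s <= 1]leNgt s1 /ind /= !andbF mul0r.
  rewrite (_ : ind _ = 1 :> R)// mul1e; have [c c0 cd] := root s0.
  have mCs : measurable_fun setT (fun t => (C t s)%:E).
    by apply/measurable_EFinP; exact: measurableT_comp mC (measurable_pair2 s).
  have mV : measurable_fun setT (fun t => (ind ((0 < en t) && (u t <= h t)))%:E : \bar R).
    apply/measurable_EFinP; apply: measurable_ind; apply: measurable_and.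
      by apply: (measurable_fun_ltr (f := fun=> 0)) => //; exact: measurable_en.
    exact: measurable_fun_ler.
  rewrite (integral_tscale c0 mCs); last by move=> t; rewrite lee_fin.
  rewrite -ge0_integralZl//; last 3 first.
  - exact: measurableT_comp mCs (measurable_tscale c).
  - by move=> t _; rewrite lee_fin.
  - by rewrite lee_fin cd ltW.
  apply: eq_integral => t _; rewrite -EFinM; congr EFin.
  rewrite /C en_scale_gt0// us// hs// cd powR_inv1 ?(ltW s0)// mulrCA mulfV ?gt_eqF// mulr1.
  by rewrite s0 s1 /= ler_pM2l// andbT.
under eq_integral do rewrite E.
have VV0 : (0 <= VV)%E by apply: integral_ge0 => t _; rewrite lee_fin ind_ge0.
rewrite ge0_integralZr//; last by move=> s _; rewrite lee_fin ind_ge0.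
  by rewrite ind_itv// mul1e.
apply/measurable_EFinP; apply: measurable_ind; apply: measurable_and.
  exact: (measurable_fun_ltr (f := fun=> 0) (g := id)).
exact: (measurable_fun_ler (f := id) (g := fun=> 1)).
Qed.

(* Both sides equal the integral of ds/s over {en t ^ d <= s <= h t}: homogeneity trades
   the factor 1/s for a rescaling of t. *)
Lemma cone_volume :
  (\int[leb]_t (ind ((0 < en t) && (en t ^+ d <= h t)))%:E = \int[leb]_t (ind (0 < en t <= 1) * h t)%:E)%E.
Proof. by rewrite ball_side -cone_side. Qed.

End Cone.

(** * Rescaling of asymptotically homogeneous symbols *)

(** u^m = e^(m ln u) <= e^(m u), and m u <= 2 m^2 + u^2 / 8. Polynomial growth is thus absorbed by a
    small part of the Gaussian. *)
Lemma powR_le_gauss (R : realType) (m u : R) : 0 < m -> 0 <= u ->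
  u `^ m <= expR (2 * m ^+ 2) * expR (u ^+ 2 / 8).
Proof.
move=> m0 u0; rewrite -expRD; have [->|un0] := eqVneq u 0.
  by rewrite powR0 ?gt_eqF// expR_ge0.
have up : 0 < u by rewrite lt_neqAle eq_sym un0.
rewrite /powR (negbTE un0) ler_expR.
have lu : ln u <= u.
  have := @expR_ge1Dx R (ln u); rewrite lnK ?posrE//; lra.
apply: (@le_trans _ _ (m * u)); first by rewrite ler_pM2l.
have := sqr_ge0 (u - 4 * m); nra.
Qed.

Lemma powR_seq_cvg0 (R : realType) (t : nat -> R) (a : R) : 0 < a -> (forall k, 0 < t k) ->
  t k @[k --> \oo] --> (0 : R) -> t k `^ a @[k --> \oo] --> (0 : R).
Proof.
move=> a0 t0 /cvgrPdist_lt ct; apply/cvgrPdist_lt => e e0.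
apply: filterS (ct (e `^ a^-1) (powR_gt0 _ e0)) => k.
rewrite !sub0r !normrN !ger0_norm ?powR_ge0 ?(ltW (t0 k))// => h.
have -> : e = (e `^ a^-1) `^ a by rewrite -powRrM mulVf ?gt_eqF// powRr1// ltW.
by rewrite gt0_ltr_powR// nnegrE ?powR_ge0// ltW.
Qed.

Section Norm.
Context {R : realType} {n : nat}.
Local Open Scope complex_scope.
Local Notation CV := 'rV[R[i]]_n.
Local Notation X := (Rtuple R (n + n)).
Local Notation leb := (@lebesgue_tuple R (n + n)).

Lemma dot_prehilbert : prehilbert setT (@dot R n).
Proof.
split => //.
- move=> a u v w _ _ _; rewrite /dot mulr_sumr -big_split/=; apply: eq_bigr => j _.
  by rewrite !mxE mulrDl mulrA.
- by move=> u v _ _; rewrite dotJ.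
- by move=> u _; rewrite dotzz ns_ge0.
Qed.

(* The Euclidean norm, as a Hilbert norm so that the lemmas on inner products apply. *)
Definition nr (z : CV) : R := hnorm (@dot R n) z.

Lemma nrE z : nr z = Num.sqrt (ns z). Proof. by rewrite /nr /hnorm dotzz. Qed.
Lemma nr_ge0 z : 0 <= nr z. Proof. exact: hnorm_ge0. Qed.
Lemma nr_sqr z : nr z ^+ 2 = ns z. Proof. by rewrite nrE sqr_sqrtr// ns_ge0. Qed.
Lemma nrD x y : nr (x + y) <= nr x + nr y. Proof. exact: (phnD dot_prehilbert). Qed.
Lemma nrN x : nr (- x) = nr x. Proof. exact: (phnN dot_prehilbert). Qed.
Lemma nr_dist x y : nr (x - y) = nr (y - x). Proof. by rewrite -nrN opprB. Qed.
Lemma nr_le_dist x y : nr x - nr (y - x) <= nr y.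
Proof. by have := nrD y (x - y); rewrite subrKC [nr (x - y)]nr_dist; lra. Qed.

Definition rs (c : R) (z : CV) : CV := c%:C *: z.

Lemma nr_scale (c : R) z : 0 <= c -> nr (rs c z) = c * nr z.
Proof. by move=> c0; rewrite /nr (phnZ dot_prehilbert)// ncR ger0_norm. Qed.

Lemma pt_tscale (c : R) t : pt (tscale c t) = rs c (pt t).
Proof.
by apply/rowP => j; rewrite !mxE !tnth_mktuple; apply: eq_creim; rewrite /= !mul0r ?subr0 ?addr0.
Qed.

Lemma rs_inv (c : R) z : 0 < c -> rs c (rs c^-1 z) = z.
Proof. by move=> c0; rewrite /rs scalerA -cRM mulfV ?gt_eqF// scale1r. Qed.

Lemma rsD (c : R) x y : rs c (x + y) = rs c x + rs c y. Proof. exact: scalerDr. Qed.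

Lemma nr_gt0 z : z != 0 -> 0 < nr z.
Proof.
move=> z0; rewrite lt_neqAle eq_sym nr_ge0 andbT; apply: contra z0 => /eqP nz.
apply/eqP/rowP => j; rewrite mxE; apply: nc0_eq0; apply/eqP.
have := nr_sqr z; rewrite nz expr0n /ns => /esym /psumr_eq0P h.
by have := h (fun j _ => sqr_ge0 (nc (z 0 j))) j isT => /eqP; rewrite sqrf_eq0.
Qed.

Lemma nr0 : nr 0 = 0. Proof. exact: (phn0 dot_prehilbert). Qed.

Lemma measurable_nr : measurable_fun setT (fun t : X => nr (pt t)).
Proof.
have -> : (fun t : X => nr (pt t)) = Num.sqrt \o (fun t => ns (pt t)) by apply/funext => t; rewrite nrE.
apply: (measurableT_comp (f := @Num.sqrt R)); last exact: measurable_ns.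
by apply: continuous_measurable_fun; exact: sqrt_continuous.
Qed.

Lemma integral_rs (c : R) (f : CV -> R) : 0 < c -> measurable_fun setT (fun t => f (pt t)) ->
  (forall z, 0 <= f z) ->
  (\int[leb]_t (f (pt t))%:E = (c ^+ (n + n))%:E * \int[leb]_t (f (rs c (pt t)))%:E)%E.
Proof.
move=> c0 mf f0; rewrite (integral_tscale c0); last 2 first.
- exact/measurable_EFinP.
- by move=> t; rewrite lee_fin.
by congr (_ * _)%E; apply: eq_integral => t _; rewrite pt_tscale.
Qed.

Lemma gauss_nr_integrable (c : R) : 0 < c -> leb.-integrable setT (EFin \o (fun t => expR (- (c * ns (pt t))))).
Proof.
move=> c0; have s0 : 0 < Num.sqrt c^-1 by rewrite sqrtr_gt0 invr_gt0.
have := gauss_integrable (n := n) s0; apply: eq_integrable => // t _ /=.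
by rewrite sqr_sqrtr ?invr_ge0 ?(ltW c0)// invrK mulrC.
Qed.

(** Dilation by 2 fixes the origin, so the integral I satisfies I = 2^(2n) I; it is finite because
    the Gaussian dominates the indicator, hence it is 0. *)
Lemma null_origin : (0 < n)%N -> (\int[leb]_t (ind (pt t == 0 :> CV))%:E = 0 :> \bar R)%E.
Proof.
move=> n0.
have E (t : X) : (pt t == 0 :> CV) = (nr (pt t) <= 0).
  apply/eqP/idP => [->|h]; first by rewrite nr0.
  by apply/eqP; apply: contraLR h => /nr_gt0; rewrite -ltNge.
have mI : measurable_fun setT (fun t : X => ind (pt t == 0 :> CV) : R).
  apply: measurable_ind; under eq_fun do rewrite E.
  by apply: measurable_fun_ler => //; exact: measurable_nr.
have := integral_rs (f := fun z => ind (z == 0)) (@ltr0n R 2) mI (fun z => ind_ge0 _ _).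
have -> : (\int[leb]_t (ind (rs 2 (pt t) == 0 :> CV))%:E = \int[leb]_t (ind (pt t == 0 :> CV))%:E :> \bar R)%E.
  apply: eq_integral => t _; congr (ind _)%:E; rewrite /rs scaler_eq0.
  have -> : ((2 : R)%:C == 0) = false; last by [].
  by apply/negbTE/eqP => /complexI/eqP; rewrite pnatr_eq0.
have : (\int[leb]_t (ind (pt t == 0 :> CV))%:E <= (pi ^+ n)%:E :> \bar R)%E.
  rewrite -integral_gw; apply: ge0_le_integral => //.
  - by move=> t _; rewrite lee_fin ind_ge0.
  - exact/measurable_EFinP.
  - by apply/measurable_EFinP; exact: measurable_gw.
  move=> t _; rewrite lee_fin; case: eqP => [->|_]; last exact: gw_ge0.
  by rewrite /gw -nr_sqr nr0 expr0n oppr0 expR0.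
have : (0 <= \int[leb]_t (ind (pt t == 0 :> CV))%:E :> \bar R)%E.
  by apply: integral_ge0 => t _; rewrite lee_fin ind_ge0.
move: (integral _ _ _) => I; case: I => [r| |]//; rewrite !lee_fin => r0 _.
rewrite -EFinM => -[] rE; congr EFin.
have h1 : 4 <= 2 ^+ (n + n) :> R.
  have -> : 4 = 2 ^+ 2 :> R by ring.
  by rewrite ler_weXn2l ?ler1n//; move: n0; clear; lia.
by apply/eqP; rewrite eq_le r0 andbT; move: rE h1 r0; set b := 2 ^+ _; clear; nra.
Qed.

End Norm.

Lemma add_le_mul (R : realType) (a b E p q : R) : 0 <= a -> 0 <= b -> 1 <= E ->
  p <= a -> q <= a + b * E -> q + p <= (2 * a + b) * E.
Proof. nra. Qed.

(** * Rescaled symbols and their oscillation *)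

Section Scaling.
Context {R : realType} {n : nat}.
Local Open Scope complex_scope.
Local Notation CV := 'rV[R[i]]_n.
Local Notation X := (Rtuple R (n + n)).
Local Notation leb := (@lebesgue_tuple R (n + n)).
Implicit Types (x y z v : CV).

(** The interface between symbol classes and spectral counting: size bounds on [f], a homogeneous
    model [F] continuous off the origin, and a faster decaying difference. The value of [F] at the
    origin, where homogeneity of degree -m is singular, is fixed by convention. *)
Record asymptotically_homogeneous (m B C : R) (f F : CV -> R[i]) : Prop := AsympHom {
  ah_m : 0 < m;
  ah_B0 : 0 <= B;
  ah_C0 : 0 < C;
  ah_mf : cmeas (fun t : X => f (pt t));
  ah_fB : forall z, nc (f z) <= B;
  ah_fC : forall z, z != 0 -> nc (f z) <= C * nr z `^ (- m);
  ah_F0 : F 0 = 0;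
  ah_Fhom : forall c z, 0 < c -> F (rs c z) = (c `^ (- m))%:C * F z;
  ah_Fcont : forall x e, x != 0 -> 0 < e -> exists2 de, 0 < de &
    forall y, nr (y - x) < de -> nc (F y - F x) < e;
  ah_fF : exists R0 C' delta, 0 < delta /\ forall z, R0 <= nr z ->
    nc (f z - F z) <= C' * nr z `^ (- m - delta) }.

Variables (m B C : R) (f F : CV -> R[i]).
Hypothesis AH : asymptotically_homogeneous m B C f F.
Variable t : nat -> R.
Hypotheses (t0 : forall k, 0 < t k) (t1 : forall k, t k <= 1) (tc : t k @[k --> \oo] --> (0 : R)).

Let m0 := ah_m AH.

Definition dil k : R := t k `^ (- m^-1).
Local Notation L := dil.

Lemma dil_gt0 k : 0 < L k. Proof. exact: powR_gt0. Qed.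

Lemma dilX (a : R) k : L k `^ a = t k `^ (- (a / m)).
Proof. by rewrite /dil -powRrM mulNr mulrC. Qed.

Lemma dil_m k : L k `^ (- m) = t k.
Proof. by rewrite dilX mulNr divff ?gt_eqF// opprK powRr1// ltW. Qed.

Lemma dil_ge1 k : 1 <= L k.
Proof.
have mi : 0 <= m^-1 by rewrite invr_ge0 ltW.
rewrite /dil powRN -[leLHS]invr1 lef_pV2 ?posrE ?powR_gt0// -[leRHS](_ : 1 `^ m^-1 = 1); last by rewrite powR1.
by rewrite ge0_ler_powR// nnegrE ltW.
Qed.

Definition rescaled k x : R[i] := ((t k)^-1)%:C * f (rs (L k) x).

Lemma nc_rescaled k x : nc (rescaled k x) = nc (f (rs (L k) x)) / t k.
Proof. by rewrite ncM ncR ger0_norm ?invr_ge0 ?(ltW (t0 k))// mulrC. Qed.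

Lemma rs_neq0 (c : R) x : 0 < c -> x != 0 -> rs c x != 0.
Proof.
move=> c0 x0; rewrite /rs scaler_eq0 negb_or x0 andbT; apply/eqP => /complexI/eqP.
by rewrite gt_eqF.
Qed.

Lemma rescaled_le k x : x != 0 -> nc (rescaled k x) <= C * nr x `^ (- m).
Proof.
move=> x0; rewrite nc_rescaled ler_pdivrMr//; apply: (le_trans (ah_fC AH (rs_neq0 (dil_gt0 k) x0))).
rewrite nr_scale ?(ltW (dil_gt0 k))// powRM ?nr_ge0 ?(ltW (dil_gt0 k))// dil_m.
by rewrite mulrCA mulrC.
Qed.

Lemma rescaled_leB k x : nc (rescaled k x) <= B * L k `^ m.
Proof. by rewrite nc_rescaled dilX divff ?gt_eqF// powR_inv1 ?(ltW (t0 k))// ler_pM2r ?invr_gt0// (ah_fB AH). Qed.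

Lemma F_scale k y : F (rs (L k) y) = (t k)%:C * F y.
Proof. by rewrite (ah_Fhom AH _ (dil_gt0 k)) dil_m. Qed.

Lemma rescaled_subF k y : rescaled k y - F y = ((t k)^-1)%:C * (f (rs (L k) y) - F (rs (L k) y)).
Proof.
by rewrite F_scale mulrBr mulrA -cRM mulVf ?gt_eqF// mul1r.
Qed.

Lemma dil_cvgy (r : R) : \forall k \near \oo, r <= L k.
Proof.
have mi : 0 < m^-1 by rewrite invr_gt0.
pose r' := `|r| + 1; have r0 : 0 < r' by rewrite ltr_wpDl.
have /cvgrPdist_lt/(_ _ (_ : 0 < r'^-1)) := powR_seq_cvg0 mi t0 tc.
rewrite invr_gt0 => /(_ r0); apply: filterS => k.
rewrite sub0r normrN ger0_norm ?powR_ge0// => h.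
apply: (@le_trans _ _ r'); first by rewrite /r' (le_trans (ler_norm r))// lerDl.
rewrite /dil powRN -[r']invrK lef_pV2 ?posrE ?powR_gt0 ?invr_gt0//; exact: ltW.
Qed.

(* Convergence of the rescaled symbol is locally uniform away from the origin. *)
Lemma rescaled_cvg x e : x != 0 -> 0 < e -> exists2 de, 0 < de &
  \forall k \near \oo, forall y, nr (y - x) < de -> nc (rescaled k y - F x) < e.
Proof.
move=> x0 e0; have nx := nr_gt0 x0; have e2 : 0 < e / 2 by rewrite divr_gt0.
have [R0 [C' [delta [d0 HF]]]] := ah_fF AH.
have [d1 d10 Hc] := ah_Fcont AH x0 e2.
have nx2 : 0 < nr x / 2 by rewrite divr_gt0.
exists (Num.min d1 (nr x / 2)); first by rewrite lt_min d10.
pose c := `|C'| * (nr x / 2) `^ (- m - delta) + 1.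
have c0 : 0 < c by rewrite ltr_wpDl// mulr_ge0// powR_ge0.
have dm : 0 < delta / m by rewrite divr_gt0.
have /cvgrPdist_lt/(_ _ (divr_gt0 e2 c0)) := powR_seq_cvg0 dm t0 tc.
move=> near1; near=> k => y; rewrite lt_min => /andP[h1 h2].
have ny : nr x / 2 <= nr y by have := nr_le_dist x y; lra.
have Lk := dil_gt0 k.
have LR : R0 <= nr (rs (L k) y).
  rewrite nr_scale ?(ltW Lk)//; have : R0 / (nr x / 2) <= L k by near: k; exact: dil_cvgy.
  rewrite ler_pdivrMr// => /le_trans; apply; by rewrite ler_pM2l.
rewrite -(subrKA (F y)); apply: (le_lt_trans (ncD _ _)).
suff : nc (rescaled k y - F y) <= e / 2 by have := Hc y h1; lra.
rewrite rescaled_subF ncM ncR ger0_norm ?invr_ge0 ?(ltW (t0 k))//.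
apply: (@le_trans _ _ ((t k)^-1 * (`|C'| * nr (rs (L k) y) `^ (- m - delta)))).
  rewrite ler_pM2l ?invr_gt0//; apply: (le_trans (HF _ LR)).
  by rewrite ler_wpM2r ?powR_ge0// ler_norm.
rewrite nr_scale ?(ltW Lk)// powRM ?nr_ge0 ?(ltW Lk)//.
have -> : L k `^ (- m - delta) = t k * t k `^ (delta / m).
  rewrite powRD; last by rewrite (gt_eqF Lk) implybT.
  by rewrite dil_m dilX mulNr opprK.
have -> : (t k)^-1 * (`|C'| * (t k * t k `^ (delta / m) * nr y `^ (- m - delta))) =
   t k `^ (delta / m) * (`|C'| * nr y `^ (- m - delta)).
  by field; rewrite gt_eqF.
apply: (@le_trans _ _ (t k `^ (delta / m) * c)).
  rewrite ler_wpM2l ?powR_ge0// /c ler_wpDr// ler_wpM2l//.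
  have -> : - m - delta = - (m + delta) by rewrite opprD.
  rewrite !powRN lef_pV2 ?posrE ?powR_gt0// ?(lt_le_trans nx2 ny)//.
  rewrite ge0_ler_powR// ?nnegrE ?nr_ge0 ?(ltW nx2)// addr_ge0// ltW//.
have : `|0 - t k `^ (delta / m)| < e / 2 / c by near: k; exact: near1.
rewrite sub0r normrN ger0_norm ?powR_ge0// => /ltW; by rewrite ler_pdivlMr.
Unshelve. all: by end_near. Qed.

Lemma F_le x : x != 0 -> nc (F x) <= C * nr x `^ (- m).
Proof.
move=> x0; apply/ler_addgt0Pr => e e0; have [de de0 [N _ HN]] := rescaled_cvg x0 e0.
have h := HN N (leqnn _) x; rewrite subrr nr0 in h; have := h de0 => {}h.
have := nc_le_dist (F x) (rescaled N x); rewrite nc_dist => h2; have := rescaled_le N x0; lra.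
Qed.

(* A truncation of the symbol acting on its values, pointwise dominated by the identity. *)
Variable Phi : R[i] -> R[i].
Hypotheses (Phi_le : forall w, nc (Phi w) <= nc w)
  (Phi_cont : forall w, exists2 c : R, 0 <= c & forall w', nc (Phi w' - Phi w) <= c * nc (w' - w)).

Definition trunc k z : R[i] := (t k)%:C * Phi (((t k)^-1)%:C * f z).
Definition rescaled_trunc k x : R[i] := Phi (rescaled k x).

Lemma trunc_dil k x : trunc k (rs (L k) x) = (t k)%:C * rescaled_trunc k x. Proof. by []. Qed.

Lemma nc_trunc_le k z : nc (trunc k z) <= nc (f z).
Proof.
rewrite /trunc ncM ncR ger0_norm ?(ltW (t0 k))//.
apply: (le_trans (ler_wpM2l (ltW (t0 k)) (Phi_le _))).
by rewrite ncM ncR ger0_norm ?invr_ge0 ?(ltW (t0 k))// mulrA mulfV ?mul1r// gt_eqF.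
Qed.

Hypothesis Phi_meas : forall k, cmeas (fun s : X => trunc k (pt s)).

Definition rescaled_osc k x : R := osc (trunc k) (rs (L k) x) / t k ^+ 2.

(** In the rescaled variable the unit Gaussian has width 1 / L k; this shrinking is what makes the
    oscillation vanish in the limit. *)
Lemma rescaled_oscE k x : rescaled_osc k x = (pi ^+ n)^-1 *
  \int[leb]_s (nc (rescaled_trunc k (x + rs (L k)^-1 (pt s)) - rescaled_trunc k x) ^+ 2 * gw (pt s)).
Proof.
rewrite /rescaled_osc /osc mulrAC -mulrA; congr (_ * _).
apply: (@mulfI _ (t k ^+ 2)); first by rewrite expf_neq0// gt_eqF.
rewrite mulrA mulfV ?mul1r; last by rewrite expf_neq0// gt_eqF.
have E s : nc (trunc k (pt s + rs (L k) x) - trunc k (rs (L k) x)) ^+ 2 * gw (pt s) =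
   t k ^+ 2 * (nc (rescaled_trunc k (x + rs (L k)^-1 (pt s)) - rescaled_trunc k x) ^+ 2 * gw (pt s)).
  rewrite -{1}(rs_inv (pt s) (dil_gt0 k)) -rsD !trunc_dil -mulrBr ncM ncR exprMn.
  by rewrite real_normK ?num_real// -mulrA [rs _ _ + x]addrC.
transitivity (\int[leb]_s (t k ^+ 2 * (nc (rescaled_trunc k (x + rs (L k)^-1 (pt s)) - rescaled_trunc k x) ^+ 2 * gw (pt s)))).
  by apply: eq_Rintegral => s _; exact: E.
have igw : leb.-integrable setT (EFin \o (fun s => (2 * B) ^+ 2 * gw (pt s))).
  have := gauss_nr_integrable (n := n) (@ltr01 R) => /(integrableZl measurableT ((2 * B) ^+ 2)).
  by apply: eq_integrable => // s _; rewrite /= mul1r.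
apply: (RintegralZl _ measurableT).
have : leb.-integrable setT (EFin \o (fun s => t k ^+ 2 * (nc (rescaled_trunc k (x + rs (L k)^-1 (pt s)) - rescaled_trunc k x) ^+ 2 * gw (pt s)))).
  apply: le_integrable igw => //.
    apply/measurable_EFinP; apply: (eq_measurable_fun (fun s => nc (trunc k (pt s + rs (L k) x) - trunc k (rs (L k) x)) ^+ 2 * gw (pt s))).
      by move=> s _; exact: E.
    apply: measurable_funM; last exact: measurable_gw.
    apply: measurable_funX; apply: cmeas_nc; apply: cmeasB; last exact: cmeas_cst.
    have := cmeas_comp (mpres_ttrans (rs (L k) x)).1 (Phi_meas k).
    by congr cmeas; apply/funext => s; rewrite pt_ttrans.
  move=> s _ /=; rewrite -E lee_fin !(ger0_norm (mulr_ge0 (sqr_ge0 _) (gw_ge0 _))).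
  rewrite ler_wpM2r ?gw_ge0//.
  have h z : nc (trunc k z) <= B by exact: le_trans (nc_trunc_le k z) (ah_fB AH z).
  have h2 : nc (trunc k (pt s + rs (L k) x) - trunc k (rs (L k) x)) <= 2 * B.
    apply: (le_trans (ncB _ _)); have := h (pt s + rs (L k) x); have := h (rs (L k) x); lra.
  have n1 : nc (trunc k (pt s + rs (L k) x) - trunc k (rs (L k) x)) \is Num.nneg by rewrite nnegrE nc_ge0.
  have n2 : 2 * B \is Num.nneg by rewrite nnegrE mulr_ge0// (ah_B0 AH).
  by rewrite ler_pXn2r.
move=> /(integrableZl measurableT ((t k ^+ 2)^-1)); apply: eq_integrable => // s _.
by rewrite /= -EFinM mulKf// expf_neq0// gt_eqF.
Qed.

(** The first term bounds the values at [x] and at shifted points of norm at least |x| / 2. A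
    shifted point nearer the origin requires |v| > L |x| / 2, with L = [L k]; then the crude bound B
    L^m is at most B (2 |v| / |x|)^m, which [powR_le_gauss] turns into the second term times
    e^(|v|^2 / 8). *)
Definition shift_majorant x : R := 2 * (C * (nr x / 2) `^ (- m)) + B * (2 / nr x) `^ m * expR (2 * m ^+ 2).

Lemma rescaled_trunc_shift_le k x v : x != 0 ->
  nc (rescaled_trunc k (x + rs (L k)^-1 v) - rescaled_trunc k x) ^+ 2 * gw v <= shift_majorant x ^+ 2 * expR (- (3 / 4 * ns v)).
Proof.
move=> x0; have nx := nr_gt0 x0; have nx2 : 0 < nr x / 2 by rewrite divr_gt0.
have Lk := dil_gt0 k; set y := x + _.
have C0 := ltW (ah_C0 AH); have B0 := ah_B0 AH.
pose a := C * (nr x / 2) `^ (- m); have a0 : 0 <= a by rewrite mulr_ge0 ?powR_ge0.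
have mono y' : y' != 0 -> nr x / 2 <= nr y' -> nc (rescaled_trunc k y') <= a.
  move=> y0 h; apply: (le_trans (Phi_le _)); apply: (le_trans (rescaled_le k y0)).
  rewrite ler_wpM2l// !powRN lef_pV2 ?posrE ?powR_gt0 ?(lt_le_trans nx2 h)//.
  by rewrite ge0_ler_powR// ?nnegrE ?nr_ge0 ?(ltW nx2)// ltW.
have hx : nc (rescaled_trunc k x) <= a by apply: mono => //; lra.
pose b := B * (2 / nr x) `^ m * expR (2 * m ^+ 2).
have b0 : 0 <= b by rewrite !mulr_ge0 ?powR_ge0 ?expR_ge0.
have hy : nc (rescaled_trunc k y) <= a + b * expR (ns v / 8).
  have [h|h] := leP (nr v) (L k * (nr x / 2)).
    have ny : nr x / 2 <= nr y.
      have := nr_le_dist x y; rewrite /y [x + _]addrC addrK nr_scale ?invr_ge0 ?(ltW Lk)//.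
      have : (L k)^-1 * nr v <= nr x / 2 by rewrite mulrC ler_pdivrMr// mulrC.
      lra.
    have y0 : y != 0 by apply/eqP => y0; move: ny; rewrite y0 nr0; lra.
    by apply: (le_trans (mono y y0 ny)); rewrite lerDl mulr_ge0// expR_ge0.
  apply: (le_trans (Phi_le _)); apply: (le_trans (rescaled_leB k y)); apply: ler_wpDl => //.
  have Lv : L k <= 2 / nr x * nr v.
    have -> : 2 / nr x * nr v = nr v / (nr x / 2) by field; rewrite gt_eqF.
    by rewrite ler_pdivlMr// ltW.
  apply: (@le_trans _ _ (B * (2 / nr x * nr v) `^ m)).
    rewrite ler_wpM2l// ge0_ler_powR ?nnegrE ?(ltW m0) ?(ltW Lk)//.
    by rewrite mulr_ge0 ?nr_ge0// divr_ge0 ?nr_ge0.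
  rewrite powRM ?nr_ge0 ?divr_ge0 ?nr_ge0// /b -!mulrA ler_wpM2l// ler_wpM2l ?powR_ge0//.
  by rewrite -(nr_sqr v); exact: powR_le_gauss m0 (nr_ge0 v).
have e1 : 1 <= expR (ns v / 8) by rewrite -expR0 ler_expR divr_ge0 ?ns_ge0.
have hd : nc (rescaled_trunc k y - rescaled_trunc k x) <= shift_majorant x * expR (ns v / 8).
  by apply: (le_trans (ncB _ _)); rewrite /shift_majorant -/a -/b; exact: add_le_mul.
have dx0 : 0 <= shift_majorant x by rewrite /shift_majorant -/a -/b addr_ge0// mulr_ge0.
apply: (@le_trans _ _ ((shift_majorant x * expR (ns v / 8)) ^+ 2 * gw v)).
  by rewrite ler_wpM2r ?gw_ge0// ler_pXn2r ?nnegrE ?nc_ge0 ?mulr_ge0 ?expR_ge0.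
rewrite [leLHS](_ : _ = shift_majorant x ^+ 2 * expR (- (3 / 4 * ns v)))//.
rewrite exprMn -(mulrA (shift_majorant x ^+ 2)); congr (_ * _).
by rewrite -expRM_natl /gw -expRD; congr expR; field.
Qed.

Lemma measurable_rescaled_trunc_shift k x : measurable_fun setT (fun s : X => nc (rescaled_trunc k (x + rs (L k)^-1 (pt s)) - rescaled_trunc k x) ^+ 2 * gw (pt s)).
Proof.
apply: measurable_funM; last exact: measurable_gw.
apply: measurable_funX; apply: cmeas_nc; apply: cmeasB; last exact: cmeas_cst.
have := cmeas_comp (mpres_ttrans (rs (L k) x)).1 (Phi_meas k) => mT.
have := cmeasM (cmeas_cst ((t k)^-1)%:C) mT; congr cmeas; apply/funext => s.
rewrite pt_ttrans -{1}(rs_inv (pt s) (dil_gt0 k)) -rsD trunc_dil mulrA -cRM mulVf ?gt_eqF// mul1r.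
by rewrite addrC.
Qed.

(** Dominated convergence in the Gaussian variable. For each fixed shift, the point x + v / L k
    tends to [x], and local uniform convergence allows the symbol and its argument to vary together;
    [Phi_cont] transfers the limit through the truncation. *)
Lemma rescaled_osc_cvg x : x != 0 -> rescaled_osc k x @[k --> \oo] --> (0 : R).
Proof.
move=> x0; under eq_fun do rewrite rescaled_oscE mulrC; apply: cvg0_mul.
have i34 : 0 < 3 / 4 :> R by [].
have idom : leb.-integrable setT (EFin \o (fun s => shift_majorant x ^+ 2 * expR (- (3 / 4 * ns (pt s))))).
  exact: (integrableZl measurableT (shift_majorant x ^+ 2) (gauss_nr_integrable (n := n) i34)).
have := @dominated_Rcvg _ _ _ leb (fun k s => nc (rescaled_trunc k (x + rs (L k)^-1 (pt s)) - rescaled_trunc k x) ^+ 2 * gw (pt s))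
  (fun=> 0) _ (fun k => measurable_rescaled_trunc_shift k x) idom.
have -> : \int[leb]_s (0 : R) = 0 by rewrite /Rintegral integral0.
apply => [k s|s].
  by rewrite (ger0_norm (mulr_ge0 (sqr_ge0 _) (gw_ge0 _))); exact: rescaled_trunc_shift_le.
apply: cvg0_mul; have [c c0 Hc] := Phi_cont (F x).
apply/cvgrPdist_lt => e e0.
have Hs : 0 < Num.sqrt e / (2 * c + 1) by rewrite divr_gt0 ?sqrtr_gt0// ltr_wpDl// mulr_ge0.
have [de de0 Hk] := rescaled_cvg x0 Hs; near=> k.
have Lk := dil_gt0 k.
have hv : nr (x + rs (L k)^-1 (pt s) - x) < de.
  rewrite [x + _]addrC addrK nr_scale ?invr_ge0 ?(ltW Lk)// mulrC ltr_pdivrMr//.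
  have : (nr (pt s) + 1) / de <= L k by near: k; exact: dil_cvgy.
  by rewrite ler_pdivrMr// [L k * de]mulrC; lra.
have HK : forall y, nr (y - x) < de -> nc (rescaled k y - F x) < Num.sqrt e / (2 * c + 1) by near: k.
have k1 := HK _ hv; have k2 : nc (rescaled k x - F x) < Num.sqrt e / (2 * c + 1).
  by apply: HK; rewrite subrr nr0.
rewrite sub0r normrN ger0_norm ?sqr_ge0//.
have : nc (rescaled_trunc k (x + rs (L k)^-1 (pt s)) - rescaled_trunc k x) < Num.sqrt e.
  rewrite -(subrKA (Phi (F x))); apply: (le_lt_trans (ncD _ _)).
  rewrite [nc (Phi (F x) - _)]nc_dist.
  have l1 := Hc (rescaled k (x + rs (L k)^-1 (pt s))); have l2 := Hc (rescaled k x).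
  have l3 : c * nc (rescaled k (x + rs (L k)^-1 (pt s)) - F x) <= c * (Num.sqrt e / (2 * c + 1)) by rewrite ler_wpM2l// ltW.
  have l4 : c * nc (rescaled k x - F x) <= c * (Num.sqrt e / (2 * c + 1)) by rewrite ler_wpM2l// ltW.
  have : Num.sqrt e = (2 * c + 1) * (Num.sqrt e / (2 * c + 1)).
    by rewrite mulrCA mulfV ?mulr1// gt_eqF// ltr_wpDl// mulr_ge0.
  move: l1 l2 l3 l4 Hs; rewrite /rescaled_trunc; set q := Num.sqrt e / _; lra.
move=> h; rewrite -[ltRHS](sqr_sqrtr (ltW e0)) ltr_pXn2r ?nnegrE ?nc_ge0 ?sqrtr_ge0//.
Unshelve. all: by end_near. Qed.

End Scaling.

(** * Counting functions along sequences *)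

Section SoftTruncation.
Context {R : realType}.
Local Open Scope complex_scope.
Variable e : R.
Hypothesis e0 : 0 < e.
Implicit Type w : R[i].

(* [soft] multiplies [w] by a Lipschitz cut-off that vanishes for [|w| <= e] and equals [1]
   for [|w| >= 2 e]. *)
Definition clamp w : R := Num.max 0 (Num.min 1 (nc w / e - 1)).
Definition soft w : R[i] := (clamp w)%:C * w.

Lemma clamp_ge0 w : 0 <= clamp w. Proof. by rewrite /clamp le_max lexx. Qed.
Lemma clamp_le1 w : clamp w <= 1. Proof. by rewrite /clamp ge_max ler01 ge_min lexx. Qed.

Lemma clamp_lip w w' : `|clamp w' - clamp w| <= nc (w' - w) / e.
Proof.
have h : `|(nc w' / e - 1) - (nc w / e - 1)| <= nc (w' - w) / e.
  have -> : (nc w' / e - 1) - (nc w / e - 1) = (nc w' - nc w) / e by field; rewrite gt_eqF.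
  have ei : 0 < e^-1 by rewrite invr_gt0.
  rewrite normrM (ger0_norm (ltW ei)) ler_pM2r//.
  rewrite ler_norml; have := nc_le_dist w' w; have := nc_le_dist w w'.
  by rewrite [nc (w - w')]nc_dist => h1 h2; apply/andP; split; lra.
apply: le_trans h; rewrite /clamp; move: (nc w' / e - 1) (nc w / e - 1) => a b.
have h1 := ler_norm (a - b); have h2 := ler_norm (- (a - b)); rewrite normrN in h2.
have h3 := normr_ge0 (a - b).
rewrite ler_norml; apply/andP; split; rewrite /Num.max /Num.min; do ![case: ifP => [|/negbT]; rewrite -?leNgt] => *; lra.
Qed.

Lemma soft_le w : nc (soft w) <= nc w.
Proof. by rewrite /soft ncM ncR ger0_norm ?clamp_ge0// ler_piMl ?nc_ge0// clamp_le1. Qed.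

(** The cut-off is Lipschitz with constant 1/e and is multiplied by the base point [w], whence a
    constant depending on [w] but not on [w']. *)
Lemma soft_cont w : exists2 c : R, 0 <= c & forall w', nc (soft w' - soft w) <= c * nc (w' - w).
Proof.
exists (1 + nc w / e); first by rewrite addr_ge0// divr_ge0 ?nc_ge0// ltW.
move=> w'; have -> : soft w' - soft w = (clamp w')%:C * (w' - w) + (clamp w' - clamp w)%:C * w.
  by rewrite /soft rmorphB/=; ring.
apply: (le_trans (ncD _ _)); rewrite !ncM !ncR (ger0_norm (clamp_ge0 w')) mulrDl mul1r.
apply: lerD; first by rewrite ler_piMl ?nc_ge0// clamp_le1.
have -> : nc w / e * nc (w' - w) = nc (w' - w) / e * nc w by ring.
by rewrite ler_wpM2r ?nc_ge0// clamp_lip.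
Qed.

Lemma soft_small w : nc w <= e -> soft w = 0.
Proof.
move=> h; have : nc w / e - 1 <= 0 by rewrite subr_le0 ler_pdivrMr// mul1r.
move=> h1; rewrite /soft /clamp; have -> : Num.max 0 (Num.min 1 (nc w / e - 1)) = 0.
  by apply/max_idPl; rewrite ge_min h1 orbT.
by rewrite mul0r.
Qed.

Lemma soft_close w : nc (w - soft w) <= 2 * e.
Proof.
have -> : w - soft w = (1 - clamp w)%:C * w by rewrite /soft rmorphB/= rmorph1 mulrBl mul1r.
have c1 := clamp_le1 w; have c0 := clamp_ge0 w.
rewrite ncM ncR ger0_norm ?subr_ge0//.
have [h|h] := leP (nc w) (2 * e); first by apply: le_trans h; rewrite ler_piMl ?nc_ge0//; lra.
have -> : clamp w = 1; last by rewrite subrr mul0r mulr_ge0// ltW.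
have h1 : 1 <= nc w / e - 1 by rewrite lerBrDr ler_pdivlMr// ltW.
by apply/eqP; rewrite eq_le c1 /clamp le_max le_min lexx h1 orbT.
Qed.

Lemma cmeas_soft (d : measure_display) (T : measurableType d) (g : T -> R[i]) :
  cmeas g -> cmeas (fun x => soft (g x)).
Proof.
move=> mg; apply: cmeasM => //; apply: cmeasR.
apply: measurable_maxr => //; apply: measurable_minr => //.
apply: measurable_funB => //; apply: measurable_funM => //; exact: cmeas_nc.
Qed.

End SoftTruncation.

(** * Lower and upper bounds for the counting function *)

Section CountLimit.
Context {R : realType} {n : nat}.
Local Open Scope complex_scope.
Local Notation CV := 'rV[R[i]]_n.
Local Notation X := (Rtuple R (n + n)).
Local Notation leb := (@lebesgue_tuple R (n + n)).
Local Notation phi := (@fock_weight R n).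
Local Notation ip := (L2ip phi).
Local Notation H := (F2 phi).
Implicit Types (x y z v : CV).
Variables (m B C : R) (f F : CV -> R[i]).
Hypothesis AH : asymptotically_homogeneous m B C f F.
Local Notation rho := ((n + n)%:R / m).

Let m0 := ah_m AH.

Lemma near_nc_cvg (a : nat -> R[i]) (l : R[i]) :
  (forall e, 0 < e -> \forall k \near \oo, nc (a k - l) < e) ->
  complex.Re (a k) @[k --> \oo] --> complex.Re l /\ complex.Im (a k) @[k --> \oo] --> complex.Im l.
Proof.
move=> h; split; apply/cvgrPdist_lt => e e0; apply: filterS (h e e0) => k; rewrite nc_dist.
  by have := nc_Re (l - a k); rewrite cReD cReN => /le_lt_trans; exact.
by have := nc_Im (l - a k); rewrite cImD cImN => /le_lt_trans; exact.
Qed.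

(** Away from the origin [F] is the pointwise limit of the rescaled symbols along t_k = 1 / (k + 1),
    and at the origin it is 0; measurability passes to the limit. *)
Lemma F_meas : cmeas (fun s : X => F (pt s)).
Proof.
pose t k : R := k.+1%:R^-1.
have t0 k : 0 < t k by rewrite invr_gt0.
have tc : t k @[k --> \oo] --> (0 : R) by exact: cvg_harmonic.
pose a k (s : X) : R[i] := (ind (nr (pt s) != 0))%:C * rescaled m f t k (pt s).
have ma k : cmeas (a k).
  apply: cmeasM.
    apply: cmeasR; apply: measurable_ind.
    have -> : (fun s : X => nr (pt s) != 0) = (fun s : X => 0 < nr (pt s)).
      by apply/funext => s; rewrite lt_neqAle nr_ge0 andbT eq_sym.
    by apply: measurable_fun_ltr => //; exact: measurable_nr.
  apply: cmeasM; first exact: cmeas_cst.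
  have := cmeas_comp (measurable_tscale (dil m t k)) (ah_mf AH).
  by congr cmeas; apply/funext => s; rewrite pt_tscale.
have ca s : complex.Re (a k s) @[k --> \oo] --> complex.Re (F (pt s)) /\
            complex.Im (a k s) @[k --> \oo] --> complex.Im (F (pt s)).
  have [s0|s0] := eqVneq (pt s) 0.
    have E k : a k s = 0 by rewrite /a s0 nr0 eqxx mul0r.
    rewrite s0 (ah_F0 AH); split; under eq_fun do rewrite E; exact: cvg_cst.
  apply: near_nc_cvg => e e0; have [de de0] := rescaled_cvg AH t0 tc s0 e0.
  apply: filterS => k /(_ (pt s)); rewrite subrr nr0 => /(_ de0).
  by rewrite /a gt_eqF ?nr_gt0// mul1r.
split.
  by apply: (measurable_fun_cvg (h := fun k s => complex.Re (a k s))) => [k|s _]; [case: (ma k)|case: (ca s)].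
by apply: (measurable_fun_cvg (h := fun k s => complex.Im (a k s))) => [k|s _]; [case: (ma k)|case: (ca s)].
Qed.

Definition superlevel (s : R) : \bar R := (\int[leb]_x (ind (s <= nc (F (pt x))))%:E)%E.

Lemma measurable_superlevel s : measurable_fun setT (fun x : X => ind (s <= nc (F (pt x))) : R).
Proof.
by apply: measurable_ind; apply: measurable_fun_ler => //; apply: cmeas_nc; exact: F_meas.
Qed.

Lemma superlevel_ge0 s : (0 <= superlevel s)%E.
Proof. by apply: integral_ge0 => x _; rewrite lee_fin ind_ge0. Qed.

(** Dilating by s^(-1/m) maps {|F| >= 1} onto {|F| >= s}. The volume is thus continuous in the
    level, which replaces any regularity of the set {|F| = 1}. *)
Lemma superlevel_scale s : 0 < s -> superlevel s = ((s `^ (- rho))%:E * superlevel 1)%E.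
Proof.
move=> s0; pose c := s `^ (- m^-1); have c0 : 0 < c by exact: powR_gt0.
rewrite /superlevel (integral_rs (f := fun z => ind (s <= nc (F z))) c0 (measurable_superlevel s)); last first.
  by move=> z; exact: ind_ge0.
congr (_ * _)%E.
  by rewrite -powR_mulrn ?(ltW c0)// /c -powRrM; congr (_ `^ _)%:E; rewrite mulrC mulrN.
apply: eq_integral => x _; congr (ind _)%:E.
rewrite (ah_Fhom AH _ c0) ncM ncR ger0_norm ?powR_ge0//.
have -> : c `^ (- m) = s by rewrite /c -powRrM mulrNN mulVf ?gt_eqF// powRr1// ltW.
by rewrite -{1}[s]mulr1 ler_pM2l.
Qed.

Lemma superlevel1_le z : 1 <= nc (F z) -> nr z `^ m <= C.
Proof.
move=> h; have z0 : z != 0 by apply/eqP => z0; move: h; rewrite z0 (ah_F0 AH) nc0 ler10.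
pose t k : R := k.+1%:R^-1.
have t0 k : 0 < t k by rewrite invr_gt0.
have tc : t k @[k --> \oo] --> (0 : R) by exact: cvg_harmonic.
have := le_trans h (F_le AH t0 tc z0).
by rewrite powRN ler_pdivlMr ?powR_gt0 ?nr_gt0// mul1r.
Qed.

(** The set {|F| >= 1} is contained in |z|^2 <= C^(2/m), where this multiple of the Gaussian is at
    least 1; finiteness of its volume then reduces to the Gaussian integral. *)
Lemma superlevel_gauss z : ind (1 <= nc (F z)) <= expR (C `^ (2 / m)) * gw z.
Proof.
case: (leP 1 (nc (F z))) => h; last by rewrite mulr_ge0 ?expR_ge0 ?gw_ge0.
rewrite /ind -[leLHS]expR0 /gw -expRD ler_expR subr_ge0 -nr_sqr -powR_mulrn ?nr_ge0//.
have -> : nr z `^ 2%:R = (nr z `^ m) `^ (2 / m).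
  by rewrite -powRrM; congr (_ `^ _); field; rewrite gt_eqF.
rewrite ge0_ler_powR ?nnegrE ?powR_ge0 ?(ltW (ah_C0 AH)) ?divr_ge0 ?(ltW m0)//.
exact: superlevel1_le.
Qed.

Lemma superlevel_fin : superlevel 1 \is a fin_num.
Proof.
rewrite ge0_fin_numE ?superlevel_ge0//.
have i1 := integrableZl measurableT (expR (C `^ (2 / m))) (gauss_nr_integrable (n := n) (@ltr01 R)).
have /integrableP[_] := i1; apply: le_lt_trans; apply: ge0_le_integral => //.
- by move=> x _; rewrite lee_fin ind_ge0.
- by apply/measurable_EFinP; exact: measurable_superlevel.
- by apply: measurableT_comp => //; case/integrableP : i1.
- move=> x _; rewrite -EFinM abse_EFin lee_fin ger0_norm ?mulr_ge0 ?expR_ge0// mul1r.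
  exact: superlevel_gauss.
Qed.

Definition volF : R := fine (superlevel 1).

Lemma superlevelE s : 0 < s -> superlevel s = (s `^ (- rho) * volF)%:E.
Proof. by move=> s0; rewrite superlevel_scale// EFinM fineK// superlevel_fin. Qed.

Lemma superlevel_integrable s : 0 < s -> leb.-integrable setT (EFin \o (fun x : X => ind (s <= nc (F (pt x))))).
Proof.
move=> s0; apply/integrableP; split; first by apply/measurable_EFinP; exact: measurable_superlevel.
rewrite (eq_integral (fun x : X => (ind (s <= nc (F (pt x))))%:E)).
  by have := superlevelE s0; rewrite /superlevel => ->; rewrite ltry.
by move=> x _; rewrite /= ger0_norm// ind_ge0.
Qed.

Lemma Rintegral_superlevel s : 0 < s -> \int[leb]_x (ind (s <= nc (F (pt x))) : R) = s `^ (- rho) * volF.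
Proof. by move=> s0; rewrite /Rintegral -/(superlevel s) superlevelE. Qed.

Lemma decay (g : CV -> R[i]) : (forall z, nc (g z) <= nc (f z)) ->
  forall e : R, 0 < e -> exists r : R, forall z, r <= ns z -> nc (g z) <= e.
Proof.
move=> gf e e0; have C0 := ah_C0 AH; pose r := (C / e) `^ m^-1.
have r0 : 0 < r by rewrite powR_gt0// divr_gt0.
exists (r ^+ 2) => z; rewrite -nr_sqr ler_pXn2r ?nnegrE ?nr_ge0 ?(ltW r0)// => h.
have z0 : z != 0 by apply/eqP => z0; move: h; rewrite z0 nr0 leNgt r0.
apply: (le_trans (gf z)); apply: (le_trans (ah_fC AH z0)).
have -> : e = C * r `^ (- m).
  rewrite /r -powRrM mulrN mulVf ?gt_eqF// powR_inv1 ?divr_ge0 ?(ltW C0) ?(ltW e0)//.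
  by field; rewrite !gt_eqF.
rewrite ler_pM2l// !powRN lef_pV2 ?posrE ?(powR_gt0 _ r0) ?(powR_gt0 _ (nr_gt0 z0))//.
by rewrite ge0_ler_powR ?nnegrE ?nr_ge0 ?(ltW m0) ?(ltW r0).
Qed.

Section Sequence.
Variable t : nat -> R.
Hypotheses (t0 : forall k, 0 < t k) (t1 : forall k, t k <= 1) (tc : t k @[k --> \oo] --> (0 : R)).
Local Notation L := (dil m t).

(** The Jacobian of the dilation by L k is (L k)^(2n) = (t k)^(-rho), which is how the power of t
    arises. Finiteness of the dilated integral is inherited from that of the original one. *)
Lemma count_scaled (p : CV -> R) (N : nat) k : measurable_fun setT (fun s : X => p (pt s)) ->
  (forall z, 0 <= p z <= 1) -> (\int[leb]_s (p (pt s))%:E = (pi ^+ n * N%:R)%:E)%E ->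
  leb.-integrable setT (EFin \o (fun s : X => p (rs (L k) (pt s)))) /\
  N%:R * t k `^ rho = (pi ^+ n)^-1 * \int[leb]_s p (rs (L k) (pt s)).
Proof.
move=> mp p01 pN; have Lk : 0 < L k := dil_gt0 m t0 k.
have p0 z : 0 <= p z by case/andP : (p01 z).
have := integral_rs Lk mp p0; rewrite pN.
have mq : measurable_fun setT (fun s : X => p (rs (L k) (pt s))).
  have := measurableT_comp mp (measurable_tscale (L k)).
  by congr measurable_fun; apply/funext => s /=; rewrite pt_tscale.
have LX : L k ^+ (n + n) = (t k `^ rho)^-1.
  by rewrite -powR_mulrn ?(ltW Lk)// dilX powRN.
have T0 : 0 < t k `^ rho by exact: powR_gt0.
have I0 : (0 <= \int[leb]_s (p (rs (L k) (pt s)))%:E)%E by apply: integral_ge0 => s _; rewrite lee_fin.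
rewrite /Rintegral LX; set I := integral _ _ _.
have iI : (I < +oo)%E -> leb.-integrable setT (EFin \o (fun s : X => p (rs (L k) (pt s)))).
  move=> Ioo; apply/integrableP; split; first exact/measurable_EFinP.
  by rewrite (eq_integral (fun s => (p (rs (L k) (pt s)))%:E))// => s _; rewrite /= ger0_norm.
move: iI I0; rewrite -/I; case: I => [r| |] iI I0 //=; last by rewrite gt0_muley// lte_fin invr_gt0.
rewrite -EFinM => -[] E; split; first by apply: iI; exact: ltry.
have pn : pi ^+ n != 0 :> R by rewrite expf_neq0// gt_eqF// pi_gt0.
by apply: (mulfI pn); rewrite mulrA E mulrA mulfV// mul1r mulrAC mulVf ?mul1r// (gt_eqF T0).
Qed.

Lemma measurable_rs_comp (p : CV -> R) k : measurable_fun setT (fun s : X => p (pt s)) ->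
  measurable_fun setT (fun s : X => p (rs (L k) (pt s))).
Proof.
move=> mp; have := measurableT_comp mp (measurable_tscale (L k)).
by congr measurable_fun; apply/funext => s /=; rewrite pt_tscale.
Qed.

Local Notation Nf k := (singular_count H ip (toeplitz phi f) (t k)).

Lemma rescaled_near x e : x != 0 -> 0 < e -> \forall k \near \oo, nc (rescaled m f t k x - F x) < e.
Proof.
move=> x0 e0; have [de de0] := rescaled_cvg AH t0 tc x0 e0.
by apply: filterS => k /(_ x); rewrite subrr nr0; exact.
Qed.

(** The lower bound takes the identity for [Phi], so that the lemmas on truncated symbols serve for
    [f] itself. *)
Lemma trunc_id : trunc f t id = fun k => f.
Proof.
apply/funext => k; apply/funext => z.
by rewrite /trunc mulrA -cRM mulfV ?mul1r// gt_eqF.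
Qed.

(** On {|F| >= 1 + e} the rescaled symbol eventually exceeds 1 by at least e / 2, so 1 - q tends to
    0 with the oscillation. The indicator of this set of finite volume is itself a majorant, so no
    truncation is called for. *)
Lemma count_lower (e eta : R) : 0 < e -> 0 < eta -> \forall k \near \oo,
  (pi ^+ n)^-1 * ((1 + e) `^ (- rho) * volF - eta) <= (Nf k)%:R * t k `^ rho.
Proof.
move=> e0 eta0; have e1 : 0 < 1 + e by rewrite addr_gt0.
have /choice[p Hp] := fun k => toeplitz_count (ah_mf AH) (ah_fB AH) (ah_B0 AH) (decay (fun z => lexx (nc (f z)))) (t0 k).
pose q k x := p k (rs (L k) x).
have mq k : measurable_fun setT (fun s : X => q k (pt s)).
  by apply: measurable_rs_comp; case: (Hp k) => -[].
have q01 k x : 0 <= q k x <= 1 by case: (Hp k) => -[_ h _] _; exact: h.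
have om0 x : x != 0 -> rescaled_osc m f t id k x @[k --> \oo] --> (0 : R).
  apply: (rescaled_osc_cvg AH t0 tc); first by [].
    by move=> w; exists 1 => // w'; rewrite mul1r.
  by move=> k; rewrite trunc_id; exact: ah_mf AH.
have omb k x : 1 < nc (rescaled m f t k x) -> (nc (rescaled m f t k x) - 1) ^+ 2 * (1 - q k x) <= 4 * rescaled_osc m f t id k x.
  move=> h; have [_ /(_ (rs (L k) x))[_]] := Hp k.
  have E : nc (f (rs (L k) x)) = t k * nc (rescaled m f t k x).
    by rewrite (nc_rescaled m f t0) mulrCA mulfV ?mulr1// gt_eqF.
  rewrite E -{1}[t k]mulr1 ltr_pM2l// => /(_ h).
  rewrite -{2}[t k]mulr1 -mulrBr exprMn -mulrA.
  have -> : 4 * osc f (rs (L k) x) = t k ^+ 2 * (4 * rescaled_osc m f t id k x).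
    by rewrite /rescaled_osc trunc_id; field; rewrite gt_eqF.
  by rewrite ler_pM2l// exprn_gt0.
pose a k (s : X) := ind (1 + e <= nc (F (pt s))) * (1 - q k (pt s)).
have ma k : measurable_fun setT (a k).
  by apply: measurable_funM; [exact: measurable_superlevel|exact: measurable_funB].
have a0 k s : 0 <= a k s.
  by rewrite mulr_ge0 ?ind_ge0// subr_ge0; case/andP : (q01 k (pt s)).
have adom k s : `|a k s| <= ind (1 + e <= nc (F (pt s))).
  rewrite ger0_norm// ler_piMr ?ind_ge0//; case/andP : (q01 k (pt s)) => h _; lra.
have ca s : a k s @[k --> \oo] --> (0 : R).
  rewrite /a; case: (leP (1 + e) (nc (F (pt s)))) => hF; last first.
    by under eq_fun do rewrite mul0r; exact: cvg_cst.
  under eq_fun do rewrite mul1r.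
  have s0 : pt s != 0 by apply/eqP => s0; move: hF; rewrite s0 (ah_F0 AH) nc0; lra.
  apply/cvgrPdist_lt => d d0.
  have e2 : 0 < e / 2 by rewrite divr_gt0.
  have c0 : 0 < d * (e / 2) ^+ 2 / 4 by rewrite divr_gt0// mulr_gt0// exprn_gt0.
  have /cvgrPdist_lt/(_ _ c0) := om0 _ s0.
  apply: filterS2 (rescaled_near s0 e2) => k sqrt_gw.
  have hq := q01 k (pt s); rewrite !sub0r !normrN => ho.
  have h1 : 1 + e / 2 <= nc (rescaled m f t k (pt s)).
    have := nc_le_dist (F (pt s)) (rescaled m f t k (pt s)); rewrite nc_dist; lra.
  have h2 : 1 < nc (rescaled m f t k (pt s)) by lra.
  have := omb k (pt s) h2; have := ler_norm (rescaled_osc m f t id k (pt s)).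
  move=> h3 h4; case/andP : hq => q0 q1; rewrite ger0_norm ?subr_ge0//.
  have h5 : (e / 2) ^+ 2 * (1 - q k (pt s)) <= (nc (rescaled m f t k (pt s)) - 1) ^+ 2 * (1 - q k (pt s)).
    rewrite ler_wpM2r ?subr_ge0//; apply: lerXn2r; rewrite ?nnegrE; lra.
  rewrite -(ltr_pM2l (exprn_gt0 2 e2)) [ltRHS]mulrC; lra.
have := dominated_Rcvg ma (superlevel_integrable e1) adom ca.
have -> : \int[leb]_s (0 : R) = 0 by rewrite /Rintegral integral0.
move=> /cvgrPdist_lt/(_ _ eta0); apply: filterS => k.
have [[mp p01 pN] _] := Hp k.
have [iq ->] := count_scaled k mp p01 pN.
rewrite ler_pM2l ?pin_gt0// -(Rintegral_superlevel e1) sub0r normrN => ha.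
have ia : leb.-integrable setT (EFin \o a k).
  apply: le_integrable (superlevel_integrable e1) => //; first exact/measurable_EFinP.
  by move=> s _; rewrite lee_fin; exact: le_trans (adom k s) (ler_norm _).
have h := ler_norm (\int[leb]_s a k s).
suff : \int[leb]_x (ind (1 + e <= nc (F (pt x))) : R) - \int[leb]_s a k s <= \int[leb]_s q k (pt s).
  rewrite /q; lra.
rewrite -(RintegralB measurableT (superlevel_integrable e1) ia).
apply: le_Rintegral => //; first exact: (integrableB measurableT (superlevel_integrable e1) ia).
move=> s _; rewrite /a; case/andP : (q01 k (pt s)) => h0 h1.
case: (leP (1 + e) _) => _; rewrite /ind/=; lra.
Qed.

Hypothesis n_gt0 : (0 < n)%N.

(** By the decay bound the truncated symbol vanishes for |x| >= r0 = (C / e)^(1/m). From |x| >= 2 r0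
    only shifts with |v| >= L |x| / 2 reach its support, where L = [L k], and part of their Gaussian
    weight is spent on e^(-|x|^2 / 8). *)
Lemma rescaled_osc_far (e : R) : 0 < e -> exists r K : R, [/\ 0 < r, 0 <= K &
  forall k x, r <= nr x -> rescaled_trunc m f t (soft e) k x = 0 /\
    rescaled_osc m f t (soft e) k x <= K * expR (- (ns x / 8))].
Proof.
move=> e0; have C0 := ah_C0 AH; have B0 := ah_B0 AH.
pose r0 := (C / e) `^ m^-1; have r00 : 0 < r0 by rewrite powR_gt0// divr_gt0.
have small k x : r0 <= nr x -> rescaled_trunc m f t (soft e) k x = 0.
  move=> h; have x0 : x != 0 by apply/eqP => x0; move: h; rewrite x0 nr0 leNgt r00.
  rewrite /rescaled_trunc (soft_small e0)//; apply: (le_trans (rescaled_le AH t0 k x0)).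
  have -> : e = C * r0 `^ (- m).
    rewrite /r0 -powRrM mulrN mulVf ?gt_eqF// powR_inv1 ?divr_ge0 ?(ltW C0) ?(ltW e0)//.
    by field; rewrite !gt_eqF.
  rewrite ler_pM2l// !powRN lef_pV2 ?posrE ?(powR_gt0 _ r00) ?(powR_gt0 _ (nr_gt0 x0))//.
  by rewrite ge0_ler_powR ?nnegrE ?nr_ge0 ?(ltW m0) ?(ltW r00).
pose b := B * (r0^-1) `^ m * expR (2 * m ^+ 2).
have b0 : 0 <= b by rewrite !mulr_ge0 ?powR_ge0 ?expR_ge0.
have i14 : 0 < 1 / 4 :> R by [].
have iG := gauss_nr_integrable (n := n) i14.
pose J := \int[leb]_s expR (- (1 / 4 * ns (pt s))).
have J0 : 0 <= J by apply: Rintegral_ge0 => s _; exact: expR_ge0.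
exists (2 * r0), ((pi ^+ n)^-1 * (b ^+ 2 * J)); split; first by rewrite mulr_gt0.
  exact: mulr_ge0 (ltW (pin_gt0)) (mulr_ge0 (sqr_ge0 _) J0).
move=> k x hx; have Lk := dil_gt0 m t0 k; have L1 := dil_ge1 AH t0 t1 k.
have Gx : rescaled_trunc m f t (soft e) k x = 0 by apply: small; lra.
split => //.
have mt j : cmeas (fun s : X => trunc f t (soft e) j (pt s)).
  apply: cmeasM; first exact: cmeas_cst.
  apply: cmeas_soft => //; apply: cmeasM; [exact: cmeas_cst|exact: ah_mf AH].
rewrite (rescaled_oscE AH t0 (soft_le e) mt) -(mulrA (pi ^+ n)^-1) ler_pM2l ?pin_gt0// -(mulrA (b ^+ 2)).
have bnd s : nc (rescaled_trunc m f t (soft e) k (x + rs (L k)^-1 (pt s)) - rescaled_trunc m f t (soft e) k x) ^+ 2 * gw (pt s) <=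
    b ^+ 2 * expR (- (ns x / 8)) * expR (- (1 / 4 * ns (pt s))).
  rewrite Gx subr0; set y := x + _; set v := pt s.
  have [h|h] := leP r0 (nr y).
    rewrite small// nc0 expr0n/= mul0r.
    exact: mulr_ge0 (mulr_ge0 (sqr_ge0 _) (expR_ge0 _)) (expR_ge0 _).
  have hv : nr x <= 2 * ((L k)^-1 * nr v).
    have E : nr (y - x) = (L k)^-1 * nr v.
      by rewrite /y [x + _]addrC addrK nr_scale// invr_ge0 ltW.
    have := nr_le_dist x y; rewrite E; lra.
  have hv1 : L k * r0 <= nr v.
    have : r0 <= (L k)^-1 * nr v by lra.
    by rewrite mulrC ler_pdivlMr// mulrC.
  (* Uses L k >= 1, that is t k <= 1; the Gaussian tail is therefore uniform in k. *)
  have hv2 : nr x <= 2 * nr v.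
    apply: (le_trans hv); rewrite ler_pM2l// ler_piMl ?nr_ge0//.
    by rewrite invf_le1.
  have hns : ns x <= 4 * ns v.
    rewrite -!nr_sqr; have := nr_ge0 x; move: hv2; move: (nr x) (nr v) => a c; nra.
  have hG : nc (rescaled_trunc m f t (soft e) k y) <= b * expR (ns v / 8).
    apply: (le_trans (soft_le e _)); apply: (le_trans (rescaled_leB AH t0 k y)).
    apply: (@le_trans _ _ (B * (r0^-1 * nr v) `^ m)).
      rewrite ler_wpM2l// ge0_ler_powR ?nnegrE ?(ltW m0) ?(ltW Lk)//.
        by rewrite mulr_ge0 ?nr_ge0// invr_ge0 ltW.
      by rewrite mulrC ler_pdivlMr.
    rewrite powRM ?nr_ge0 ?invr_ge0 ?(ltW r00)// /b -!mulrA ler_wpM2l// ler_wpM2l ?powR_ge0//.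
    by rewrite -(nr_sqr v); exact: powR_le_gauss m0 (nr_ge0 v).
  apply: (@le_trans _ _ ((b * expR (ns v / 8)) ^+ 2 * gw v)).
    by apply: ler_wpM2r (gw_ge0 _) _ _ _; apply: lerXn2r hG; rewrite nnegrE ?nc_ge0// (mulr_ge0 b0 (expR_ge0 _)).
  rewrite exprMn -(mulrA (b ^+ 2)) -(mulrA (b ^+ 2)) ler_wpM2l ?sqr_ge0//.
  rewrite -expRM_natl /gw -!expRD ler_expR.
  have -> : 2%:R * (ns v / 8) = ns v / 4 by field.
  lra.
have idom : leb.-integrable setT (EFin \o (fun s => b ^+ 2 * expR (- (ns x / 8)) * expR (- (1 / 4 * ns (pt s))))).
  exact: (integrableZl measurableT (b ^+ 2 * expR (- (ns x / 8))) iG).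
have -> : b ^+ 2 * (J * expR (- (ns x / 8))) = \int[leb]_s (b ^+ 2 * expR (- (ns x / 8)) * expR (- (1 / 4 * ns (pt s)))).
  by rewrite (RintegralZl _ measurableT iG) -/J; ring.
apply: le_Rintegral => //.
apply: le_integrable idom => //; first by apply/measurable_EFinP; exact: (measurable_rescaled_trunc_shift m t0 mt).
move=> s _; rewrite /= lee_fin (ger0_norm (mulr_ge0 (sqr_ge0 _) (gw_ge0 _))).
exact: le_trans (bnd s) (ler_norm _).
Qed.

(** Removing the values below the cut-off perturbs the operator by at most 2 e t, so the count at t
    is at most that of the truncated symbol at (1 - 2 e) t. There q is at most 1 on {|F| >= 1 - 2 e}
    and tends to 0 elsewhere off the origin, under a Gaussian majorant. *)
Lemma count_upper (e eta : R) : 0 < e -> 2 * e < 1 -> 0 < eta -> \forall k \near \oo,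
  (Nf k)%:R * t k `^ rho <= (pi ^+ n)^-1 * ((1 - 2 * e) `^ (- rho) * volF + eta).
Proof.
move=> e0 e12 eta0; pose e1 := 1 - 2 * e; have e10 : 0 < e1 by rewrite subr_gt0.
have Pl := soft_le e; pose f1 k := trunc f t (soft e) k.
have mt k : cmeas (fun s : X => f1 k (pt s)).
  apply: cmeasM; first exact: cmeas_cst.
  apply: cmeas_soft => //; apply: cmeasM; [exact: cmeas_cst|exact: ah_mf AH].
have f1B k z : nc (f1 k z) <= B by exact: le_trans (nc_trunc_le f t0 Pl k z) (ah_fB AH z).
have dec k := decay (nc_trunc_le f t0 Pl k).
have t'0 k : 0 < t k - 2 * e * t k by rewrite -{1}[t k]mul1r -mulrBl mulr_gt0.
have /choice[p Hp] := fun k => toeplitz_count (mt k) (f1B k) (ah_B0 AH) (dec k) (t'0 k).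
pose N1 k := singular_count H ip (toeplitz phi (f1 k)) (t k - 2 * e * t k).
have NN k : (Nf k <= N1 k)%N.
  apply: (toeplitz_count_le (ah_mf AH) (ah_fB AH) (ah_B0 AH) (decay (fun z => lexx (nc (f z)))) (mt k) (f1B k) (ah_B0 AH) (dec k)).
    by rewrite mulr_ge0 ?mulr_ge0 ?(ltW e0) ?(ltW (t0 k))//=; have := t'0 k; lra.
  move=> z; rewrite /f1 /trunc.
  have -> : f z - (t k)%:C * soft e (((t k)^-1)%:C * f z) =
      (t k)%:C * (((t k)^-1)%:C * f z - soft e (((t k)^-1)%:C * f z)).
    by rewrite mulrBr (mulrA (t k)%:C ((t k)^-1)%:C) -cRM mulfV ?gt_eqF// mul1r.
  rewrite ncM ncR ger0_norm ?(ltW (t0 k))// mulrC ler_wpM2r ?(ltW (t0 k))//.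
  exact: soft_close.
pose q k x := p k (rs (L k) x).
have mq k : measurable_fun setT (fun s : X => q k (pt s)).
  by apply: measurable_rs_comp; case: (Hp k) => -[].
have q01 k x : 0 <= q k x <= 1 by case: (Hp k) => -[_ h _] _; exact: h.
have om0 x : x != 0 -> rescaled_osc m f t (soft e) k x @[k --> \oo] --> (0 : R).
  exact: (rescaled_osc_cvg AH t0 tc Pl (soft_cont e0) mt).
have omb k x : nc (rescaled_trunc m f t (soft e) k x) < e1 ->
    (e1 - nc (rescaled_trunc m f t (soft e) k x)) ^+ 2 * q k x <= 4 * rescaled_osc m f t (soft e) k x.
  move=> h; have [_ /(_ (rs (L k) x))[+ _]] := Hp k.
  have -> : nc (f1 k (rs (L k) x)) = t k * nc (rescaled_trunc m f t (soft e) k x).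
    by rewrite /f1 trunc_dil ncM ncR ger0_norm// ltW.
  have -> : t k - 2 * e * t k = t k * e1 by rewrite /e1; ring.
  rewrite ltr_pM2l// => /(_ h); rewrite -mulrBr exprMn -mulrA.
  have -> : 4 * osc (f1 k) (rs (L k) x) = t k ^+ 2 * (4 * rescaled_osc m f t (soft e) k x).
    by rewrite /rescaled_osc -/(f1 k); field; rewrite gt_eqF.
  by rewrite ler_pM2l// exprn_gt0.
have [r [K [r0 K0 far]]] := rescaled_osc_far e0.
(* The first term makes the majorant at least 1 for |x| < r, where q <= 1; the second covers |x| >=
   r, where the truncated symbol is 0 and thus e1^2 q is at most 4 times the oscillation. *)
pose K1 := expR (r ^+ 2 / 8) + 4 * K / e1 ^+ 2.
have i18 : 0 < 1 / 8 :> R by [].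
have iG := gauss_nr_integrable (n := n) i18.
have idom : leb.-integrable setT (EFin \o (fun s : X => K1 * expR (- (1 / 8 * ns (pt s))))).
  exact: (integrableZl measurableT K1 iG).
pose ok x := (0 < nr x) && (nc (F x) < e1).
pose a k (s : X) := ind (ok (pt s)) * q k (pt s).
have ma k : measurable_fun setT (a k).
  apply: measurable_funM => //; apply: measurable_ind; apply: measurable_and.
    by apply: measurable_fun_ltr => //; exact: measurable_nr.
  by apply: measurable_fun_ltr => //; apply: cmeas_nc; exact: F_meas.
have a0 k s : 0 <= a k s by rewrite mulr_ge0 ?ind_ge0//; case/andP : (q01 k (pt s)).
have adom k s : `|a k s| <= K1 * expR (- (1 / 8 * ns (pt s))).
  rewrite ger0_norm//; have /andP[q0 q1] := q01 k (pt s).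
  have -> : 1 / 8 * ns (pt s) = ns (pt s) / 8 by ring.
  have E0 : 0 <= expR (- (ns (pt s) / 8)) by exact: expR_ge0.
  have K40 : 0 <= 4 * K / e1 ^+ 2 by exact: divr_ge0 (mulr_ge0 (ler0n _ 4) K0) (sqr_ge0 _).
  apply: (@le_trans _ _ (q k (pt s))); first by rewrite ler_piMl// ind_le1.
  rewrite /K1 mulrDl; have [h|h] := leP r (nr (pt s)).
    have [G0 ob] := far k _ h; apply: ler_wpDl; first by rewrite mulr_ge0 ?expR_ge0.
    have := omb k (pt s); rewrite G0 nc0 subr0 => /(_ e10) h1.
    rewrite mulrAC ler_pdivlMr ?exprn_gt0// mulrC; apply: (le_trans h1).
    by rewrite -mulrA ler_pM2l.
  apply: ler_wpDr; first by rewrite mulr_ge0.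
  apply: (le_trans q1); rewrite -expRD -[leLHS]expR0 ler_expR -nr_sqr.
  have : nr (pt s) ^+ 2 <= r ^+ 2 by rewrite ler_pXn2r ?nnegrE ?nr_ge0 ?(ltW r0) ?(ltW h).
  lra.
have ca s : a k s @[k --> \oo] --> (0 : R).
  rewrite /a; case: (boolP (ok (pt s))) => hok; last first.
    by under eq_fun do rewrite mul0r; exact: cvg_cst.
  under eq_fun do rewrite mul1r.
  have /andP[n0 hF] := hok.
  have s0 : pt s != 0 by apply/eqP => s0; move: n0; rewrite s0 nr0 ltxx.
  apply/cvgrPdist_lt => d d0.
  pose g := (e1 - nc (F (pt s))) / 2; have g0 : 0 < g by rewrite divr_gt0// subr_gt0.
  have c0 : 0 < d * g ^+ 2 / 4 by rewrite divr_gt0// mulr_gt0// exprn_gt0.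
  have /cvgrPdist_lt/(_ _ c0) := om0 _ s0.
  apply: filterS2 (rescaled_near s0 g0) => k sqrt_gw; rewrite !sub0r !normrN => ho.
  have /andP[q0 q1] := q01 k (pt s); rewrite ger0_norm//.
  have h1 : nc (rescaled_trunc m f t (soft e) k (pt s)) <= e1 - g.
    apply: (le_trans (Pl _)); have := nc_le_dist (rescaled m f t k (pt s)) (F (pt s)).
    have : nc (F (pt s)) = e1 - 2 * g by rewrite /g; field.
    lra.
  have h2 : nc (rescaled_trunc m f t (soft e) k (pt s)) < e1 by lra.
  have h3 := omb k _ h2; have h4 := ler_norm (rescaled_osc m f t (soft e) k (pt s)).
  have h5 : g ^+ 2 * q k (pt s) <= (e1 - nc (rescaled_trunc m f t (soft e) k (pt s))) ^+ 2 * q k (pt s).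
    rewrite ler_wpM2r//; apply: lerXn2r; rewrite ?nnegrE; lra.
  rewrite -(ltr_pM2l (exprn_gt0 2 g0)) [ltRHS]mulrC; lra.
have := dominated_Rcvg ma idom adom ca.
have -> : \int[leb]_s (0 : R) = 0 by rewrite /Rintegral integral0.
move=> /cvgrPdist_lt/(_ _ eta0); apply: filterS => k.
have [[mp p01 pN] _] := Hp k.
have [iq E] := count_scaled k mp p01 pN.
move=> ha; apply: (@le_trans _ _ ((N1 k)%:R * t k `^ rho)).
  have h1 : (Nf k)%:R <= (N1 k)%:R :> R by rewrite ler_nat; exact: NN.
  exact: ler_wpM2r (powR_ge0 _ _) _ _ h1.
rewrite E ler_pM2l ?pin_gt0// -(Rintegral_superlevel e10).
have ia : leb.-integrable setT (EFin \o a k).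
  apply: le_integrable idom => //; first exact/measurable_EFinP.
  by move=> s _; rewrite lee_fin; exact: le_trans (adom k s) (ler_norm _).
(* No convergence is known at the origin, which [ok] excludes; as [F 0 = 0], the superlevel set does
   not contain it either. Its null indicator is therefore added to the bound on q. *)
have iO : leb.-integrable setT (EFin \o (fun s : X => ind (pt s == 0 :> CV) : R)).
  apply/integrableP; split.
    apply/measurable_EFinP; apply: measurable_ind.
    have -> : (fun s : X => pt s == 0 :> CV) = (fun s : X => nr (pt s) <= 0).
      apply/funext => s; apply/eqP/idP => [->|h]; first by rewrite nr0.
      by apply/eqP; apply: contraLR h => /nr_gt0; rewrite -ltNge.
    by apply: measurable_fun_ler => //; exact: measurable_nr.
  rewrite (eq_integral (fun s : X => (ind (pt s == 0 :> CV))%:E)); first by rewrite null_origin// ltry.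
  by move=> s _; rewrite /= ger0_norm// ind_ge0.
have O0 : \int[leb]_s (ind (pt s == 0 :> CV) : R) = 0 by rewrite /Rintegral null_origin.
have iS := superlevel_integrable e10.
have i2 := integrableD measurableT iS iO.
have i3 := integrableD measurableT i2 ia.
have h := ler_norm (- \int[leb]_s a k s); rewrite sub0r in ha.
suff : \int[leb]_s q k (pt s) <= \int[leb]_x (ind (e1 <= nc (F (pt x))) : R) + \int[leb]_s (ind (pt s == 0 :> CV) : R) + \int[leb]_s a k s.
  rewrite O0 addr0 /q; move: ha h; rewrite normrN; have := ler_norm (\int[leb]_s a k s); lra.
rewrite -(RintegralD measurableT iS iO) -(RintegralD measurableT i2 ia).
apply: le_Rintegral => //.
move=> s _; rewrite /a /ok; case/andP : (q01 k (pt s)) => h0 h1.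
case: (leP e1 _) => _ /=; first by case: (_ == _); rewrite andbF /ind/=; lra.
have [s0|/nr_gt0 ->] := eqVneq (pt s) 0; first by rewrite s0 nr0 ltxx /ind/= -s0; lra.
rewrite /ind/=; lra.
Qed.

End Sequence.
End CountLimit.

(** * Asymptotics of counting functions *)

Lemma powR_near1 (R : realType) (a eta : R) : 0 < eta ->
  exists2 de, 0 < de & forall x, `|x - 1| < de -> `|x `^ a - 1| < eta.
Proof.
move=> eta0; have : {for (1 : R), continuous (fun x : R => x `^ a)}.
  by apply: differentiable_continuous; apply/derivable1_diffP; apply: derivable_powR; rewrite in_itv/= ltr01.
move=> /cvgrPdist_lt/(_ _ eta0); rewrite near_nbhs => /nbhs_ballP[de /= de0 h].
exists de => // x hx; have := h x; rewrite /ball/= distrC => /(_ hx).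
by rewrite distrC powR1.
Qed.

Section SpectralAsymptotics.
Context {R : realType}.
Variables (N : R -> nat) (s : nat -> R) (rho g : R).
Hypotheses (rho0 : 0 < rho) (g0 : 0 < g).
Hypothesis NP : forall t k, 0 < t -> (k < N t)%N = (t < s k).
Hypothesis N_cvg : forall t : nat -> R, (forall k, 0 < t k) -> t k @[k --> \oo] --> (0 : R) ->
  (N (t k))%:R * t k `^ rho @[k --> \oo] --> g.

Lemma counting_function_asymptotics : (N t)%:R / (g * t `^ (- rho)) @[t --> 0^'+] --> (1 : R).
Proof.
apply/cvg_at_rightP => t [t0 tc].
have -> : (fun k => (N (t k))%:R / (g * t k `^ (- rho))) = (fun k => (N (t k))%:R * t k `^ rho * g^-1).
  by apply/funext => k; rewrite powRN invfM invrK; ring.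
rewrite -[X in _ --> X](_ : g / g = _); last by rewrite mulfV// gt_eqF.
by apply: cvgM; [exact: N_cvg|exact: cvg_cst].
Qed.

(** Evaluate the count at c a_j: divided by j + 1 it tends to c^(-rho). For c > 1 this limit is
    below 1, so eventually N (c a_j) <= j and s j <= c a_j; for c < 1 it is above 1, and s j > c
    a_j. *)
Lemma singular_value_asymptotics :
  s j / (g `^ rho^-1 * j.+1%:R `^ (- rho^-1)) @[j --> \oo] --> (1 : R).
Proof.
(* The solution of g a^(-rho) = j + 1; [s j] is the singular value number j + 1. *)
pose a j := g `^ rho^-1 * j.+1%:R `^ (- rho^-1).
have a0 j : 0 < a j by rewrite mulr_gt0 ?powR_gt0.
have aX j : a j `^ rho = g / j.+1%:R.
  rewrite powRM ?powR_ge0// -!powRrM mulVf ?gt_eqF// mulNr mulVf ?gt_eqF// powRr1 ?(ltW g0)//.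
  by rewrite powR_inv1.
have ac : a j @[j --> \oo] --> (0 : R).
  rewrite /a -[X in _ --> X](mulr0 (g `^ rho^-1)); apply: cvgM; first exact: cvg_cst.
  have -> : (fun j => j.+1%:R `^ (- rho^-1)) = (fun j => (j.+1%:R^-1 : R) `^ rho^-1).
    by apply/funext => j; rewrite -(powR_inv1 (ler0n R j.+1)) -powRrM mulN1r.
  have i0 : 0 < rho^-1 by rewrite invr_gt0.
  have h0 k : 0 < k.+1%:R^-1 :> R by rewrite invr_gt0.
  exact: (powR_seq_cvg0 i0 h0 cvg_harmonic).
have key (c : R) : 0 < c -> (N (c * a j))%:R / j.+1%:R @[j --> \oo] --> c `^ (- rho).
  move=> c0; have h : (N (c * a j))%:R * (c * a j) `^ rho @[j --> \oo] --> g.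
    apply: N_cvg => [k|]; first by rewrite mulr_gt0.
    by rewrite -[X in _ --> X](mulr0 c); apply: cvgM => //; exact: cvg_cst.
  have -> : (fun j => (N (c * a j))%:R / j.+1%:R) =
      (fun j => (N (c * a j))%:R * (c * a j) `^ rho * (c `^ (- rho) / g)).
    apply/funext => j; rewrite powRM ?(ltW c0) ?(ltW (a0 j))// aX powRN; field.
    by rewrite !gt_eqF ?powR_gt0.
  rewrite -[X in _ --> X](_ : g * (c `^ (- rho) / g) = _); last by field; rewrite gt_eqF.
  by apply: cvgM => //; exact: cvg_cst.
have up (c : R) : 1 < c -> \forall j \near \oo, s j <= c * a j.
  move=> c1; have c0 : 0 < c by lra.
  have d0 : 0 < 1 - c `^ (- rho).
    have h : 1 `^ rho < c `^ rho by rewrite gt0_ltr_powR ?nnegrE ?ler01 ?(ltW c0).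
    by rewrite subr_gt0 powRN invf_lt1 ?powR_gt0//; rewrite powR1 in h.
  have /cvgrPdist_lt/(_ _ d0) := key c c0; apply: filterS => j hj.
  rewrite leNgt -(NP _ (mulr_gt0 c0 (a0 j))); apply/negP => hN.
  have : (N (c * a j))%:R / j.+1%:R < 1 :> R.
    move: hj; move: (_ / j.+1%:R) => q hj; have := ler_norm (- (c `^ (- rho) - q)); rewrite normrN; lra.
  by rewrite ltr_pdivrMr// mul1r ltr_nat ltnNge hN.
have lo (c : R) : 0 < c -> c < 1 -> \forall j \near \oo, c * a j < s j.
  move=> c0 c1; have d0 : 0 < c `^ (- rho) - 1.
    have h : c `^ rho < 1 `^ rho by rewrite gt0_ltr_powR ?nnegrE ?ler01 ?(ltW c0).
    by rewrite subr_gt0 powRN invf_gt1 ?powR_gt0//; rewrite powR1 in h.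
  have /cvgrPdist_lt/(_ _ d0) := key c c0; apply: filterS => j hj.
  rewrite -(NP _ (mulr_gt0 c0 (a0 j))); apply: ltnW; rewrite -(ltr_nat R).
  have : 1 < (N (c * a j))%:R / j.+1%:R :> R.
    move: hj; move: (_ / j.+1%:R) => q hj; have := ler_norm (c `^ (- rho) - q); lra.
  by rewrite ltr_pdivlMr// mul1r.
apply/cvgrPdist_le => e e0; pose d := Num.min e (1 / 2).
have d0 : 0 < d by rewrite lt_min e0 divr_gt0.
have [de d2] : d <= e /\ d <= 1 / 2 by rewrite !ge_min !lexx orbT.
have h1 : 1 < 1 + d by lra.
have h2 : 0 < 1 - d by lra.
have h3 : 1 - d < 1 by lra.
apply: filterS2 (up _ h1) (lo _ h2 h3) => j u l; rewrite -/(a j).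
have : s j / a j <= 1 + d by rewrite ler_pdivrMr.
have : 1 - d <= s j / a j by rewrite ler_pdivlMr// ltW.
by move=> h4 h5; rewrite ler_norml; apply/andP; split; lra.
Qed.

End SpectralAsymptotics.

(** * The limit of the counting function *)

Section CountAsymptotics.
Context {R : realType} {n : nat}.
Local Open Scope complex_scope.
Local Notation CV := 'rV[R[i]]_n.
Local Notation X := (Rtuple R (n + n)).
Local Notation leb := (@lebesgue_tuple R (n + n)).
Local Notation phi := (@fock_weight R n).
Local Notation ip := (L2ip phi).
Local Notation H := (F2 phi).

Let measurable_ball (r : R) : measurable_fun setT (fun s : X => ind (nr (pt s) < r) : R).
Proof. by apply: measurable_ind; apply: measurable_fun_ltr => //; exact: measurable_nr. Qed.

(** If one ball were null, dilation would make every ball null; exhausting the space by balls, the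
    Gaussian integral would vanish, but it equals pi^n. *)
Lemma ball_gt0 (r : R) : 0 < r -> (0 < \int[leb]_s (ind (nr (pt s) < r))%:E)%E.
Proof.
move=> r0; rewrite lt0e integral_ge0 ?andbT; last by move=> s _; rewrite lee_fin ind_ge0.
apply/eqP => I0.
have B0 (c : R) : 0 < c -> (\int[leb]_s (ind (nr (pt s) < c))%:E)%E = 0%E.
  move=> c0; have d0 : 0 < c / r by rewrite divr_gt0.
  rewrite (@integral_rs _ _ (c / r) (fun z => ind (nr z < c)) d0 (measurable_ball c)); last first.
    by move=> z; exact: ind_ge0.
  rewrite (eq_integral (fun s : X => (ind (nr (pt s) < r))%:E)); first by rewrite I0 mule0.
  move=> s _; congr (ind _)%:E; rewrite nr_scale ?(ltW d0)// -(ltr_pM2l d0 (nr (pt s))).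
  by congr (_ < _); field; rewrite gt_eqF.
have ig : leb.-integrable setT (EFin \o (fun s : X => gw (pt s))).
  have := gauss_nr_integrable (n := n) (@ltr01 R); apply: eq_integrable => // s _.
  by rewrite /= /gw mul1r.
pose a k (s : X) : R := gw (pt s) * ind (nr (pt s) < k%:R).
have ma k : measurable_fun setT (a k).
  by apply: measurable_funM; [exact: measurable_gw|exact: measurable_ball].
have ca s : a k s @[k --> \oo] --> gw (pt s).
  apply: cvg_near_cst; exists (Num.bound (nr (pt s))) => // k /= hk.
  have : nr (pt s) < k%:R by apply: (lt_le_trans (archi_boundP (nr_ge0 _))); rewrite ler_nat.
  by rewrite /a /ind => ->; rewrite mulr1.
have adom k s : `|a k s| <= gw (pt s).
  by rewrite /a ger0_norm ?(mulr_ge0 (gw_ge0 _) (ind_ge0 _ _))// ler_piMr ?gw_ge0// ind_le1.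
have := dominated_Rcvg ma ig adom ca.
have E k : \int[leb]_s a k s = 0.
  rewrite /Rintegral [X in fine X](_ : _ = 0%E)//; apply/eqP; rewrite eq_le; apply/andP; split; last first.
    by apply: integral_ge0 => s _; rewrite lee_fin (mulr_ge0 (gw_ge0 _) (ind_ge0 _ _)).
  have k0 : 0 < (k.+1%:R : R) by [].
  rewrite -(B0 _ k0); apply: ge0_le_integral => //.
  - by move=> s _; rewrite lee_fin (mulr_ge0 (gw_ge0 _) (ind_ge0 _ _)).
  - exact/measurable_EFinP.
  - by apply/measurable_EFinP; exact: measurable_ball.
  move=> s _; rewrite lee_fin /a; case: (ltP (nr (pt s)) k%:R) => h; last by rewrite mulr0 ind_ge0.
  have -> : nr (pt s) < k.+1%:R by apply: (lt_trans h); rewrite ltr_nat.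
  by rewrite mulr1 /ind -[leRHS]expR0 ler_expR oppr_le0 ns_ge0.
under eq_fun do rewrite E; move=> h; have := cvg_unique (@norm_hausdorff _ R^o) h (@cvg_cst _ (0 : R) _ \oo _).
have -> : \int[leb]_s gw (pt s) = pi ^+ n by rewrite /Rintegral integral_gw.
by move=> h1; have := exprn_gt0 n (pi_gt0 R); rewrite h1 ?ltxx.
Qed.

Variables (m B C : R) (f F : CV -> R[i]).
Hypothesis AH : asymptotically_homogeneous m B C f F.
Hypothesis n_gt0 : (0 < n)%N.
Local Notation rho := ((n + n)%:R / m).
Let m0 := ah_m AH.

(** By continuity |F| exceeds half of |F(z)| on a ball around [z], so some superlevel set has
    positive volume; scaling carries this to level 1. *)
Lemma volF_gt0 z : F z != 0 -> 0 < volF F.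
Proof.
move=> Fz; have z0 : z != 0 by apply: contraNN Fz => /eqP ->; rewrite (ah_F0 AH).
pose c := nc (F z) / 2; have c0 : 0 < c by rewrite divr_gt0// nc_gt0.
have [de de0 hde] := ah_Fcont AH z0 c0.
have h : (\int[leb]_s (ind (nr (pt s) < de))%:E <= superlevel F c)%E.
  have mb : measurable_fun setT (fun s : X => (ind (nr (pt s - z) < de))%:E : \bar R).
    have := measurableT_comp (measurable_ball de) (mpres_ttrans (- z)).1.
    by move=> /measurable_EFinP; congr measurable_fun; apply/funext => s /=; rewrite pt_ttrans.
  have -> : (\int[leb]_s (ind (nr (pt s) < de))%:E = \int[leb]_s (ind (nr (pt s - z) < de))%:E :> \bar R)%E.
    have mb0 : measurable_fun setT (fun s : X => (ind (nr (pt s) < de))%:E : \bar R).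
      by apply/measurable_EFinP; exact: measurable_ball.
    have <- := mpres_integral (mpres_ttrans (- z)) mb0.
    by apply: eq_integral => s _; rewrite pt_ttrans.
  apply: ge0_le_integral => //.
  - by move=> s _; rewrite lee_fin ind_ge0.
  - by apply/measurable_EFinP; exact: (measurable_superlevel AH).
  - move=> s _; rewrite lee_fin; case: ltP => hs; last exact: ind_ge0.
    have := hde _ hs; have := nc_le_dist (F z) (F (pt s)); rewrite nc_dist => h1 h2.
    by have -> : c <= nc (F (pt s)) by move: h1 h2; rewrite /c; lra.
have := lt_le_trans (ball_gt0 de0) h.
by rewrite (superlevelE AH c0) lte_fin pmulr_rgt0 ?powR_gt0.
Qed.

Local Notation Nt t := (singular_count H ip (toeplitz phi f) t).

(** The bounds at the levels 1 + d and 1 - 2 d squeeze the count because s^(-rho) is continuous at s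
    = 1; [d] is at most 1/4 so that the lower level stays positive. *)
Lemma count_cvg_le1 (t : nat -> R) : (forall k, 0 < t k) -> (forall k, t k <= 1) -> t k @[k --> \oo] --> (0 : R) ->
  (Nt (t k))%:R * t k `^ rho @[k --> \oo] --> (pi ^+ n)^-1 * volF F.
Proof.
move=> t0 t1 tc; apply/cvgrPdist_le => e e0.
have p0 := @pin_gt0 R n; have v0 : 0 <= volF F by exact/fine_ge0/superlevel_ge0.
pose e1 := e / (pi ^+ n)^-1 / 2; have e10 : 0 < e1 by rewrite !divr_gt0.
have x0 : 0 < e1 / (volF F + 1) by rewrite divr_gt0// ltr_wpDl.
have [de de0 hde] := powR_near1 (- rho) x0.
have hv x : `|x - 1| < de -> `|x `^ (- rho) * volF F - volF F| <= e1.
  move=> /hde/ltW h; rewrite -{2}[volF F]mul1r -mulrBl normrM (ger0_norm v0).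
  apply: (@le_trans _ _ (e1 / (volF F + 1) * volF F)); first by rewrite ler_wpM2r.
  by rewrite mulrAC ler_pdivrMr ?ler_wpM2l ?(ltW e10)//; lra.
pose d := Num.min (de / 4) (1 / 4).
have d0 : 0 < d by rewrite lt_min !divr_gt0.
have [dde d4] : d <= de / 4 /\ d <= 1 / 4 by rewrite !ge_min !lexx orbT.
have d2 : 2 * d < 1 by lra.
have H1 : `|1 + d - 1| < de by rewrite addrC addKr ger0_norm ?(ltW d0)//; lra.
have H2 : `|1 - 2 * d - 1| < de by rewrite addrAC subrr sub0r normrN ger0_norm; lra.
apply: filterS2 (count_lower AH t0 tc d0 e10) (count_upper AH t0 t1 tc n_gt0 d0 d2 e10) => k.
have := hv _ H1; have := hv _ H2; rewrite !ler_norml => /andP[_ a1] /andP[a2 _] l u.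
have E : (pi ^+ n)^-1 * (e1 + e1) = e by rewrite /e1; field; rewrite gt_eqF// exprn_gt0// pi_gt0.
apply/andP; split.
  have : (pi ^+ n)^-1 * ((1 - 2 * d) `^ (- rho) * volF F + e1) <= (pi ^+ n)^-1 * (volF F + (e1 + e1)).
    by rewrite ler_pM2l//; lra.
  rewrite [(pi ^+ n)^-1 * (volF F + _)]mulrDr E; lra.
have : (pi ^+ n)^-1 * (volF F - (e1 + e1)) <= (pi ^+ n)^-1 * ((1 + d) `^ (- rho) * volF F - e1).
  by rewrite ler_pM2l//; lra.
rewrite [(pi ^+ n)^-1 * (volF F - _)]mulrBr E; lra.
Qed.

(** Replacing t k by its minimum with 1 changes only finitely many terms. *)
Lemma count_cvg (t : nat -> R) : (forall k, 0 < t k) -> t k @[k --> \oo] --> (0 : R) ->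
  (Nt (t k))%:R * t k `^ rho @[k --> \oo] --> (pi ^+ n)^-1 * volF F.
Proof.
move=> t0 tc; pose u k := Num.min (t k) 1.
have tu : \forall k \near \oo, u k = t k.
  have /cvgrPdist_lt/(_ _ ltr01) := tc; apply: filterS => k.
  rewrite sub0r normrN ger0_norm ?(ltW (t0 k))// => /ltW h; exact/min_idPl.
have uc : u k @[k --> \oo] --> (0 : R).
  by apply: cvg_trans tc; apply: near_eq_cvg; apply: filterS tu => k ->.
have u0 k : 0 < u k by rewrite lt_min t0 ltr01.
have u1 k : u k <= 1 by rewrite ge_min lexx orbT.
have := count_cvg_le1 u0 u1 uc; apply: cvg_trans; apply: near_eq_cvg.
by apply: filterS tu => k ->.
Qed.

End CountAsymptotics.

(** * Homogeneous extension of the principal symbol *)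

Section RealCoordinates.
Context {R : realType} {n : nat}.
Local Open Scope complex_scope.
Local Notation CV := 'rV[R[i]]_n.
Local Notation X := (Rtuple R (n + n)).
Implicit Types (x y z : CV).

Definition rc z : 'rV[R]_(n + n) := rv (tp z).

Lemma toC_rc z : toC (rc z) = z. Proof. exact: tpK. Qed.

Lemma rc_pt (t : X) : rc (pt t) = rv t. Proof. by rewrite /rc ptK. Qed.

Lemma enorm_rv (t : X) : enorm (rv t) = nr (pt t).
Proof. by rewrite nrE ns_pt /enorm; congr Num.sqrt; apply: eq_bigr => i _; rewrite mxE. Qed.

Lemma enorm_rc z : enorm (rc z) = nr z.
Proof. by rewrite enorm_rv tpK. Qed.

Lemma rc_rs c z : rc (rs c z) = c *: rc z.
Proof.
rewrite -{1}(tpK z) -pt_tscale rc_pt; apply/rowP => i.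
by rewrite !mxE tnth_mktuple.
Qed.

Lemma rcB y x : rc (y - x) = rc y - rc x.
Proof.
apply/rowP => i; rewrite !mxE !tnth_mktuple.
by case: (fintype.split i) => j; rewrite !mxE ?cReD ?cReN ?cImD ?cImN.
Qed.

Lemma rc_le z i : `|rc z 0 i| <= nr z.
Proof.
rewrite -enorm_rc /enorm -sqrtr_sqr ler_wsqrtr// (bigD1 i)//= lerDl.
by apply: sumr_ge0 => j _; exact: sqr_ge0.
Qed.

(** At the origin the power 0^(-m) evaluates to 0 for m > 0, so the extension vanishes there by
    itself. *)
Definition homog (m : R) (g : 'rV[R]_(n + n) -> R[i]) z : R[i] :=
  (nr z `^ (- m))%:C * g ((nr z)^-1 *: rc z).

Lemma homog0 m g : 0 < m -> homog m g 0 = 0.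
Proof. by move=> m0; rewrite /homog nr0 powR0 ?mul0r// oppr_eq0 gt_eqF. Qed.

Lemma homog_scale m g c z : 0 < c -> homog m g (rs c z) = (c `^ (- m))%:C * homog m g z.
Proof.
move=> c0; rewrite /homog nr_scale ?(ltW c0)// rc_rs powRM ?nr_ge0 ?(ltW c0)//.
have -> : (c * nr z)^-1 *: (c *: rc z) = (nr z)^-1 *: rc z.
  by rewrite scalerA invfM mulrAC mulVf ?mul1r// gt_eqF.
by rewrite cRM mulrA.
Qed.

End RealCoordinates.

Section SymbolClass.
Context {R : realType} {d : nat}.
Local Open Scope complex_scope.
Implicit Types x y : 'rV[R]_d.

Lemma row_continuous_eps (h : 'rV[R]_d -> R) x e : {for x, continuous h} -> 0 < e ->
  exists2 de, 0 < de & forall y, (forall i, `|y 0 i - x 0 i| < de) -> `|h y - h x| < e.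
Proof.
move=> + e0 => /cvgrPdist_lt/(_ _ e0); rewrite near_nbhs => /nbhs_ballP[de /= de0 hd].
exists de => // y hy; rewrite distrC; apply: hd; split=> // i j.
by rewrite (ord1 i) /ball/= distrC.
Qed.

Lemma csmooth_continuous (U : set 'rV[R]_d) (g : 'rV[R]_d -> R[i]) x e : csmooth_on U g -> U x -> 0 < e ->
  exists2 de, 0 < de & forall y, (forall i, `|y 0 i - x 0 i| < de) -> nc (g y - g x) < e.
Proof.
move=> [hr hi] Ux e0; have e2 : 0 < e / 2 by rewrite divr_gt0.
have cr : {for x, continuous (@complex.Re R \o g)} := differentiable_continuous (hr [::] x Ux).
have ci : {for x, continuous (@complex.Im R \o g)} := differentiable_continuous (hi [::] x Ux).
have [d1 d10 h1] := row_continuous_eps cr e2.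
have [d2 d20 h2] := row_continuous_eps ci e2.
exists (Num.min d1 d2) => [|y hy]; first by rewrite lt_min d10.
apply: (le_lt_trans (nc_leRI _)); rewrite cReD cReN cImD cImN.
have b1 i : `|y 0 i - x 0 i| < d1 by apply: (lt_le_trans (hy i)); rewrite ge_min lexx.
have b2 i : `|y 0 i - x 0 i| < d2 by apply: (lt_le_trans (hy i)); rewrite ge_min lexx orbT.
have := h1 y b1; have := h2 y b2; rewrite /=; lra.
Qed.

Lemma mi_word0 : mi_word (fun=> 0%N : nat) = [::] :> seq 'I_d.
Proof. by rewrite /mi_word; elim: (enum _). Qed.

Lemma enorm_ge0 x : 0 <= enorm x. Proof. exact: sqrtr_ge0. Qed.

(** The estimate for the zero multi-index, with the Japanese bracket bounded below by 1 for the
    uniform bound and by |x| for the decay; both use that mu is negative. *)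
Lemma symbol_bound (mu : R) (g : 'rV[R]_d -> R[i]) : mu < 0 -> symbol mu g ->
  exists2 C : R, 0 < C & forall x, nc (g x) <= C /\ (0 < enorm x -> nc (g x) <= C * enorm x `^ mu).
Proof.
move=> mu0 [_ /(_ (fun=> 0%N))[C hC]].
have gle x : nc (g x) <= C * japanese x `^ mu.
  have := hC x; rewrite big1_eq subr0.
  by have -> : mi_derive (fun=> 0%N) g x = g x by rewrite /mi_derive mi_word0 /=; case: (g x).
have j1 x : 1 <= japanese x.
  by rewrite /japanese -[leLHS]sqrtr1 ler_wsqrtr// lerDl sqr_ge0.
have je x : enorm x <= japanese x.
  by rewrite /japanese -{1}(ger0_norm (enorm_ge0 x)) -sqrtr_sqr ler_wsqrtr// lerDr.
have C0 : 0 <= `|C| by [].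
have mono (a b : R) : 0 < a -> a <= b -> b `^ mu <= a `^ mu.
  move=> a0 ab; have b0 := lt_le_trans a0 ab.
  have : 0 <= - mu by rewrite oppr_ge0 ltW.
  rewrite -[mu]opprK; move: (- mu) => nu nu0; rewrite !powRN lef_pV2 ?posrE ?powR_gt0// ge0_ler_powR ?nnegrE ?(ltW a0) ?(ltW b0)//.
  by rewrite -[nu]opprK.
have up x a : 0 < a -> a <= japanese x -> nc (g x) <= (`|C| + 1) * a `^ mu.
  move=> a0 ax; apply: (le_trans (gle x)); apply: (@le_trans _ _ ((`|C| + 1) * japanese x `^ mu)).
    by rewrite ler_wpM2r ?powR_ge0//; have := ler_norm C; lra.
  by apply: ler_wpM2l (mono _ _ a0 ax); lra.
exists (`|C| + 1) => [|x]; first by lra.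
split=> [|x0]; last exact: up.
by have := up x 1 ltr01 (j1 x); rewrite powR1 mulr1.
Qed.

End SymbolClass.

Section AsymptoticSymbol.
Context {R : realType} {n : nat}.
Local Open Scope complex_scope.
Local Notation CV := 'rV[R[i]]_n.
Local Notation X := (Rtuple R (n + n)).
Implicit Types (x y z : CV).

Lemma direction_close x y i : x != 0 ->
  `|((nr y)^-1 *: rc y - (nr x)^-1 *: rc x) 0 i| <= 2 * (nr x)^-1 * nr (y - x).
Proof.
move=> x0; have nx := nr_gt0 x0; have ix : 0 < (nr x)^-1 by rewrite invr_gt0.
have rowE (a b : R) (u v : 'rV[R]_(n + n)) : (a *: u - b *: v) 0 i = a * u 0 i - b * v 0 i by rewrite !mxE.
have rowB (u v : 'rV[R]_(n + n)) : (u - v) 0 i = u 0 i - v 0 i by rewrite !mxE.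
rewrite rowE; have hy := rc_le y i; have := rc_le (y - x) i; rewrite rcB rowB.
(* For y = 0 the inverse norm is 0 by convention, so only the direction of x remains, whose
   coordinates are at most 1, while the right-hand side equals 2. *)
have [y0|y0] := eqVneq y 0.
  move: hy; rewrite y0 sub0r nrN nr0 invr0 mul0r sub0r normrN normrM (ger0_norm (ltW ix)).
  have hx := rc_le x i => _ _; have : (nr x)^-1 * `|rc x 0 i| <= (nr x)^-1 * nr x by rewrite ler_pM2l.
  by rewrite -[2 / nr x * _]mulrA mulVf ?gt_eqF//; lra.
have ny := nr_gt0 y0; set a := rc y 0 i; set b := rc x 0 i => hab.
have -> : (nr y)^-1 * a - (nr x)^-1 * b = (nr x)^-1 * ((a - b) + a * (nr y)^-1 * (nr x - nr y)).
  by field; rewrite !gt_eqF.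
rewrite normrM (ger0_norm (ltW ix)).
have -> : 2 / nr x * nr (y - x) = (nr x)^-1 * (2 * nr (y - x)) by ring.
rewrite ler_pM2l//.
apply: (le_trans (ler_normD _ _)).
have h1 : `|a * (nr y)^-1| <= 1 by rewrite normrM (ger0_norm (_ : 0 <= (nr y)^-1)) ?invr_ge0 ?nr_ge0// ler_pdivrMr// mul1r.
have h2 : `|nr x - nr y| <= nr (y - x).
  by rewrite ler_norml; have := nr_le_dist x y; have := nr_le_dist y x; rewrite (nr_dist x y) => ? ?; apply/andP; split; lra.
have : `|a * (nr y)^-1 * (nr x - nr y)| <= nr (y - x).
  by rewrite normrM; apply: le_trans h2; rewrite ler_piMl.
lra.
Qed.

Lemma enorm_direction x : x != 0 -> enorm ((nr x)^-1 *: rc x) = 1.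
Proof.
move=> x0; have i0 : 0 < (nr x)^-1 by rewrite invr_gt0 nr_gt0.
by rewrite -rc_rs enorm_rc nr_scale ?(ltW i0)// mulVf// gt_eqF ?nr_gt0.
Qed.

Variables (m delta : R) (f : CV -> R[i]).
Variables (fm r : 'rV[R]_(n + n) -> R[i]) (chi : 'rV[R]_(n + n) -> R).
Hypotheses (m_gt0 : 0 < m) (delta_gt0 : 0 < delta).
Hypothesis fm_smooth : smooth_on_sphere fm.

(** Near the direction of [x], [fm] agrees on the sphere with a smooth function [G] on an open set.
    Directions depend continuously on the point and stay on the sphere, so continuity of [G] there
    is enough. *)
Lemma sphere_cont x e : x != 0 -> 0 < e -> exists2 de, 0 < de &
  forall y, y != 0 -> nr (y - x) < de -> nc (fm ((nr y)^-1 *: rc y) - fm ((nr x)^-1 *: rc x)) < e.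
Proof.
move=> x0 e0; have [U [G [oU Ux sG fG]]] := fm_smooth (enorm_direction x0).
have [d1 d10 h1] := csmooth_continuous sG Ux e0.
move: (oU); rewrite openE => /(_ _ Ux); rewrite /interior => /nbhs_ballP[d2 /= d20 h2].
have nx := nr_gt0 x0; pose de := Num.min d1 d2 * nr x / 2.
have de0 : 0 < de by rewrite divr_gt0// mulr_gt0// lt_min d10.
exists de => // y y0 hy.
have close i : `|((nr y)^-1 *: rc y - (nr x)^-1 *: rc x) 0 i| < Num.min d1 d2.
  apply: (le_lt_trans (direction_close y i x0)).
  have -> : Num.min d1 d2 = 2 * (nr x)^-1 * de by rewrite /de; field; rewrite gt_eqF.
  by rewrite ltr_pM2l// mulr_gt0// invr_gt0.
have Uy : U ((nr y)^-1 *: rc y).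
  apply: h2; split=> // i j; rewrite (ord1 i) /ball/= distrC.
  by have := close j; rewrite !mxE lt_min => /andP[].
rewrite !fG ?enorm_direction//; apply: h1 => i.
by have := close i; rewrite !mxE lt_min => /andP[].
Qed.

Lemma homog_cont x e : x != 0 -> 0 < e -> exists2 de, 0 < de &
  forall y, nr (y - x) < de -> nc (homog m fm y - homog m fm x) < e.
Proof.
move=> x0 e0; have nx := nr_gt0 x0; pose P := nr x `^ (- m).
have P0 : 0 < P by exact: powR_gt0.
pose c := nc (fm ((nr x)^-1 *: rc x)); have c0 : 0 <= c := nc_ge0 _.
pose e1 := Num.min 1 (e / P / 2); have e10 : 0 < e1 by rewrite lt_min ltr01 !divr_gt0.
have e2 : 0 < e / P / 2 / (c + 1) by rewrite !divr_gt0//; lra.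
have [d1 d10 h1] := sphere_cont x0 e10.
have [d2 d20 h2] := powR_near1 (- m) e2.
exists (Num.min (Num.min d1 (d2 * nr x)) (nr x)) => [|y]; first by rewrite !lt_min d10 mulr_gt0.
rewrite !lt_min => /andP[/andP[y1 y2] y3].
have ny : 0 < nr y by have := nr_le_dist x y; lra.
have y0 : y != 0 by apply: contraTneq ny => ->; rewrite nr0 ltxx.
have := h1 y y0 y1; rewrite lt_min => /andP[k1 k2].
have q1 : `|nr y / nr x - 1| < d2.
  have -> : nr y / nr x - 1 = (nr y - nr x) / nr x by field; rewrite gt_eqF.
  rewrite normrM (ger0_norm (_ : 0 <= (nr x)^-1)) ?invr_ge0 ?nr_ge0// ltr_pdivrMr//.
  apply: le_lt_trans y2; rewrite ler_norml; have := nr_le_dist x y; have := nr_le_dist y x.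
  by rewrite (nr_dist x y) => ? ?; apply/andP; split; lra.
have := h2 _ q1; set q := _ `^ _ => hq.
set w := fm ((nr y)^-1 *: rc y); set v := fm ((nr x)^-1 *: rc x).
have E : homog m fm y - homog m fm x = P%:C * ((q - 1)%:C * w + (w - v)).
  have : nr y `^ (- m) = P * q by rewrite /P /q -powRM ?nr_ge0 ?divr_ge0 ?nr_ge0// mulrCA mulfV ?mulr1// gt_eqF.
  by rewrite /homog -/w -/v -/P => ->; rewrite cRM rmorphB/= rmorph1; ring.
rewrite E ncM ncR (ger0_norm (ltW P0)).
have hw : nc w <= c + 1 by have := nc_le_dist w v; rewrite -/v -/w in k1; rewrite /c -/v; lra.
have : nc ((q - 1)%:C * w) <= e / P / 2.
  rewrite ncM ncR; apply: (@le_trans _ _ (e / P / 2 / (c + 1) * (c + 1))); last by rewrite divfK// gt_eqF//; lra.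
  by apply: ler_pM; rewrite ?nc_ge0//; exact: ltW.
have := ncD ((q - 1)%:C * w) (w - v); rewrite -/v -/w in k2 => t1 t2.
have : nc ((q - 1)%:C * w + (w - v)) < e / P by lra.
by rewrite ltr_pdivlMr// mulrC.
Qed.

Hypothesis f_symbol : symbol (- m) (f \o toC).
Hypothesis chi_eq1 : exists M : R, forall x : 'rV[R]_(n + n), M <= enorm x -> chi x = 1.
Hypothesis fE : forall x : 'rV[R]_(n + n), f (toC x) = (chi x * enorm x `^ (- m))%:C * fm ((enorm x)^-1 *: x) + r x.
Hypothesis r_symbol : symbol (- m - delta) r.

Lemma symbol_cmeas : cmeas (fun t : X => f (pt t)).
Proof.
have [sf _] := f_symbol.
have h (t : X) e : 0 < e -> exists2 de, 0 < de & forall s : X,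
    (forall i, `|tnth s i - tnth t i : R| < de) -> nc (f (pt s) - f (pt t)) < e.
  move=> e0; have [de de0 hd] := csmooth_continuous sf (I : setT (rv t)) e0.
  by exists de => // s hs; apply: hd => i; rewrite !mxE.
split; apply: measurable_tuple_cont => t e e0; have [de de0 hd] := h t e e0; exists de => // s hs.
  by apply: le_lt_trans (hd s hs); have := nc_Re (f (pt s) - f (pt t)); rewrite cReD cReN.
by apply: le_lt_trans (hd s hs); have := nc_Im (f (pt s) - f (pt t)); rewrite cImD cImN.
Qed.

Lemma symbol_asymptotically_homogeneous : exists C, asymptotically_homogeneous m C C f (homog m fm).
Proof.
have m1 : - m < 0 by rewrite oppr_lt0.
have [C C0 hC] := symbol_bound m1 f_symbol; exists C.
have fz z : f z = (f \o toC) (rc z) by rewrite /= toC_rc.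
split => //; first exact: ltW.
- exact: symbol_cmeas.
- by move=> z; rewrite fz; case: (hC (rc z)).
- by move=> z z0; rewrite fz; have [_] := hC (rc z); rewrite enorm_rc => /(_ (nr_gt0 z0)).
- exact: homog0.
- by move=> c z c0; exact: homog_scale.
- exact: homog_cont.
have md : - m - delta < 0 by rewrite subr_lt0 (lt_trans m1).
have [Cr Cr0 hr] := symbol_bound md r_symbol; have [M hM] := chi_eq1.
exists (Num.max M 1), Cr, delta; split => // z; rewrite ge_max => /andP[zM z1].
have z0 : 0 < nr z by lra.
have [_] := hr (rc z); rewrite enorm_rc => /(_ z0); congr (_ <= _); congr nc.
rewrite -{2}(toC_rc z) fE hM ?enorm_rc// mul1r /homog; ring.
Qed.

End AsymptoticSymbol.

Section Sphere.
Context {R : realType}.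

Lemma cone_volume_pos (d : nat) (h : Rtuple R d -> R) : (0 < d)%N ->
  measurable_fun setT h -> (forall t, 0 <= h t) ->
  (forall c t, 0 < c -> h (tscale c t) = h t) ->
  (\int[lebesgue_tuple d]_t (ind ((0 < enorm (rv t)) && (enorm (rv t) ^+ d <= h t)))%:E =
   \int[lebesgue_tuple d]_t (ind (0 < enorm (rv t) <= 1) * h t)%:E)%E.
Proof. by case: d h => // d h _ mh h0 hs; exact: cone_volume mh h0 hs. Qed.

(** The surface measure is d times the image under [direction] of Lebesgue measure restricted to the
    punctured ball, so this is the change of variables for image measures. *)
Lemma integral_sphere_measure d (g : Rtuple R d -> R) :
  measurable_fun setT g -> (forall t, 0 <= g t) ->
  (\int[sphere_measure d]_t (g t)%:E =
   d%:R%:E * \int[lebesgue_tuple d]_(t in @punctured_ball R d) (g (direction t))%:E)%E.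
Proof.
move=> mg g0; have mB := @measurable_punctured_ball R d.
pose mr : {measure set (Rtuple R d) -> \bar R} := mrestr (lebesgue_tuple d) mB.
pose mp : {measure set (Rtuple R d) -> \bar R} := pushforward mr (@direction R d).
pose ms : {measure set (Rtuple R d) -> \bar R} := mscale (NngNum (ler0n R d)) (mp (@measurable_direction R d)).
have mEg : measurable_fun setT (fun t => (g t)%:E : \bar R) by exact/measurable_EFinP.
rewrite (eq_measure_integral ms)// (ge0_integral_mscale _ measurableT _ mEg)//; last first.
  by move=> t _; rewrite lee_fin.
congr (_ * _)%E.
rewrite (ge0_integral_pushforward (@measurable_direction R d) mr measurableT mEg); last first.
  by move=> t _; rewrite lee_fin.
rewrite preimage_setT.
have mgd : measurable_fun setT (fun t => (g (direction t))%:E : \bar R).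
  by exact: measurableT_comp mEg (@measurable_direction R d).
rewrite (@ge0_negligible_integral _ _ _ mr setT (~` @punctured_ball R d)) //=.
- rewrite setTD setCK; apply: eq_measure_integral => A mA AB.
  by rewrite /mr/= /mrestr setIidl.
- exact: measurableC.
- by move=> t _; rewrite lee_fin.
- by rewrite /mrestr setICl measure0.
Qed.

End Sphere.

(** * The constant as an integral over the sphere *)

Section WeylConstant.
Context {R : realType} {n : nat}.
Local Open Scope complex_scope.
Local Notation CV := 'rV[R[i]]_n.
Local Notation X := (Rtuple R (n + n)).
Local Notation leb := (@lebesgue_tuple R (n + n)).
Variables (m B C : R) (f : CV -> R[i]) (fm : 'rV[R]_(n + n) -> R[i]).
Hypothesis AH : asymptotically_homogeneous m B C f (homog m fm).
Hypothesis n_gt0 : (0 < n)%N.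
Local Notation F := (homog m fm).
Local Notation rho := ((n + n)%:R / m).
Let m0 := ah_m AH.

Lemma pt_direction (t : X) : pt (direction t) = rs (nr (pt t))^-1 (pt t).
Proof.
rewrite -enorm_rv -pt_tscale; congr pt; apply: eq_from_tnth => i.
by rewrite !tnth_mktuple mulrC.
Qed.

Lemma direction_tscale (c : R) (t : X) : 0 < c -> direction (tscale c t) = direction t.
Proof.
move=> c0; apply: eq_from_tnth => i.
by rewrite !tnth_mktuple !enorm_rv pt_tscale nr_scale ?(ltW c0)// invfM mulrACA mulfV ?mul1r// gt_eqF.
Qed.

(** [cone_volume] is applied to h(x) = |F(x / |x|)|^rho, which is constant along rays: the integral
    of h over the unit ball is the volume of {|x|^(2n) <= h(x)}, and this set is {|F| >= 1}. *)
Lemma sphere_integral :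
  \int[sphere_measure (n + n)]_(w in sphere (n + n)) (nc (fm (rv w)) `^ rho) =
  (n + n)%:R * volF F.
Proof.
pose g (w : X) : R := ind (enorm (rv w) == 1) * nc (F (pt w)) `^ rho.
have g0 w : 0 <= g w by rewrite mulr_ge0 ?ind_ge0 ?powR_ge0.
have mF : measurable_fun setT (fun w : X => nc (F (pt w)) `^ rho).
  apply: (measurableT_comp (f := @powR R ^~ rho)); first exact: measurable_powR.
  by apply: cmeas_nc; exact: F_meas AH.
have mE : measurable_fun setT (fun w : X => enorm (rv w) == 1).
  by apply: measurable_fun_eqr => //; exact: measurable_enorm.
have mg : measurable_fun setT g by apply: measurable_funM => //; exact: measurable_ind.
have -> : \int[sphere_measure (n + n)]_(w in sphere (n + n)) (nc (fm (rv w)) `^ rho) =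
    fine (\int[sphere_measure (n + n)]_w (g w)%:E)%E.
  rewrite /Rintegral integral_mkcond; congr fine; apply: eq_integral => w _.
  rewrite patchE /g; case: ifPn => [/set_mem hw|/negP hw]; last first.
    rewrite (_ : (enorm (rv w) == 1) = false) /ind ?mul0r//.
    by apply/negP => /eqP h; apply: hw; exact: mem_set.
  rewrite /sphere/= in hw.
  rewrite hw eqxx /ind mul1r /homog -enorm_rv hw powR1 mul1r invr1 scale1r.
  by rewrite rc_pt.
have h (t : X) : nr (pt t) != 0 -> nc (F (pt (direction t))) `^ rho = nr (pt t) ^+ (n + n) * nc (F (pt t)) `^ rho.
  move=> t0; have nt : 0 < nr (pt t) by rewrite lt_neqAle eq_sym t0 nr_ge0.
  rewrite pt_direction homog_scale ?invr_gt0// ncM ncR ger0_norm ?powR_ge0//.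
  rewrite powRM ?powR_ge0 ?nc_ge0// -powR_inv1 ?nr_ge0// -!powRrM -powR_mulrn ?nr_ge0//.
  by congr (_ `^ _ * _); field; rewrite gt_eqF.
rewrite (integral_sphere_measure mg g0).
have -> : (\int[leb]_(t in @punctured_ball R (n + n)) (g (direction t))%:E =
    \int[leb]_t (ind (0 < enorm (rv t) <= 1) * nc (F (pt (direction t))) `^ rho)%:E)%E.
  rewrite integral_mkcond; apply: eq_integral => t _; rewrite patchE.
  case: ifPn => [/set_mem ht|/negP ht]; last first.
    rewrite (_ : (0 < enorm (rv t) <= 1) = false) /ind ?mul0r//.
    by apply/negP => h1; apply: ht; exact: mem_set.
  rewrite /punctured_ball/= in ht.
  rewrite ht /g /ind mul1r (_ : _ == 1) ?mul1r//.
  case/andP : ht; rewrite !enorm_rv => ht _.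
  by rewrite pt_direction nr_scale ?invr_ge0 ?nr_ge0// mulVf// gt_eqF.
have nn0 : (0 < n + n)%N by rewrite addn_gt0 n_gt0.
rewrite -(cone_volume_pos nn0); last 3 first.
- exact: measurableT_comp mF (@measurable_direction R (n + n)).
- by move=> t; exact: powR_ge0.
- by move=> c t c0; rewrite direction_tscale.
have -> : (\int[leb]_t (ind ((0 < enorm (rv t)) && (enorm (rv t) ^+ (n + n) <= nc (F (pt (direction t))) `^ rho)))%:E =
    superlevel F 1)%E.
  apply: eq_integral => t _; congr (ind _)%:E; rewrite enorm_rv.
  have [t0|t0] := eqVneq (nr (pt t)) 0.
    by rewrite t0 ltxx /= /homog t0 powR0 ?mul0r ?nc0 ?oppr_eq0 ?gt_eqF// leNgt ltr01.
  have nt : 0 < nr (pt t) by rewrite lt_neqAle eq_sym t0 nr_ge0.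
  (* As m rho = 2n, homogeneity factors |x|^(2n) out of |F(x / |x|)|^rho, and what remains to
     compare is 1 with |F(x)|^rho. *)
  rewrite nt h//= -{1}[_ ^+ _]mulr1 ler_pM2l ?exprn_gt0//.
  have rho0 : 0 < rho by rewrite divr_gt0// ltr0n.
  apply/idP/idP => [|hF]; last first.
    have : 1 `^ rho <= nc (F (pt t)) `^ rho by rewrite ge0_ler_powR ?nnegrE ?(ltW rho0) ?nc_ge0.
    by rewrite powR1.
  apply: contraLR; rewrite -!ltNge => hF.
  have : nc (F (pt t)) `^ rho < 1 `^ rho by rewrite gt0_ltr_powR ?nnegrE ?nc_ge0.
  by rewrite powR1.
by rewrite (superlevelE AH ltr01) powR1 mul1r.
Qed.

End WeylConstant.

Theorem theorem5p1 (R : realType) (n : nat) (m delta : R)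
    (f : 'rV[R[i]]_n -> R[i])
    (fm r : 'rV[R]_(n + n) -> R[i]) (chi : 'rV[R]_(n + n) -> R)
    (n_gt0 : (0 < n)%N) (m_gt0 : 0 < m) (delta_gt0 : 0 < delta)
    (f_symbol : symbol (- m) (f \o toC))
    (fm_smooth : smooth_on_sphere fm)
    (chi_smooth : smooth_on setT chi)
    (chi_eq0 : \forall x \near (0 : 'rV[R]_(n + n)), chi x = 0)
    (chi_eq1 : exists M : R, forall x, M <= enorm x -> chi x = 1)
    (fE : forall x, f (toC x) =
      (chi x * enorm x `^ (- m))%:C%C * fm ((enorm x)^-1 *: x) + r x)
    (r_symbol : symbol (- m - delta) r)
    (fm_neq0 : exists w, enorm w = 1 /\ fm w <> 0) :
  let phi (z : 'rV[R[i]]_n) : R := (\sum_j Normc.normc (z 0 j) ^+ 2) / 2 in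
  let rho : R := (2 * n)%:R / m in
  let Cf : R := ((2 * n)%:R * pi ^+ n)^-1 *
    \int[sphere_measure (n + n)]_(w in sphere (n + n))
      (Normc.normc (fm (rv w)) `^ rho) in
  let T := toeplitz phi f in
  [/\ compact_operator (F2 phi) (L2ip phi) T,
      (singular_count (F2 phi) (L2ip phi) T t)%:R / (Cf * t `^ (- rho))
        @[t --> 0^'+] --> (1 : R) &
      singular_value (F2 phi) (L2ip phi) T j /
        (Cf `^ rho^-1 * j.+1%:R `^ (- rho^-1))
        @[j --> \oo] --> (1 : R)].

Proof.
move=> phi rho Cf T.
have [C AH] := symbol_asymptotically_homogeneous m_gt0 delta_gt0 fm_smooth f_symbol chi_eq1 fE r_symbol.
have nn : (2 * n = n + n)%N by rewrite mul2n addnn.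
have rho0 : 0 < rho by rewrite divr_gt0// ltr0n muln_gt0.
(* The factor 2 n from the surface measure cancels the one in the denominator of [Cf]. *)
have CfE : Cf = (pi ^+ n)^-1 * volF (homog m fm).
  rewrite /Cf /rho nn (sphere_integral AH n_gt0) invfM [_^-1 * _^-1]mulrC -mulrA; apply: (congr1 (fun x => _ * x)).
  by rewrite mulrA mulVf ?mul1r// pnatr_eq0 -nn muln_eq0/= -lt0n.
have Cf0 : 0 < Cf.
  (* On the unit sphere the homogeneous extension equals [fm], so a nonzero value of [fm] gives a
     nonzero value of the extension. *)
  have [w [w1 fw]] := fm_neq0; pose t : Rtuple R (n + n) := [tuple (w 0 i : measurableTypeR R) | i < n + n].
  have tw : rv t = w by apply/rowP => i; rewrite mxE tnth_mktuple.
  rewrite CfE mulr_gt0 ?pin_gt0// (volF_gt0 AH (z := pt t))//.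
  rewrite /homog rc_pt -enorm_rv tw w1 powR1 invr1 scale1r mul1r.
  exact/eqP.
have dec := decay AH (fun z => lexx (nc (f z))).
have BP := toeplitz_bounded_pair (ah_mf AH) (ah_fB AH) (ah_B0 AH) dec.
have NP t k : 0 < t -> (k < singular_count (F2 phi) (L2ip phi) T t)%N = (t < singular_value (F2 phi) (L2ip phi) T k).
  by move=> t0; exact: (singular_countP F2_prehilbert F2_definite BP).
have Nc (t : nat -> R) : (forall k, 0 < t k) -> t k @[k --> \oo] --> (0 : R) ->
    (singular_count (F2 phi) (L2ip phi) T (t k))%:R * t k `^ rho @[k --> \oo] --> Cf.
  move=> t0 tc; rewrite CfE /rho nn. exact: (count_cvg AH n_gt0 t0 tc).
split.
- exact: bp_compact BP.
- exact: counting_function_asymptotics Cf0 Nc.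
- exact: singular_value_asymptotics rho0 Cf0 NP Nc.
Qed.
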